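(* Fix boundary types $c_l,c_r\in\{el,oa,deel,eoa\}$ and $u,v\in(0,1)$. Consider the piecewise periodic Jack-scaled doubly free-boundary Macdonald measures of the context, with $\beta=1$, and suppose that all $a_j=L$ and that the separation conditions (A1)--(A3) and (B1)--(B2) of the context hold, together with the relevant one-point contour and branch admissibility conditions (i)--(ii). Let $\mathcal H$ be the limit shape and $S_\chi$, $S_{\chi,K}$, $C_{\chi,K}$ the functions and constants defined in the context. Let $(\chi,\kappa)$ be a regular slope point, put $x:=e^{-n\kappa}$, and assume: (i) the Stieltjes boundary-value formula $\partial_\kappa\mathcal H(\chi,\kappa)=-\frac1\pi\lim_{\eta\downarrow0}\operatorname{Im}\mathrm{St}_{\nu_\chi}(x+\mathbf i\eta)$ holds at $x$, and the root labels $w_{\xi,\chi,K}(\zeta)$ and the logarithms described in the context admit continuation to $\zeta=x+\mathbf i0$ through the upper half-plane; (ii) $S_\chi(0)\ne x$; (iii) there exists $K_*\ge1$ such that $S_{\chi,K}(0)\neq x$ and $C_{\chi,K}\ne x$ for all $K\ge K_*$. Then the characteristic equation $S_\chi(w)=x$ has at most one nonreal conjugate pair of roots, counted with multiplicity. Moreover $$(\chi,\kappa)\text{ is liquid}\iff S_\chi(w)=x\text{ has a unique nonreal conjugate pair},$$ and in that case, writing $w_+$ for its member in the upper half-plane, $$\frac{\partial\mathcal H(\chi,\kappa)}{\partial\kappa}=\frac2\alpha-\frac{2\arg w_+}{\pi\alpha},\qquad\arg w_+\in(0,\pi).$$ Equivalently, $(\chi,\kappa)$ is frozen if and only if $S_\chi(w)=x$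 has only real roots. Let $\mathscr N$ be the set of regular slope points satisfying (i)--(iii). At every point of $\operatorname{int}\mathscr N$ where the characteristic equation has no multiple real root, the number of upper-half-plane roots is locally constant. Consequently the portion of the regular frozen boundary (interface between liquid and frozen regular slope points) lying in $\operatorname{int}\mathscr N$ is contained in the real multiple-root locus $$S_\chi(w)=e^{-n\kappa},\qquad\frac{d}{dw}\mathrm{Log}_{\chi,\mathcal C_\chi}S_\chi(w)=0,\qquad w\in\mathbb R .$$ At a nondegenerate fold point the multiple root has multiplicity two, so this is the usual double-root system.
   Context: **Partitions and Macdonald notation.** A partition $\lambda$ has conjugate $\lambda'$, size $|\lambda|$, length $\ell(\lambda)$; it is even if all parts are even, conjugate-even if $\lambda'$ is even. $\mu\prec\lambda$ (equivalently $\lambda\succ\mu$) means $\lambda_1\ge\mu_1\ge\lambda_2\ge\mu_2\ge\cdots$. For $0<q,t<1$, $P_{\lambda/\mu}(\cdot;q,t)$, $Q_{\lambda/\mu}(\cdot;q,t)$ are the skew Macdonald symmetric functions (Macdonald's normalization), $[x]$ a single variable. For a box $s=(i,j)\in\lambda$: $a_\lambda(s)=\lambda_i-j$, $l_\lambda(s)=\lambda'_j-i$, $b_\lambda(s;q,t)=\frac{1-q^{a_\lambda(s)}t^{l_\lambda(s)+1}}{1-q^{a_\lambda(s)+1}t^{l_\lambda(s)}}$, $b_\lambda=\prod_sb_\lambda(s;q,t)$; $b^{el}_\lambda=b^{deel}_\lambda$ is the product over boxes with even leg $l_\lambda(s)$, $b^{oa}_\lambda=b^{eoa}_\lambda$ over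 boxes with odd arm $a_\lambda(s)$; $\overline b^{\,c}_\lambda=b_\lambda/b_\lambda^c$. $\mathbf 1_{el}=\mathbf 1_{oa}=1$; $\mathbf 1_{deel}$, $\mathbf 1_{eoa}$ are the indicators of conjugate-even, resp. even, partitions. **Measure and scaling (all-$L$ case).** Fix $n\ge1$, reals $V_0<\dots<V_m$, $b_{p,j}\in\{+,-\}$, $\tau_j>0$ ($p\in[m]=\{1,\dots,m\}$, $j\in[n]$), $\alpha>0$; $i_{\equiv_n}\in[n]$ denotes the residue of $i$ mod $n$. For $\epsilon>0$ let $q=t^\alpha$, $t=e^{-n\beta\epsilon}$ (here $\beta=1$); integer multiples of $n$, $l^{(\epsilon)}=v_0^{(\epsilon)}<\dots<v_m^{(\epsilon)}=r^{(\epsilon)}$, satisfy $\epsilon v_p^{(\epsilon)}\to V_p$; $b_i=b_{p,i_{\equiv_n}}$ for $i\in(v^{(\epsilon)}_{p-1},v^{(\epsilon)}_p)$; with $k=i_{\equiv_n}$, $x_i=e^{-\epsilon(i-k)}\tau_k$ if $b_i=+$ and $x_i=e^{\epsilon(i-k)}\tau_k^{-1}$ if $b_i=-$. The measure $\mathbb P^{(\epsilon)}$ lives on sequences $(\mu^{(l)},\dots,\mu^{(r+1)})$ with $\mu^{(i)}\prec\mu^{(i+1)}$ if $b_i=+$ and $\mu^{(i)}\succ\mu^{(i+1)}$ if $b_i=-$, and is proportional (the total mass being assumed finite and positive) to $$\mathbf 1_{c_l}(\mu^{(l)})\mathbf 1_{c_r}(\mu^{(r+1)})u^{|\mu^{(l)}|}v^{|\mu^{(r+1)}|}\frac{b^{c_r}_{\mu^{(r+1)}}}{\overline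 b^{\,c_l}_{\mu^{(l)}}}\prod_{b_i=+}P_{\mu^{(i+1)}/\mu^{(i)}}([x_i];q,t)\prod_{b_i=-}Q_{\mu^{(i)}/\mu^{(i+1)}}([x_i];q,t).$$ **Functions.** For $\chi\in[V_0,V_m]$ put $$\mathcal G_{>\chi}(w)=\prod_{p:V_p>\chi}\ \prod_{j:b_{p,j}=-}\frac{1-e^{V_p}(w\tau_j)^{-1}}{1-e^{\max\{V_{p-1},\chi\}}(w\tau_j)^{-1}},\qquad\mathcal G_{<\chi}(w)=\prod_{p:V_{p-1}<\chi}\ \prod_{j:b_{p,j}=+}\frac{1-we^{-V_{p-1}}\tau_j}{1-we^{-\min\{V_p,\chi\}}\tau_j},$$ $\mathcal G_\chi=\mathcal G_{>\chi}\mathcal G_{<\chi}$, $$\mathcal F_{u,v,k}(w)=\mathcal G_{>V_0}(u^{-2k}v^{-2k}w)\,\mathcal G_{<V_m}(u^{2k}v^{2k}w)\,\mathcal G_{>V_0}(u^{2-2k}v^{-2k}w)\,\mathcal G_{<V_m}(u^{2k}v^{2k-2}w),$$ $S_{\chi,K}=\mathcal G_\chi\prod_{k=1}^K\mathcal F_{u,v,k}$ (taken as a reduced rational function), $C_{\chi,K}=\lim_{w\to\infty}S_{\chi,K}(w)$, $S_\chi=\mathcal G_\chi\prod_{k\ge1}\mathcal F_{u,v,k}$, and $S_\chi(0)=\lim_{K\to\infty}S_{\chi,K}(0)$. **Pole sets.** $\mathcal R_{\chi,1,1}=\{e^{\max\{V_{p-1},\chi\}}\tau_j^{-1}\}$,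 $\mathcal R_{\chi,1,2}=\{e^{V_p}\tau_j^{-1}\}$ over $V_p>\chi$, $b_{p,j}=-$; $\mathcal R_{\chi,2,1}=\{e^{\min\{V_p,\chi\}}\tau_j^{-1}\}$, $\mathcal R_{\chi,2,2}=\{e^{V_{p-1}}\tau_j^{-1}\}$ over $V_{p-1}<\chi$, $b_{p,j}=+$; with $c=u^{2k_1}v^{2k_2}$, $\mathcal R_{5,1,k_1,k_2}=\{c\,e^{V_{p-1}}\tau_j^{-1}\}$, $\mathcal R_{5,2,k_1,k_2}=\{c\,e^{V_p}\tau_j^{-1}\}$ over $p\in[m]$, $b_{p,j}=-$; $\mathcal R_{6,1,k_1,k_2}=\{c^{-1}e^{V_p}\tau_j^{-1}\}$, $\mathcal R_{6,2,k_1,k_2}=\{c^{-1}e^{V_{p-1}}\tau_j^{-1}\}$ over $p\in[m]$, $b_{p,j}=+$. For $K\in\mathbb Z_{>0}\cup\{\infty\}$, $$\mathcal D_{\chi,K}=(\mathcal R_{\chi,1,1}\setminus\mathcal R_{\chi,1,2})\cup\bigcup_{1\le k\le K}\bigl[(\mathcal R_{5,1,k,k}\setminus\mathcal R_{5,2,k,k})\cup(\mathcal R_{5,1,k-1,k}\setminus\mathcal R_{5,2,k-1,k})\bigr],\qquad\mathcal D_\chi=\mathcal D_{\chi,\infty},$$ $$\mathcal E_\chi=\mathcal R_{\chi,2,1}\cup\mathcal R_{\chi,2,2}\cup\bigcup_{k\ge1}\bigl[\mathcal R_{6,1,k,k}\cup\mathcal R_{6,2,k,k}\cup\mathcal R_{6,1,k,k-1}\cup\mathcal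 R_{6,2,k,k-1}\bigr].$$ **Separation conditions.** For all $p_1,p_2\in[m]$, $j_1,j_2\in[n]$: (A1) if $b_{p_1,j_1}=b_{p_1,j_2}$ and $j_1\ne j_2$, then $\tau_{j_1}\ne\tau_{j_2}$; (A2) if $b_{p_1,j_1}=-$, $b_{p_2,j_2}=+$ and $p_1\ge p_2$, then $\tau_{j_1}^{-1}\tau_{j_2}<e^{V_{p_2-1}-V_{p_1}}$; (A3) if $b_{p_1,j_1}=b_{p_2,j_2}$ and $\tau_{j_1}>\tau_{j_2}$, then $\tau_{j_1}^{-1}\tau_{j_2}<e^{V_{p_2-1}-V_{p_1}}$; (B1) if $b_{p_1,j_1}=b_{p_2,j_2}=-$, then $\max\{u,v\}<e^{V_{p_2-1}-V_{p_1}}\tau_{j_2}^{-1}\tau_{j_1}$; (B2) the same inequality if $b_{p_1,j_1}=b_{p_2,j_2}=+$. **One-point admissibility at $\chi$.** (i) There is a positively oriented contour $\mathcal C_\chi$ enclosing $0$ with $\mathcal D_\chi\subset\mathrm{Int}(\mathcal C_\chi)$, $\mathcal E_\chi\cap\overline{\mathrm{Int}(\mathcal C_\chi)}=\varnothing$, and an open annular neighborhood $U_\chi$ of $\mathcal C_\chi$, independent of $\epsilon$ for small $\epsilon$, containing no finite-$\epsilon$ pole of the one-point integrand (below) and no pole of the limiting one-point integrand. (ii) $S_\chi$ is holomorphic and non-vanishing on $U_\chi$ and $\oint_{\mathcal C_\chi}\frac{S_\chi'}{S_\chi}dw=0$; $\mathrm{Log}_{\chi,\mathcal C_\chi}S_\chi$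 is the resulting single-valued logarithm. *Finite-$\epsilon$ one-point integrand at column $i$:* for specializations $\rho$ of symmetric functions (given by power sums $p_d(\rho)$; $p_d(\rho_1\cup\rho_2)=p_d(\rho_1)+p_d(\rho_2)$, $p_d(c\rho)=c^dp_d(\rho)$) let $H(\rho_1;\rho_2)=\exp\sum_{d\ge1}\frac{1-t^d}{1-q^d}\frac{p_d(\rho_1)p_d(\rho_2)}d$ and $\Theta_c(\rho)=\sum_\lambda\mathbf 1_c(\lambda)b^c_\lambda P_\lambda(\rho;q,t)$; $\rho_A$ (resp. $\rho_B$) is the alphabet of all $x_j$ with $b_j=-$ (resp. $+$); for $W=(w_1,\dots,w_g)$, $p_d(\rho_W)=(q/t)^d(q^d-1)\sum_sw_s^{-d}$, $p_d(\rho_W^\circ)=(1-q^{-d})\sum_sw_s^d$. The integrand is, up to a factor in the ratios of the $w_s$, $\prod_{j\ge i,b_j=-}H(\rho_W;x_j)\prod_{j<i,b_j=+}H(\rho_W^\circ;x_j)\prod_{k\ge1}\Theta_k(W)$ with $\Theta_k(W)=\Theta_{c_l}(u^{2k-2}v^{2k-1}\rho_W)\Theta_{c_r}(u^{2k-1}v^{2k}\rho_W)\Theta_{c_l}(u^{2k-1}v^{2k-2}\rho_W^\circ)\Theta_{c_r}(u^{2k}v^{2k-1}\rho_W^\circ)H(u^{2k}\rho_B;v^{2k}\rho_W^\circ)H(u^{2k-2}\rho_B;v^{2k}\rho_W)H(u^{2k}\rho_W;v^{2k}\rho_W^\circ)H(u^{2k}\rho_A;v^{2k}\rho_W)H(u^{2k}\rho_A;v^{2k-2}\rho_W^\circ)$.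 **Limit shape.** With $\rho=\alpha$ and $Y_i=\rho\lambda_i-i+\frac12$, let $h^{(q,t)}(\lambda,y)=0$ for $y\le-\ell(\lambda)$ and $h^{(q,t)}(\lambda,y)=\frac2\rho\int_{-\ell(\lambda)}^y(1-\sum_{i\le\ell(\lambda)}\mathbf 1_{[Y_i-1/2,Y_i+1/2]})dy'$ for $y>-\ell(\lambda)$. For $\epsilon i^{(\epsilon)}\to\chi\in(V_0,V_m)\setminus\{V_1,\dots,V_{m-1}\}$ (fixed residue mod $n$) let $H_\epsilon(\kappa)=\epsilon h^{(q,t)}(\mu^{(i^{(\epsilon)})},\kappa/\epsilon)$; the measures $\nu^{(\epsilon)}_\chi(B)=\int_{\{e^{-n\beta\kappa}\in B\}}n\beta e^{-n\beta\kappa}dH_\epsilon(\kappa)$ converge weakly in probability to a deterministic compactly supported measure $\nu_\chi$ with $\int x^{k-1}\nu_\chi(dx)=\frac1{\alpha k\pi\mathbf i}\oint_{\mathcal C_\chi}e^{k\beta\,\mathrm{Log}_{\chi,\mathcal C_\chi}S_\chi(w)}\frac{dw}w$ ($k\ge1$), and $\mathcal H(\chi,\kappa)=\frac1{n\beta}\int_{(e^{-n\beta\kappa},\infty)}\frac1x\nu_\chi(dx)$. $\mathrm{St}_{\nu}(z)=\int\frac{\nu(dx)}{z-x}$. **Regular points.** $(\chi,\kappa)$ is a regular slope point if $\chi\in(V_0,V_m)\setminus\{V_1,\dots,V_{m-1}\}$ and $\partial_\kappa\mathcal H(\chi,\kappa)$ is well defined. It is liquid if $\partial_\kappa\mathcal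 H\in(0,\frac2\alpha)$ and frozen if $\partial_\kappa\mathcal H\in\{0,\frac2\alpha\}$. **Root labels.** For $|\zeta|$ large and $\xi\in\mathcal D_{\chi,K}$, $w_{\xi,\chi,K}(\zeta)$ is the unique root of $S_{\chi,K}(w)=\zeta$ near $\xi$, with $w_{\xi,\chi,K}(\zeta)\to\xi$ as $|\zeta|\to\infty$. Logarithms are chosen so that $\log(1-S_{\chi,K}(0)/\zeta)\to0$ and $\log w_{\xi,\chi,K}(\zeta)-\log\xi\to0$ as $|\zeta|\to\infty$. *)

(* Defs.v *)
From HB Require Import structures.
From mathcomp Require Import all_boot all_order all_algebra.
From mathcomp Require Import complex.
From mathcomp Require Import all_classical all_reals all_analysis.

Set Implicit Arguments.
Unset Strict Implicit.
Unset Printing Implicit Defensive.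

Import Order.TTheory GRing.Theory Num.Theory.
Import numFieldNormedType.Exports.
Local Open Scope classical_set_scope.
Local Open Scope ring_scope.
Local Open Scope complex_scope.

(* R[i] with the topology of its norm, as a normed space over itself: for
   f : R[i] -> R[i], [derivable f w 1] is complex differentiability at w. *)
HB.instance Definition _ (R : realType) := GRing.ComAlgebra.copy R[i] R[i]^o.
HB.instance Definition _ (R : realType) := Vector.copy R[i] R[i]^o.
HB.instance Definition _ (R : realType) := NormedModule.copy R[i] R[i]^o.

Section ComplexAnalysis.
Context {R : realType}.
Local Notation C := R[i].
Local Notation Re := complex.Re.
Local Notation Im := complex.Im.

Definition cabs (z : C) : R := Num.sqrt (Re z ^+ 2 + Im z ^+ 2).

Definition cexp (z : C) : C :=
  (expR (Re z))%:C * (cos (Im z) +i* sin (Im z)).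

(* principal argument, in (-pi, pi] *)
Definition carg (z : C) : R :=
  if 0 <= Im z then acos (Re z / cabs z) else - acos (Re z / cabs z).

Definition upper : set C := [set z | 0 < Im z].
Definition nonreal : set C := [set z | Im z != 0].

Definition holomorphic_on (U : set C) (f : C -> C) : Prop :=
  forall w, U w -> derivable f w 1.

(* the filter |z| -> oo *)
Definition cinfty : set_system C :=
  [set A | exists M : R, forall z, M < cabs z -> A z].

(* The reduced form of a meromorphic expression: removable singularities are
   filled in.  At a point where the punctured limit does not exist in C, the
   value is the junk value 0. *)
Definition reduced (f : C -> C) (w : C) : C := lim (f z @[z --> w^']).

Definition dlog (f : C -> C) (w : C) : C := derive1 f w / f w.

(* order of vanishing of f - x at w, possibly infinite *)
Definition root_mult (f : C -> C) (x w : C) : \bar R :=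
  ereal_sup [set k%:R%:E | k in
    [set k : nat | forall j, (j < k)%N -> derive1n j (fun z => f z - x) w = 0]].

Definition root_count (f : C -> C) (x : C) (A : set C) : \bar R :=
  (\esum_(w in A `&` [set w | f w = x]) root_mult f x w)%E.

Definition cintegral d (T : measurableType d) (mu : {measure set T -> \bar R})
    (D : set T) (f : T -> C) : C :=
  Rintegral mu D (fun s => Re (f s)) +i* Rintegral mu D (fun s => Im (f s)).

Definition velocity (g : R -> C) (s : R) : C :=
  derive1 (fun r => Re (g r)) s +i* derive1 (fun r => Im (g r)) s.

Definition is_C1 (g : R -> C) : Prop :=
  [/\ forall s, derivable (fun r => Re (g r)) s 1,
      forall s, derivable (fun r => Im (g r)) s 1 &
      continuous (velocity g)].

Definition piecewise_C1 (g : R -> C) : Prop :=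
  exists s : seq R, let cuts := 0 :: rcons s 1 in
    sorted <%R cuts /\
    forall k, (k <= size s)%N -> exists h, is_C1 h /\
      forall r, nth 0 cuts k <= r <= nth 0 cuts k.+1 -> g r = h r.

Definition simple_contour (g : R -> C) : Prop :=
  [/\ piecewise_C1 g, g 0 = g 1 &
      forall r s, 0 <= r < 1 -> 0 <= s < 1 -> g r = g s -> r = s].

(* closed curves are parametrized by [0, 1] *)
Definition curve (g : R -> C) : set C := g @` [set s | 0 <= s <= 1].

Definition contour_integral (g : R -> C) (f : C -> C) : C :=
  cintegral (@lebesgue_measure R) [set s | 0 <= s <= 1]
    (fun s => f (g s) * velocity g s).

Definition winding (g : R -> C) (a : C) : C :=
  (2 * pi%:C * 'i)^-1 * contour_integral g (fun z => (z - a)^-1).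

(* union of the bounded components of the complement of the curve *)
Definition Int (g : R -> C) : set C :=
  [set z | ~ curve g z /\
    exists M : R, forall y, connected_component (~` curve g) z y -> cabs y <= M].

Definition positively_oriented (g : R -> C) : Prop :=
  forall z, Int g z -> winding g z = 1.

(* U is an open annulus, up to homeomorphism, with the curve as a core *)
Definition annular_neighborhood (g : R -> C) (U : set C) : Prop :=
  let A := [set z : C | 1 < cabs z < 2] in
  open U /\
  exists Phi Psi : C -> C,
    [/\ {within A, continuous Phi}, {within U, continuous Psi},
        Phi @` A = U, forall z, A z -> Psi (Phi z) = z &
        Phi @` [set z | cabs z = 3 / 2] = curve g].

Definition log_branch (U : set C) (f L : C -> C) : Prop :=
  holomorphic_on U L /\ forall w, U w -> cexp (L w) = f w.

(* a region reaching x + i0 from |zeta| = oo through the upper half-plane *)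
Definition continuation_domain (x : R) (Om : set C) : Prop :=
  [/\ open Om, connected Om, Om `<=` upper,
      exists M : R, forall z, upper z -> M < cabs z -> Om z &
      exists d : R, 0 < d /\ forall eta, 0 < eta < d -> Om (x +i* eta)].

Definition has_boundary_value (x : R) (f : C -> C) : Prop :=
  exists l : C, f (x +i* eta) @[eta --> 0^'+] --> l.

(* The root label w_xi of S(w) = zeta attached to the (positive) pole xi,
   and the branch of log w_xi with log w_xi - log xi -> 0 at infinity. *)
Definition root_label_continues (S : C -> C) (x xi : R) : Prop :=
  exists Om (w logw : C -> C),
    [/\ continuation_domain x Om,
        [/\ holomorphic_on Om w, forall z, Om z -> S (w z) = z,
            w @ within Om cinfty --> (xi%:C : C) &
            exists2 B, nbhs (xi%:C : C) B &
              exists M : R, forall z, Om z -> M < cabs z ->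
                forall w', B w' -> S w' = z -> w' = w z],
        [/\ holomorphic_on Om logw, forall z, Om z -> cexp (logw z) = w z &
            logw @ within Om cinfty --> ((ln xi)%:C : C)] &
        has_boundary_value x w /\ has_boundary_value x logw].

(* the branch of log (1 - s / zeta) vanishing at infinity *)
Definition log_at_zero_continues (s : C) (x : R) : Prop :=
  exists Om (L : C -> C),
    [/\ continuation_domain x Om, holomorphic_on Om L,
        forall z, Om z -> cexp (L z) = 1 - s / z,
        L @ within Om cinfty --> (0 : C) &
        has_boundary_value x L].

Definition Stieltjes (nu : {measure set R -> \bar R}) (z : C) : C :=
  cintegral nu setT (fun s : R => (z - s%:C)^-1).

End ComplexAnalysis.

Definition is_part (s : seq nat) : bool := sorted geq s && (0%N \notin s).

Record intpart := IntPart { parts :> seq nat; _ : is_part parts }.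
HB.instance Definition _ := [isSub for parts].
HB.instance Definition _ := [Countable of intpart by <:].

Lemma empty_part_proof : is_part [::]. Proof. by []. Qed.
Definition empty_part : intpart := IntPart empty_part_proof.

Lemma punion_proof (mu nu : intpart) : is_part (sort geq (mu ++ nu)).
Proof.
have [/andP[_ s0] /andP[_ r0]] := (valP mu, valP nu).
apply/andP; split => /=.
  by apply: sort_sorted => a b; exact: leq_total.
by rewrite mem_sort mem_cat negb_or s0.
Qed.
Definition punion (mu nu : intpart) : intpart := IntPart (punion_proof mu nu).

Definition psize (lam : intpart) : nat := sumn lam.
Definition part (lam : intpart) (i : nat) : nat := nth 0%N lam i.
(* lambda'_j, for j >= 1 *)
Definition pconj (lam : intpart) (j : nat) : nat := count (leq j) lam.
Definition parts_of (N : nat) : set intpart := [set lam | psize lam = N].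

(* mu -< lam; [part] is 0-based *)
Definition interlace (mu lam : intpart) : Prop :=
  forall i, (part lam i.+1 <= part mu i <= part lam i)%N.

(* mu <= lam in the dominance order *)
Definition dominated (mu lam : intpart) : Prop :=
  psize mu = psize lam /\
  forall k, (\sum_(i < k) part mu i <= \sum_(i < k) part lam i)%N.

Definition even_part (lam : intpart) : bool := all (fun k => ~~ odd k) lam.
Definition conj_even (lam : intpart) : bool :=
  [forall j : 'I_(part lam 0), ~~ odd (pconj lam j.+1)].

Inductive boundary := el | oa | deel | eoa.

Definition bd_ind (c : boundary) (lam : intpart) : bool :=
  match c with
  | el | oa => true
  | deel => conj_even lam
  | eoa => even_part lam
  end.

(* the boxes, given by arm a and leg l, that enter b^c *)
Definition bd_box (c : boundary) (a l : nat) : bool :=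
  match c with
  | el | deel => ~~ odd l
  | oa | eoa => odd a
  end.

(* A symmetric function is given by its coefficients on the power sums p_rho. *)
Section Macdonald.
Context {R : realType}.
Variables q t : R.

Definition bprod (A : nat -> nat -> bool) (lam : intpart) : R :=
  \prod_(i < size lam) \prod_(j < part lam i)
    let a := (part lam i - j.+1)%N in
    let l := (pconj lam j.+1 - i.+1)%N in
    if A a l then (1 - q ^+ a * t ^+ l.+1) / (1 - q ^+ a.+1 * t ^+ l) else 1.

Definition b_all : intpart -> R := bprod (fun _ _ => true).
Definition b_in (c : boundary) : intpart -> R := bprod (bd_box c).
Definition b_out (c : boundary) (lam : intpart) : R := b_all lam / b_in c lam.

(* <p_rho, p_rho>_{q,t} *)
Definition psum_norm (rho : intpart) : R :=
  (\prod_(1 <= i < (psize rho).+1)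
     (i ^ count_mem i rho * (count_mem i rho)`!)%N)%:R *
  \prod_(k <- rho) ((1 - q ^+ k) / (1 - t ^+ k)).

(* <f, g>_{q,t}, for f and g homogeneous of degree N *)
Definition mac_ip (N : nat) (f g : intpart -> R) : R :=
  \sum_(rho \in parts_of N) f rho * g rho * psum_norm rho.

(* coefficient of the monomial symmetric function m_mu in p_rho: the number of
   ways to choose one variable per factor of p_rho so as to obtain x^mu *)
Definition psum_mono (rho mu : intpart) : nat :=
  #|[set f : {ffun 'I_(size rho) -> 'I_(size mu)} |
      [forall i, (\sum_(j | f j == i) part rho j)%N == part mu i]]|.

Definition mono_coef (f : intpart -> R) (mu : intpart) : R :=
  \sum_(rho \in parts_of (psize mu)) f rho * (psum_mono rho mu)%:R.

(* Macdonald's characterization: unitriangular in the monomial basis for the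
   dominance order, and orthogonal for <,>_{q,t} *)
Definition is_macdonald (P : intpart -> intpart -> R) : Prop :=
  [/\ forall lam rho, psize rho <> psize lam -> P lam rho = 0,
      forall lam, mono_coef (P lam) lam = 1,
      forall lam mu, mono_coef (P lam) mu <> 0 -> dominated mu lam &
      forall lam mu, psize lam = psize mu -> lam <> mu ->
        mac_ip (psize lam) (P lam) (P mu) = 0].

Definition macP : intpart -> intpart -> R :=
  xget (fun _ _ => 0) [set P | is_macdonald P].

Definition macQ (lam rho : intpart) : R :=
  macP lam rho / mac_ip (psize lam) (macP lam) (macP lam).

(* the value of f, homogeneous of degree N, at the specialization p_k *)
Definition specialize (K : comNzRingType) (N : nat) (f : intpart -> K)
    (p : nat -> K) : K :=
  \sum_(rho \in parts_of N) f rho * \prod_(k <- rho) p k.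

(* the adjoint to multiplication by g (homogeneous of degree M), applied to f:
   coefficients <f, g p_nu> / <p_nu, p_nu> *)
Definition skewing (M : nat) (g f : intpart -> R) (nu : intpart) : R :=
  (\sum_(rho \in parts_of M)
     g rho * f (punion rho nu) * psum_norm (punion rho nu)) / psum_norm nu.

Definition skewP (lam mu : intpart) : intpart -> R :=
  skewing (psize mu) (macQ mu) (macP lam).
Definition skewQ (lam mu : intpart) : intpart -> R :=
  skewing (psize mu) (macP mu) (macQ lam).

(* P_{lam/mu}([x]) and Q_{lam/mu}([x]) *)
Definition skewP1 (lam mu : intpart) (x : R) : R :=
  specialize (psize lam - psize mu) (skewP lam mu) (fun d => x ^+ d).
Definition skewQ1 (lam mu : intpart) (x : R) : R :=
  specialize (psize lam - psize mu) (skewQ lam mu) (fun d => x ^+ d).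

(* A specialization is given by its power sums p_d, d >= 1. *)

Local Notation C := R[i].
Definition spec := nat -> C.
Definition sscale (c : R) (rho : spec) : spec := fun d => c%:C ^+ d * rho d.
Definition svar (x : R) : spec := fun d => x%:C ^+ d.

Definition Hspec_term (r1 r2 : spec) (d : nat) : C :=
  ((1 - t ^+ d) / (1 - q ^+ d))%:C * (r1 d * r2 d) / d%:R.
Definition Hspec_conv (r1 r2 : spec) : Prop :=
  cvgn (series (fun d => cabs (Hspec_term r1 r2 d.+1))).
Definition Hspec (r1 r2 : spec) : C :=
  cexp (limn (series (fun d => Hspec_term r1 r2 d.+1))).

Definition Theta_term (c : boundary) (rho : spec) (lam : intpart) : C :=
  if bd_ind c lam then
    (b_in c lam)%:C *
    specialize (psize lam) (fun nu => (macP lam nu)%:C) rho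
  else 0.
(* the sum over partitions is taken degree by degree *)
Definition Theta_conv (c : boundary) (rho : spec) : Prop :=
  cvgn (series (fun N =>
    cabs (\sum_(lam \in parts_of N) Theta_term c rho lam))).
Definition Theta (c : boundary) (rho : spec) : C :=
  limn (series (fun N => \sum_(lam \in parts_of N) Theta_term c rho lam)).

End Macdonald.

(* p ranges over 1..m, j over 1..n, and V over 0..m; other values are unused. *)
Record model (R : realType) := Model {
  period : nat;                 (* n *)
  pieces : nat;                 (* m *)
  knot : nat -> R;              (* V_p *)
  sgn : nat -> nat -> bool;     (* b_{p,j}, [true] for + *)
  tau : nat -> R;
  alpha : R;
  cl : boundary;
  cr : boundary;
  uu : R;
  vv : R }.

(* the epsilon-dependent data: v_p^(eps) and b_i^(eps) *)
Record discretization (R : realType) := Discretization {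
  dknot : R -> nat -> int;
  dsgn : R -> int -> bool }.

Section Model.
Context {R : realType}.
Variable M : model R.
Local Notation C := R[i].
Local Notation n := (period M).
Local Notation m := (pieces M).
Local Notation V := (knot M).
Local Notation b := (sgn M).
Local Notation tau := (tau M).
Local Notation alpha := (alpha M).
Local Notation u := (uu M).
Local Notation v := (vv M).

Definition wf_model : Prop :=
  [/\ (0 < n)%N, (0 < m)%N,
      forall p, (p < m)%N -> V p < V p.+1,
      forall j, (1 <= j <= n)%N -> 0 < tau j &
      [/\ 0 < alpha, 0 < u < 1 & 0 < v < 1]].

Definition sepA1 : Prop := forall p1 j1 j2,
  (1 <= p1 <= m)%N -> (1 <= j1 <= n)%N -> (1 <= j2 <= n)%N ->
  b p1 j1 = b p1 j2 -> j1 <> j2 -> tau j1 <> tau j2.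

Definition sepA2 : Prop := forall p1 p2 j1 j2,
  (1 <= p1 <= m)%N -> (1 <= p2 <= m)%N -> (1 <= j1 <= n)%N -> (1 <= j2 <= n)%N ->
  b p1 j1 = false -> b p2 j2 = true -> (p2 <= p1)%N ->
  (tau j1)^-1 * tau j2 < expR (V p2.-1 - V p1).

Definition sepA3 : Prop := forall p1 p2 j1 j2,
  (1 <= p1 <= m)%N -> (1 <= p2 <= m)%N -> (1 <= j1 <= n)%N -> (1 <= j2 <= n)%N ->
  b p1 j1 = b p2 j2 -> tau j2 < tau j1 ->
  (tau j1)^-1 * tau j2 < expR (V p2.-1 - V p1).

Definition sepB (s : bool) : Prop := forall p1 p2 j1 j2,
  (1 <= p1 <= m)%N -> (1 <= p2 <= m)%N -> (1 <= j1 <= n)%N -> (1 <= j2 <= n)%N ->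
  b p1 j1 = s -> b p2 j2 = s ->
  Num.max u v < expR (V p2.-1 - V p1) * (tau j2)^-1 * tau j1.

Definition separation : Prop :=
  [/\ sepA1, sepA2, sepA3, sepB false & sepB true].

Definition G_gt (chi : R) (w : C) : C :=
  \prod_(1 <= p < m.+1 | chi < V p) \prod_(1 <= j < n.+1 | ~~ b p j)
    ((1 - (expR (V p))%:C * (w * (tau j)%:C)^-1) /
     (1 - (expR (Num.max (V p.-1) chi))%:C * (w * (tau j)%:C)^-1)).

Definition G_lt (chi : R) (w : C) : C :=
  \prod_(1 <= p < m.+1 | V p.-1 < chi) \prod_(1 <= j < n.+1 | b p j)
    ((1 - w * (expR (- V p.-1))%:C * (tau j)%:C) /
     (1 - w * (expR (- Num.min (V p) chi))%:C * (tau j)%:C)).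

(* for k >= 1 *)
Definition F_fun (k : nat) (w : C) : C :=
  G_gt (V 0%N) ((u ^- (2 * k) * v ^- (2 * k))%:C * w) *
  G_lt (V m) ((u ^+ (2 * k) * v ^+ (2 * k))%:C * w) *
  G_gt (V 0%N) ((u ^- (2 * k - 2) * v ^- (2 * k))%:C * w) *
  G_lt (V m) ((u ^+ (2 * k) * v ^+ (2 * k - 2))%:C * w).

Definition S_raw (chi : R) (K : nat) (w : C) : C :=
  G_gt chi w * G_lt chi w * \prod_(1 <= k < K.+1) F_fun k w.

Definition S_K (chi : R) (K : nat) : C -> C := reduced (S_raw chi K).

Definition C_K (chi : R) (K : nat) : C := lim (S_K chi K w @[w --> cinfty]).

Definition S_inf (chi : R) : C -> C :=
  reduced (fun z => limn (fun K => S_raw chi K z)).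

(* S_chi(0); S_{chi,K}(0) is real, and may tend to +oo, whence \bar R *)
Definition S_inf0 (chi : R) : \bar R :=
  limn (fun K => (complex.Re (S_K chi K 0))%:E).

Local Notation idx p j := ((1 <= p <= m)%N /\ (1 <= j <= n)%N).

Definition R11 (chi : R) : set R := [set z | exists p j,
  [/\ idx p j, chi < V p, b p j = false &
      z = expR (Num.max (V p.-1) chi) * (tau j)^-1]].
Definition R12 (chi : R) : set R := [set z | exists p j,
  [/\ idx p j, chi < V p, b p j = false & z = expR (V p) * (tau j)^-1]].
Definition R21 (chi : R) : set R := [set z | exists p j,
  [/\ idx p j, V p.-1 < chi, b p j = true &
      z = expR (Num.min (V p) chi) * (tau j)^-1]].
Definition R22 (chi : R) : set R := [set z | exists p j,
  [/\ idx p j, V p.-1 < chi, b p j = true & z = expR (V p.-1) * (tau j)^-1]].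

Definition refl_scale (k1 k2 : nat) : R := u ^+ (2 * k1) * v ^+ (2 * k2).

Definition R51 (k1 k2 : nat) : set R := [set z | exists p j,
  [/\ idx p j, b p j = false &
      z = refl_scale k1 k2 * expR (V p.-1) * (tau j)^-1]].
Definition R52 (k1 k2 : nat) : set R := [set z | exists p j,
  [/\ idx p j, b p j = false &
      z = refl_scale k1 k2 * expR (V p) * (tau j)^-1]].
Definition R61 (k1 k2 : nat) : set R := [set z | exists p j,
  [/\ idx p j, b p j = true &
      z = (refl_scale k1 k2)^-1 * expR (V p) * (tau j)^-1]].
Definition R62 (k1 k2 : nat) : set R := [set z | exists p j,
  [/\ idx p j, b p j = true &
      z = (refl_scale k1 k2)^-1 * expR (V p.-1) * (tau j)^-1]].

Definition D_K (chi : R) (K : nat) : set R :=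
  (R11 chi `\` R12 chi) `|`
  \bigcup_(k in [set k | (1 <= k <= K)%N])
    ((R51 k k `\` R52 k k) `|` (R51 k.-1 k `\` R52 k.-1 k)).

Definition D_inf (chi : R) : set R :=
  (R11 chi `\` R12 chi) `|`
  \bigcup_(k in [set k | (1 <= k)%N])
    ((R51 k k `\` R52 k k) `|` (R51 k.-1 k `\` R52 k.-1 k)).

Definition E_set (chi : R) : set R :=
  R21 chi `|` R22 chi `|`
  \bigcup_(k in [set k | (1 <= k)%N])
    (R61 k k `|` R62 k k `|` R61 k k.-1 `|` R62 k k.-1).

Definition regular_col (chi : R) : Prop :=
  V 0%N < chi < V m /\ forall p, (1 <= p < m)%N -> chi <> V p.

Variable D : discretization R.

Definition t_ (eps : R) : R := expR (- (n%:R * eps)).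
Definition q_ (eps : R) : R := t_ eps `^ alpha.
Definition lft (eps : R) : int := dknot D eps 0%N.
Definition rgt (eps : R) : int := dknot D eps m.
(* columns carrying a sign are l, l+1, ..., l + width = r *)
Definition width (eps : R) : nat := absz (rgt eps - lft eps).

(* the residue of i modulo n, in 1..n *)
Definition resid (i : int) : nat := (absz ((i - 1) %% n%:Z)%Z).+1.

Definition xvar (eps : R) (i : int) : R :=
  let k := resid i in
  if dsgn D eps i then expR (- (eps * (i - k%:Z)%:~R)) * tau k
  else expR (eps * (i - k%:Z)%:~R) * (tau k)^-1.

(* s is the sequence mu^(l), ..., mu^(r+1) *)
Definition paths (eps : R) : set (seq intpart) := [set s |
  size s = (width eps).+2 /\
  forall k, (k <= width eps)%N ->
    if dsgn D eps (lft eps + k%:Z)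
    then interlace (nth empty_part s k) (nth empty_part s k.+1)
    else interlace (nth empty_part s k.+1) (nth empty_part s k)].

Definition weight (eps : R) (s : seq intpart) : R :=
  let q := q_ eps in let t := t_ eps in
  let mu k := nth empty_part s k in
  let lam0 := mu 0%N in let lam1 := mu (width eps).+1 in
  (bd_ind (cl M) lam0)%:R * (bd_ind (cr M) lam1)%:R *
  u ^+ psize lam0 * v ^+ psize lam1 *
  (b_in q t (cr M) lam1 / b_out q t (cl M) lam0) *
  \prod_(k < (width eps).+1)
    let i := lft eps + k%:Z in
    if dsgn D eps i then skewP1 q t (mu k.+1) (mu k) (xvar eps i)
    else skewQ1 q t (mu k) (mu k.+1) (xvar eps i).

Definition mass (eps : R) (A : set (seq intpart)) : \bar R :=
  (\esum_(s in paths eps `&` A) (weight eps s)%:E)%E.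

Definition prob (eps : R) (A : set (seq intpart)) : R :=
  fine (mass eps A) / fine (mass eps setT).

Definition scaling_assumptions : Prop :=
  [/\ \forall eps \near 0^'+,
        (forall p, (p <= m)%N -> (n%:Z %| dknot D eps p)%Z) /\
        (forall p, (p < m)%N -> (dknot D eps p < dknot D eps p.+1)%R),
      forall p, (p <= m)%N ->
        eps * (dknot D eps p)%:~R @[eps --> 0^'+] --> V p,
      \forall eps \near 0^'+, forall p i, (1 <= p <= m)%N ->
        (dknot D eps p.-1 < i < dknot D eps p)%R ->
        dsgn D eps i = b p (resid i) &
      \forall eps \near 0^'+, (0 < mass eps setT < +oo)%E].

(* a family of columns i^(eps) with fixed residue mod n and eps i^(eps) -> chi *)
Definition column_at (chi : R) (col : R -> int) : Prop :=
  (eps * (col eps)%:~R @[eps --> 0^'+] --> chi) /\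
  exists k, \forall eps \near 0^'+, resid (col eps) = k.

(* power sums over the x_j, l <= j <= r, with sign s *)
Definition rho_alph (eps : R) (s : bool) : spec (R := R) := fun d =>
  \sum_(k < (width eps).+1 | dsgn D eps (lft eps + k%:Z) == s)
    (xvar eps (lft eps + k%:Z))%:C ^+ d.

Section Integrand.
Variables (eps : R) (i : int) (g : nat) (W : 'rV[C]_g).
Let q := q_ eps.
Let t := t_ eps.

Definition rho_W : spec (R := R) := fun d =>
  ((q / t) ^+ d * (q ^+ d - 1))%:C * \sum_(s < g) (W 0 s) ^- d.
Definition rho_Wo : spec (R := R) := fun d =>
  (1 - q ^- d)%:C * \sum_(s < g) (W 0 s) ^+ d.

Local Notation rA := (rho_alph eps false).
Local Notation rB := (rho_alph eps true).

Definition Theta_k_factors (k : nat) : seq (boundary * spec (R := R)) :=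
  [:: (cl M, sscale (u ^+ (2 * k - 2) * v ^+ (2 * k - 1)) rho_W);
      (cr M, sscale (u ^+ (2 * k - 1) * v ^+ (2 * k)) rho_W);
      (cl M, sscale (u ^+ (2 * k - 1) * v ^+ (2 * k - 2)) rho_Wo);
      (cr M, sscale (u ^+ (2 * k) * v ^+ (2 * k - 1)) rho_Wo)].

Definition H_k_factors (k : nat) : seq (spec (R := R) * spec (R := R)) :=
  [:: (sscale (u ^+ (2 * k)) rB, sscale (v ^+ (2 * k)) rho_Wo);
      (sscale (u ^+ (2 * k - 2)) rB, sscale (v ^+ (2 * k)) rho_W);
      (sscale (u ^+ (2 * k)) rho_W, sscale (v ^+ (2 * k)) rho_Wo);
      (sscale (u ^+ (2 * k)) rA, sscale (v ^+ (2 * k)) rho_W);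
      (sscale (u ^+ (2 * k)) rA, sscale (v ^+ (2 * k - 2)) rho_Wo)].

Definition Theta_k (k : nat) : C :=
  (\prod_(cs <- Theta_k_factors k) Theta q t cs.1 cs.2) *
  \prod_(rr <- H_k_factors k) Hspec q t rr.1 rr.2.

(* (rho_W; x_j) for j >= i, b_j = -, and (rho_Wo; x_j) for j < i, b_j = + *)
Definition col_spec (j : int) : option (spec (R := R) * spec (R := R)) :=
  if (i <= j)%R && ~~ dsgn D eps j then Some (rho_W, svar (xvar eps j))
  else if (j < i)%R && dsgn D eps j then Some (rho_Wo, svar (xvar eps j))
  else None.

Definition integrand : C :=
  (\prod_(k < (width eps).+1)
     if col_spec (lft eps + k%:Z) is Some rr then Hspec q t rr.1 rr.2 else 1) *
  limn (fun K => \prod_(1 <= k < K.+1) Theta_k k).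

Definition integrand_conv : Prop :=
  [/\ forall k, (k <= width eps)%N ->
        if col_spec (lft eps + k%:Z) is Some rr then Hspec_conv q t rr.1 rr.2
        else True,
      forall k, (1 <= k)%N ->
        \big[and/True]_(cs <- Theta_k_factors k) Theta_conv q t cs.1 cs.2,
      forall k, (1 <= k)%N ->
        \big[and/True]_(rr <- H_k_factors k) Hspec_conv q t rr.1 rr.2 &
      cvgn (fun K => \prod_(1 <= k < K.+1) Theta_k k)].

End Integrand.

(* The integrand in g variables, continued analytically from its domain of
   convergence, has no pole with all its coordinates in U. *)
Definition no_finite_pole (eps : R) (i : int) (g : nat) (U : set C) : Prop :=
  exists (Om Om0 : set 'rV[C]_g) (Fc : 'rV[C]_g -> C),
    [/\ open Om /\ connected Om,
        forall W, Om W -> differentiable Fc W /\ forall s, W 0 s != 0,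
        forall W : 'rV[C]_g, (forall s, U (W 0 s)) -> Om W,
        [/\ open Om0, Om0 !=set0 & Om0 `<=` Om] &
        forall W, Om0 W -> integrand_conv eps i W /\ Fc W = integrand eps i W].

(* Lg is Log_{chi, C_chi} S_chi *)
Definition admissible (chi : R) (col : R -> int) (gam : R -> C) (U : set C)
    (Lg : C -> C) : Prop :=
  [/\ [/\ simple_contour gam, positively_oriented gam & Int gam 0],
      (forall xi, D_inf chi xi -> Int gam xi%:C) /\
      (forall xi, E_set chi xi -> ~ closure (Int gam) xi%:C),
      [/\ annular_neighborhood gam U,
          forall g, (0 < g)%N -> \forall eps \near 0^'+,
            no_finite_pole eps (col eps) g U &
          forall k, (0 < k)%N ->
            holomorphic_on U (fun w => S_inf chi w ^+ k / w)],
      [/\ holomorphic_on U (S_inf chi), forall w, U w -> S_inf chi w != 0 &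
          contour_integral gam (dlog (S_inf chi)) = 0] &
      log_branch U (S_inf chi) Lg].

(* h^(q,t)(lam, y), with rho = alpha *)
Definition height (lam : intpart) (y : R) : R :=
  let ell := (size lam)%:R in
  let Y (i : nat) : R := alpha * (part lam i)%:R - i.+1%:R + 1 / 2 in
  if y <= - ell then 0 else
  2 / alpha * Rintegral (@lebesgue_measure R) [set y' | - ell <= y' <= y]
    (fun y' => 1 - \sum_(i < size lam)
       \1_[set z : R | Y i - 1 / 2 <= z <= Y i + 1 / 2] y').

Definition H_eps (eps : R) (lam : intpart) (kappa : R) : R :=
  eps * height lam (kappa / eps).

(* the integral of f against nu^(eps); dH_eps = H_eps' d kappa, as H_eps is
   piecewise affine *)
Definition nu_eps_integral (eps : R) (lam : intpart) (f : R -> R) : R :=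
  Rintegral (@lebesgue_measure R) setT (fun kappa =>
    f (expR (- (n%:R * kappa))) * (n%:R * expR (- (n%:R * kappa))) *
    derive1 (H_eps eps lam) kappa).

Definition column_part (eps : R) (i : int) (s : seq intpart) : intpart :=
  nth empty_part s (absz (i - lft eps)).

Definition limit_measure (chi : R) (col : R -> int) (gam : R -> C)
    (Lg : C -> C) (nu : {finite_measure set R -> \bar R}) : Prop :=
  [/\ exists B : R, nu (~` [set x | - B <= x <= B]) = 0%E,
      forall f : R -> R, continuous f -> (exists B, forall x, `|f x| <= B) ->
        forall delta : R, 0 < delta ->
        prob eps [set s | delta <=
          `|nu_eps_integral eps (column_part eps (col eps) s) f -
            Rintegral nu setT f|] @[eps --> 0^'+] --> (0 : R) &
      forall k, (1 <= k)%N ->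
        (Rintegral nu setT (fun x => x ^+ k.-1))%:C =
        (alpha%:C * k%:R * pi%:C * 'i)^-1 *
        contour_integral gam (fun w => cexp (k%:R * Lg w) / w)].

Variable nu : R -> {finite_measure set R -> \bar R}.

Definition limit_shape (chi kappa : R) : R :=
  n%:R^-1 * Rintegral (nu chi) [set x | expR (- (n%:R * kappa)) < x]
    (fun x => x^-1).

Definition slope (chi kappa : R) : R := derive1 (limit_shape chi) kappa.

Definition regular_point (chi kappa : R) : Prop :=
  regular_col chi /\ derivable (limit_shape chi) kappa 1.

Definition liquid (chi kappa : R) : Prop :=
  regular_point chi kappa /\ 0 < slope chi kappa < 2 / alpha.

Definition frozen (chi kappa : R) : Prop :=
  regular_point chi kappa /\
  (slope chi kappa = 0 \/ slope chi kappa = 2 / alpha).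

Definition xpt (kappa : R) : R := expR (- (n%:R * kappa)).

Definition assumption_i (chi kappa : R) : Prop :=
  let x := xpt kappa in
  (- (pi^-1) * complex.Im (Stieltjes (nu chi) (x +i* eta))
     @[eta --> 0^'+] --> slope chi kappa) /\
  exists K0, forall K, (K0 <= K)%N ->
    (forall xi, D_K chi K xi -> root_label_continues (S_K chi K) x xi) /\
    log_at_zero_continues (S_K chi K 0) x.

Definition assumption_ii (chi kappa : R) : Prop :=
  S_inf0 chi <> (xpt kappa)%:E.

Definition assumption_iii (chi kappa : R) : Prop :=
  exists Ks, (1 <= Ks)%N /\ forall K, (Ks <= K)%N ->
    S_K chi K 0 <> (xpt kappa)%:C /\ C_K chi K <> (xpt kappa)%:C.

Definition good_point (chi kappa : R) : Prop :=
  [/\ regular_point chi kappa, assumption_i chi kappa,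
      assumption_ii chi kappa & assumption_iii chi kappa].

Definition NN : set (R * R) := [set pt | good_point pt.1 pt.2].

Definition is_root (chi kappa : R) (w : C) : Prop :=
  S_inf chi w = (xpt kappa)%:C.

Definition unique_nonreal_pair (chi kappa : R) : Prop :=
  exists wp, upper wp /\
    [set w | nonreal w /\ is_root chi kappa w] = [set wp; conjc wp].

Definition roots_in (A : set C) (chi kappa : R) : \bar R :=
  root_count (S_inf chi) (xpt kappa)%:C A.

Definition has_multiple_real_root (chi kappa : R) : Prop :=
  exists w : R, is_root chi kappa w%:C /\
    (1 < root_mult (S_inf chi) (xpt kappa)%:C w%:C)%E.

(* d/dw Log S_chi is the logarithmic derivative of S_chi, which makes sense
   also outside the domain of the logarithm *)
Definition real_multiple_root (chi kappa w : R) : Prop :=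
  is_root chi kappa w%:C /\ dlog (S_inf chi) w%:C = 0.

Definition frozen_boundary : set (R * R) :=
  closure [set pt | liquid pt.1 pt.2] `&` closure [set pt | frozen pt.1 pt.2].

(* the second derivative of Log S_chi does not vanish at the multiple root *)
Definition nondegenerate_fold (chi kappa w : R) : Prop :=
  real_multiple_root chi kappa w /\ derive1 (dlog (S_inf chi)) w%:C <> 0.

End Model.

(* Main.v *)
(* Up to the scaled copies in F_k, S_chi is a product of factors attached to intervals
 on the positive axis, one endpoint a zero and the other a pole, and by separation the
 intervals of the same sign are disjoint. With both signs present, taking c to be the
 largest zero of sign -, each S_{chi,K} is (w - c) times a Stieltjes function with
 positive weights; such a function takes each real value at most once in the upper half
 plane, and it does so along a path w(x), 0 <= x <= B, from c to the negative axis.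
 Deforming the contour to the path, the moments of nu_chi become those of the density
 2 (1 - arg w(x) / pi) / alpha, and Poisson's kernel recovers the slope at x. With one
 sign only, the moments are those of [0, 1] and all the roots are real. *)
Require Import Defs.
From HB Require Import structures.
From mathcomp Require Import all_boot all_order all_algebra.
From mathcomp Require Import complex.
From mathcomp Require Import all_classical all_reals all_analysis.
From mathcomp Require Import measurable_realfun.
From mathcomp Require Import ring lra.

Set Implicit Arguments.
Unset Strict Implicit.
Unset Printing Implicit Defensive.

Import Order.TTheory GRing.Theory Num.Theory.
Import numFieldNormedType.Exports.
Local Open Scope classical_set_scope.
Local Open Scope ring_scope.
Local Open Scope complex_scope.

(** The obstacle is that the poles of S_chi accumulate at 0 or at infinity: S_chi has no finite
    partial fractions and is reached only through the rational S_{chi,K}, whose cancellations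
    between zeros and poles vary with K and chi. Whatever must survive the limit is therefore an
    inequality for S_{chi,K} with constants independent of both. The central one comes from a kernel
    identity in two points ([Kq_sum]), which expresses a positive sum over the poles through the
    values of S at these points. It yields uniqueness and simplicity of the upper root, the growth
    of |w(x) - c| along the path and a modulus of continuity, all without differentiating the path.
    Residues are replaced by explicit primitives of partial fractions on the closed upper
    half-plane, and derivatives of limits by second-order Taylor bounds uniform in K. *)

Lemma uniq_map_inj (T U : eqType) (f : T -> U) (s : seq T) : uniq (map f s) ->
 {in s &, injective f}.
Proof.
elim: s => [//|a s ih] /= /andP[na us] p q; rewrite !inE.
move=> /orP[/eqP ->|ps] /orP[/eqP ->|qs] // E; last exact: ih.
 by move: na; rewrite E map_f.
by move: na; rewrite -E map_f.
Qed.

Lemma uniq_notin_rem (T : eqType) (s : seq T) : {in s, forall x, x \notin rem x s} -> uniq s.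
Proof.
elim: s => [//|a s ih] h /=.
have na : a \notin s by have := h a (mem_head a s); rewrite /= eqxx.
rewrite na ih // => x xs; have := h x; rewrite inE xs orbT /= => /(_ isT).
have /negPf -> : a != x by apply: contraNneq na => ->.
by rewrite inE negb_or => /andP[].
Qed.

Lemma seq_strict_ub (R : realDomainType) (s : seq R) : exists T, forall x, x \in s -> x < T.
Proof.
elim: s => [|a s [T h]]; first by exists 0.
exists (Num.max (a + 1) T) => x; rewrite inE lt_max => /orP[/eqP ->|/h ->]; last by rewrite orbT.
by rewrite ltrDl ltr01.
Qed.

Lemma jump_absurd (R : realFieldType) (p q x : R) : x < 1 -> q + 1 <= p -> p <= x + q -> False.
Proof. by move=> *; lra. Qed.

Section Analysis.
Context {R : realType}.
Notation C := R[i].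
Notation Re := complex.Re.
Notation Im := complex.Im.
Notation mu := (@lebesgue_measure R).
Notation cint := contour_integral.
Notation CI := (@complexI R).

(** * Modulus, and epsilon forms of continuity and complex differentiability *)

Section Cabs.
Implicit Types (z w : C) (x y : R).

Lemma cabsE z : `|z| = (cabs z)%:C.
Proof. by rewrite normc_def. Qed.

Lemma cabs_ge0 z : 0 <= cabs z. Proof. exact: sqrtr_ge0. Qed.

Lemma cabs0 : cabs (0 : C) = 0.
Proof. by apply: CI; rewrite -cabsE normr0. Qed.

Lemma cabs_eq0 z : (cabs z == 0) = (z == 0).
Proof. by rewrite -[z == 0]normr_eq0 cabsE -(inj_eq CI). Qed.

Lemma cabs_gt0 z : (0 < cabs z) = (z != 0).
Proof. by rewrite lt_def cabs_ge0 andbT cabs_eq0. Qed.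

Lemma cabsM z w : cabs (z * w) = cabs z * cabs w.
Proof. by apply: CI; rewrite rmorphM /= -!cabsE normrM. Qed.

Lemma cabsV z : cabs z^-1 = (cabs z)^-1.
Proof. by apply: CI; rewrite fmorphV /= -!cabsE normfV. Qed.

Lemma cabsX z n : cabs (z ^+ n) = cabs z ^+ n.
Proof. by apply: CI; rewrite rmorphXn /= -!cabsE normrX. Qed.

Lemma cabsN z : cabs (- z) = cabs z.
Proof. by apply: CI; rewrite -!cabsE normrN. Qed.

Lemma cabsBC z w : cabs (z - w) = cabs (w - z).
Proof. by rewrite -cabsN opprB. Qed.

Lemma cabsD z w : cabs (z + w) <= cabs z + cabs w.
Proof. by rewrite -lecR rmorphD /= -!cabsE ler_normD. Qed.

Lemma cabs_i : cabs ('i : C) = 1.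
Proof. by rewrite /cabs /= expr0n expr1n add0r sqrtr1. Qed.

Lemma cabsD_le z w (x : R) : cabs z + cabs w <= x -> cabs (z + w) <= x.
Proof. exact: le_trans (cabsD z w). Qed.

Lemma cabsB_ge z w : cabs z - cabs w <= cabs (z - w).
Proof. by rewrite lerBlDr -{1}[z](subrK w) cabsD. Qed.

Lemma cabsR x : cabs x%:C = `|x|.
Proof. by rewrite /cabs /= expr0n addr0 sqrtr_sqr. Qed.

Lemma cabs1 : cabs (1 : C) = 1.
Proof. by rewrite -[1]/(1%:C) cabsR normr1. Qed.

Lemma cabsJ z : cabs z^* = cabs z.
Proof. by case: z => a b; rewrite /cabs /= sqrrN. Qed.

Lemma cabs_sq z : cabs z ^+ 2 = Re z ^+ 2 + Im z ^+ 2.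
Proof. by rewrite sqr_sqrtr // addr_ge0 // sqr_ge0. Qed.

Lemma cabs_sqC z : (cabs z ^+ 2)%:C = z * z^*.
Proof.
by case: z => a b; rewrite cabs_sq /=; apply/eqP; rewrite eq_complex /=; apply/andP; split; apply/eqP; ring.
Qed.

Lemma Re_le_cabs z : `|Re z| <= cabs z.
Proof.
by rewrite -(ler_pXn2r (ltn0Sn 1)) ?nnegrE ?cabs_ge0 // cabs_sq real_normK ?num_real // lerDl sqr_ge0.
Qed.

Lemma Im_le_cabs z : `|Im z| <= cabs z.
Proof.
by rewrite -(ler_pXn2r (ltn0Sn 1)) ?nnegrE ?cabs_ge0 // cabs_sq real_normK ?num_real // lerDr sqr_ge0.
Qed.

Lemma cabs_le_ReIm z : cabs z <= `|Re z| + `|Im z|.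
Proof.
rewrite -(ler_pXn2r (ltn0Sn 1)) ?nnegrE ?cabs_ge0 ?addr_ge0 // cabs_sq.
by rewrite sqrrD !real_normK ?num_real // lerD2r lerDl mulrn_wge0 // mulr_ge0.
Qed.

Lemma cabs_sum (I : Type) (r : seq I) (P : pred I) (F : I -> C) :
 cabs (\sum_(i <- r | P i) F i) <= \sum_(i <- r | P i) cabs (F i).
Proof.
elim/big_rec2: _ => [|i y x _ le]; first by rewrite cabs0.
exact: le_trans (cabsD _ _) (lerD (lexx _) le).
Qed.

Lemma cReD z w : Re (z + w) = Re z + Re w. Proof. by case: z w => ? ? []. Qed.
Lemma cImD z w : Im (z + w) = Im z + Im w. Proof. by case: z w => ? ? []. Qed.
Lemma cReN z : Re (- z) = - Re z. Proof. by case: z. Qed.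
Lemma cImN z : Im (- z) = - Im z. Proof. by case: z. Qed.
Lemma cReB z w : Re (z - w) = Re z - Re w. Proof. by rewrite cReD cReN. Qed.
Lemma cImB z w : Im (z - w) = Im z - Im w. Proof. by rewrite cImD cImN. Qed.
Lemma cReM z w : Re (z * w) = Re z * Re w - Im z * Im w.
Proof. by case: z w => ? ? []. Qed.
Lemma cImM z w : Im (z * w) = Re z * Im w + Im z * Re w.
Proof. by case: z w => ? ? [] ? ? /=; rewrite addrC [in RHS]addrC addrC. Qed.
Lemma cReZ x z : Re (x%:C * z) = x * Re z.
Proof. by rewrite cReM /= mul0r subr0. Qed.
Lemma cImZ x z : Im (x%:C * z) = x * Im z.
Proof. by rewrite cImM /= mul0r addr0. Qed.
Lemma cReV z : Re z^-1 = Re z / cabs z ^+ 2.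
Proof. by rewrite cabs_sq; case: z. Qed.
Lemma cImV z : Im z^-1 = - Im z / cabs z ^+ 2.
Proof. by rewrite cabs_sq; case: z => a b /=; rewrite mulNr. Qed.
Lemma cReJ z : Re z^* = Re z. Proof. by case: z. Qed.
Lemma cImJ z : Im z^* = - Im z. Proof. by case: z. Qed.

Lemma Re_sum (I : Type) (r : seq I) (P : pred I) (F : I -> C) :
 Re (\sum_(i <- r | P i) F i) = \sum_(i <- r | P i) Re (F i).
Proof. by elim/big_rec2: _ => // i y x _ <-; rewrite cReD. Qed.
Lemma Im_sum (I : Type) (r : seq I) (P : pred I) (F : I -> C) :
 Im (\sum_(i <- r | P i) F i) = \sum_(i <- r | P i) Im (F i).
Proof. by elim/big_rec2: _ => // i y x _ <-; rewrite cImD. Qed.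

Lemma complexP z w : Re z = Re w -> Im z = Im w -> z = w.
Proof. by case: z w => ? ? [] ? ? /= -> ->. Qed.

Lemma nbhs_cabsP w (A : set C) :
 nbhs w A <-> exists2 d : R, 0 < d & forall z, cabs (z - w) < d -> A z.
Proof.
split.
 move=> /nbhs_normP[e /= e0 eA].
 have [d ed] : exists d : R, e = d%:C.
  by move: e0; rewrite ltcE => /andP[/eqP /= i0 _]; exists (Re e); case: e i0 {eA} => a b /= ->.
 exists d; first by rewrite -ltcR -ed.
 by move=> z zd; apply: eA => /=; rewrite cabsE cabsBC ed ltcR.
move=> [d d0 dA]; apply/nbhs_normP; exists d%:C => /=; first by rewrite ltcR.
by move=> z; rewrite /= cabsE cabsBC ltcR; exact: dA.
Qed.

Lemma cvg_cabsP (T : Type) (F : set_system T) (FF : Filter F) (f : T -> C) l :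
 (f @ F --> l) <-> forall e : R, 0 < e -> \forall x \near F, cabs (f x - l) < e.
Proof.
split=> [fl e e0|H].
 have : nbhs l [set z | cabs (z - l) < e] by apply/nbhs_cabsP; exists e.
 exact: fl.
move=> A /nbhs_cabsP[e e0 eA]; rewrite /nbhs /=.
by apply: filterS (H e e0) => x; exact: eA.
Qed.

Lemma cont_cabsP (f : C -> C) w : {for w, continuous f} <->
 forall e : R, 0 < e -> exists2 d : R, 0 < d &
  forall z, cabs (z - w) < d -> cabs (f z - f w) < e.
Proof.
rewrite /continuous_at; split=> [/(cvg_cabsP (nbhs_filter w)) H e e0|H].
 have := H e e0; rewrite -[X in X -> _]/(nbhs w _) => /nbhs_cabsP[d d0 dH].
 by exists d.
by apply/(cvg_cabsP (nbhs_filter w)) => e e0; apply/nbhs_cabsP; exact: H.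
Qed.

(** First-order expansion instead of the punctured quotient behind [is_derive]: it tolerates [h = 0]
    and composes with real curves that may stand still. *)
Definition cder (f : C -> C) (w d : C) := forall e : R, 0 < e ->
 exists2 r : R, 0 < r & forall h, cabs h < r ->
  cabs (f (w + h) - f w - d * h) <= e * cabs h.

Lemma cder_der f w d : cder f w d -> is_derive w 1 f d.
Proof.
move=> fd.
have H : h^-1 *: ((f \o shift w) (h *: (1 : C)) - f w) @[h --> 0^'] --> d.
 apply/cvg_cabsP => e e0.
 have [r r0 H] := fd (e / 2) ltac:(by rewrite divr_gt0).
 apply/nbhs_cabsP; exists r => // h; rewrite subr0 => hr h0.
 rewrite /=.
 have := H h hr; rewrite /= /shift /=.
 have -> : h *: (1 : C) = h by exact: mulr1.
 rewrite -[_ *: _]/(_ * _) [h + w]addrC => le.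
 have ch : 0 < cabs h by rewrite cabs_gt0.
 have -> : h^-1 * (f (w + h) - f w) - d = h^-1 * (f (w + h) - f w - d * h).
  by field.
 rewrite cabsM cabsV ltr_pdivrMl // (le_lt_trans le) // mulrC ltr_pM2l //.
 by rewrite ltr_pdivrMr // ltr_pMr // ltr1n.
by apply: DeriveDef; [apply/cvg_ex; exists d | apply: cvg_lim].
Qed.

Lemma der_cder f w d : is_derive w 1 f d -> cder f w d.
Proof.
move=> [/cvg_ex[l fl] dd]; have {dd} ld : l = d.
 by rewrite -dd; apply/esym/cvg_lim.
move=> e e0; have /cvg_cabsP/(_ e e0) := fl.
move=> /nbhs_cabsP[r r0 H]; exists r => // h hr.
have [->|h0] := eqVneq h 0.
 by rewrite addr0 subrr mulr0 subr0 cabs0 mulr0.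
have := H h; rewrite subr0 => /(_ hr h0) /=.
rewrite /shift /= -[_ *: _]/(_ * (_ : C)) -[h *: _]/(h * (_ : C)) mulr1 [h + w]addrC ld => lt.
have -> : f (w + h) - f w - d * h = h * (h^-1 * (f (w + h) - f w) - d) by field.
by rewrite cabsM mulrC ler_wpM2r ?cabs_ge0 // ltW.
Qed.

Lemma cder_derive1 f w d : cder f w d -> derive1 f w = d.
Proof. by move=> /cder_der [_ <-]; rewrite derive1E. Qed.

End Cabs.

(** * Bounded measurable integrands on a segment *)

Section RealInt.

Lemma segment_bounded (f : R -> R) (a b : R) :
 {within `[a, b], continuous f} -> exists V, forall s, a <= s <= b -> `|f s| <= V.
Proof.
have [ab fc|ba _] := leP a b; last first.
 by exists 0 => s /andP[as_ sb]; move: (le_trans as_ sb); rewrite leNgt ba.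
have nc : {within `[a, b], continuous (fun s => `|f s|)}.
 by move=> s; apply: cvg_norm; exact: fc.
have [c _ H] := EVT_max ab nc.
by exists `|f c| => s sab; apply: H; rewrite in_itv.
Qed.

(** The class of integrands used throughout. It contains the speed of a piecewise C1 curve, whose
    values at the corners are arbitrary, and it is stable under products and concatenation. *)
Definition mbd (f : R -> R) (a b : R) :=
 measurable_fun `[a, b] f /\ exists V, forall s, a <= s <= b -> `|f s| <= V.

Lemma mbd_int f a b : mbd f a b -> mu.-integrable `[a, b] (EFin \o f).
Proof.
move=> [mf [V fV]]; apply: measurable_bounded_integrable => //.
 exact/compact_finite_measure/segment_compact.
exists `|V|; split; first exact: num_real.
move=> x Vx s /=; rewrite in_itv /= => sab.
apply: le_trans (fV s sab) _; exact: le_trans (ler_norm _) (ltW Vx).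
Qed.

Lemma mbd_cat f a b c : a <= b <= c -> mbd f a b -> mbd f b c -> mbd f a c.
Proof.
move=> /andP[ab bc] [mf [V fV]] [mg [W fW]]; split.
 have -> : `[a, c]%classic = `[a, b]%classic `|` `[b, c]%classic.
  apply/seteqP; split => s /=; rewrite !in_itv /=.
   move=> /andP[as_ sc]; have [sb|bs] := leP s b; [left|right].
    by rewrite as_.
   by rewrite ltW.
  by case=> /andP[u v]; rewrite ?(le_trans u bc) ?(le_trans v bc) ?(le_trans ab u) ?u ?v.
 exact/measurable_funU.
exists (Num.max V W) => s /andP[as_ sc]; rewrite le_max.
have [sb|bs] := leP s b; first by rewrite fV ?as_.
by rewrite fW ?orbT // sc ltW.
Qed.

Lemma mbd_cont (f : R -> R) (a b : R) : {within `[a, b], continuous f} -> mbd f a b.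
Proof.
move=> fc; split; last exact: segment_bounded.
exact: subspace_continuous_measurable_fun.
Qed.

(** The two endpoints carry arbitrary values without harm to measurability or boundedness. This is
    how the corners of a contour, where [velocity] has no meaning, are handled. *)
Lemma mbd_oo (f h : R -> R) (a b : R) : {within `[a, b], continuous h} ->
 (forall s, a < s < b -> f s = h s) -> mbd f a b.
Proof.
move=> hc fh; have [mh [V hV]] := mbd_cont hc; split.
 suff mf : measurable_fun `]a, b[ f by exact: measurable_fun_itv_cc mf.
 apply: (@eq_measurable_fun _ _ _ _ _ h).
  by move=> s; rewrite inE /= in_itv /= => sab; rewrite fh.
 by apply: measurable_funS mh => // s /=; rewrite !in_itv /= => /andP[u v]; rewrite !ltW.
exists (Num.max V (Num.max `|f a| `|f b|)) => s /andP[]; rewrite !le_max.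
rewrite le_eqVlt => /predU1P[<-|as_]; first by rewrite lexx orbT.
rewrite le_eqVlt => /predU1P[->|sb]; first by rewrite lexx !orbT.
by rewrite fh ?as_ // hV // !ltW.
Qed.

Lemma Rint_cat (f : R -> R) (a b c : R) : a <= b <= c -> mbd f a c ->
 \int[mu]_(s in `[a, c]) f s =
 \int[mu]_(s in `[a, b]) f s + \int[mu]_(s in `[b, c]) f s.
Proof.
move=> /andP[ab bc] /mbd_int fi.
have fi2 : mu.-integrable `]b, c] (EFin \o f).
 by apply: integrableS fi => // s /=; rewrite !in_itv /= => /andP[bs ->]; rewrite andbT (le_trans ab) // ltW.
rewrite -(Rintegral_itv_obnd_cbnd fi2) -(Rintegral_itvB fi) ?bnd_simp //.
by rewrite addrC subrK.
Qed.

Lemma Rint_oo (f h : R -> R) (a b : R) : a <= b -> mbd f a b -> mbd h a b ->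
 (forall s, a < s < b -> f s = h s) ->
 \int[mu]_(s in `[a, b]) f s = \int[mu]_(s in `[a, b]) h s.
Proof.
move=> ab mf mh fh.
have E k : mbd k a b -> \int[mu]_(s in `[a, b]) k s = \int[mu]_(s in `]a, b[) k s.
 move=> /mbd_int ki.
 have k1 : mu.-integrable `]a, b] (EFin \o k).
  by apply: integrableS ki => // s /=; rewrite !in_itv /= => /andP[/ltW-> ->].
 have k2 : mu.-integrable `]a, b[ (EFin \o k).
  by apply: integrableS ki => // s /=; rewrite !in_itv /= => /andP[/ltW-> /ltW->].
 by rewrite -(Rintegral_itv_obnd_cbnd k1) -Rintegral_itv_bndo_bndc.
rewrite !E //; apply: eq_Rintegral => s; rewrite inE /= in_itv /=; exact: fh.
Qed.

Lemma Rint_bound (f : R -> R) (a b m : R) : a <= b -> 0 <= m -> mbd f a b ->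
 (forall s, a <= s <= b -> `|f s| <= m) ->
 `|\int[mu]_(s in `[a, b]) f s| <= m * (b - a).
Proof.
move=> ab m0 mf fm; apply: le_trans (le_normr_Rintegral _ (mbd_int mf)) _ => //.
have -> : m * (b - a) = \int[mu]_(s in `[a, b]) m.
 rewrite Rintegral_cst //; congr (_ * _).
 have /= -> := @lebesgue_measure_itv R `[a, b]; rewrite -EFinD.
 by case: ifP => //; move: ab; rewrite le_eqVlt lte_fin => /predU1P[->|->] //; rewrite subrr.
apply: le_Rintegral => //.
- by apply: integrable_norm => //; exact: mbd_int.
- apply: mbd_int; apply: mbd_cont => s; exact: cvg_cst.
Qed.

End RealInt.

(** * Derivatives along real curves *)

Lemma is_derive_epsP (f : R -> R) (s d : R) : is_derive s 1 f d <->
 forall e, 0 < e -> exists2 r : R, 0 < r & forall t, `|t| < r ->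
  `|f (s + t) - f s - d * t| <= e * `|t|.
Proof.
split.
 move=> [/cvg_ex[l fl] dd]; have {dd} ld : l = d.
  by rewrite -dd; apply/esym/cvg_lim.
 move=> e e0; have /cvgrPdist_lt/(_ e e0) := fl.
 move=> /nbhs_normP[r /= r0 H]; exists r => // t tr.
 have [->|t0] := eqVneq t 0.
  by rewrite addr0 subrr mulr0 subr0 normr0 mulr0.
 have := H t; rewrite /= sub0r normrN => /(_ tr t0).
 rewrite /shift /= -[_ *: _]/(_ * _) -[t *: _]/(t * _) mulr1 [t + s]addrC ld => lt.
 have -> : f (s + t) - f s - d * t = - t * (d - t^-1 * (f (s + t) - f s)) by field.
 by rewrite normrM normrN mulrC ler_wpM2r // ltW.
move=> fd.
have H : h^-1 *: ((f \o shift s) (h *: (1 : R)) - f s) @[h --> 0^'] --> d.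
 apply/cvgrPdist_lt => e e0.
 have [r r0 H] := fd (e / 2) ltac:(by rewrite divr_gt0).
 apply/nbhs_normP; exists r => //= h; rewrite /= sub0r normrN => hr h0.
 have := H h hr; rewrite /shift /=.
 have -> : h *: (1 : R) = h by exact: mulr1.
 rewrite -[_ *: _]/(_ * _) [h + s]addrC => le.
 have ch : 0 < `|h| by rewrite normr_gt0.
 have -> : d - h^-1 * (f (s + h) - f s) = - (h^-1 * (f (s + h) - f s - d * h)).
  by field.
 rewrite normrN normrM normfV ltr_pdivrMl // (le_lt_trans le) // mulrC ltr_pM2l //.
 by rewrite ltr_pdivrMr // ltr_pMr // ltr1n.
by apply: DeriveDef; [apply/cvg_ex; exists d | apply: cvg_lim].
Qed.

Definition rder (h : R -> C) (s : R) (v : C) := forall e : R, 0 < e ->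
 exists2 r : R, 0 < r & forall t, `|t| < r ->
  cabs (h (s + t) - h s - t%:C * v) <= e * `|t|.

Lemma rder_ReIm (h : R -> C) (s : R) (v : C) : is_derive s 1 (fun r => Re (h r)) (Re v) ->
 is_derive s 1 (fun r => Im (h r)) (Im v) -> rder h s v.
Proof.
move=> /is_derive_epsP hr /is_derive_epsP hi e e0.
have e2 : 0 < e / 2 by rewrite divr_gt0.
have [r1 r10 H1] := hr _ e2; have [r2 r20 H2] := hi _ e2.
exists (Num.min r1 r2) => [|t]; first by rewrite lt_min r10.
rewrite lt_min => /andP[t1 t2]; apply: le_trans (cabs_le_ReIm _) _.
rewrite !cReB !cImB cReZ cImZ [t * Re _]mulrC [t * Im _]mulrC.
by have := lerD (H1 t t1) (H2 t t2); rewrite -mulrDl -splitr.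
Qed.

Lemma rder_Re (h : R -> C) (s : R) (v : C) : rder h s v -> is_derive s 1 (fun r => Re (h r)) (Re v).
Proof.
move=> hv; apply/is_derive_epsP => e e0; have [r r0 H] := hv e e0.
exists r => // t /H; apply: le_trans.
by rewrite (le_trans _ (Re_le_cabs _)) // !cReB cReZ mulrC.
Qed.

Lemma rder_Im (h : R -> C) (s : R) (v : C) : rder h s v -> is_derive s 1 (fun r => Im (h r)) (Im v).
Proof.
move=> hv; apply/is_derive_epsP => e e0; have [r r0 H] := hv e e0.
exists r => // t /H; apply: le_trans.
by rewrite (le_trans _ (Im_le_cabs _)) // !cImB cImZ mulrC.
Qed.

Lemma rder_lip (h : R -> C) (s : R) (v : C) : rder h s v ->
 exists2 r : R, 0 < r & forall t, `|t| < r -> cabs (h (s + t) - h s) <= (cabs v + 1) * `|t|.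
Proof.
move=> hv; have [r r0 H] := hv 1 ltr01; exists r => // t /H; rewrite mul1r => le.
have -> : h (s + t) - h s = (h (s + t) - h s - t%:C * v) + t%:C * v by ring.
apply: cabsD_le; rewrite cabsM cabsR mulrDl mul1r addrC lerD //.
by rewrite mulrC.
Qed.

Lemma rder_comp (F : C -> C) (h : R -> C) (s : R) (v d : C) : cder F (h s) d -> rder h s v ->
 rder (F \o h) s (d * v).
Proof.
move=> Fd hv e e0.
pose A := cabs v + 1; have A0 : 0 < A by rewrite ltr_wpDl // cabs_ge0.
pose B := cabs d + 1; have B0 : 0 < B by rewrite ltr_wpDl // cabs_ge0.
have [r1 r10 H1] := Fd (e / 2 / A) ltac:(by rewrite !divr_gt0).
have [r2 r20 H2] := rder_lip hv.
have [r3 r30 H3] := hv (e / 2 / B) ltac:(by rewrite !divr_gt0).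
exists (Num.min (r1 / A) (Num.min r2 r3)) => [|t].
 by rewrite !lt_min divr_gt0 // r20.
rewrite !lt_min => /and3P[t1 t2 t3].
have h1 := H2 t t2; have h2 := H3 t t3.
have h3 : cabs (h (s + t) - h s) < r1.
 by apply: le_lt_trans h1 _; rewrite -/A mulrC -ltr_pdivlMr.
have := H1 _ h3; rewrite [h s + _]addrC subrK => h4 /=.
have -> : F (h (s + t)) - F (h s) - t%:C * (d * v) =
 (F (h (s + t)) - F (h s) - d * (h (s + t) - h s)) +
 d * (h (s + t) - h s - t%:C * v) by ring.
apply: cabsD_le; rewrite cabsM [e]splitr mulrDl lerD //.
 apply: le_trans h4 _; rewrite -mulrA ler_pM2l ?divr_gt0 //.
 by rewrite ler_pdivrMl.
apply: (@le_trans _ _ (B * (e / 2 / B * `|t|))).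
 apply: ler_pM => //; rewrite ?cabs_ge0 //.
 by rewrite /B lerDl.
by rewrite mulrA [B * _]mulrC divfK // gt_eqF.
Qed.

(** * Piecewise C1 curves *)

Section Contour.
Variable g : R -> C.
Hypothesis gC1 : piecewise_C1 g.

(** The cuts are consumed from the left, which is why the left end is generalized in the proof.
    Boundedness of the speed, continuity and the fundamental theorem for a contour are thereby
    reduced to single C1 pieces. *)
Lemma piecewise_ind (Pr : R -> R -> Prop) :
 (forall a b h, 0 <= a -> a < b -> b <= 1 -> is_C1 h ->
  (forall r, a <= r <= b -> g r = h r) -> Pr a b) ->
 (forall a b c, 0 <= a -> a < b -> b < c -> c <= 1 -> Pr a b -> Pr b c -> Pr a c) -> Pr 0 1.
Proof.
move=> Hp Hc; have [s [ss Hs]] := gC1.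
suff : forall s a, 0 <= a -> sorted <%R (a :: rcons s 1) ->
  (forall k, (k <= size s)%N -> exists h, is_C1 h /\
   forall r, nth 0 (a :: rcons s 1) k <= r <= nth 0 (a :: rcons s 1) k.+1 -> g r = h r) ->
  Pr a 1.
 by move=> /(_ s 0 (lexx _)); apply.
elim=> {s ss Hs} [a a0 /= /andP[a1 _] H|b s IH a a0].
 have [h [hC gh]] := H 0%N isT; exact: (Hp a 1 h).
rewrite rcons_cons /= => /andP[ab bs] H.
have b1 : b < 1.
 have := order_path_min lt_trans bs; move/allP/(_ 1); apply.
 by rewrite mem_rcons mem_head.
have b0 : 0 <= b by rewrite (le_trans a0) // ltW.
apply: (Hc a b 1) => //.
 have [h [hC gh]] := H 0%N isT; apply: (Hp a b h) => //; exact: ltW.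
apply: IH => // k ks; have [h [hC gh]] := H k.+1 ks.
by exists h; split.
Qed.

Lemma C1_rder (h : R -> C) s : is_C1 h -> rder h s (velocity h s).
Proof.
move=> [hr hi _]; apply: rder_ReIm; rewrite /velocity /= derive1E; apply: derivableP;
 [exact: hr | exact: hi].
Qed.

Lemma velocity_eq (h : R -> C) a b s : (forall r, a <= r <= b -> g r = h r) ->
 a < s < b -> velocity g s = velocity h s.
Proof.
move=> gh /andP[as_ sb]; rewrite /velocity !derive1E.
have H : \near s, g s = h s.
 near=> x; apply: gh; apply/andP; split; apply: ltW; near: x.
  exact: lt_nbhsr.
 exact: lt_nbhsl.
by congr (_ +i* _); apply: near_eq_derive; near=> x; congr (_ _); near: x.
Unshelve. all: by end_near. Qed.

Lemma Re_within (h : R -> C) (A : set R) :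
 (forall s, A s -> {for s, continuous h}) ->
 {within A, continuous (fun s => Re (h s))} /\ {within A, continuous (fun s => Im (h s))}.
Proof.
move=> hc; split; apply: continuous_in_subspaceT => s /set_mem As;
 apply/cvgrPdist_lt => e e0; have /cvg_cabsP/(_ e e0) := hc s As;
 apply: filterS => x; apply: le_lt_trans.
 by rewrite distrC -cReB Re_le_cabs.
by rewrite distrC -cImB Im_le_cabs.
Qed.

Lemma velocity_mbd : mbd (fun s => Re (velocity g s)) 0 1 /\
 mbd (fun s => Im (velocity g s)) 0 1.
Proof.
apply: (@piecewise_ind (fun a b => mbd (fun s => Re (velocity g s)) a b /\
 mbd (fun s => Im (velocity g s)) a b)).
 move=> a b h a0 ab b1 [hr hi hc] gh.
 have [cr ci] := @Re_within (velocity h) `[a, b] (fun s _ => hc s).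
 split.
  by apply: (mbd_oo cr) => s sab; rewrite (velocity_eq gh).
 by apply: (mbd_oo ci) => s sab; rewrite (velocity_eq gh).
move=> a b c a0 ab bc c1 [h1 h2] [h3 h4].
by split; apply: (@mbd_cat _ a b c) => //; rewrite !ltW.
Qed.

Lemma curve_cont : {within `[0, 1], continuous (fun s => Re (g s))} /\
 {within `[0, 1], continuous (fun s => Im (g s))}.
Proof.
apply: (@piecewise_ind (fun a b => {within `[a, b], continuous (fun s => Re (g s))} /\
 {within `[a, b], continuous (fun s => Im (g s))})).
 move=> a b h a0 ab b1 hC gh.
 have hc s : {for s, continuous h}.
  have := rder_lip (C1_rder s hC) => -[r r0 H].
  apply/cvg_cabsP => e e0.
  pose A := cabs (velocity h s) + 1; have A0 : 0 < A by rewrite ltr_wpDl // cabs_ge0.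
  near=> t; have -> : t = s + (t - s) by rewrite addrC subrK.
  have ts : `|t - s| < Num.min r (e / A).
   near: t; apply/nbhs_normP; exists (Num.min r (e / A)) => /=.
    by rewrite lt_min r0 divr_gt0.
   by move=> y /=; rewrite distrC.
  move: ts; rewrite lt_min => /andP[t1 t2].
  by apply: le_lt_trans (H _ t1) _; rewrite -/A mulrC -ltr_pdivlMr.
 have [cr ci] := @Re_within h `[a, b] (fun s _ => hc s).
 split; last first.
  apply: (@subspace_eq_continuous _ _ _ (fun s => Im (h s))) ci => s.
  by rewrite inE /= in_itv /= => sab; rewrite /from_subspace /= gh.
 apply: (@subspace_eq_continuous _ _ _ (fun s => Re (h s))) cr => s.
 by rewrite inE /= in_itv /= => sab; rewrite /from_subspace /= gh.
move=> a b c a0 ab bc c1 [h1 h2] [h3 h4].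
have E : `[a, c]%classic = `[a, b]%classic `|` `[b, c]%classic.
 apply/seteqP; split => s /=; rewrite !in_itv /=.
  move=> /andP[as_ sc]; have [sb|bs] := leP s b; [left|right].
   by rewrite as_.
  by rewrite ltW.
 by case=> /andP[u v]; rewrite ?(le_trans u (ltW bc)) ?(le_trans v (ltW bc)) ?(le_trans (ltW ab) u) ?u ?v.
by rewrite E; split; apply: withinU_continuous => //; exact: itv_closed.
Unshelve. all: by end_near. Qed.

End Contour.

Section MbdAlg.
Implicit Types (f h : R -> R) (a b : R).

Lemma mbdM f h a b : mbd f a b -> mbd h a b -> mbd (fun s => f s * h s) a b.
Proof.
move=> [mf [V fV]] [mh [W hW]]; split; first exact: measurable_funM.
by exists (V * W) => s sab; rewrite normrM ler_pM ?fV ?hW.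
Qed.

Lemma mbd_lin (x y : R) f h a b : mbd f a b -> mbd h a b -> mbd (fun s => x * f s + y * h s) a b.
Proof.
move=> [mf [V fV]] [mh [W hW]]; split.
 by apply: measurable_funD; apply: measurable_funM.
exists (`|x| * V + `|y| * W) => s sab.
by rewrite (le_trans (ler_normD _ _)) // !normrM lerD // ler_wpM2l ?fV ?hW.
Qed.

Lemma Rint_lin (x y : R) f h a b : mbd f a b -> mbd h a b ->
 \int[mu]_(s in `[a, b]) (x * f s + y * h s) =
 x * \int[mu]_(s in `[a, b]) f s + y * \int[mu]_(s in `[a, b]) h s.
Proof.
move=> mf mh.
have m1 k z : mbd k a b -> mbd (fun s => z * k s) a b.
 move=> mk; have [u [V uV]] := mbd_lin z 0 mk mk; split.
  by apply: measurable_funM => //; case: mk.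
 by exists V => s /uV; rewrite mul0r addr0.
rewrite RintegralD // ?RintegralZl //; by apply: mbd_int => //; exact: m1.
Qed.

End MbdAlg.

(** * Contour integrals: linearity, size, primitives *)

Section ContourFunctional.
Variable g : R -> C.
Hypothesis gC1 : piecewise_C1 g.
Implicit Types f h F : C -> C.

Definition ccont (f : C -> C) := forall s, 0 <= s <= 1 -> {for g s, continuous f}.

Lemma ccont_within f : ccont f -> {within `[0, 1], continuous (fun s => Re (f (g s)))} /\
 {within `[0, 1], continuous (fun s => Im (f (g s)))}.
Proof.
move=> fc; have [/subspace_continuousP cr /subspace_continuousP ci] := curve_cont gC1.
have H (s : R) : `[0, 1]%classic s -> forall e : R, 0 < e ->
  \forall x \near within `[0, 1]%classic (nbhs s), cabs (f (g x) - f (g s)) < e.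
 move=> s01 e e0.
 have := fc s; rewrite /= in_itv /= in s01 => /(_ s01) /cont_cabsP/(_ e e0)[d d0 H].
 have d2 : 0 < d / 2 by rewrite divr_gt0.
 have s01' : `[0, 1]%classic s by rewrite /= in_itv.
 have /cvgrPdist_lt/(_ _ d2) n1 := cr s s01'.
 have /cvgrPdist_lt/(_ _ d2) n2 := ci s s01'.
 apply: filterS2 n1 n2 => x h1 h2; apply: H.
 apply: le_lt_trans (cabs_le_ReIm _) _.
 by rewrite cReB cImB [d]splitr ltrD // distrC.
split; apply/subspace_continuousP => s s01; apply/cvgrPdist_lt => e e0;
 apply: filterS (H s s01 e e0) => x; apply: le_lt_trans; rewrite distrC.
 by rewrite -cReB Re_le_cabs.
by rewrite -cImB Im_le_cabs.
Qed.

Lemma integrand_mbd f : ccont f ->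
 mbd (fun s => Re (f (g s) * velocity g s)) 0 1 /\
 mbd (fun s => Im (f (g s) * velocity g s)) 0 1.
Proof.
move=> fc; have [cr ci] := ccont_within fc; have [vr vi] := velocity_mbd gC1.
have {}cr := mbd_cont cr; have {}ci := mbd_cont ci.
split.
 have := mbd_lin 1 (-1) (mbdM cr vr) (mbdM ci vi).
 by under eq_fun do rewrite mul1r mulN1r -cReM.
have := mbd_lin 1 1 (mbdM cr vi) (mbdM ci vr).
by under eq_fun do rewrite !mul1r -cImM.
Qed.

Lemma cintE f : cint g f =
 (\int[mu]_(s in `[0, 1]) Re (f (g s) * velocity g s)) +i*
 (\int[mu]_(s in `[0, 1]) Im (f (g s) * velocity g s)).
Proof. by rewrite /contour_integral /cintegral set_itvcc. Qed.

Lemma eq_cint f h : (forall s, 0 <= s <= 1 -> f (g s) = h (g s)) ->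
 cint g f = cint g h.
Proof.
move=> fh; rewrite !cintE; congr (_ +i* _); apply: eq_Rintegral => s;
 by rewrite inE /= in_itv /= => /fh ->.
Qed.

Lemma cint_lin (k l : C) f h : ccont f -> ccont h ->
 cint g (fun w => k * f w + l * h w) =
 k * cint g f + l * cint g h.
Proof.
move=> fc hc; have [fr fi] := integrand_mbd fc; have [hr hi] := integrand_mbd hc.
rewrite !cintE; apply: complexP; rewrite /= ?cReD ?cImD ?cReM ?cImM /=.
 rewrite -!mulNr -(Rint_lin _ _ fr fi) -(Rint_lin _ _ hr hi).
 have m1 := mbd_lin (Re k) (- Im k) fr fi.
 have m2 := mbd_lin (Re l) (- Im l) hr hi.
 rewrite -[RHS]mul1r mulrDr -(Rint_lin _ _ m1 m2).
 by apply: eq_Rintegral => s _; rewrite !(cReD, cReM, cImD, cImM); ring.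
rewrite -(Rint_lin _ _ fi fr) -(Rint_lin _ _ hi hr).
have m1 := mbd_lin (Re k) (Im k) fi fr.
have m2 := mbd_lin (Re l) (Im l) hi hr.
rewrite -[RHS]mul1r mulrDr -(Rint_lin _ _ m1 m2).
by apply: eq_Rintegral => s _; rewrite !(cReD, cReM, cImD, cImM); ring.
Qed.

(** [V] comes from bounds of the two components of the speed alone, so one constant serves every
    integrand and every uniform limit. *)
Lemma cint_bound : exists2 V : R, 0 <= V & forall f m, 0 <= m -> ccont f ->
 (forall s, 0 <= s <= 1 -> cabs (f (g s)) <= m) -> cabs (cint g f) <= V * m.
Proof.
have [[_ [V vV]] [_ [W vW]]] := velocity_mbd gC1.
have V0 : 0 <= V by have := vV 0; rewrite lexx ler01 => /(_ isT); apply: le_trans.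
have W0 : 0 <= W by have := vW 0; rewrite lexx ler01 => /(_ isT); apply: le_trans.
exists ((V + W) + (V + W)) => [|f m m0 fc fm]; first by rewrite !addr_ge0.
have [fr fi] := integrand_mbd fc.
have cv s : 0 <= s <= 1 -> cabs (f (g s) * velocity g s) <= m * (V + W).
 move=> s01; rewrite cabsM ler_pM ?cabs_ge0 ?fm //.
 by rewrite (le_trans (cabs_le_ReIm _)) // lerD ?vV ?vW.
have m1 : 0 <= m * (V + W) by rewrite mulr_ge0 // addr_ge0.
rewrite cintE (le_trans (cabs_le_ReIm _)) //= mulrDl mulrC lerD //.
 have := Rint_bound ler01 m1 fr; rewrite subr0 mulr1; apply => s /cv.
 exact/le_trans/Re_le_cabs.
have := Rint_bound ler01 m1 fi; rewrite subr0 mulr1; apply => s /cv.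
exact/le_trans/Im_le_cabs.
Qed.

Lemma mbdS (f : R -> R) (a b c d : R) : a <= c -> d <= b -> mbd f a b -> mbd f c d.
Proof.
move=> ac db [mf [V fV]]; split.
 apply: measurable_funS mf => // s /=; rewrite !in_itv /= => /andP[cs sd].
 by rewrite (le_trans ac cs) (le_trans sd db).
by exists V => s /andP[cs sd]; rewrite fV // (le_trans ac cs) (le_trans sd db).
Qed.

Lemma rder_continuous (h : R -> C) (s : R) (v : C) : rder h s v -> {for s, continuous h}.
Proof.
move=> /rder_lip[r r0 H]; apply/cvg_cabsP => e e0.
pose A := cabs v + 1; have A0 : 0 < A by rewrite ltr_wpDl // cabs_ge0.
near=> t; have -> : t = s + (t - s) by rewrite addrC subrK.
have ts : `|t - s| < Num.min r (e / A).
 near: t; apply/nbhs_normP; exists (Num.min r (e / A)) => /=.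
  by rewrite lt_min r0 divr_gt0.
 by move=> y /=; rewrite distrC.
move: ts; rewrite lt_min => /andP[t1 t2].
by apply: le_lt_trans (H _ t1) _; rewrite -/A mulrC -ltr_pdivlMr.
Unshelve. all: by end_near. Qed.

(** On a C1 piece the real part of [F] along the curve has a continuous derivative, so the
    fundamental theorem applies there; the pieces telescope. *)
Lemma cint_der_Re F f :
 (forall s, 0 <= s <= 1 -> cder F (g s) (f (g s))) -> ccont f ->
 Re (cint g f) = Re (F (g 1)) - Re (F (g 0)).
Proof.
move=> Fd fc; have [mf _] := integrand_mbd fc.
rewrite cintE /=.
pose phi s := Re (f (g s) * velocity g s).
apply: (@piecewise_ind _ gC1 (fun a b => \int[mu]_(s in `[a, b]) phi s =
 Re (F (g b)) - Re (F (g a)))); last first.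
 move=> a b c a0 ab bc c1 h1 h2; rewrite (@Rint_cat phi a b c) ?h1 ?h2 ?ltW //.
  by rewrite addrC subrKA.
 by apply: mbdS mf.
move=> a b h a0 ab b1 hC gh.
pose psi s := Re (f (h s) * velocity h s).
have hab s : a <= s <= b -> cder F (h s) (f (h s)) /\ {for h s, continuous f}.
 move=> sab; rewrite -(gh _ sab); have s01 : 0 <= s <= 1.
  by case/andP: sab => u v; rewrite (le_trans a0 u) (le_trans v b1).
 by split; [exact: Fd | exact: fc].
have pc : {within `[a, b], continuous psi}.
 have hc (s : R) : a <= s <= b -> {for s, continuous (fun r => f (h r) * velocity h r)}.
  move=> sab; apply: cvgM.
   apply: (continuous_comp (g := f)); last by case: (hab s sab).
   exact: rder_continuous (C1_rder s hC).
  by have [_ _ cv] := hC; exact: cv.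
 by have [] := @Re_within (fun r => f (h r) * velocity h r) `[a, b]
  (fun s sab => hc s ltac:(by move: sab; rewrite /= in_itv)).
have mpsi := mbd_cont pc.
rewrite (@Rint_oo phi psi) ?ltW //; first last.
- by move=> s sab; rewrite /phi /psi (velocity_eq gh sab) gh // !ltW //; case/andP: sab.
- by apply: mbdS mf => //; exact: le_trans (ltW ab) b1.
have rd s : a <= s <= b -> rder (F \o h) s (f (h s) * velocity h s).
 by move=> sab; apply: rder_comp; [case: (hab s sab) | exact: C1_rder].
have rc s : a <= s <= b -> {for s, continuous (fun r => Re (F (h r)))}.
 move=> sab; apply/differentiable_continuous/derivable1_diffP.
 by have [] := rder_Re (rd s sab).
rewrite /Rintegral (@continuous_FTC2 _ psi (fun r => Re (F (h r))) a b) //=.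
- by rewrite !gh ?lexx ?ltW.
- split=> [s||].
 + rewrite in_itv /= => /andP[u v].
  by have [] := rder_Re (rd s ltac:(by rewrite !ltW)).
 + by apply: cvg_at_right_filter (rc a _); rewrite lexx ltW.
 + by apply: cvg_at_left_filter (rc b _); rewrite lexx ltW.
- move=> s; rewrite in_itv /= => /andP[u v]; rewrite derive1E.
 by have [_ ->] := rder_Re (rd s ltac:(by rewrite !ltW)).
Qed.

Lemma cder_scale (k : C) F w d : cder F w d -> cder (fun z => k * F z) w (k * d).
Proof.
move=> Fd e e0; pose A := cabs k + 1.
have A0 : 0 < A by rewrite ltr_wpDl // cabs_ge0.
have [r r0 H] := Fd (e / A) ltac:(by rewrite divr_gt0).
exists r => // h /H le.
have -> : k * F (w + h) - k * F w - k * d * h = k * (F (w + h) - F w - d * h) by ring.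
rewrite cabsM (le_trans (ler_wpM2l (cabs_ge0 _) le)) //.
rewrite mulrA ler_wpM2r ?cabs_ge0 // mulrA ler_pdivrMr // mulrC ler_pM2l //.
by rewrite /A lerDl.
Qed.

(** The imaginary part is the real part of the same statement for [- 'i * F]. *)
Lemma cint_der F f :
 (forall s, 0 <= s <= 1 -> cder F (g s) (f (g s))) -> ccont f ->
 cint g f = F (g 1) - F (g 0).
Proof.
move=> Fd fc; apply: complexP; first by rewrite cReB; exact: cint_der_Re.
have ImE (z : C) : Im z = Re (- 'i * z) by case: z => x y /=; ring.
rewrite !ImE mulrBr cReB.
rewrite -(@cint_der_Re (fun z => - 'i * F z) (fun z => - 'i * f z)).
- have := cint_lin (- 'i) 0 fc fc; rewrite mul0r addr0 => <-.
 by rewrite (@eq_cint (fun w => - 'i * f w + 0 * f w) (fun w => - 'i * f w)) // => s _;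
  rewrite mul0r addr0.
- by move=> s s01; apply: cder_scale; exact: Fd.
- by move=> s s01; apply: (@cvgM _ _ _ _ (fun=> - 'i) f (- 'i) (f (g s)) (cvg_cst _) (fc s s01)).
Qed.

Hypothesis gcl : g 0 = g 1.

Lemma cint_prim F f :
 (forall s, 0 <= s <= 1 -> cder F (g s) (f (g s))) -> ccont f ->
 cint g f = 0.
Proof. by move=> Fd fc; rewrite (cint_der Fd fc) gcl subrr. Qed.

End ContourFunctional.

(** * The winding integral and its values inside and outside *)

Section Winding.
Variable g : R -> C.
Hypotheses (gC1 : piecewise_C1 g) (gcl : g 0 = g 1).

Lemma cabs_le0_eq (z w : C) : cabs (z - w) <= 0 -> z = w.
Proof.
move=> h; have /eqP : cabs (z - w) = 0 by apply/eqP; rewrite eq_le h cabs_ge0.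
by rewrite cabs_eq0 subr_eq0 => /eqP.
Qed.

Lemma cder_id (w : C) : cder id w 1.
Proof.
move=> e e0; exists 1 => // h _.
have -> : id (w + h) - id w - 1 * h = 0 by rewrite /=; ring.
by rewrite cabs0 mulr_ge0 ?cabs_ge0 // ltW.
Qed.

Lemma cder_cst (k w : C) : cder (fun=> k) w 0.
Proof.
by move=> e e0; exists 1 => // h _; rewrite subrr mul0r subrr cabs0 mulr_ge0 ?cabs_ge0 // ltW.
Qed.

Lemma cderD (F G : C -> C) (w d k : C) : cder F w d -> cder G w k ->
 cder (fun z => F z + G z) w (d + k).
Proof.
move=> Fd Gk; apply: der_cder.
by have := is_deriveD (cder_der Fd) (cder_der Gk).
Qed.

Lemma cderM (F G : C -> C) (w d k : C) : cder F w d -> cder G w k ->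
 cder (fun z => F z * G z) w (F w * k + G w * d).
Proof.
move=> Fd Gk; apply: der_cder.
by have := is_deriveM (cder_der Fd) (cder_der Gk).
Qed.

Lemma cderV (F : C -> C) (w d : C) : F w != 0 -> cder F w d ->
 cder (fun z => (F z)^-1) w (- (F w) ^- 2 * d).
Proof.
move=> F0 Fd; apply: der_cder.
have [dF <-] := cder_der Fd.
by apply: DeriveDef; [exact: derivableV | rewrite deriveV].
Qed.

Lemma cder_exp (F : C -> C) (w d : C) n : cder F w d ->
 cder (fun z => F z ^+ n) w (n%:R * F w ^+ n.-1 * d).
Proof.
move=> Fd; elim: n => [|n IH].
 by rewrite !mul0r; under eq_fun do rewrite expr0; exact: cder_cst.
under eq_fun do rewrite exprS.
have := cderM Fd IH.
suff -> : F w * (n%:R * F w ^+ n.-1 * d) + F w ^+ n * d = n.+1%:R * F w ^+ n.+1.-1 * d by [].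
case: n {IH} => [|n] /=; first by ring.
by rewrite !exprS -[n.+2%:R]natr1; ring.
Qed.

Lemma cder_cont (F : C -> C) (w d : C) : cder F w d -> {for w, continuous F}.
Proof.
move=> Fd; have [Fw _] := cder_der Fd.
exact/differentiable_continuous/derivable1_diffP.
Qed.

Lemma cder_inv (a w : C) : w != a -> cder (fun z => (z - a)^-1) w (- (w - a) ^- 2).
Proof.
move=> wa.
have H : cder (fun z => z - a) w 1.
 by have := cderD (cder_id w) (cder_cst (- a) w); rewrite addr0.
by have := @cderV _ _ _ _ H; rewrite subr_eq0 mulr1 => /(_ wa).
Qed.

Lemma off_curve_dist (a : C) : ~ curve g a ->
 exists2 d : R, 0 < d & forall s, 0 <= s <= 1 -> d <= cabs (g s - a).
Proof.
move=> ga.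
have [/subspace_continuousP cr /subspace_continuousP ci] := curve_cont gC1.
have nc : {within `[0, 1], continuous (fun s => cabs (g s - a))}.
 apply/subspace_continuousP => s s01; apply/cvgrPdist_lt => e e0.
 have e2 : 0 < e / 2 by rewrite divr_gt0.
 have /cvgrPdist_lt/(_ _ e2) n1 := cr s s01.
 have /cvgrPdist_lt/(_ _ e2) n2 := ci s s01.
 apply: filterS2 n1 n2 => x h1 h2.
 have H (p q : C) : `|cabs p - cabs q| <= cabs (p - q).
  by rewrite ler_norml cabsB_ge andbT lerNl opprB cabsBC cabsB_ge.
 apply: le_lt_trans (H _ _) _; rewrite opprB addrA subrK.
 apply: le_lt_trans (cabs_le_ReIm _) _.
 by rewrite cReB cImB [e]splitr ltrD.
have [s0 s01 H] := EVT_min ler01 nc.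
exists (cabs (g s0 - a)).
 rewrite cabs_gt0 subr_eq0; apply/eqP => ge; apply: ga; exists s0 => //=.
by move=> s sI; apply: H; rewrite in_itv.
Qed.

Definition wint (a : C) := cint g (fun w => (w - a)^-1).

Lemma ccont_inv (a : C) : ~ curve g a -> ccont g (fun w => (w - a)^-1).
Proof.
move=> ga s s01; apply: cder_cont (cder_inv _).
by apply/eqP => E; apply: ga; exists s.
Qed.

Lemma ccontM (f h : C -> C) : ccont g f -> ccont g h -> ccont g (fun w => f w * h w).
Proof. by move=> fc hc s s01; exact: (@cvgM _ _ _ _ f h (f (g s)) (h (g s)) (fc s s01) (hc s s01)). Qed.

(** The derivative of the integral in its parameter is the integral of (w - b)^-2, which vanishes
    because the integrand has a primitive. Increments are thus quadratic, and cutting the segment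
    from [a] to [b] into n steps leaves a total of order 1/n. *)
Lemma wint_locally (a : C) : ~ curve g a -> exists2 d : R, 0 < d &
 forall b, cabs (b - a) < d -> ~ curve g b /\ wint b = wint a.
Proof.
move=> ga; have [d d0 H] := off_curve_dist ga.
pose r := d / 2; have r0 : 0 < r by rewrite divr_gt0.
have far b s : cabs (b - a) < r -> 0 <= s <= 1 -> r <= cabs (g s - b).
 move=> bd s01; have := H s s01; rewrite [d]splitr -/r => le.
 have : cabs (g s - a) <= cabs (g s - b) + cabs (b - a).
  have -> : g s - a = (g s - b) + (b - a) by ring.
  exact: cabsD.
 by move=> le2; have := le_trans le le2; lra.
have off b : cabs (b - a) < r -> ~ curve g b.
 move=> bd [s s01 gs]; have := far b s bd s01.
 by rewrite gs subrr cabs0 leNgt r0.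
have [V V0 HV] := cint_bound gC1.
have quad b b' : cabs (b - a) < r -> cabs (b' - a) < r ->
  cabs (wint b' - wint b) <= V * (cabs (b' - b) ^+ 2 / r ^+ 3).
 move=> bd bd'.
 have c1 := ccont_inv (off b bd); have c2 := ccont_inv (off b' bd').
 pose f w := (w - b)^-1 * (w - b)^-1.
 pose h w := f w * (w - b')^-1.
 have cf : ccont g f := ccontM c1 c1.
 have ch : ccont g h := ccontM cf c2.
 have f0 : cint g f = 0.
  apply: (@cint_prim _ gC1 gcl (fun w => - (w - b)^-1)) => // s s01.
  have gb : g s != b by apply/eqP => E; apply: (off b bd); exists s.
  have := cder_scale (-1) (cder_inv gb); rewrite mulN1r opprK.
  rewrite (_ : (fun z => -1 * _) = (fun w => - (w - b)^-1)); last by apply/funext => z; rewrite mulN1r.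
  by rewrite /f -invfM -expr2.
 (* Second-order resolvent identity: 1/(w - b') - 1/(w - b) = (b' - b)/(w - b)^2 + (b' - b)^2/((w -
    b)^2 (w - b')). *)
 have -> : wint b' - wint b = cint g (fun w => (b' - b) * f w + (b' - b) ^+ 2 * h w).
  have := cint_lin gC1 1 (-1) c2 c1; rewrite mul1r mulN1r => <-.
  apply: eq_cint => s s01; rewrite /h /f.
  have gb : g s - b != 0 by rewrite subr_eq0; apply/eqP => E; apply: (off b bd); exists s.
  have gb' : g s - b' != 0 by rewrite subr_eq0; apply/eqP => E; apply: (off b' bd'); exists s.
  by field; rewrite gb gb'.
 rewrite (cint_lin gC1) // f0 mulr0 add0r cabsM cabsX.
 rewrite mulrCA ler_wpM2l ?exprn_ge0 ?cabs_ge0 //.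
 apply: HV => // [|s s01]; first by rewrite invr_ge0 exprn_ge0 // ltW.
 rewrite /h /f !cabsM !cabsV -!invfM lef_pV2 ?posrE ?exprn_gt0 //; last first.
  by rewrite !mulr_gt0 // (lt_le_trans r0) // far.
 have h1 := far b s bd s01; have h2 := far b' s bd' s01; have r0' := ltW r0.
 rewrite exprSr expr2; exact: (ler_pM (mulr_ge0 r0' r0') r0' (ler_pM r0' r0' h1 h1) h2).
exists r => // b bd; split; first exact: off.
(* Telescoping over n + 1 equal steps, of which k have been made. *)
have line (n : nat) (k : nat) : (k <= n.+1)%N ->
  cabs (wint (a + (k%:R / n.+1%:R)%:C * (b - a)) - wint a) <=
  k%:R * (V * ((cabs (b - a) / n.+1%:R) ^+ 2 / r ^+ 3)).
 have inr (j : nat) : (j <= n.+1)%N -> cabs (a + (j%:R / n.+1%:R)%:C * (b - a) - a) < r.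
  move=> jn; rewrite addrC addKr cabsM cabsR ger0_norm ?divr_ge0 //.
  by apply: le_lt_trans bd; rewrite ler_piMl ?cabs_ge0 // ler_pdivrMr // mul1r ler_nat.
 elim: k => [_|k IH kn].
  by rewrite mul0r !mul0r addr0 subrr cabs0.
 have := IH (ltnW kn); rewrite -[k.+1%:R * (V * _)]/(k.+1%:R * _).
 set wk := wint (a + (k%:R / _)%:C * _); set wk1 := wint (a + _) => le.
 have -> : wk1 - wint a = (wk1 - wk) + (wk - wint a) by ring.
 apply: cabsD_le; rewrite -[in leRHS]natr1 mulrDl mul1r addrC lerD //.
 apply: le_trans (quad _ _ (inr _ (ltnW kn)) (inr _ kn)) _.
 rewrite ler_wpM2l // ler_wpM2r ?invr_ge0 ?exprn_ge0 ?(ltW r0) //.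
 have -> : a + (k.+1%:R / n.+1%:R)%:C * (b - a) - (a + (k%:R / n.+1%:R)%:C * (b - a)) =
  (n.+1%:R^-1)%:C * (b - a).
  by rewrite -natr1 mulrDl mul1r rmorphD /=; ring.
 by rewrite cabsM cabsR normfV normr_nat mulrC lexx.
apply: cabs_le0_eq.
apply/ler_addgt0Pl => e e0; rewrite addr0.
pose Q := V * (cabs (b - a) ^+ 2 / r ^+ 3).
have Q0 : 0 <= Q by rewrite mulr_ge0 // divr_ge0 // exprn_ge0 ?cabs_ge0 // ltW.
have [n nQ] : exists n : nat, Q / e < n.+1%:R.
 have [n] := @archi_boundP R (Q / e) ltac:(by rewrite divr_ge0 // ltW).
 by exists (Num.bound (Q / e)); rewrite (lt_trans (archi_boundP _)) ?divr_ge0 ?(ltW e0) // ltr_nat.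
have E1 : a + 1%:C * (b - a) = b by rewrite -[1%:C]/(1 : C); ring.
have := line n n.+1 (leqnn _); rewrite divff // E1 => /le_trans; apply.
rewrite exprMn -/Q; have -> : n.+1%:R * (V * (cabs (b - a) ^+ 2 * n.+1%:R^-1 ^+ 2 / r ^+ 3)) = Q / n.+1%:R.
 rewrite /Q; have : (n.+1%:R : R) != 0 by rewrite pnatr_eq0.
 by move: (n.+1%:R) => N N0; field; rewrite N0 gt_eqF.
by rewrite ler_pdivrMr // mulrC -ler_pdivrMr // ltW.
Qed.

(** The set where the integral keeps its value at [a] is both open and closed in the component, by
    local constancy. *)
Lemma wint_component (a b : C) : connected_component (~` curve g) a b -> wint b = wint a.
Proof.
move=> [A [Aa Ag Ac] Ab].
pose B := A `&` [set y | wint y = wint a].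
suff E : B = A by move: Ab; rewrite -E => -[].
apply: Ac.
- by exists a.
- exists [set y | ~ curve g y /\ wint y = wint a].
  rewrite openE => y [gy wy]; have [d d0 H] := wint_locally gy.
  by apply/nbhs_cabsP; exists d => // z /H[gz wz]; split; rewrite ?wz.
 by apply/seteqP; split => [y [Ay wy]|y [Ay [_ wy]]]; split => //; split => //; exact: Ag.
exists (~` [set y | ~ curve g y /\ wint y <> wint a]).
 rewrite closedC openE => y [gy wy]; have [d d0 H] := wint_locally gy.
 by apply/nbhs_cabsP; exists d => // z /H[gz wz]; split; rewrite ?wz.
apply/seteqP; split => [y [Ay wy]|y [Ay ny]]; split => //=; first by case.
by apply: contrapT => wy; apply: ny; split => //; exact: Ag.
Qed.

(** Outside [Int] the component is unbounded, so the integral can be evaluated arbitrarily far away,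
    where the integrand is uniformly small. *)
Lemma wint_outside (a : C) : ~ curve g a -> ~ Int g a -> wint a = 0.
Proof.
move=> ga nIa.
have far (m : R) : exists2 y, wint y = wint a & ~ curve g y /\ m < cabs y.
 apply: contrapT => H; apply: nIa; split => //; exists m => y ya.
 rewrite leNgt; apply/negP => my; apply: H; exists y; first exact: wint_component.
 by split=> //; case: ya => A [_ Ag _]; exact: Ag.
have [V V0 HV] := cint_bound gC1.
have [G HG] : exists G : R, forall s, 0 <= s <= 1 -> cabs (g s) <= G.
 have [cr ci] := curve_cont gC1.
 have [p Hp] := segment_bounded cr; have [q Hq] := segment_bounded ci.
 by exists (p + q) => s s01; rewrite (le_trans (cabs_le_ReIm _)) // lerD ?Hp ?Hq.
apply: cabs_le0_eq; rewrite subr0.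
apply/ler_addgt0Pl => e e0; rewrite addr0.
have [y <- [gy my]] := far (G + (V + 1) / e).
have V1 : 0 < V + 1 by rewrite ltr_wpDl.
apply: le_trans (HV _ (e / (V + 1)) _ (ccont_inv gy) _) _.
- by rewrite divr_ge0 // ltW.
- move=> s s01; rewrite cabsV -[e / _]invf_div lef_pV2 ?posrE ?divr_gt0 //.
  have := cabsB_ge y (g s); rewrite cabsBC; have := HG s s01 => h1 h2.
  by apply: le_trans _ h2; rewrite lerBrDr addrC (le_trans _ (ltW my)) // lerD2r.
 rewrite cabs_gt0 subr_eq0; apply/eqP => E; apply: gy; exists s => //.
rewrite mulrCA -[leRHS]mulr1 ler_wpM2l ?(ltW e0) // ler_pdivrMr // mul1r lerDl.
exact: ler01.
Qed.

Lemma wint_inside (a : C) : positively_oriented g -> Int g a -> wint a = 2 * pi%:C * 'i.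
Proof.
move=> po /po; rewrite /winding -/(wint a) => H.
have n0 : 2 * pi%:C * 'i != 0 :> C.
 rewrite !mulf_neq0 ?pnatr_eq0 // ?eq_complex /= ?oner_eq0 ?andbF //.
 by rewrite gt_eqF // pi_gt0.
by rewrite -[LHS](mulVKf n0) H mulr1.
Qed.

End Winding.

(** * Argument and logarithm on the closed upper half-plane *)

Section LogUpper.
Implicit Types (f g : R -> R) (s a b : R).

Lemma rdM f g s a b : is_derive s 1 f a -> is_derive s 1 g b ->
 is_derive s 1 (fun r => f r * g r) (f s * b + g s * a).
Proof. by move=> fa gb; exact: is_deriveM. Qed.

Lemma rdD f g s a b : is_derive s 1 f a -> is_derive s 1 g b ->
 is_derive s 1 (fun r => f r + g r) (a + b).
Proof. by move=> fa gb; exact: is_deriveD. Qed.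

Lemma rdC k s : is_derive s 1 (fun=> k : R) 0.
Proof. exact: is_derive_cst. Qed.

Lemma rdV f s a : f s != 0 -> is_derive s 1 f a ->
 is_derive s 1 (fun r => (f r)^-1) (- (f s) ^- 2 * a).
Proof.
move=> f0 [df <-].
by apply: DeriveDef; [exact: derivableV | rewrite deriveV].
Qed.

Lemma rdcomp f g s a b : is_derive s 1 f a -> is_derive (f s) 1 g b ->
 is_derive s 1 (fun r => g (f r)) (b * a).
Proof. by move=> fa gb; exact: is_derive1_comp. Qed.

Lemma rd_eq f s a b : is_derive s 1 f a -> a = b -> is_derive s 1 f b.
Proof. by move=> fa <-. Qed.

Lemma rd_cabs (h : R -> C) s v : h s != 0 -> rder h s v ->
 is_derive s 1 (fun r => cabs (h r)) ((Re (h s) * Re v + Im (h s) * Im v) / cabs (h s)).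
Proof.
move=> h0 hv; have hr := rder_Re hv; have hi := rder_Im hv.
have := rdD (rdM hr hr) (rdM hi hi).
have N0 : 0 < Re (h s) * Re (h s) + Im (h s) * Im (h s).
 by rewrite -!expr2 -cabs_sq exprn_gt0 // cabs_gt0.
move=> /rdcomp/(_ (is_derive1_sqrt N0)) H.
have -> : (fun r => cabs (h r)) = (fun r => Num.sqrt (Re (h r) * Re (h r) + Im (h r) * Im (h r))).
 by apply/funext => r; rewrite /cabs -!expr2.
apply: rd_eq H _; rewrite -!expr2 -/(cabs (h s)).
by field; rewrite gt_eqF // cabs_gt0.
Qed.

(** Half-angle formula for the argument. It agrees with [carg] on the closed upper half-plane
    without 0, and is smooth across both real half-lines, because |z| + Im z vanishes only on the
    closed negative imaginary axis. Curves that touch the real axis can thus be differentiated. *)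
Definition ang (z : C) : R := pi / 2 - 2 * atan (Re z / (cabs z + Im z)).

Definition lg (z : C) : C := ln (cabs z) +i* ang z.

Lemma cabs_Im_gt0 (z : C) : 0 <= Im z -> z != 0 -> 0 < cabs z + Im z.
Proof. by move=> iz z0; rewrite ltr_wpDr // cabs_gt0. Qed.

Lemma cabs_Im_sq (z : C) : (cabs z + Im z) ^+ 2 + Re z ^+ 2 = 2 * cabs z * (cabs z + Im z).
Proof.
have := cabs_sq z => E; have -> : Re z ^+ 2 = cabs z ^+ 2 - Im z ^+ 2 by rewrite E addrK.
by ring.
Qed.

(** By [cabs_Im_sq] the derivative of the arctangent becomes (|z| + Im z)/(2 |z|), after which both
    components are rational identities in |z|, Re z and Im z. *)
Lemma rder_lg (h : R -> C) s v : 0 <= Im (h s) -> h s != 0 -> rder h s v ->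
 rder (lg \o h) s (v / h s).
Proof.
move=> ih h0 hv.
have hc := rd_cabs h0 hv; have hr := rder_Re hv; have hi := rder_Im hv.
have c0 : 0 < cabs (h s) by rewrite cabs_gt0.
have ci0 := cabs_Im_gt0 ih h0.
have sq := cabs_sq (h s).
apply: rder_ReIm => /=.
 have := rdcomp hc (is_derive1_ln c0) => H; apply: rd_eq H _.
 rewrite cReM cReV cImV.
 by field; rewrite gt_eqF.
have := rdcomp (rdM hr (@rdV (fun r => cabs (h r) + Im (h r)) _ _ (lt0r_neq0 ci0) (rdD hc hi)))
 (is_derive1_atan _).
move=> /(rdM (rdC 2 s)) /(rdM (rdC (-1) s)) /(rdD (rdC (pi / 2) s)) H.
have -> : (fun r => ang (h r)) = (fun r => pi / 2 + -1 * (2 * atan (Re (h r) * (cabs (h r) + Im (h r))^-1))).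
 by apply/funext => r; rewrite mulN1r.
apply: rd_eq H _; rewrite cImM cReV cImV.
have D := cabs_Im_sq (h s).
move: (cabs (h s)) (Re (h s)) (Im (h s)) c0 ci0 sq D => c x y c0 ci0 sq D.
have -> : (1 + (x * (c + y)^-1) ^+ 2)^-1 = (c + y) / (2 * c).
 have -> : 1 + (x * (c + y)^-1) ^+ 2 = ((c + y) ^+ 2 + x ^+ 2) / (c + y) ^+ 2.
  by field; rewrite gt_eqF.
 by rewrite D; field; rewrite !gt_eqF.
have cn := lt0r_neq0 c0; have cyn := lt0r_neq0 ci0.
set p := Re v; set q := Im v.
have x2 : x ^+ 2 = c ^+ 2 - y ^+ 2 by rewrite sq addrK.
transitivity (- (p * c * (c + y) - x ^+ 2 * p - x * q * (c + y)) / (c ^+ 2 * (c + y))).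
 by field; rewrite cn cyn.
by rewrite x2; field; rewrite cn cyn.
Qed.

Lemma rder_line (w h : C) s : rder (fun t => w + t%:C * h) s h.
Proof.
move=> e e0; exists 1 => // t _.
have -> : w + (s + t)%:C * h - (w + s%:C * h) - t%:C * h = 0 by rewrite rmorphD /=; ring.
by rewrite cabs0 mulr_ge0 // ltW.
Qed.

Lemma ang_bound (z : C) : 0 <= Im z -> z != 0 -> 0 <= ang z <= pi.
Proof.
move=> iz z0; have ci0 := cabs_Im_gt0 iz z0.
have : `|Re z / (cabs z + Im z)| <= 1.
 rewrite normrM normfV (gtr0_norm ci0) ler_pdivrMr // mul1r.
 by rewrite (le_trans (Re_le_cabs z)) // lerDl.
rewrite ler_norml => /andP[l1 l2]; have := le_atan l1; have := le_atan l2.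
rewrite atanN atan1 /ang => h1 h2; have : pi / 4 + pi / 4 = pi / 2 :> R by field.
by move=> E; have : pi / 2 + pi / 2 = pi :> R by [field]; move=> E2; apply/andP; split; lra.
Qed.

Lemma ang_carg (z : C) : 0 <= Im z -> z != 0 -> ang z = carg z.
Proof.
move=> iz z0; have ci0 := cabs_Im_gt0 iz z0.
rewrite /carg iz -(cosK (x := ang z)); last by rewrite in_itv /= ang_bound.
congr acos; rewrite /ang cosB cos_pihalf mul0r add0r sin_pihalf mul1r.
set a := atan _; have -> : 2 * a = a + a by ring.
rewrite sinD; have ca : cos a != 0 by rewrite cos_atan invr_eq0 gt_eqF // sqrtr_gt0 ltr_pwDl // sqr_ge0.
have sa : sin a = cos a * (Re z / (cabs z + Im z)).
 by rewrite -[X in cos a * X]atanK -/a /tan mulrC divfK.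
have c2 : cos a ^+ 2 = (cabs z + Im z) / (2 * cabs z).
 rewrite cos_atan exprVn sqr_sqrtr ?addr_ge0 ?sqr_ge0 //.
 have c0 : cabs z != 0 by rewrite cabs_eq0.
 have -> : 1 + (Re z / (cabs z + Im z)) ^+ 2 =
   ((cabs z + Im z) ^+ 2 + Re z ^+ 2) / (cabs z + Im z) ^+ 2.
  by field; rewrite gt_eqF.
 by rewrite cabs_Im_sq; field; rewrite c0 gt_eqF.
rewrite sa; transitivity (2 * cos a ^+ 2 * (Re z / (cabs z + Im z))); first by ring.
by rewrite c2; field; rewrite cabs_eq0 z0 gt_eqF.
Qed.

Lemma ang_pos (x : R) : 0 < x -> ang x%:C = 0.
Proof.
move=> x0; rewrite /ang cabsR /= addr0 gtr0_norm // divff ?gt_eqF // atan1.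
by field.
Qed.

Lemma ang_neg (x : R) : x < 0 -> ang x%:C = pi.
Proof.
move=> x0; rewrite /ang cabsR /= addr0 ltr0_norm // invrN mulrN divff ?lt_eqF // atanN atan1.
by field.
Qed.

Lemma ang_upper (z : C) : 0 < Im z -> 0 < ang z < pi.
Proof.
move=> iz; have z0 : z != 0 by apply/eqP => z0; rewrite z0 ltxx in iz.
have ci0 := cabs_Im_gt0 (ltW iz) z0.
have : `|Re z / (cabs z + Im z)| < 1.
 rewrite normrM normfV (gtr0_norm ci0) ltr_pdivrMr // mul1r.
 by rewrite (le_lt_trans (Re_le_cabs z)) // ltrDl.
rewrite ltr_norml => /andP[l1 l2]; have := lt_atan l1; have := lt_atan l2.
rewrite atanN atan1 /ang => h1 h2; have : pi / 4 + pi / 4 = pi / 2 :> R by field.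
by move=> E; have : pi / 2 + pi / 2 = pi :> R by [field]; move=> E2; apply/andP; split; lra.
Qed.

End LogUpper.

(** * Contour integrals of rational functions with real poles *)

Section Rational.
Variable g : R -> C.
Hypotheses (gC1 : piecewise_C1 g) (gcl : g 0 = g 1) (gpos : positively_oriented g).
Variables (e c : R) (Pl : seq R).
Hypothesis Plgood : forall a, a \in Pl -> e < a /\
 ((a < c /\ Int g a%:C) \/ (c < a /\ ~ curve g a%:C /\ ~ Int g a%:C)).

(** Differentiability is asked along curves, at points of the closed upper half-plane off the poles.
    That region is simply connected, so that the logarithms at all poles are primitives there
    simultaneously. *)
Definition primU (P f : C -> C) := forall h s v, 0 <= Im (h s) ->
 (forall a, a \in Pl -> h s != a%:C) -> rder h s v -> rder (P \o h) s (f (h s) * v).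

(** The residue formula in a form linear in [f]: going from [c] to [e] above the axis, the logarithm
    at each pole between them gains the argument pi, and by [Plgood] these poles are the ones inside
    the contour. *)
Definition has_prim (f : C -> C) := ccont g f /\
 exists P, primU P f /\ cint g f = 2 * 'i * (Im (P e%:C) - Im (P c%:C))%:C.

Lemma Pl_off a : a \in Pl -> ~ curve g a%:C.
Proof. by move=> /Plgood[_ [[_ []]|[_ []]]]. Qed.

Lemma primU_cder P f : (forall w, (forall a, a \in Pl -> w != a%:C) -> cder P w (f w)) ->
 primU P f.
Proof. by move=> H h s v _ ha hv; apply: rder_comp => //; exact: H. Qed.

Lemma rderD (h k : R -> C) s v w : rder h s v -> rder k s w ->
 rder (fun t => h t + k t) s (v + w).
Proof.
move=> hv kw; apply: rder_ReIm.
 have := rdD (rder_Re hv) (rder_Re kw); rewrite -cReD.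
 by under eq_fun do rewrite -cReD.
have := rdD (rder_Im hv) (rder_Im kw); rewrite -cImD.
by under eq_fun do rewrite -cImD.
Qed.

Lemma rder_scale (k : C) (h : R -> C) s v : rder h s v -> rder (fun t => k * h t) s (k * v).
Proof.
move=> hv; apply: (@rder_comp (fun z => k * z) h s v k) => //.
by have := cder_scale k (cder_id (h s)); rewrite mulr1.
Qed.

Lemma ccont_cst (k : C) : ccont g (fun=> k).
Proof. by move=> s _; exact: cder_cont (cder_cst k (g s)). Qed.

Lemma ccontD (f h : C -> C) : ccont g f -> ccont g h -> ccont g (fun w => f w + h w).
Proof.
by move=> fc hc s s01; exact: (@cvgD _ _ _ _ _ f h (f (g s)) (h (g s)) (fc s s01) (hc s s01)).
Qed.

Lemma has_prim_lin (x y : R) f f' : has_prim f -> has_prim f' ->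
 has_prim (fun w => x%:C * f w + y%:C * f' w).
Proof.
move=> [fc [P [fP If]]] [fc' [P' [fP' If']]]; split.
 exact: (ccontD (ccontM (@ccont_cst x%:C) fc) (ccontM (@ccont_cst y%:C) fc')).
exists (fun w => x%:C * P w + y%:C * P' w); split.
 move=> h s v ih ha hv; rewrite mulrDl -!mulrA.
 apply: (@rderD (fun t => x%:C * P (h t)) (fun t => y%:C * P' (h t))).
  exact: (rder_scale x%:C (fP h s v ih ha hv)).
 exact: (rder_scale y%:C (fP' h s v ih ha hv)).
rewrite (cint_lin gC1) // If If' !cImD !cImZ.
by rewrite !(rmorphB, rmorphD, rmorphM) /=; ring.
Qed.

Lemma has_prim_ext f f' : (forall w, (forall a, a \in Pl -> w != a%:C) -> f w = f' w) ->
 has_prim f -> ccont g f' -> has_prim f'.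
Proof.
move=> ff' [fc [P [fP If]]] fc'; split => //; exists P; split.
 by move=> h s v ih ha hv; rewrite -ff' //; exact: fP.
rewrite -If; apply: eq_cint => s s01; apply/esym/ff' => a aP.
by apply/eqP => E; apply: (Pl_off aP); exists s.
Qed.

Lemma has_prim1 : has_prim (fun=> 1).
Proof.
split; first exact: ccont_cst.
exists id; split; first by apply: primU_cder => w _; exact: cder_id.
rewrite (@cint_prim _ gC1 gcl id) /= ?subrr ?mulr0 //.
- by move=> s _; exact: cder_id.
- exact: ccont_cst.
Qed.

Lemma Pl_neq a w s : a \in Pl -> 0 <= s <= 1 -> w = g s -> w != a%:C.
Proof. by move=> aP s01 ->; apply/eqP => E; apply: (Pl_off aP); exists s. Qed.

Lemma ccont_invX a n : a \in Pl -> ccont g (fun w => ((w - a%:C)^-1) ^+ n).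
Proof.
move=> aP s s01; apply: (@cder_cont _ (g s)); apply: cder_exp; apply: cder_inv.
exact: Pl_neq s01 _.
Qed.

(** Only the exponent 1 contributes, through [lg] and the winding integral. For higher exponents the
    primitive is rational with real coefficients, so both sides vanish. *)
Lemma has_prim_invX a n : a \in Pl -> has_prim (fun w => ((w - a%:C)^-1) ^+ n).
Proof.
move=> aP; case: n => [|[|n]].
- by under eq_fun do rewrite expr0; exact: has_prim1.
- split; first exact: ccont_invX.
 exists (fun w => lg (w - a%:C)); split.
  move=> h s v ih ha hv; rewrite expr1 mulrC.
  apply: (@rder_lg (fun t => h t - a%:C)).
  + by rewrite cImB /= subr0.
  + by rewrite subr_eq0 ha.
  + rewrite -[v]addr0; apply: rderD => // x x0; exists 1 => // t _.
   by rewrite subrr mulr0 subrr cabs0 mulr_ge0 // ltW.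
 have -> : cint g (fun w => (w - a%:C)^-1 ^+ 1) = wint g a%:C.
  by apply: eq_cint => s _; rewrite expr1.
 have [ea H] := Plgood aP.
 rewrite -!rmorphB /= ang_neg ?subr_lt0 //.
 case: H => [[ac Ia]|[ca [nc nI]]].
  by rewrite ang_pos ?subr_gt0 // subr0 (wint_inside gpos Ia); ring.
 by rewrite ang_neg ?subr_lt0 // subrr mulr0 (wint_outside gC1 gcl nc nI).
- split; first exact: ccont_invX.
 pose P (w : C) := - n.+1%:R^-1 * ((w - a%:C)^-1) ^+ n.+1.
 have dP w : w != a%:C -> cder P w ((w - a%:C)^-1 ^+ n.+2).
  move=> wa; have := cder_scale (- n.+1%:R^-1) (cder_exp n.+1 (cder_inv wa)).
  suff -> : - n.+1%:R^-1 * (n.+1%:R * (w - a%:C)^-1 ^+ n.+1.-1 * - (w - a%:C) ^- 2) =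
   (w - a%:C)^-1 ^+ n.+2 by [].
  have n0 : n.+1%:R != 0 :> C by rewrite pnatr_eq0.
  rewrite /= -exprVn; move: ((w - a%:C)^-1) => z.
  have -> : z ^+ n.+2 = z ^+ n * z ^+ 2 by rewrite -exprD addn2.
  by move: n0; move: (n.+1%:R) => N N0; field.
 exists P; split.
  by apply: primU_cder => w wa; exact: dP (wa a aP).
 have rP (x : R) : Im (P x%:C) = 0.
  have -> : P x%:C = (- n.+1%:R^-1 * ((x - a)^-1) ^+ n.+1)%:C.
   by rewrite rmorphM rmorphN fmorphV rmorph_nat rmorphXn fmorphV rmorphB.
  by [].
 clearbody P; rewrite (rP e) (rP c) subrr; pose f2 (w : C) := (w - a%:C)^-1 ^+ n.+2.
 have H1 s : 0 <= s <= 1 -> cder P (g s) (f2 (g s)).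
  by move=> s01; apply: dP; exact: Pl_neq s01 _.
 have H2 : ccont g f2 := @ccont_invX a n.+2 aP.
 transitivity (0 : C); last by rewrite [RHS]mulr0.
 exact: (cint_prim gC1 gcl H1 H2).
Qed.

Definition inv_prod (l : seq R) (w : C) : C := \prod_(a <- l) (w - a%:C)^-1.

Lemma ccont_inv_prod l : {subset l <= Pl} -> ccont g (inv_prod l).
Proof.
elim: l => [|a l IH] lP.
 have -> : inv_prod [::] = fun=> 1 by apply/funext => w; rewrite /inv_prod big_nil.
 exact: ccont_cst.
have -> : inv_prod (a :: l) = fun w => (w - a%:C)^-1 * inv_prod l w.
 by apply/funext => w; rewrite /inv_prod big_cons.
have c1 : ccont g (fun w => (w - a%:C)^-1).
 by apply: ccont_inv; apply: Pl_off; apply: lP; rewrite mem_head.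
have c2 : ccont g (inv_prod l).
 by apply: IH => x xl; apply: lP; rewrite in_cons xl orbT.
exact: (ccontM c1 c2).
Qed.

(** Induction on the number of factors. Two distinct poles a and b are split by 1/((w - a)(w - b)) =
    (1/(w - a) - 1/(w - b))/(a - b); if all poles coincide the product is a power. *)
Lemma has_prim_inv_prod l : {subset l <= Pl} -> has_prim (inv_prod l).
Proof.
have [n] := ubnP (size l); elim: n l => // n IH [|a l] /= ln lP.
 by rewrite /inv_prod; under eq_fun do rewrite big_nil; exact: has_prim1.
have aP : a \in Pl by apply: lP; rewrite mem_head.
have [la|] := boolP (all (pred1 a) l).
 have -> : inv_prod (a :: l) = fun w => ((w - a%:C)^-1) ^+ (size l).+1.
  apply/funext => w; rewrite /inv_prod big_cons exprS; congr (_ * _).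
  have /all_pred1P -> := la; rewrite size_nseq.
  by elim: (size l) => [|k IHk]; rewrite ?big_nil //= big_cons IHk exprS.
 exact: has_prim_invX.
move=> /allPn[b bl /= ba].
pose l' := rem b l.
have pl : perm_eq (a :: l) (a :: b :: l') by rewrite perm_cons perm_to_rem.
have sl' : {subset a :: b :: l' <= Pl} by move=> x; rewrite -(perm_mem pl); exact: lP.
have sz : size l = (size l').+1.
 by rewrite (perm_size (perm_to_rem bl)).
have H1 : has_prim (inv_prod (a :: l')).
 apply: IH => /=; first by move: ln; rewrite sz ltnS.
 by move=> x; rewrite in_cons => /orP[/eqP->|xl] //; apply: sl'; rewrite !in_cons xl !orbT.
have H2 : has_prim (inv_prod (b :: l')).
 apply: IH => /=; first by move: ln; rewrite sz ltnS.
 by move=> x xl; apply: sl'; rewrite in_cons xl orbT.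
have := has_prim_lin (a - b)^-1 (- (a - b)^-1) H1 H2.
move=> /has_prim_ext; apply; last exact: ccont_inv_prod.
move=> w wP; rewrite /inv_prod (perm_big _ pl) /= !big_cons.
have wa : w - a%:C != 0 by rewrite subr_eq0 wP.
have wb : w - b%:C != 0 by rewrite subr_eq0 wP // sl' // !in_cons eqxx orbT.
have ab : a%:C - b%:C != 0 :> C.
 by rewrite -rmorphB /= -[0]/(0%:C) (inj_eq CI) subr_eq0 eq_sym.
by rewrite rmorphN fmorphV rmorphB /=; field; rewrite wa wb ab.
Qed.

(** Closed under real combinations and under division by w - a for a pole a, which is enough to
    reach all powers of S divided by w. *)
Inductive pfrac : (C -> C) -> Prop :=
 | Pfrac0 l of {subset l <= Pl} : pfrac (inv_prod l)
 | PfracL x y f f' of pfrac f & pfrac f' : pfrac (fun w => x%:C * f w + y%:C * f' w).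

Lemma pfrac_has_prim f : pfrac f -> has_prim f.
Proof.
by elim=> [l lP|x y h h' _ hh _ hh']; [exact: has_prim_inv_prod | exact: has_prim_lin].
Qed.

Lemma pfrac_inv a f : a \in Pl -> pfrac f -> pfrac (fun w => f w * (w - a%:C)^-1).
Proof.
move=> aP; elim=> [l lP|x y h h' _ hh _ hh'].
 have -> : (fun w => inv_prod l w * (w - a%:C)^-1) = inv_prod (a :: l).
  by apply/funext => w; rewrite /inv_prod big_cons mulrC.
 by apply: Pfrac0 => z; rewrite in_cons => /orP[/eqP->|/lP].
have -> : (fun w => (x%:C * h w + y%:C * h' w) * (w - a%:C)^-1) =
 fun w => x%:C * (h w * (w - a%:C)^-1) + y%:C * (h' w * (w - a%:C)^-1).
 by apply/funext => w; ring.
exact: PfracL.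
Qed.

Lemma pfrac_sum (I : Type) (r : seq I) (x : I -> R) (f : I -> C -> C) :
 (forall i, pfrac (f i)) -> pfrac (fun w => \sum_(i <- r) (x i)%:C * f i w).
Proof.
move=> H; elim: r => [|i r IH].
 have -> : (fun w => \sum_(i <- [::]) (x i)%:C * f i w) =
   fun w => 0%:C * inv_prod [::] w + 0%:C * inv_prod [::] w.
  by apply/funext => w; rewrite big_nil !mul0r addr0.
 by apply: PfracL; apply: Pfrac0.
have -> : (fun w => \sum_(j <- i :: r) (x j)%:C * f j w) =
   fun w => (x i)%:C * f i w + 1%:C * \sum_(j <- r) (x j)%:C * f j w.
 by apply/funext => w; rewrite big_cons mul1r.
exact: PfracL.
Qed.

End Rational.

(** * Partial fractions by interpolation *)

Section Lagrange.
Variable F : fieldType.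

(** [N] minus its interpolation polynomial at [xs] has more roots than its degree allows, hence
    vanishes. *)
Lemma lagrange_pfrac (xs : seq F) (N : {poly F}) (w : F) : uniq xs -> w \notin xs ->
 (size N <= size xs)%N ->
 N.[w] / \prod_(x <- xs) (w - x) =
 \sum_(x <- xs) N.[x] / ((w - x) * \prod_(y <- xs | y != x) (x - y)).
Proof.
move=> uxs wxs sN.
pose d x := \prod_(y <- xs | y != x) (x - y).
pose L x := (N.[x] / d x) *: \prod_(y <- xs | y != x) ('X - y%:P).
have LE x y : (L x).[y] = N.[x] / d x * \prod_(z <- xs | z != x) (y - z).
 rewrite /L hornerZ; congr (_ * _); rewrite horner_prod.
 by apply: eq_bigr => z _; rewrite hornerXsubC.
have nz x : d x != 0.
 by rewrite prodf_seq_neq0; apply/allP => y _; apply/implyP => yx; rewrite subr_eq0 eq_sym.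
have N0 : N - \sum_(x <- xs) L x = 0.
 apply: (@roots_geq_poly_eq0 _ _ xs) => //.
  apply/allP => x xxs; rewrite rootE !hornerE horner_sum (bigD1_seq x) //= LE.
  rewrite divfK // big1 ?addr0 ?subrr // => y yx; rewrite LE.
  rewrite [X in _ * X](_ : _ = 0) ?mulr0 //; apply/eqP; rewrite prodf_seq_eq0.
  by apply/hasP; exists x => //=; rewrite subrr eqxx andbT eq_sym.
 apply: leq_trans (size_polyD _ _) _; rewrite size_polyN geq_max sN /=.
 apply: leq_trans (size_sum _ _ _) _; rewrite big_seq; apply/bigmax_leqP_seq => x /= _ xxs.
 apply: leq_trans (size_scale_leq _ _) _; rewrite -big_filter size_prod_XsubC.
 rewrite (_ : [seq i <- xs | i != x] = rem x xs) ?size_rem //; last by rewrite rem_filter.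
 by case: (xs) xxs.
have -> : N.[w] = \sum_(x <- xs) (L x).[w].
 by move/eqP: N0; rewrite subr_eq0 -horner_sum => /eqP <-.
rewrite mulr_suml; apply: eq_big_seq => x xxs; rewrite -/(d x) LE.
rewrite [X in _ / X](bigD1_seq x) //=.
have wx : w - x != 0 by rewrite subr_eq0; apply: contraNneq wxs => ->.
have pn : \prod_(z <- xs | z != x) (w - z) != 0.
 rewrite prodf_seq_neq0; apply/allP => y yxs; apply/implyP => _; rewrite subr_eq0.
 by apply: contraNneq wxs => ->.
by field; rewrite nz pn wx.
Qed.

End Lagrange.

(** * The kernel identity for sums of positive multiples of (w - c)/(w - p) *)

Section StieltjesForm.
Variables (l : seq (R * R)) (c : R).
Implicit Types (w : C) (p : R * R).

Definition sS w : C := \sum_(p <- l) p.1%:C * ((w - c%:C) / (w - p.2%:C)).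
(** Off the axis this is -|w - c|^2 Im(S/(w - c))/Im w ([sM_nonreal]), hence equal to S(w) whenever
    S(w) is real; at a real t it is S(t) - (t - c) S'(t) ([sM_S_real]). It extends the former
    quantity continuously to the axis. *)
Definition sM w : R := \sum_(p <- l) p.1 * (cabs (w - c%:C) ^+ 2 / cabs (w - p.2%:C) ^+ 2).
(** What remains of the pole sum in [Kq_sum] after |w - p| <= (1 + |w|)(1 + p) has been used at both
    points: a lower bound free of w. *)
Definition sN : R := \sum_(p <- l) p.1 * ((p.2 - c) ^+ 2 / (1 + p.2) ^+ 4).
Definition sD w : C := - \sum_(p <- l) p.1%:C * ((p.2 - c)%:C / (w - p.2%:C) ^+ 2).
Definition offp w := forall p, p \in l -> w != p.2%:C.

Hypothesis lpos : forall p, p \in l -> 0 < p.1 /\ 0 < p.2.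

Lemma ReE (z : C) : (Re z)%:C = (z + z^*) / 2.
Proof. exact: ReJ_add. Qed.

Lemma cjBR (w : C) (r : R) : conjc (w - r%:C) = conjc w - r%:C.
Proof. by rewrite rmorphB /= /conjc /real_complex_def oppr0. Qed.

Lemma sqBR (w : C) (r : R) : (cabs (w - r%:C) ^+ 2)%:C = (w - r%:C) * (conjc w - r%:C).
Proof. by rewrite -cjBR; exact: cabs_sqC. Qed.

Lemma sqBJ (w w' : C) : (cabs (w - conjc w') ^+ 2)%:C = (w - conjc w') * (conjc w - w').
Proof.
have -> : conjc w - w' = conjc (w - conjc w') by rewrite rmorphB /= conjcK.
exact: cabs_sqC.
Qed.

Lemma cdivE (a z : C) : z != 0 -> a / z = ((cabs z ^+ 2)^-1)%:C * (a * conjc z).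
Proof.
move=> z0; have E : (cabs z ^+ 2)%:C = z * conjc z := cabs_sqC z.
have cz0 : conjc z != 0 by rewrite conjc_eq0.
have -> : ((cabs z ^+ 2)^-1)%:C = (z * conjc z)^-1 by rewrite -E fmorphV.
by move: (conjc z) cz0 => y y0; field; rewrite y0 z0.
Qed.

(** A rational identity in four independent variables, w1, w2 and their conjugates, once the real
    part and the squared moduli are rewritten in terms of them. *)
Lemma sK_term (w1 w2 : C) (a : R) : w1 != a%:C -> w2 != a%:C -> w1 != w2 ->
 cabs (w1 - conjc w2) ^+ 2 * ((a - c) ^+ 2 / (cabs (w1 - a%:C) ^+ 2 * cabs (w2 - a%:C) ^+ 2)) =
 cabs (w1 - c%:C) ^+ 2 / cabs (w1 - a%:C) ^+ 2 + cabs (w2 - c%:C) ^+ 2 / cabs (w2 - a%:C) ^+ 2 -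
 2 * Re (((w1 - c%:C) / (w1 - a%:C) * (w2 - c%:C) - (w2 - c%:C) / (w2 - a%:C) * (w1 - c%:C)) / (w2 - w1)).
Proof.
move=> n1 n2 n12; apply: CI.
have m1 : conjc w1 != a%:C by apply: contraNneq n1 => E; rewrite -[w1]conjcK E conjc_real.
have m2 : conjc w2 != a%:C by apply: contraNneq n2 => E; rewrite -[w2]conjcK E conjc_real.
have m12 : conjc w1 != conjc w2 by apply: contraNneq n12 => E; rewrite -[w1]conjcK E conjcK.
have e0 := sqBJ w1 w2; have e1 := sqBR w1 a; have e2 := sqBR w2 a.
have e3 := sqBR w1 c; have e4 := sqBR w2 c.
set X := ((w1 - c%:C) / _ * _ - _) / _; have eX : (Re X)%:C = (X + conjc X) / 2 := ReE X.
have XJ : conjc X = ((conjc w1 - c%:C) / (conjc w1 - a%:C) * (conjc w2 - c%:C) -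
  (conjc w2 - c%:C) / (conjc w2 - a%:C) * (conjc w1 - c%:C)) / (conjc w2 - conjc w1).
 by rewrite /X -!cjBR -!rmorphB /= -!conjc_inv -!rmorphM /= -rmorphB /= -rmorphM.
rewrite {}XJ in eX; move: (Re X) eX; rewrite /X {X}.
move: (cabs (w1 - conjc w2) ^+ 2) e0 (cabs (w1 - a%:C) ^+ 2) e1 (cabs (w2 - a%:C) ^+ 2) e2.
move: (cabs (w1 - c%:C) ^+ 2) (cabs (w2 - c%:C) ^+ 2) e3 e4.
move=> q3 q4 e3 e4 q0 e0 q1 e1 q2 e2 r er; rewrite (_ : 2 * r = r + r); last by ring.
rewrite !(rmorphD, rmorphB, rmorphM, fmorphV, rmorphN) /= er e0 e1 e2 e3 e4.
rewrite -subr_eq0 in n1; rewrite -subr_eq0 in n2; rewrite -subr_eq0 in m1; rewrite -subr_eq0 in m2.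
rewrite eq_sym -subr_eq0 in n12; rewrite eq_sym -subr_eq0 in m12.
move: n1 n2 n12 m1 m2 m12 {er e0 e1 e2 e3 e4}.
move: (conjc w1) (conjc w2) (a%:C) (c%:C) => v1 v2 A B n1 n2 n12 m1 m2 m12.
by field; rewrite n1 n2 m1 m2 n12 m12.
Qed.

(** The pole identity cleared of the denominator w2 - w1, with the values s and m as free arguments.
    Being linear in them, it allows the sum over poles, the limit in K, and the comparison with
    nearby real values. *)
Definition Kq w1 w2 (s1 s2 : C) (m1 m2 : R) : R :=
 cabs (w1 - w2) ^+ 2 * (m1 + m2) -
 2 * Re ((s1 * (w2 - c%:C) - s2 * (w1 - c%:C)) * conjc (w2 - w1)).

(** The source of monotonicity: since the pole sum is nonnegative, a larger real value forces a
    larger distance to [c]. *)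
Lemma KqE w1 w2 (x1 x2 : R) : Kq w1 w2 x1%:C x2%:C x1 x2 =
 (x2 - x1) * (cabs (w2 - c%:C) ^+ 2 - cabs (w1 - c%:C) ^+ 2).
Proof.
rewrite /Kq !cabs_sq; case: w1 => a1 b1; case: w2 => a2 b2 /=.
by ring.
Qed.

Lemma Kq_term w1 w2 (a : R) : w1 != a%:C -> w2 != a%:C ->
 cabs (w1 - conjc w2) ^+ 2 * cabs (w1 - w2) ^+ 2 *
  ((a - c) ^+ 2 / (cabs (w1 - a%:C) ^+ 2 * cabs (w2 - a%:C) ^+ 2)) =
 Kq w1 w2 ((w1 - c%:C) / (w1 - a%:C)) ((w2 - c%:C) / (w2 - a%:C))
  (cabs (w1 - c%:C) ^+ 2 / cabs (w1 - a%:C) ^+ 2) (cabs (w2 - c%:C) ^+ 2 / cabs (w2 - a%:C) ^+ 2).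
Proof.
move=> n1 n2; have [<-|n12] := eqVneq w1 w2.
 by rewrite /Kq !subrr cabs0 conjc0 !mulr0 expr0n /= !(mulr0, mul0r) subr0.
rewrite /Kq -(mulrAC (cabs (w1 - conjc w2) ^+ 2)) sK_term //.
have d0 : w2 - w1 != 0 by rewrite subr_eq0 eq_sym.
have nz : cabs (w1 - w2) ^+ 2 != 0 by rewrite expf_neq0 // cabs_eq0 subr_eq0.
have key X : cabs (w1 - w2) ^+ 2 * Re (X / (w2 - w1)) = Re (X * conjc (w2 - w1)).
 rewrite cdivE // (cabsBC w2 w1).
 by rewrite cReZ mulrA mulfV // mul1r.
by rewrite mulrBl mulrC; congr (_ - _); rewrite mulrC mulrCA key.
Qed.

Lemma Kq_sum w1 w2 : offp w1 -> offp w2 ->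
 cabs (w1 - conjc w2) ^+ 2 * cabs (w1 - w2) ^+ 2 *
  \sum_(p <- l) p.1 * ((p.2 - c) ^+ 2 / (cabs (w1 - p.2%:C) ^+ 2 * cabs (w2 - p.2%:C) ^+ 2)) =
 Kq w1 w2 (sS w1) (sS w2) (sM w1) (sM w2).
Proof.
move=> o1 o2.
have -> : Kq w1 w2 (sS w1) (sS w2) (sM w1) (sM w2) = \sum_(p <- l) p.1 *
 Kq w1 w2 ((w1 - c%:C) / (w1 - p.2%:C)) ((w2 - c%:C) / (w2 - p.2%:C))
  (cabs (w1 - c%:C) ^+ 2 / cabs (w1 - p.2%:C) ^+ 2) (cabs (w2 - c%:C) ^+ 2 / cabs (w2 - p.2%:C) ^+ 2).
 rewrite /Kq /sS /sM -big_split /= mulr_sumr !mulr_suml -sumrB mulr_suml Re_sum mulr_sumr -sumrB.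
 apply: eq_bigr => p _.
 rewrite -!mulrA -mulrBr !mulrA; rewrite -[X in Re X]mulrA cReZ; set X := Re _.
 by ring.
rewrite mulr_sumr; apply: eq_big_seq => p pl; rewrite -Kq_term; [by ring|exact: o1|exact: o2].
Qed.

Lemma cabs_pole_ub w (a : R) : 0 < a -> cabs (w - a%:C) <= (1 + cabs w) * (1 + a).
Proof.
move=> a0; have := cabsD w (- a%:C); rewrite cabsN cabsR (gtr0_norm a0) => h.
by apply: le_trans h _; have := cabs_ge0 w; nra.
Qed.

Lemma sN_Kq w1 w2 : offp w1 -> offp w2 ->
 cabs (w1 - conjc w2) ^+ 2 * cabs (w1 - w2) ^+ 2 * sN <=
 Kq w1 w2 (sS w1) (sS w2) (sM w1) (sM w2) * ((1 + cabs w1) ^+ 2 * (1 + cabs w2) ^+ 2).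
Proof.
move=> o1 o2; rewrite -Kq_sum // -[leRHS]mulrA; apply: ler_wpM2l.
 by rewrite mulr_ge0 ?exprn_ge0 ?cabs_ge0.
rewrite mulr_suml /sN !big_seq; apply: ler_sum => p pl.
have [p1 p2] := lpos pl; rewrite -mulrA ler_pM2l //.
have h1 := cabs_pole_ub w1 p2; have h2 := cabs_pole_ub w2 p2.
have c1 : 0 < cabs (w1 - p.2%:C) by rewrite cabs_gt0 subr_eq0 o1.
have c2 : 0 < cabs (w2 - p.2%:C) by rewrite cabs_gt0 subr_eq0 o2.
rewrite -mulrA ler_wpM2l ?sqr_ge0 //.
rewrite ler_pdivlMl; last by rewrite mulr_gt0 // exprn_gt0.
rewrite ler_pdivrMr; last by rewrite exprn_gt0 // addr_gt0.
have -> : (1 + cabs w1) ^+ 2 * (1 + cabs w2) ^+ 2 * (1 + p.2) ^+ 4 =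
 ((1 + cabs w1) * (1 + p.2)) ^+ 2 * ((1 + cabs w2) * (1 + p.2)) ^+ 2 by ring.
have l1 := ltW c1; have l2 := ltW c2.
by apply: ler_pM; rewrite ?exprn_ge0 // lerXn2r // nnegrE ?(le_trans _ h1) ?(le_trans _ h2).
Qed.

Lemma cabs_conj_ge w1 w2 : 0 <= Im w1 -> 0 <= Im w2 -> cabs (w1 - w2) <= cabs (w1 - conjc w2).
Proof.
case: w1 => a1 b1; case: w2 => a2 b2 /= h1 h2.
by rewrite /cabs /= ler_wsqrtr //; nra.
Qed.

Lemma sN_ge0 : 0 <= sN.
Proof.
rewrite /sN big_seq; apply: sumr_ge0 => p pl; have [p1 p2] := lpos pl.
by rewrite mulr_ge0 ?(ltW p1) // divr_ge0 ?sqr_ge0 // exprn_ge0 // addr_ge0 // ltW.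
Qed.

Lemma sM_nonreal w : Im w != 0 -> sM w = Re (sS w) - (Re w - c) * Im (sS w) / Im w.
Proof.
move=> w0; rewrite /sM /sS Re_sum Im_sum mulr_sumr mulr_suml -sumrB.
apply: eq_bigr => p _; rewrite cReZ cImZ.
have nz : cabs (w - p.2%:C) ^+ 2 != 0.
 rewrite expf_neq0 // cabs_eq0 subr_eq0; apply: contraNneq w0 => -> /=; exact: eqxx.
rewrite cdivE; last by move: nz; rewrite expf_eq0 /= cabs_eq0.
rewrite cReZ cImZ; move: nz; rewrite !cabs_sq; move: w0; case: w => x y /= y0 nz.
by rewrite subr0 in nz *; field; rewrite y0 nz.
Qed.

Lemma offp_nonreal w : Im w != 0 -> offp w.
Proof. by move=> w0 p _; apply: contraNneq w0 => -> /=. Qed.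

Lemma sSJ w : sS (conjc w) = conjc (sS w).
Proof.
rewrite /sS rmorph_sum; apply: eq_bigr => p _.
rewrite rmorphM /= [conjc (_ / _)]rmorphM /= conjc_inv !cjBR; congr (_ * _); by apply/eqP; rewrite eq_complex /= oppr0 !eqxx.
Qed.

Lemma sS_real (t : R) : sS t%:C = (\sum_(p <- l) p.1 * ((t - c) / (t - p.2)))%:C.
Proof. by rewrite /sS rmorph_sum; apply: eq_bigr => p _; rewrite !(rmorphM, fmorphV, rmorphB). Qed.

Lemma sM_real (t : R) : sM t%:C = \sum_(p <- l) p.1 * ((t - c) ^+ 2 / (t - p.2) ^+ 2).
Proof. by apply: eq_bigr => p _; rewrite -!rmorphB /= !cabsR !real_normK ?num_real. Qed.

End StieltjesForm.

(** * Estimates that depend on the poles only through a single sum *)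

Section StieltjesAnalysis.
Variables (l : seq (R * R)) (c : R).
Implicit Types (w : C) (p : R * R).
Hypothesis lpos : forall p, p \in l -> 0 < p.1 /\ 0 < p.2.

(** This is S(-1)/(1 + c) ([sB_neg]), a value on the negative axis that is later bounded uniformly
    in K. *)
Definition sB : R := \sum_(p <- l) p.1 / (1 + p.2).

Lemma cder_sS w : offp l w -> cder (sS l c) w (sD l c w).
Proof.
move=> ow; rewrite /sD -sumrN.
suff H s : {subset s <= l} -> cder (fun w => \sum_(p <- s) p.1%:C * ((w - c%:C) / (w - p.2%:C))) w
  (\sum_(p <- s) - (p.1%:C * ((p.2 - c)%:C / (w - p.2%:C) ^+ 2))) by exact: H.
elim: s => [_|p s ih sl].
 by rewrite big_nil; under eq_fun do rewrite big_nil; exact: cder_cst.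
rewrite big_cons; under eq_fun do rewrite big_cons.
have H2 := ih (fun q qs => sl q (mem_behead (s := p :: s) qs)).
suff H1 : cder (fun w => p.1%:C * ((w - c%:C) / (w - p.2%:C))) w (- (p.1%:C * ((p.2 - c)%:C / (w - p.2%:C) ^+ 2))).
 exact: cderD H1 H2.
have d0 : w - p.2%:C != 0 by rewrite subr_eq0; apply: ow; apply: sl; rewrite inE eqxx.
have dd (a : R) : cder (fun z : C => z - a%:C) w 1.
 by rewrite -[1]addr0; apply: cderD; [exact: cder_id|exact: cder_cst].
have := cderM (cder_cst p.1%:C w) (cderM (dd c) (@cder_inv p.2%:C w _)). move=> /(_ (ow p (sl p (mem_head _ _)))).
rewrite mulr0 addr0; set X := (X in cder _ _ X) => H.
suff -> : - (p.1%:C * ((p.2 - c)%:C / (w - p.2%:C) ^+ 2)) = X by []; rewrite {H}/X.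
rewrite rmorphB /=; move: d0; move: (p.1%:C) (p.2%:C) (c%:C) => A B E d0.
by field.
Qed.

(** The distance to a pole is measured relatively to 1 + p because the poles are unbounded as K
    grows. *)
Definition kfar (k : R) w := forall p, p \in l -> k * (1 + p.2) <= cabs (w - p.2%:C).

Lemma c_pole_ub p : p \in l -> `|p.2 - c| <= (1 + `|c|) * (1 + p.2).
Proof.
move=> pl; have [_ p2] := lpos pl; have := ler_normB p.2 c; rewrite (gtr0_norm p2) => h.
by have := normr_ge0 c; nra.
Qed.

Lemma sB_ge0 : 0 <= sB.
Proof.
rewrite /sB big_seq; apply: sumr_ge0 => p pl; have [p1 p2] := lpos pl.
by rewrite divr_ge0 ?(ltW p1) // addr_ge0 // ltW.
Qed.

Lemma sS_bound k w : 0 < k -> kfar k w -> cabs (sS l c w) <= (cabs w + `|c|) / k * sB.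
Proof.
move=> k0 kw; apply: le_trans (cabs_sum _ _ _) _; rewrite /sB mulr_sumr !big_seq.
apply: ler_sum => p pl; have [p1 p2] := lpos pl; have h := kw p pl.
have p3 : 0 < 1 + p.2 by rewrite addr_gt0.
rewrite !cabsM cabsR (gtr0_norm p1) cabsV [leRHS]mulrCA ler_pM2l //.
have h0 : 0 < cabs (w - p.2%:C) by apply: lt_le_trans h; rewrite mulr_gt0.
have := cabsD w (- c%:C); rewrite cabsN cabsR => h1.
rewrite -mulrA; apply: ler_pM; rewrite ?cabs_ge0 ?invr_ge0 ?cabs_ge0 // -invfM lef_pV2 //.
by rewrite posrE mulr_gt0.
Qed.

(** For one pole the remainder is exactly p1 (p - c)(w' - w)^2/((w' - p)(w - p)^2). [kfar] bounds it
    by a multiple of p1/(1 + p)^2, and one power of 1 + p is given away to reach [sB]. *)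
Lemma sS_taylor k w w' : 0 < k -> kfar k w -> kfar k w' ->
 cabs (sS l c w' - sS l c w - (w' - w) * sD l c w) <=
 (1 + `|c|) / k ^+ 3 * sB * cabs (w' - w) ^+ 2.
Proof.
move=> k0 kw kw'; rewrite /sS /sD mulrN mulr_sumr opprK -sumrB -big_split /=.
apply: le_trans (cabs_sum _ _ _) _.
rewrite /sB mulr_sumr mulr_suml !big_seq.
apply: ler_sum => p pl; have [p1 p2] := lpos pl; have h := kw p pl; have h' := kw' p pl.
have p3 : 0 < 1 + p.2 by rewrite addr_gt0.
have g0 : 0 < cabs (w - p.2%:C) by apply: lt_le_trans h; rewrite mulr_gt0.
have g0' : 0 < cabs (w' - p.2%:C) by apply: lt_le_trans h'; rewrite mulr_gt0.
have e0 : w - p.2%:C != 0 by rewrite -cabs_gt0.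
have e0' : w' - p.2%:C != 0 by rewrite -cabs_gt0.
have -> : p.1%:C * ((w' - c%:C) / (w' - p.2%:C)) - p.1%:C * ((w - c%:C) / (w - p.2%:C)) +
  (w' - w) * (p.1%:C * ((p.2 - c)%:C / (w - p.2%:C) ^+ 2)) =
 p.1%:C * ((p.2 - c)%:C * (w' - w) ^+ 2 * ((w' - p.2%:C)^-1 * (w - p.2%:C) ^- 2)).
 rewrite rmorphB /=; move: (p.1%:C) (p.2%:C) (c%:C) e0 e0' => P A E a1 a2; by field; rewrite a1 a2.
rewrite !cabsM !cabsV !cabsX !cabsR (gtr0_norm p1).
have cp := c_pole_ub pl.
have q : (cabs (w' - p.2%:C))^-1 * (cabs (w - p.2%:C)) ^- 2 <= (k ^+ 3 * (1 + p.2) ^+ 3)^-1.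
 rewrite -invfM lef_pV2 ?posrE ?mulr_gt0 ?exprn_gt0 // -exprMn exprS.
 have t0 : 0 <= k * (1 + p.2) by rewrite mulr_ge0 ?(ltW k0) ?(ltW p3).
 by apply: ler_pM => //; rewrite ?exprn_ge0 // lerXn2r // nnegrE ltW.
have [A0 B0] : 0 <= cabs (w' - w) ^+ 2 /\ 0 <= (cabs (w' - p.2%:C))^-1 * (cabs (w - p.2%:C)) ^- 2.
 by rewrite -invfM invr_ge0 exprn_ge0 ?cabs_ge0 // mulr_ge0 ?exprn_ge0 ?cabs_ge0.
apply: (@le_trans _ _ (p.1 * ((1 + `|c|) * (1 + p.2) * cabs (w' - w) ^+ 2 * (k ^+ 3 * (1 + p.2) ^+ 3)^-1))).
 rewrite ler_pM2l //; apply: ler_pM => //; first by rewrite mulr_ge0.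
 by rewrite ler_wpM2r.
have -> : p.1 * ((1 + `|c|) * (1 + p.2) * cabs (w' - w) ^+ 2 * (k ^+ 3 * (1 + p.2) ^+ 3)^-1) =
 (1 + `|c|) / k ^+ 3 * (p.1 / (1 + p.2)) * cabs (w' - w) ^+ 2 * (1 + p.2)^-1.
 by field; rewrite !gt_eqF.
rewrite ler_piMr ?invf_le1 //; last by rewrite lerDl ltW.
rewrite mulr_ge0 // mulr_ge0 // divr_ge0 ?exprn_ge0 ?(ltW k0) ?addr_ge0 //.
 exact: ltW.
exact: ltW.
Qed.

Lemma sD_real (t : R) : sD l c t%:C = (- \sum_(p <- l) p.1 * ((p.2 - c) / (t - p.2) ^+ 2))%:C.
Proof.
rewrite /sD rmorphN rmorph_sum; congr (- _); apply: eq_bigr => p _.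
by rewrite !(rmorphM, fmorphV, rmorphXn, rmorphB).
Qed.

Lemma sM_S_real (t : R) : offp l t%:C ->
 Re (sS l c t%:C) - sM l c t%:C = (t - c) * Re (sD l c t%:C).
Proof.
move=> ot; rewrite sS_real sM_real /sD cReN Re_sum /= -sumrB mulrN mulr_sumr -sumrN.
apply: eq_big_seq => p pl.
have tp : t - p.2 != 0.
 by rewrite subr_eq0; apply: contraNneq (ot p pl) => ->.
rewrite !(subrr, mulr0, mul0r, subr0, addr0, oppr0, expr0n) /=.
by field.
Qed.

End StieltjesAnalysis.

(** * Existence of a point of the path at every level *)

Section Existence.
Variables (l : seq (R * R)) (c : R).
Implicit Types (w : C) (p : R * R).
Hypotheses (lpos : forall p, p \in l -> 0 < p.1 /\ 0 < p.2) (lc : forall p, p \in l -> p.2 != c).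
Hypothesis ul : uniq (map snd l).

(** In the open upper half-plane the last condition is an equality. At a real point it reads (w - c)
    S'(w) >= 0 and keeps those real solutions of S = x that move away from c as x grows, the only
    ones through which the path may run. *)
Definition onG w (x : R) := [/\ 0 <= Im w, offp l w, sS l c w = x%:C & sM l c w <= x].

Let D : {poly C} := \prod_(p <- l) ('X - p.2%:C%:P).
Let Dr p : {poly C} := \prod_(q <- rem p l) ('X - q.2%:C%:P).

Let DE p : p \in l -> D = ('X - p.2%:C%:P) * Dr p.
Proof. by move=> pl; rewrite /D (big_rem p pl) /=. Qed.

(** (S - x) cleared of its denominators. It does not vanish at the poles ([lev_root]), so none of
    its roots is spurious. *)
Definition lev (x : R) : {poly C} := \sum_(p <- l) p.1%:C *: (('X - c%:C%:P) * Dr p) - x%:C *: D.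

Lemma levE x w : offp l w -> (lev x).[w] = (sS l c w - x%:C) * D.[w].
Proof.
move=> ow; rewrite /lev /sS hornerD hornerN hornerZ horner_sum mulrBl mulr_suml; congr (_ - _).
apply: eq_big_seq => p pl; rewrite hornerZ hornerM (DE pl) hornerM !hornerXsubC.
have d0 : w - p.2%:C != 0 by rewrite subr_eq0; exact: ow.
by rewrite -mulrA; congr (_ * _); rewrite mulrA divfK.
Qed.

Let D_neq0 w : offp l w -> D.[w] != 0.
Proof.
move=> ow; rewrite horner_prod prodf_seq_neq0; apply/allP => p pl /=.
by rewrite hornerXsubC subr_eq0 ow.
Qed.

Let ul' : uniq l.
Proof. exact: map_uniq ul. Qed.

Let Dr_other p q : p \in l -> q \in l -> p != q -> (Dr q).[p.2%:C] = 0.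
Proof.
move=> pl ql pq; rewrite horner_prod; apply/eqP; rewrite prodf_seq_eq0; apply/hasP.
by exists p; [rewrite mem_rem_uniq // inE pq|rewrite /= hornerXsubC subrr].
Qed.

Let Dr_self p : p \in l -> (Dr p).[p.2%:C] != 0.
Proof.
move=> pl; rewrite horner_prod prodf_seq_neq0; apply/allP => q; rewrite mem_rem_uniq // inE.
case/andP => qp ql /=; rewrite hornerXsubC subr_eq0; apply: contraNneq qp => /CI E.
by apply/eqP; apply: (uniq_map_inj ul).
Qed.

Lemma lev_root x w : root (lev x) w -> offp l w.
Proof.
move=> rw p pl; apply: contraTneq rw => ->; rewrite rootE /lev hornerD hornerN hornerZ horner_sum.
rewrite (DE pl) hornerM hornerXsubC subrr mul0r mulr0 subr0 (bigD1_seq p) //= big1_seq ?addr0.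
 have [p1 _] := lpos pl.
 rewrite hornerZ hornerM hornerXsubC !mulf_eq0 negb_or (negPf (Dr_self pl)) orbF -rmorphB.
 by rewrite !fmorph_eq0 subr_eq0 (negPf (lc pl)) gt_eqF.
by move=> q /andP[qp ql]; rewrite hornerZ hornerM Dr_other ?mulr0 // eq_sym.
Qed.

Let C1 : R := \sum_(p <- l) p.1.

(** [C1] is the value of S at infinity; below it the degree does not drop. *)
Lemma lev_size x : x < C1 -> size (lev x) = (size l).+1 /\ lead_coef (lev x) = (C1 - x)%:C.
Proof.
move=> xC.
have sD : size D = (size l).+1 by rewrite size_prod_XsubC.
have sDr p : p \in l -> size (('X - c%:C%:P) * Dr p) = (size l).+1.
 move=> pl; rewrite size_mul ?polyXsubC_eq0 // ?monic_neq0 ?monic_prod_XsubC //.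
 by rewrite size_XsubC size_prod_XsubC size_rem //; case: (l) pl.
have cf : (lev x)`_(size l) = (C1 - x)%:C.
 rewrite /lev coefD coefN coefZ coef_sum rmorphB /C1 rmorph_sum /=; congr (_ - _); last first.
  have := monic_prod_XsubC l predT (fun p => p.2%:C); rewrite -/D => /monicP.
  by rewrite lead_coefE sD /= => ->; rewrite mulr1.
 apply: eq_big_seq => p pl; rewrite coefZ.
 have m : ('X - c%:C%:P) * Dr p \is monic by rewrite monicMl ?monicXsubC // monic_prod_XsubC.
 by move/monicP: m; rewrite lead_coefE sDr //= => ->; rewrite mulr1.
have sz : (size (lev x) <= (size l).+1)%N.
 apply: leq_trans (size_polyD _ _) _; rewrite size_polyN geq_max; apply/andP; split; last first.
  by apply: leq_trans (size_scale_leq _ _) _; rewrite sD.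
 apply: leq_trans (size_sum _ _ _) _; rewrite big_seq; apply/bigmax_leqP_seq => p /= _ pl.
 by apply: leq_trans (size_scale_leq _ _) _; rewrite sDr.
have s1 : size (lev x) = (size l).+1.
 apply/eqP; rewrite eqn_leq sz /= ltnNge; apply/negP => /(nth_default 0); rewrite cf => /eqP.
 by rewrite fmorph_eq0 subr_eq0 gt_eqF.
by split=> //; rewrite lead_coefE s1.
Qed.

(* [lev x] vanishes at [t] as soon as [x = S t], and then its quotient by ['X - t]
  takes the value [D t * S' t] at [t]. *)
Lemma lev_quot x t : offp l t -> sS l c t = x%:C ->
 exists G : {poly C}, lev x = ('X - t%:P) * G /\ G.[t] = D.[t] * sD l c t.
Proof.
move=> ot St; exists (\sum_(p <- l) (p.1%:C * ((c - p.2)%:C / (t - p.2%:C))) *: Dr p); split.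
 rewrite /lev -St /sS scaler_suml -sumrB mulr_sumr; apply: eq_big_seq => p pl.
 have d0 : t - p.2%:C != 0 by rewrite subr_eq0; exact: ot.
 rewrite (DE pl) -!mul_polyC !(polyCM p.1%:C).
 set u := ((t - c%:C) / _)%:P; set v := ((c - p.2)%:C / _)%:P.
 have hv : v = 1 - u.
  rewrite /u /v -polyC1 -polyCB; congr polyC; rewrite rmorphB /=.
  by move: (c%:C) (p.2%:C) d0 => a b d0; field.
 have hc : c%:C%:P = t%:P * v + u * p.2%:C%:P.
  rewrite /u /v -!polyCM -polyCD; congr polyC; rewrite rmorphB /=.
  by move: (c%:C) (p.2%:C) d0 => a b d0; field.
 by rewrite hc hv; ring.
rewrite horner_sum /sD -sumrN mulr_sumr; apply: eq_big_seq => p pl.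
have d0 : t - p.2%:C != 0 by rewrite subr_eq0; exact: ot.
rewrite hornerZ (DE pl) hornerM hornerXsubC !rmorphB /=.
by field.
Qed.

(** By contradiction. A nonreal root of [lev x], or its conjugate, would be such a point, so all
    roots are real with (t - c) S'(t) < 0; this makes them simple and fixes the signs of
    residues. *)
Lemma exists_onG x : 0 < x < C1 -> exists w, onG w x.
Proof.
move=> /andP[x0 xC]; apply: contrapT => nex.
have [sz lc'] := lev_size xC.
have [rs] := closed_field_poly_normal (lev x); rewrite lc' => E.
have CX0 : (C1 - x)%:C != 0 :> C by rewrite fmorph_eq0 subr_eq0 gt_eqF.
have srs : size rs = size l.
 have := sz; rewrite E size_scale // size_prod_XsubC => -[] //.
have rsS t : t \in rs -> offp l t /\ sS l c t = x%:C.
 move=> trs; have rt : root (lev x) t.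
  rewrite E rootZ // root_prod_XsubC //.
 have ot := lev_root rt; split=> //.
 move: rt; rewrite rootE levE // mulf_eq0 (negPf (D_neq0 ot)) orbF subr_eq0 => /eqP //.
have rsR t : t \in rs -> Im t = 0 /\ x < sM l c t.
 move=> /rsS[ot St]; have [t0|t0] := eqVneq (Im t) 0.
  split=> //; rewrite ltNge; apply/negP => Mt; apply: nex; exists t; split=> //; by rewrite t0.
 exfalso; apply: nex; have [tp|tn] := leP 0 (Im t).
  by exists t; split=> //; rewrite sM_nonreal // St /= mulr0 mul0r subr0.
 exists (conjc t); have t1 : Im (conjc t) != 0 by rewrite cImJ oppr_eq0.
 split; rewrite ?cImJ ?oppr_ge0 ?(ltW tn) //; first exact: offp_nonreal.
  by rewrite sSJ St conjc_real.
 by rewrite sM_nonreal // sSJ St /= oppr0 mulr0 mul0r subr0.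
have rsD t : t \in rs -> t = (Re t)%:C /\ (Re t - c) * Re (sD l c t) < 0.
 move=> trs; have [t0 Mt] := rsR t trs; have [ot St] := rsS t trs.
 have tE : t = (Re t)%:C by apply: complexP.
 split=> //; rewrite {2}tE -sM_S_real -?tE // St /= subr_lt0 //.
(* The derivative of [lev x] at a root, computed once from the factorization and once from S. *)
have quot t : t \in rs -> (C1 - x)%:C * \prod_(r <- rem t rs) (t - r) = D.[t] * sD l c t.
 move=> trs; have [ot St] := rsS t trs; have [G [GE <-]] := lev_quot ot St.
 have : ('X - t%:P) * ((C1 - x)%:C *: \prod_(r <- rem t rs) ('X - r%:P)) = ('X - t%:P) * G.
  by rewrite -GE E (big_rem t trs) /= scalerAr.
 move/(mulfI _) => <-; last by rewrite polyXsubC_eq0.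
 rewrite hornerZ horner_prod; congr (_ * _); by apply: eq_bigr => r _; rewrite hornerXsubC.
have qnz t : t \in rs -> \prod_(r <- rem t rs) (t - r) != 0.
 move=> trs; have [ot St] := rsS t trs; have [tE dn] := rsD t trs.
 apply/negP => /eqP q0; have := quot t trs; rewrite q0 mulr0 => /esym/eqP.
 rewrite mulf_eq0 (negPf (D_neq0 ot)) /= => /eqP d0; move: dn; rewrite d0 /= mulr0 ltxx //.
have urs : uniq rs.
 apply: uniq_notin_rem => t trs; apply/negP => tr; have := qnz t trs.
 by rewrite prodf_seq_neq0 => /allP /(_ t tr) /=; rewrite subrr eqxx.
have crs : c%:C \notin rs.
 apply/negP => /rsS[_]; rewrite /sS big1 => [/esym/eqP|p _].
  by rewrite fmorph_eq0 gt_eqF.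
 by rewrite subrr mul0r mulr0.
(* The partial fraction expansion of [D / ((w - c) (lev x))] has only negative
  residues, whereas the function itself is positive for large real [w]. *)
have [T hT] := seq_strict_ub (c :: [seq Re r | r <- rs] ++ map snd l).
have Tc : c < T by apply: hT; rewrite mem_head.
have Tr r : r \in rs -> Re r < T by move=> rrs; apply: hT; rewrite inE mem_cat (map_f (fun r : C => Re r) rrs) orbT.
have Tl p : p \in l -> p.2 < T.
 by move=> pl; apply: hT; rewrite inE mem_cat (map_f snd pl) !orbT.
have pR (y : R) : (0 < y%:C) = (0 < y) by rewrite ltcR.
have TB (y : R) : y < T -> 0 < T%:C - y%:C :> C by rewrite -rmorphB pR subr_gt0.
have TP : T%:C \notin c%:C :: rs.
 rewrite inE negb_or -subr_eq0 gt_eqF ?TB //=; apply/negP => /Tr /=; rewrite ltxx //.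
have := @lagrange_pfrac _ (c%:C :: rs) D T%:C; rewrite /= crs urs TP => /(_ isT isT).
rewrite size_prod_XsubC srs => /(_ (leqnn _)) H.
have : 0 < D.[T%:C] / \prod_(r <- c%:C :: rs) (T%:C - r).
 rewrite divr_gt0 // ?big_cons ?mulr_gt0 ?TB //.
  rewrite horner_prod big_seq prodr_gt0 // => p pl; by rewrite hornerXsubC TB ?Tl.
 by rewrite big_seq prodr_gt0 // => r rrs; have [-> _] := rsD r rrs; rewrite TB ?Tr.
rewrite {}H big_cons big_cons eqxx /=.
(* S(c) = 0 gives the value - x D(c) of [lev x] at c, so the residue there has the sign of - 1/x. *)
have -> : \prod_(j <- rs | j != c%:C) (c%:C - j) = - ((x / (C1 - x))%:C * D.[c%:C]).
 have oc : offp l c%:C by move=> p pl; rewrite (inj_eq CI) eq_sym lc.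
 have S0 : sS l c c%:C = 0 by rewrite /sS big1 // => p _; rewrite subrr mul0r mulr0.
 have := levE x oc; rewrite E hornerZ horner_prod S0 => H.
 have -> : \prod_(j <- rs | j != c%:C) (c%:C - j) = \prod_(r <- rs) ('X - r%:P).[c%:C].
  rewrite big_seq_cond [RHS]big_seq; apply: eq_big => [r|r _]; last by rewrite hornerXsubC.
  by case rrs: (r \in rs) => //=; apply: contraNneq crs => <-.
 apply: (mulfI CX0); rewrite H fmorph_div /=; move: CX0; move: ((C1 - x)%:C) => k k0.
 by rewrite sub0r mulrN mulrA mulrCA divff // mulr1 mulNr.
have oc : offp l c%:C by move=> p pl; rewrite (inj_eq CI) eq_sym lc.
have -> : D.[c%:C] / ((T%:C - c%:C) * - ((x / (C1 - x))%:C * D.[c%:C])) = - ((C1 - x) / (x * (T - c)))%:C.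
 have d0 := D_neq0 oc; have t0 : (T - c)%:C != 0 :> C by rewrite fmorph_eq0 subr_eq0 gt_eqF.
 rewrite -[T%:C - c%:C]rmorphB !(rmorphM, fmorphV) /= invfM.
 have x0' : x%:C != 0 :> C by rewrite fmorph_eq0 gt_eqF.
 move: d0 t0 CX0 x0'; move: (D.[_]) ((T - c)%:C) ((C1 - x)%:C) (x%:C) => d t k y d0 t0 k0 y0.
 by field; rewrite ?d0 ?t0 ?k0 ?y0.
move=> /lt_le_trans h; suff /h : - ((C1 - x) / (x * (T - c)))%:C +
  \sum_(j <- rs) D.[j] / ((T%:C - j) * \prod_(y <- c%:C :: rs | y != j) (j - y)) <= 0 by rewrite ltxx.
rewrite -[leRHS]addr0 lerD //.
 by rewrite oppr_le0 lecR divr_ge0 ?mulr_ge0 ?subr_ge0 // ltW.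
rewrite big_seq sumr_le0 // => t trs; have [tE dn] := rsD t trs; have [ot _] := rsS t trs.
rewrite big_cons (_ : c%:C != t); last by apply: contraNneq crs => ->.
have -> : \prod_(j <- rs | j != t) (t - j) = \prod_(r <- rem t rs) (t - r).
 by rewrite rem_filter // big_filter.
have q := quot t trs; have d0 := D_neq0 ot; rewrite tE sD_real -sD_real -tE in dn q *.
have sE : sD l c t = (Re (sD l c t))%:C by rewrite tE sD_real.
have pE : \prod_(r <- rem t rs) (t - r) = ((C1 - x)%:C)^-1 * (D.[t] * sD l c t) by rewrite -q mulKf.
have tT : 0 < T - Re t by rewrite subr_gt0 Tr.
have dn0 : (Re t - c) * Re (sD l c t) != 0 by rewrite lt_eqF.
have -> : D.[t] / ((T%:C - t) * ((t - c%:C) * \prod_(r <- rem t rs) (t - r))) =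
 ((C1 - x) / ((T - Re t) * ((Re t - c) * Re (sD l c t))))%:C.
 have e1 : T%:C - t = (T - Re t)%:C by rewrite {1}tE rmorphB.
 have e2 : t - c%:C = (Re t - c)%:C by rewrite {1}tE rmorphB.
 rewrite pE e1 e2 {1}sE !(rmorphM, fmorphV) /=.
 have a0 : (T - Re t)%:C != 0 :> C by rewrite fmorph_eq0 gt_eqF.
 have [b0 e0] : (Re t - c)%:C != 0 :> C /\ (Re (sD l c t))%:C != 0 :> C.
  by rewrite !fmorph_eq0; move: dn0; rewrite mulf_eq0 negb_or => /andP[].
 move: d0 a0 b0 e0 CX0; move: (D.[t]) ((T - Re t)%:C) ((Re t - c)%:C) ((Re (sD l c t))%:C) ((C1 - x)%:C).
 by move=> d a b e k d0 a0 b0 e0 k0; field; apply/and5P.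
by rewrite lecR pmulr_rle0 ?subr_gt0 // invr_le0 pmulr_rle0 // ltW.
Qed.

End Existence.

(** * Mean value bounds along segments *)

Definition seg (w0 w1 : C) (s : R) : C := w0 + s%:C * (w1 - w0).

Lemma segE (w0 w1 : C) s : 0 <= s <= 1 -> 0 <= Im w0 -> 0 <= Im w1 ->
 0 <= Im (seg w0 w1 s) /\ cabs (seg w0 w1 s - w0) <= cabs (w1 - w0).
Proof.
move=> /andP[s0 s1] h0 h1; split.
 by rewrite /seg cImD cImZ cImB; nra.
by rewrite /seg addrAC subrr add0r cabsM cabsR (ger0_norm s0) ler_piMl ?cabs_ge0.
Qed.

(** Stated for imaginary parts because the mean value theorem fails for complex values; only
    imaginary parts of primitives are ever compared. *)
Lemma seg_MVT (Q : C -> C) (q : R -> C) (w0 w1 : C) (m : R) :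
 (forall s, 0 <= s <= 1 -> rder (Q \o seg w0 w1) s (q s * (w1 - w0))) ->
 (forall s, 0 <= s <= 1 -> cabs (q s) <= m) ->
 `|Im (Q w1) - Im (Q w0)| <= m * cabs (w1 - w0).
Proof.
move=> hQ hq; pose f (s : R) := Im (Q (seg w0 w1 s)).
have df (s : R) : 0 <= s <= 1 -> is_derive s 1 f (Im (q s * (w1 - w0))).
 by move=> s01; exact: (rder_Im (hQ s s01)).
have e0 : seg w0 w1 0 = w0 by rewrite /seg mul0r addr0.
have e1 : seg w0 w1 1 = w1 by rewrite /seg mul1r addrC subrK.
have [||s s01 E] := @MVT_segment R f (fun s => Im (q s * (w1 - w0))) 0 1 ler01.
- by move=> s; rewrite in_itv /= => /andP[a b]; apply: df; rewrite !ltW.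
- apply: continuous_in_subspaceT => s; rewrite inE /= in_itv /= => s01.
 by have [/derivable1_diffP/differentiable_continuous] := df s s01.
rewrite in_itv /= in s01.
move: E; rewrite /f e0 e1 subr0 mulr1 => ->.
by apply: le_trans (Im_le_cabs _) _; rewrite cabsM ler_wpM2r ?cabs_ge0 // hq.
Qed.

Lemma cder_horner (p : {poly C}) w : cder (fun z => p.[z]) w p^`().[w].
Proof.
elim/poly_ind: p => [|p k ih].
 by rewrite deriv0 horner0; under eq_fun do rewrite horner0; exact: cder_cst.
rewrite derivD derivC addr0 derivM derivX mulr1 !hornerE.
under eq_fun do rewrite !hornerE.
have := cderD (cderM ih (cder_id w)) (cder_cst k w).
by rewrite addr0 mulr1 addrC mulrC.
Qed.

Lemma within_epsP (f : R -> R) (a b : R) :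
 (forall x, a <= x <= b -> forall e, 0 < e -> exists2 d : R, 0 < d &
   forall y, a <= y <= b -> `|y - x| < d -> `|f y - f x| <= e) ->
 {within `[a, b], continuous f}.
Proof.
move=> H; apply/subspace_continuousP => x; rewrite /= in_itv /= => xab.
apply/cvgrPdist_le => e e0; have [d d0 hd] := H x xab e e0.
rewrite near_withinE; near=> y; rewrite /= in_itv /= => yab.
by rewrite distrC; apply: hd.
Unshelve. all: by end_near. Qed.

Section WithinContinuous.
Implicit Types (f g : R -> R) (A : set R).

Lemma wcontM f g A : {within A, continuous f} -> {within A, continuous g} ->
 {within A, continuous (fun x => f x * g x)}.
Proof. by move=> fc gc x; have := cvgM (fc x) (gc x); exact. Qed.

Lemma wcontB f g A : {within A, continuous f} -> {within A, continuous g} ->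
 {within A, continuous (fun x => f x - g x)}.
Proof. by move=> fc gc x; have := cvgB (fc x) (gc x); exact. Qed.

End WithinContinuous.

(** * The path from c to the negative axis, and the moments along it *)

Section Path.
Variables (l : seq (R * R)) (c : R).
Implicit Types (w : C) (p : R * R).
Hypotheses (lpos : forall p, p \in l -> 0 < p.1 /\ 0 < p.2) (lc : forall p, p \in l -> p.2 != c).
Hypotheses (ul : uniq (map snd l)) (c0 : 0 < c).
Variables (e B : R).
Hypotheses (B0 : 0 < B) (e0 : e < 0) (eG : onG l c e%:C B) (n0 : forall x, ~ onG l c 0 x).

Lemma onG_c : onG l c c%:C 0.
Proof.
split=> //.
- by move=> p pl; rewrite (inj_eq CI) eq_sym lc.
- by rewrite /sS big1 // => p _; rewrite subrr mul0r mulr0.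
- by rewrite /sM big1 // => p _; rewrite subrr cabs0 expr0n /= mul0r mulr0.
Qed.

(** [sN_Kq] at real values, with M <= x used at both points and |w1 - conj w2| >= |w1 - w2| in the
    closed upper half-plane. Uniqueness at a level, the bound on the radius and continuity of the
    path are all read off this inequality. *)
Lemma onG_ineq w1 w2 x1 x2 : onG l c w1 x1 -> onG l c w2 x2 ->
 cabs (w1 - w2) ^+ 4 * sN l c <=
 (x2 - x1) * (cabs (w2 - c%:C) ^+ 2 - cabs (w1 - c%:C) ^+ 2) * ((1 + cabs w1) ^+ 2 * (1 + cabs w2) ^+ 2).
Proof.
move=> [i1 o1 S1 M1] [i2 o2 S2 M2].
have := sN_Kq c lpos o1 o2; rewrite S1 S2 => H.
apply: le_trans (le_trans H _); last first.
 rewrite ler_wpM2r ?mulr_ge0 ?exprn_ge0 ?addr_ge0 ?cabs_ge0 // -KqE /Kq lerD2r.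
 by rewrite ler_wpM2l ?exprn_ge0 ?cabs_ge0 // lerD.
rewrite ler_wpM2r ?sN_ge0 //.
have -> : cabs (w1 - w2) ^+ 4 = cabs (w1 - w2) ^+ 2 * cabs (w1 - w2) ^+ 2 by ring.
rewrite ler_wpM2r ?exprn_ge0 ?cabs_ge0 //.
by rewrite lerXn2r ?nnegrE ?cabs_ge0 // cabs_conj_ge.
Qed.

(** There is at least one pole, since S(e) = B > 0, and each one contributes a positive term because
    it differs from [c]. *)
Lemma sN_gt0 : 0 < sN l c.
Proof.
rewrite lt_neqAle sN_ge0 // andbT eq_sym; apply/negP => /eqP N0.
have := N0; rewrite /sN big_seq => /eqP; rewrite psumr_eq0; last first.
 move=> p pl; have [p1 p2] := lpos pl.
 by rewrite mulr_ge0 ?(ltW p1) // divr_ge0 ?sqr_ge0 // exprn_ge0 // addr_ge0 // ltW.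
move=> /allP H; have [ll|[p pl]] : l = [::] \/ exists p, p \in l.
 by case: (l) => [|p s]; [left|right; exists p; rewrite mem_head].
 by have [_ _ + _] := eG; rewrite ll /sS big_nil => /eqP; rewrite eq_sym fmorph_eq0 gt_eqF.
have := H p pl; rewrite pl /=; have [p1 p2] := lpos pl.
by rewrite !mulf_eq0 invr_eq0 !expf_eq0 /= subr_eq0 (negPf (lc pl)) !gt_eqF // addr_gt0.
Qed.

Lemma onG_uniq w1 w2 x : onG l c w1 x -> onG l c w2 x -> w1 = w2.
Proof.
move=> h1 h2; have := onG_ineq h1 h2; rewrite subrr !mul0r => h.
have : cabs (w1 - w2) ^+ 4 <= 0 by rewrite -(pmulr_lle0 _ sN_gt0).
move=> h'; apply/eqP; rewrite -subr_eq0 -cabs_eq0 -[_ == 0](@expf_eq0 _ _ 4).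
by rewrite -[_ == 0]andTb eq_le h' exprn_ge0 ?cabs_ge0.
Qed.

(** Comparison with the end point: in [onG_ineq] the left side is nonnegative and B - x is
    positive. *)
Lemma onG_radius w x : x < B -> onG l c w x -> cabs (w - c%:C) <= c - e.
Proof.
move=> xB h; have := onG_ineq h eG => H.
have : 0 <= (B - x) * (cabs (e%:C - c%:C) ^+ 2 - cabs (w - c%:C) ^+ 2) *
  ((1 + cabs w) ^+ 2 * (1 + cabs e%:C) ^+ 2).
 by apply: le_trans H; rewrite mulr_ge0 ?sN_ge0 // exprn_ge0 ?cabs_ge0.
rewrite pmulr_lge0; last by rewrite mulr_gt0 // exprn_gt0 // ltr_pwDl ?cabs_ge0.
rewrite pmulr_rge0 ?subr_gt0 // subr_ge0 -rmorphB cabsR ltr0_norm ?subr_lt0 ?(lt_trans e0) //.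
by rewrite opprB ler_pXn2r // nnegrE ?cabs_ge0 // subr_ge0 ltW // (lt_trans e0).
Qed.

(** The sum of p1 ((e - c)/(e - p) - 1)^2 is nonnegative and equals M - 2 S + C1 at e, where S = B
    and M <= B. All levels below B are therefore covered by [exists_onG]. *)
Lemma B_le_sum : B <= \sum_(p <- l) p.1.
Proof.
have [_ oe Se Me] := eG.
have : 0 <= \sum_(p <- l) p.1 * ((e - c) / (e - p.2) - 1) ^+ 2.
 rewrite big_seq sumr_ge0 // => p pl; have [p1 _] := lpos pl.
 by rewrite mulr_ge0 ?sqr_ge0 ?(ltW p1).
have -> : \sum_(p <- l) p.1 * ((e - c) / (e - p.2) - 1) ^+ 2 =
  sM l c e%:C - 2 * Re (sS l c e%:C) + \sum_(p <- l) p.1.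
 rewrite sM_real sS_real /= mulr_sumr -sumrB -big_split /=; apply: eq_bigr => p _.
 by rewrite -expr_div_n; ring.
rewrite Se /=; lra.
Qed.

Lemma path_exists : exists w : R -> C, [/\ w 0 = c%:C, w B = e%:C &
 forall x, 0 <= x <= B -> onG l c (w x) x].
Proof.
pose Q (x : R) (z : C) := 0 <= x <= B -> onG l c z x.
have ex x : exists z, Q x z.
 have [x01|x01] := boolP (0 <= x <= B); last by exists 0 => /idPn.
 have /andP[x0 xB] := x01.
 have [->|x0'] := eqVneq x 0; first by exists c%:C => _; exact: onG_c.
 have [->|xB'] := eqVneq x B; first by exists e%:C.
 have [z zG] : exists z, onG l c z x.
  apply: exists_onG => //; rewrite lt_neqAle eq_sym x0' x0 /=.
  by apply: lt_le_trans B_le_sum; rewrite lt_neqAle xB'.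
 by exists z.
have [w wQ] := choice ex; exists w; have wG x : 0 <= x <= B -> onG l c (w x) x by exact: wQ.
split=> //; last by apply: onG_uniq (wG _ _) eG; rewrite lexx ltW.
by apply: onG_uniq (wG _ _) onG_c; rewrite lexx ltW.
Qed.

Lemma cabs_expB (a b : C) (M : R) k : 1 <= M -> cabs a <= M -> cabs b <= M ->
 cabs (a ^+ k - b ^+ k) <= k%:R * M ^+ k * cabs (a - b).
Proof.
move=> M1 aM bM; elim: k => [|k ih]; first by rewrite !expr0 subrr cabs0 mul0r mul0r.
have M0 : 0 <= M by apply: le_trans M1.
have -> : a ^+ k.+1 - b ^+ k.+1 = a * (a ^+ k - b ^+ k) + (a - b) * b ^+ k by rewrite !exprS; ring.
apply: cabsD_le; rewrite !cabsM cabsX.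
have h1 : cabs a * cabs (a ^+ k - b ^+ k) <= M * (k%:R * M ^+ k * cabs (a - b)).
 by apply: ler_pM; rewrite ?cabs_ge0.
have h2 : cabs (a - b) * cabs b ^+ k <= cabs (a - b) * (M * M ^+ k).
 rewrite ler_wpM2l ?cabs_ge0 // (le_trans (_ : _ <= M ^+ k)) ?lerXn2r ?nnegrE ?cabs_ge0 //.
 by rewrite ler_peMl // exprn_ge0.
have := cabs_ge0 (a - b); move: h1 h2; rewrite -natr1 exprS; move: (M ^+ k) (k%:R) (cabs (a - b)) => A N d.
move: (cabs a * _) (d * _ ^+ k) => X Y; lra.
Qed.

Lemma rd_exp k (x : R) : is_derive x 1 (fun x : R => x ^+ k) (k%:R * x ^+ k.-1).
Proof.
elim: k => [|k ih].
 by rewrite mul0r; under eq_fun do rewrite expr0; exact: rdC.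
under eq_fun do rewrite exprS.
apply: rd_eq (rdM (is_derive_id x 1) ih) _.
by case: k {ih} => [|k]; rewrite /= ?expr0; [ring|rewrite !exprS -natr1; ring].
Qed.

Lemma seq_pos_lb (T : eqType) (f : T -> R) (s : seq T) : (forall x, x \in s -> 0 < f x) ->
 exists2 d, 0 < d & forall x, x \in s -> d <= f x.
Proof.
elim: s => [_|a s ih h]; first by exists 1.
have [|d d0 H] := ih; first by move=> x xs; apply: h; rewrite inE xs orbT.
exists (Num.min d (f a)); first by rewrite lt_min d0 h ?mem_head.
by move=> x; rewrite inE ge_min => /orP[/eqP ->|/H ->]; rewrite ?lexx ?orbT.
Qed.

Variable w : R -> C.
Hypotheses (w0c : w 0 = c%:C) (wBe : w B = e%:C) (wG : forall x, 0 <= x <= B -> onG l c (w x) x).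

Let Pl := 0 :: map snd l.

Lemma path_radius x : 0 <= x <= B -> cabs (w x - c%:C) <= c - e.
Proof.
move=> x01; have /andP[x0 xB] := x01; have [xB'|xB'] := ltP x B.
 exact: (onG_radius xB' (wG x01)).
have -> : x = B by apply/eqP; rewrite eq_le xB.
by rewrite wBe -rmorphB cabsR ltr0_norm ?subr_lt0 ?(lt_trans e0) // opprB.
Qed.

Lemma path_neq x a : 0 <= x <= B -> a \in Pl -> w x != a%:C.
Proof.
move=> x01; have G := wG x01; have [_ o _ _] := G; rewrite inE => /orP[/eqP ->|/mapP[p pl ->]]; last exact: o.
by apply/eqP => E; apply: (n0 (x := x)); rewrite -[0]/(0%:C) -E.
Qed.

(** Hölder continuity of exponent 1/4 by [onG_ineq], whose right side is controlled by
    [path_radius]. *)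
Lemma path_cont x0 : 0 <= x0 <= B -> forall t, 0 < t -> exists2 d : R, 0 < d &
 forall x, 0 <= x <= B -> `|x - x0| < d -> cabs (w x - w x0) < t.
Proof.
move=> x01 t t0.
pose A : R := (c - e) ^+ 2 * ((1 + (c + (c - e))) ^+ 2 * (1 + (c + (c - e))) ^+ 2).
have ce : 0 < c - e by rewrite subr_gt0 (lt_trans e0).
have W0 : 0 < 1 + (c + (c - e)) by rewrite addr_gt0 // addr_gt0.
have A0 : 0 < A by rewrite /A !mulr_gt0 // exprn_gt0.
have N0 := sN_gt0.
exists (t ^+ 4 * sN l c / A); first by rewrite divr_gt0 ?mulr_gt0 ?exprn_gt0.
move=> x x1 xd; rewrite ltNge; apply/negP => tw.
have H := onG_ineq (wG x1) (wG x01).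
have r0 := path_radius x01; have r1 := path_radius x1.
have ub y : 0 <= y <= B -> 1 + cabs (w y) <= 1 + (c + (c - e)).
 move=> y1; rewrite lerD2l; have -> : w y = c%:C + (w y - c%:C) by ring.
 by apply: cabsD_le; rewrite lerD ?path_radius // cabsR gtr0_norm.
have : t ^+ 4 * sN l c <= `|x - x0| * A.
 apply: le_trans (_ : cabs (w x - w x0) ^+ 4 * sN l c <= _).
  by rewrite ler_wpM2r ?(ltW N0) // lerXn2r // nnegrE ?cabs_ge0 // ltW.
 apply: le_trans H _; apply: le_trans (ler_norm _) _.
 rewrite normrM normrM distrC -mulrA ler_wpM2l // /A.
 have sq (y : C) : 0 <= cabs y ^+ 2 by rewrite exprn_ge0 ?cabs_ge0.
 have q0 : 0 <= (1 + cabs (w x)) ^+ 2 * (1 + cabs (w x0)) ^+ 2.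
  by rewrite mulr_ge0 // exprn_ge0 // addr_ge0 ?cabs_ge0.
 rewrite (ger0_norm q0); apply: ler_pM => //.
  have a1 : cabs (w x - c%:C) ^+ 2 <= (c - e) ^+ 2 by rewrite lerXn2r // nnegrE ?cabs_ge0 // ltW.
  have a2 : cabs (w x0 - c%:C) ^+ 2 <= (c - e) ^+ 2 by rewrite lerXn2r // nnegrE ?cabs_ge0 // ltW.
  by rewrite ler_norml; have := sq (w x - c%:C); have := sq (w x0 - c%:C); lra.
 apply: ler_pM; rewrite ?exprn_ge0 ?addr_ge0 ?cabs_ge0 //;
  by rewrite lerXn2r ?ub // nnegrE ?(ltW W0) // addr_ge0 ?cabs_ge0.
by rewrite leNgt -ltr_pdivlMr // xd.
Qed.

Lemma path_gap x0 : 0 <= x0 <= B -> exists2 d : R, 0 < d & forall z a, a \in Pl ->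
 cabs (z - w x0) < d -> d <= cabs (z - a%:C).
Proof.
move=> x01; have [|d d0 H] := @seq_pos_lb _ (fun a => cabs (w x0 - a%:C)) Pl.
 by move=> a aP; rewrite cabs_gt0 subr_eq0 path_neq.
exists (d / 2); first by rewrite divr_gt0.
move=> z a aP zd; have := H a aP; have := cabsD (w x0 - z) (z - a%:C).
rewrite (_ : w x0 - z + _ = w x0 - a%:C); last by ring.
by rewrite (cabsBC (w x0) z); move: zd; lra.
Qed.

(** [m] is the multiplicity of w(x0) as a root of [lev]. It may exceed 1 where the path meets the
    real axis, and there the path need not be differentiable. *)
Lemma local_order x0 : 0 < x0 < B -> exists (m : nat) (k1 k2 d : R), [/\ 0 < k1, 0 < k2, 0 < d &
 forall z, cabs (z - w x0) < d -> k1 * cabs (z - w x0) ^+ m <= cabs (sS l c z - x0%:C) <=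
  k2 * cabs (z - w x0) ^+ m].
Proof.
move=> /andP[x00 x0B]; have x01 : 0 <= x0 <= B by rewrite !ltW.
pose p := lev l c x0; have [m [q qw pE]] := multiplicity_XsubC p (w x0).
have pn : p != 0.
 have [] := @lev_size l c x0 (lt_le_trans x0B B_le_sum).
 by rewrite -/p -size_poly_eq0 => ->.
move: qw; rewrite pn /= rootE => qw.
pose D : {poly C} := \prod_(p <- l) ('X - p.2%:C%:P).
have Dn z : offp l z -> D.[z] != 0.
 move=> oz; rewrite horner_prod prodf_seq_neq0; apply/allP => r rl /=.
 by rewrite hornerXsubC subr_eq0 oz.
have [_ o0 _ _] := wG x01.
pose h z := q.[z] * (D.[z])^-1.
have hc : {for w x0, continuous h}.
 exact: cder_cont (cderM (cder_horner q _) (cderV (Dn _ o0) (cder_horner D _))).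
have hn : 0 < cabs (h (w x0)) by rewrite cabs_gt0 mulf_neq0 // invr_neq0 // Dn.
have /cont_cabsP /(_ _ (divr_gt0 hn (ltr0n _ 2))) [d1 d10 H1] := hc.
have [d2 d20 H2] := path_gap x01.
exists m, (cabs (h (w x0)) / 2), (cabs (h (w x0)) * 2), (Num.min d1 d2).
split; [by rewrite divr_gt0|by rewrite mulr_gt0|by rewrite lt_min d10|].
move=> z; rewrite lt_min => /andP[/H1 zh zd].
have oz : offp l z.
 move=> r rl; have := H2 z r.2 _ zd; rewrite /Pl inE map_f // orbT => /(_ isT).
 by move=> /(lt_le_trans d20); rewrite cabs_gt0 subr_eq0.
have E : sS l c z - x0%:C = h z * (z - w x0) ^+ m.
 have := levE c x0 oz; rewrite -/p -/D pE hornerM horner_exp hornerXsubC => E.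
 by rewrite /h mulrAC E mulfK // Dn.
have t1 := cabsD (h (w x0) - h z) (h z); have t2 := cabsD (h z - h (w x0)) (h (w x0)).
rewrite subrK (cabsBC (h (w x0))) in t1; rewrite subrK in t2.
rewrite {}E; clearbody h; rewrite cabsM cabsX !ler_wpM2r ?exprn_ge0 ?cabs_ge0 //; move: zh t1 t2; move: (cabs (h z - _)) => a; lra.
Qed.

Section Primitive.
Variables (k : nat) (P f : C -> C).
Hypotheses (fE : forall z, (forall a, a \in Pl -> z != a%:C) -> f z = sS l c z ^+ k / z) (fP : primU Pl P f).

(** Imaginary part of x^k lg(w) - P(w), whose formal derivative is k x^(k-1) lg(w) + (x^k - S(w)^k)
    w'/w. The second term vanishes on the path. *)
Definition pathF (x : R) : R := x ^+ k * ang (w x) - Im (P (w x)).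

Lemma seg_diff x0 z (y : R) (m : R) : 0 <= x0 <= B -> 0 <= Im z ->
 (forall s, 0 <= s <= 1 -> forall a, a \in Pl -> seg (w x0) z s != a%:C) ->
 (forall s, 0 <= s <= 1 -> cabs ((y%:C ^+ k - sS l c (seg (w x0) z s) ^+ k) / seg (w x0) z s) <= m) ->
 `|(y ^+ k * ang z - Im (P z)) - (y ^+ k * ang (w x0) - Im (P (w x0)))| <= m * cabs (z - w x0).
Proof.
move=> x01 iz ha hm; have [i0 _ _ _] := wG x01.
have := @seg_MVT (fun z => (y ^+ k)%:C * lg z + (- 1)%:C * P z) _ (w x0) z m _ hm.
rewrite !cImD !cImZ /= !mulN1r; apply.
move=> s s01; have [is_ _] := segE s01 i0 iz.
have hz : seg (w x0) z s != 0 by apply: (ha s s01 0); rewrite mem_head.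
have rl := rder_line (w x0) (z - w x0) s.
have r1 := rder_scale (y ^+ k)%:C (rder_lg is_ hz rl).
have r2 := rder_scale (- 1)%:C (fP is_ (ha s s01) rl).
have := rderD r1 r2; rewrite fE; last exact: ha.
rewrite rmorphXn rmorphN /=; congr (rder _ _ _); move: hz; rewrite -/(seg (w x0) z s).
move: (seg _ _ _) => u u0; by field.
Qed.

(** The derivative of w is avoided, as w may fail to be differentiable. On the segment from w(x0) to
    w(x0 + h), [local_order] gives |S - x0| <= (k2/k1) |h|, so the integrand ((x0 + h)^k - S^k)/w is
    O(h), while the length of the segment tends to 0 by [path_cont]. *)
Lemma pathF_deriv x0 : 0 < x0 < B -> is_derive x0 1 pathF (k%:R * x0 ^+ k.-1 * ang (w x0)).
Proof.
move=> xI; have /andP[x00 x0B] := xI; have x01 : 0 <= x0 <= B by rewrite !ltW.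
have [m [k1 [k2 [d1 [k10 k20 d10 H1]]]]] := local_order xI.
have [d2 d20 H2] := path_gap x01.
(* Bounds both the levels and |S| near w(x0), for the Lipschitz constant of the k-th power. *)
pose M : R := 1 + B + k2 * (1 + d1) ^+ m.
have M1 : 1 <= M.
 by rewrite /M -addrA lerDl addr_ge0 ?(ltW B0) // mulr_ge0 ?exprn_ge0 ?addr_ge0 // ltW.
pose A : R := k%:R * M ^+ k * (1 + k2 / k1) / d2.
have M0 : 0 <= M by apply: le_trans M1.
have A0 : 0 <= A.
 rewrite /A divr_ge0 ?(ltW d20) // mulr_ge0 ?addr_ge0 ?divr_ge0 ?(ltW k20) ?(ltW k10) //.
 by rewrite mulr_ge0 // exprn_ge0.
apply/is_derive_epsP => t t0.
have ang0 : 0 < `|ang (w x0)| + 1 by rewrite ltr_wpDl.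
have dX : is_derive x0 1 (fun x : R => x ^+ k) (k%:R * x0 ^+ k.-1).
 exact: rd_exp.
have /is_derive_epsP /(_ (t / 2 / (`|ang (w x0)| + 1))) [|r1 r10 HX] := dX.
 by rewrite !divr_gt0.
have tA : 0 < t / 2 / (A + 1) by rewrite !divr_gt0 // ltr_wpDl.
have [|r2 r20 Hc] := @path_cont x0 x01 (Num.min (t / 2 / (A + 1)) (Num.min d1 d2)).
 by rewrite !lt_min tA d10.
exists (Num.min (Num.min r1 r2) (Num.min 1 (Num.min x0 (B - x0)))).
 by rewrite !lt_min r10 r20 ltr01 x00 subr_gt0.
move=> h; rewrite !lt_min => /andP[/andP[/HX hX h2]] /and3P[hh1 hx0 hB].
have x1 : 0 <= x0 + h <= B by move: hx0 hB; rewrite !ltr_norml => /andP[? ?] /andP[? ?]; apply/andP; split; lra.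
have [i1 _ S1 _] := wG x1; have [i0 _ _ _] := wG x01.
have := Hc (x0 + h) x1; rewrite addrAC subrr add0r => /(_ h2); rewrite !lt_min => /and3P[wt wd1 wd2].
have sg s : 0 <= s <= 1 -> cabs (seg (w x0) (w (x0 + h)) s - w x0) <= cabs (w (x0 + h) - w x0).
 by move=> s01; have [_] := segE s01 i0 i1.
have key : `|((x0 + h) ^+ k * ang (w (x0 + h)) - Im (P (w (x0 + h)))) -
  ((x0 + h) ^+ k * ang (w x0) - Im (P (w x0)))| <= A * `|h| * cabs (w (x0 + h) - w x0).
 apply: seg_diff => //.
  move=> s s01 a aP; have := H2 (seg (w x0) (w (x0 + h)) s) a aP (le_lt_trans (sg s s01) wd2).
  by move=> /(lt_le_trans d20); rewrite cabs_gt0 subr_eq0.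
 move=> s s01; set z := seg _ _ s; have zd := sg s s01; rewrite -/z in zd.
 have zd1 := le_lt_trans zd wd1; have /andP[_ up] := H1 z zd1.
 have /andP[lo _] := H1 _ wd1; rewrite S1 -rmorphB cabsR addrAC subrr add0r in lo.
 have pw : cabs (z - w x0) ^+ m <= cabs (w (x0 + h) - w x0) ^+ m.
  by rewrite lerXn2r // nnegrE ?cabs_ge0 // (le_trans _ zd) ?cabs_ge0.
 have pw1 : cabs (z - w x0) ^+ m <= (1 + d1) ^+ m.
  by rewrite lerXn2r ?nnegrE ?cabs_ge0 ?addr_ge0 ?(ltW d10) // ltW // (lt_trans zd1) // ltrDr.
 have zz : d2 <= cabs z.
  have := H2 z 0 (mem_head _ _) (le_lt_trans zd wd2); by rewrite subr0.
 have diff : cabs ((x0 + h)%:C - sS l c z) <= (1 + k2 / k1) * `|h|.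
  have -> : (x0 + h)%:C - sS l c z = h%:C - (sS l c z - x0%:C) by rewrite rmorphD /=; ring.
  apply: cabsD_le; rewrite cabsN cabsR mulrDl mul1r lerD2l.
  apply: le_trans up _; apply: le_trans (_ : k2 * (k1^-1 * `|h|) <= _); last by rewrite mulrA.
  rewrite ler_wpM2l ?(ltW k20) // ler_pdivlMl //; apply: le_trans lo; by rewrite ler_wpM2l // ltW.
 have sM1 : cabs (sS l c z) <= M.
  have -> : sS l c z = x0%:C + (sS l c z - x0%:C) by ring.
  apply: cabsD_le; rewrite /M cabsR (gtr0_norm x00) lerD //; first by lra.
  by apply: le_trans up _; rewrite ler_wpM2l // ltW.
 have xM1 : cabs (x0 + h)%:C <= M.
  rewrite cabsR (ger0_norm _); last by case/andP: x1.
  apply: (@le_trans _ _ (1 + B)); first by case/andP: x1; lra.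
  by rewrite /M lerDl mulr_ge0 ?exprn_ge0 ?addr_ge0 // ltW.
 rewrite cabsM cabsV; apply: le_trans (_ : (k%:R * M ^+ k * ((1 + k2 / k1) * `|h|)) * d2^-1 <= _).
  apply: ler_pM; rewrite ?cabs_ge0 ?invr_ge0 ?cabs_ge0 //.
   apply: le_trans (cabs_expB k M1 xM1 sM1) _.
   by rewrite ler_wpM2l // mulr_ge0 // exprn_ge0.
  by rewrite lef_pV2 // posrE // (lt_le_trans d20).
 rewrite /A le_eqVlt; apply/orP; left; apply/eqP; ring.
have -> : pathF (x0 + h) - pathF x0 - k%:R * x0 ^+ k.-1 * ang (w x0) * h =
 (((x0 + h) ^+ k * ang (w (x0 + h)) - Im (P (w (x0 + h)))) -
  ((x0 + h) ^+ k * ang (w x0) - Im (P (w x0)))) +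
  ((x0 + h) ^+ k - x0 ^+ k - k%:R * x0 ^+ k.-1 * h) * ang (w x0) by rewrite /pathF; ring.
apply: le_trans (ler_normD _ _) _; rewrite [t in leRHS]splitr [leRHS]mulrDl lerD //.
 apply: le_trans key _; rewrite mulrAC ler_wpM2r //.
 have := ltW wt; rewrite ler_pdivlMr; last by rewrite ltr_wpDl.
 by apply: le_trans; rewrite mulrC ler_wpM2l ?cabs_ge0 // lerDl.
rewrite normrM; apply: le_trans (_ : t / 2 / (`|ang (w x0)| + 1) * `|h| * `|ang (w x0)| <= _).
 by rewrite ler_wpM2r.
have q : t / 2 / (`|ang (w x0)| + 1) * `|ang (w x0)| <= t / 2.
 by rewrite mulrAC ler_pdivrMr // ler_pM2l ?divr_gt0 // lerDl.
by rewrite mulrAC ler_wpM2r.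
Qed.

Lemma seg_near x0 z d : 0 <= x0 <= B -> 0 <= Im z -> cabs (z - w x0) < d ->
 (forall y a, a \in Pl -> cabs (y - w x0) < d -> d <= cabs (y - a%:C)) ->
 forall s, 0 <= s <= 1 -> (forall a, a \in Pl -> seg (w x0) z s != a%:C) /\
  d <= cabs (seg (w x0) z s) /\ kfar l (d / (1 + \sum_(p <- l) p.2)) (seg (w x0) z s).
Proof.
move=> x01 iz zd H s s01; have [i0 _ _ _] := wG x01; have [_ sz] := segE s01 i0 iz.
have d0 : 0 < d by apply: le_lt_trans zd; exact: cabs_ge0.
have Ha a : a \in Pl -> d <= cabs (seg (w x0) z s - a%:C).
 by move=> aP; apply: H => //; exact: le_lt_trans sz zd.
split; first by move=> a /Ha; move=> /(lt_le_trans d0); rewrite cabs_gt0 subr_eq0.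
split; first by have := Ha 0 (mem_head _ _); rewrite subr0.
move=> p pl; have := Ha p.2; rewrite inE map_f // orbT => /(_ isT); apply: le_trans.
have pS : p.2 <= \sum_(p <- l) p.2.
 rewrite (big_rem p pl) /= lerDl big_seq sumr_ge0 // => q /mem_rem /lpos[_ q2]; exact: ltW.
have [_ p2] := lpos pl.
by rewrite mulrAC ler_pdivrMr ?ler_pM2l ?lerD2l // ltr_pwDl // (le_trans _ pS) // ltW.
Qed.

Lemma cont_helper (Q q : C -> C) x0 m d : 0 <= x0 <= B -> 0 < d ->
 (forall z, 0 <= Im z -> cabs (z - w x0) < d -> forall s, 0 <= s <= 1 ->
   rder (Q \o seg (w x0) z) s (q (seg (w x0) z s) * (z - w x0)) /\ cabs (q (seg (w x0) z s)) <= m) ->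
 forall t, 0 < t -> exists2 d : R, 0 < d &
  forall x, 0 <= x <= B -> `|x - x0| < d -> `|Im (Q (w x)) - Im (Q (w x0))| <= t.
Proof.
move=> x01 d0 H t t0; have m1 : 0 < `|m| + 1 by rewrite ltr_wpDl.
have [|r r0 Hr] := @path_cont x0 x01 (Num.min d (t / (`|m| + 1))).
 by rewrite lt_min d0 divr_gt0.
exists r => // x x1 /(Hr x x1); rewrite lt_min => /andP[xd xt]; have [ix _ _ _] := wG x1.
apply: le_trans (_ : m * cabs (w x - w x0) <= _).
 apply: (@seg_MVT Q (fun s => q (seg (w x0) (w x) s))) => s s01; by have [] := H _ ix xd s s01.
apply: le_trans (_ : (`|m| + 1) * cabs (w x - w x0) <= _).
 by rewrite ler_wpM2r ?cabs_ge0 // (le_trans (ler_norm _)) // lerDl.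
by move: xt; rewrite ltr_pdivlMr // mulrC => /ltW.
Qed.

Lemma ang_cont x0 : 0 <= x0 <= B -> forall t, 0 < t -> exists2 d : R, 0 < d &
 forall x, 0 <= x <= B -> `|x - x0| < d -> `|ang (w x) - ang (w x0)| <= t.
Proof.
move=> x01; have [d d0 H] := path_gap x01; have [i0 _ _ _] := wG x01.
apply: (@cont_helper (@lg) (fun z => z^-1) x0 d^-1 d x01 d0) => z iz zd s s01.
have [h1 [h2 _]] := seg_near x01 iz zd H s01; have [is_ _] := segE s01 i0 iz.
split; last by rewrite cabsV lef_pV2 ?posrE // (lt_le_trans d0).
rewrite mulrC; apply: rder_lg => //; last exact: rder_line.
exact: (h1 0 (mem_head _ _)).
Qed.

Lemma P_cont x0 : 0 <= x0 <= B -> forall t, 0 < t -> exists2 d : R, 0 < d &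
 forall x, 0 <= x <= B -> `|x - x0| < d -> `|Im (P (w x)) - Im (P (w x0))| <= t.
Proof.
move=> x01; have [d d0 H] := path_gap x01; have [i0 _ _ _] := wG x01.
pose r := d / (1 + \sum_(p <- l) p.2).
have r0 : 0 < r.
 by rewrite divr_gt0 // ltr_pwDl // big_seq sumr_ge0 // => q /lpos[_ q2]; exact: ltW.
pose m := ((cabs (w x0) + d + `|c|) / r * sB l) ^+ k / d.
apply: (@cont_helper P f x0 m d x01 d0) => z iz zd s s01.
have [h1 [h2 h3]] := seg_near x01 iz zd H s01; have [is_ sz] := segE s01 i0 iz.
split; first by apply: fP => //; exact: rder_line.
rewrite fE // cabsM cabsV cabsX /m; apply: ler_pM; rewrite ?exprn_ge0 ?invr_ge0 ?cabs_ge0 //; last first.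
 by rewrite lef_pV2 ?posrE // (lt_le_trans d0).
have ub : cabs (seg (w x0) z s) <= cabs (w x0) + d.
 have -> : seg (w x0) z s = w x0 + (seg (w x0) z s - w x0) by ring.
 by apply: cabsD_le; rewrite lerD2l (le_trans sz) // ltW.
have bnd := sS_bound c lpos r0 h3.
have le2 : (cabs (seg (w x0) z s) + `|c|) / r * sB l <= (cabs (w x0) + d + `|c|) / r * sB l.
 by rewrite ler_wpM2r ?sB_ge0 // ler_wpM2r ?invr_ge0 ?(ltW r0) // lerD2r.
by rewrite lerXn2r ?nnegrE ?cabs_ge0 // ?(le_trans bnd) // (le_trans (cabs_ge0 _) (le_trans bnd le2)).
Qed.

(** The argument is 0 at c and pi at e, so the difference of P is pi B^k - (pathF B - pathF 0), and
    both terms are integrals over [0, B]. *)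
Lemma moment_ang : (0 < k)%N -> Im (P e%:C) - Im (P c%:C) =
 k%:R * \int[mu]_(x in `[0, B]) (x ^+ k.-1 * (pi - ang (w x))).
Proof.
move=> k0.
have cang : {within `[0, B], continuous (fun x => ang (w x))}.
 by apply: within_epsP => x x01 t t0; exact: ang_cont.
have rdc (g : R -> R) (x a : R) : is_derive x 1 g a -> {for x, continuous g}.
 by move=> [/derivable1_diffP/differentiable_continuous].
have cX (j : nat) : {within `[0, B], continuous (fun x : R => x ^+ j)}.
 by apply: continuous_subspaceT => x; exact: rdc (rd_exp j x).
have cKX : {within `[0, B], continuous (fun x : R => k%:R * x ^+ k.-1)}.
 by apply: continuous_subspaceT => x; exact: rdc (rdM (rdC k%:R x) (rd_exp k.-1 x)).
have cP : {within `[0, B], continuous (fun x => Im (P (w x)))}.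
 by apply: within_epsP => x x01 t t0; exact: P_cont.
have cF : {within `[0, B], continuous pathF}.
 exact: wcontB (wcontM (cX k) cang) cP.
have E1 : \int[mu]_(x in `[0, B]) (k%:R * x ^+ k.-1 * ang (w x)) = pathF B - pathF 0.
 rewrite /Rintegral (@continuous_FTC2 _ _ pathF) //.
 - exact: wcontM cKX cang.
 - move/(continuous_within_itvP _ B0): cF => [_ c1 c2]; split=> // x.
  by rewrite in_itv /= => /pathF_deriv[].
 - by move=> x; rewrite in_itv /= => /pathF_deriv[]; rewrite derive1E.
have E2 : \int[mu]_(x in `[0, B]) (k%:R * x ^+ k.-1) = B ^+ k.
 rewrite /Rintegral (@continuous_FTC2 _ _ (fun x : R => x ^+ k)) //.
 - by rewrite /= expr0n (gtn_eqF k0) subr0.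
 - move/(continuous_within_itvP _ B0): (cX k) => [_ c1 c2]; split=> // x _.
  by have [] := rd_exp k x.
 - by move=> x _; rewrite derive1E; have [] := rd_exp k x.
have bang := mbd_cont cang; have bX := mbd_cont cKX.
have bg : mbd (fun x => x ^+ k.-1 * (pi - ang (w x))) 0 B.
 apply: mbdM; first exact: mbd_cont (cX _).
 apply: mbd_cont; apply: wcontB cang; apply: continuous_subspaceT => x; exact: cst_continuous.
have -> : k%:R * \int[mu]_(x in `[0, B]) (x ^+ k.-1 * (pi - ang (w x))) =
  \int[mu]_(x in `[0, B]) (k%:R * (x ^+ k.-1 * (pi - ang (w x))) + 0 * (x ^+ k.-1 * (pi - ang (w x)))).
 by rewrite Rint_lin // mul0r addr0.
have -> : \int[mu]_(x in `[0, B]) (k%:R * (x ^+ k.-1 * (pi - ang (w x))) + 0 * (x ^+ k.-1 * (pi - ang (w x)))) =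
  \int[mu]_(x in `[0, B]) (pi * (k%:R * x ^+ k.-1) + (-1) * (k%:R * x ^+ k.-1 * ang (w x))).
 by apply: eq_Rintegral => x _; ring.
rewrite Rint_lin //; last exact: mbdM.
rewrite E1 E2 /pathF wBe w0c ang_neg // ang_pos // expr0n (gtn_eqF k0) mul0r.
by ring.
Qed.

End Primitive.

Variable g : R -> C.
Hypotheses (gC1 : piecewise_C1 g) (gcl : g 0 = g 1) (gpos : positively_oriented g) (g0 : Int g 0).
Hypothesis lg_ : forall p, p \in l ->
 (p.2 < c /\ Int g p.2%:C) \/ (c < p.2 /\ ~ curve g p.2%:C /\ ~ Int g p.2%:C).
Let Plgood a : a \in Pl -> e < a /\
 ((a < c /\ Int g a%:C) \/ (c < a /\ ~ curve g a%:C /\ ~ Int g a%:C)).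
Proof.
rewrite inE => /orP[/eqP ->|/mapP[p pl ->]]; first by split=> //; left.
by split; [have [_ p2] := lpos pl; exact: lt_trans p2|exact: lg_].
Qed.

(** S^k/w written inside [pfrac], with (w - c)/(w - p) = 1 + (p - c)/(w - p). The test on membership
    makes the summand a [pfrac] for every index, as [pfrac_sum] requires. *)
Fixpoint powdiv (k : nat) : C -> C :=
 if k is j.+1 then fun z => \sum_(p <- l) p.1%:C *
   (if p \in l then 1%:C * powdiv j z + (p.2 - c)%:C * (powdiv j z * (z - p.2%:C)^-1) else powdiv j z)
 else inv_prod [:: 0].

Lemma powdiv_pfrac k : pfrac Pl (powdiv k).
Proof.
elim: k => [|k ih] /=.
 by apply: Pfrac0 => a; rewrite inE => /eqP ->; rewrite mem_head.
apply: (@pfrac_sum Pl _ l (fun p => p.1)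
 (fun p z => if p \in l then 1%:C * powdiv k z + (p.2 - c)%:C * (powdiv k z * (z - p.2%:C)^-1)
       else powdiv k z)).
move=> p; case pl: (p \in l); last exact: ih.
by apply: PfracL => //; apply: pfrac_inv => //; rewrite inE map_f ?orbT.
Qed.

Lemma powdivE k z : (forall a, a \in Pl -> z != a%:C) -> powdiv k z = sS l c z ^+ k / z.
Proof.
move=> hz; elim: k => [|k ih] /=.
 by rewrite /inv_prod big_seq1 subr0 expr0 mul1r.
rewrite ih exprS -mulrA /sS mulr_suml; apply: eq_big_seq => p pl; rewrite pl.
have d0 : z - p.2%:C != 0 by rewrite subr_eq0 hz // inE map_f ?orbT.
rewrite -[RHS]mulrA; congr (_ * _); rewrite rmorphB rmorph1; move: (_ ^+ k / z) => X.
by field.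
Qed.

(** Both sides are 2i (Im P(e) - Im P(c)): the left one by [has_prim], the right one along the
    path. *)
Lemma contour_moment k : (0 < k)%N ->
 cint g (fun z => sS l c z ^+ k / z) =
 2 * 'i * (k%:R * \int[mu]_(x in `[0, B]) (x ^+ k.-1 * (pi - ang (w x))))%:C.
Proof.
move=> k0.
have [_ [P [PU PI]]] := pfrac_has_prim gC1 gcl gpos Plgood (powdiv_pfrac k).
rewrite -(moment_ang (powdivE k) PU k0) -PI.
apply: eq_cint => s s01; rewrite powdivE // => a aP.
exact: (Pl_neq Plgood aP s01 erefl).
Qed.

End Path.

(** * Products attached to separated intervals *)

Section Configuration.
Implicit Types (i j : R * R) (zs : seq (R * R)) (w : C).

(* A pair (z, p) of a zero and a pole spans an interval, which is of sign - when p < z. *)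
Definition isM i := i.2 < i.1.

Definition fac i w : C :=
 if isM i then (w - i.1%:C) / (w - i.2%:C) else (1 - w / i.1%:C) / (1 - w / i.2%:C).

Definition rawp zs w : C := \prod_(i <- zs) fac i w.

(** Intervals of the same sign may share an endpoint, where a zero of one cancels the pole of the
    other; hence the weak inequalities. [cfg_MP] places all intervals of sign - to the left of those
    of sign +. *)
Record cfg zs : Prop := Cfg {
 cfg_uniq : uniq zs;
 cfg_pos : forall i, i \in zs -> [/\ 0 < i.1, 0 < i.2 & i.1 != i.2];
 cfg_MM : forall i j, i \in zs -> j \in zs -> isM i -> isM j -> i != j -> i.1 <= j.2 \/ j.1 <= i.2;
 cfg_PP : forall i j, i \in zs -> j \in zs -> ~~ isM i -> ~~ isM j -> i != j -> i.2 <= j.1 \/ j.2 <= i.1;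
 cfg_MP : forall i j, i \in zs -> j \in zs -> isM i -> ~~ isM j -> i.1 < j.1 }.

Variable zs : seq (R * R).
Hypothesis zsC : cfg zs.

Lemma isMN i : i \in zs -> ~~ isM i -> i.1 < i.2.
Proof. by move=> iz; have [_ _ n] := cfg_pos zsC iz; rewrite /isM -leNgt le_eqVlt (negPf n). Qed.

(** The pole of i never lies strictly inside the interval of j, and this determines the sign of the
    quotient. *)
Lemma pole_ratio i j : i \in zs -> j \in zs -> i != j ->
 i.2 != j.2 /\ 0 <= (i.2 - j.1) / (i.2 - j.2).
Proof.
move=> iz jz ij.
have P a b : a <= 0 -> b < 0 -> b != 0 /\ 0 <= a / b.
 by move=> a0 b0; split; [rewrite lt_eqF|rewrite -mulrNN -invrN divr_ge0 // oppr_ge0 // ltW].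
have Q a b : 0 <= a -> 0 < b -> b != 0 /\ 0 <= a / b.
 by move=> a0 b0; split; [rewrite gt_eqF|rewrite divr_ge0 // ltW].
suff H : i.2 - j.2 != 0 /\ 0 <= (i.2 - j.1) / (i.2 - j.2) by rewrite -subr_eq0.
have [mi|pi] := boolP (isM i); have [mj|pj] := boolP (isM j).
- move: (mi) (mj); rewrite /isM => a b; have [h|h] := cfg_MM zsC iz jz mi mj ij.
  by apply: P; lra.
 by apply: Q; lra.
- have h := cfg_MP zsC iz jz mi pj; have k := isMN jz pj; move: mi; rewrite /isM => a.
 by apply: P; lra.
- have h := cfg_MP zsC jz iz mj pi; have k := isMN iz pi; move: mj; rewrite /isM => a.
 by apply: Q; lra.
- have a := isMN iz pi; have b := isMN jz pj; have [h|h] := cfg_PP zsC iz jz pi pj ij.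
  by apply: P; lra.
 by apply: Q; lra.
Qed.

Lemma uniq_poles : uniq (map snd zs).
Proof.
rewrite map_inj_in_uniq ?(cfg_uniq zsC) // => i j iz jz E.
by apply/eqP/negPn/negP => ij; have [] := pole_ratio iz jz ij; rewrite E eqxx.
Qed.

(** The value of the product at infinity. *)
Definition kap : R := \prod_(i <- zs) (if isM i then 1 else i.2 / i.1).

Lemma kap_gt0 : 0 < kap.
Proof.
rewrite /kap big_seq prodr_gt0 // => i iz; have [h1 h2 _] := cfg_pos zsC iz.
by case: ifP => // _; rewrite divr_gt0.
Qed.

Definition offr w := forall i, i \in zs -> w != i.2%:C.

Lemma facE i w : i \in zs -> w != i.2%:C ->
 fac i w = (if isM i then 1 else i.2 / i.1)%:C * ((w - i.1%:C) / (w - i.2%:C)).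
Proof.
move=> iz wi; rewrite /fac; case: ifP => _; first by rewrite rmorph1 mul1r.
have [h1 h2 _] := cfg_pos zsC iz.
have a : i.1%:C != 0 :> C by rewrite fmorph_eq0 gt_eqF.
have b : i.2%:C != 0 :> C by rewrite fmorph_eq0 gt_eqF.
have d : w - i.2%:C != 0 by rewrite subr_eq0.
rewrite fmorph_div /=; move: a b d; move: (i.1%:C) (i.2%:C) => x y x0 y0 d.
have d' : y - w != 0 by rewrite -opprB oppr_eq0.
by field; rewrite ?x0 ?y0 ?d ?d'.
Qed.

(** The residue at the pole of i divided by [kap]. It is 0 exactly when the pole is cancelled by the
    zero of another interval ([rsd_neq0]); otherwise its sign is that of i.2 - i.1. *)
Definition rsd i : R := (i.2 - i.1) * \prod_(j <- rem i zs) ((i.2 - j.1) / (i.2 - j.2)).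

Lemma rsd_sign i : i \in zs -> if isM i then rsd i <= 0 else 0 <= rsd i.
Proof.
move=> iz; have P : 0 <= \prod_(j <- rem i zs) ((i.2 - j.1) / (i.2 - j.2)).
 rewrite big_seq prodr_ge0 // => j; rewrite mem_rem_uniq ?(cfg_uniq zsC) // inE => /andP[ji jz].
 by have [] := pole_ratio iz jz; rewrite // eq_sym.
rewrite /rsd; case: ifPn => [|/(isMN iz)]; rewrite ?/isM => h.
 by rewrite mulr_le0_ge0 // subr_le0 ltW.
by rewrite mulr_ge0 // subr_ge0 ltW.
Qed.

Lemma rsd_neq0 i : i \in zs -> (rsd i != 0) = all (fun j => i.2 != j.1) zs.
Proof.
move=> iz; have [_ _ n] := cfg_pos zsC iz.
rewrite /rsd mulf_eq0 subr_eq0 eq_sym (negPf n) /= prodf_seq_neq0.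
rewrite (perm_all _ (perm_to_rem iz)) /= eq_sym n /=.
apply: eq_in_all => j; rewrite mem_rem_uniq ?(cfg_uniq zsC) // inE => /andP[ji jz] /=.
have ij : i != j by rewrite eq_sym.
have [n' _] := pole_ratio iz jz ij.
by rewrite mulf_eq0 invr_eq0 negb_or !subr_eq0 n' andbT.
Qed.

Lemma rawp_gform w : offr w ->
 rawp zs w = kap%:C * (1 + \sum_(i <- zs) (rsd i)%:C / (w - i.2%:C)).
Proof.
move=> ow.
have -> : rawp zs w = kap%:C * (\prod_(i <- zs) (w - i.1%:C) / \prod_(i <- zs) (w - i.2%:C)).
 rewrite /rawp /kap rmorph_prod -prodf_div -big_split /=; apply: eq_big_seq => i iz.
 by rewrite facE // ow.
congr (_ * _).
have wx : w \notin [seq i.2%:C | i <- zs].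
 by apply/mapP => -[i iz E]; have := ow i iz; rewrite E eqxx.
have ux : uniq [seq i.2%:C | i <- zs].
 have -> : [seq i.2%:C | i <- zs] = map (fun x : R => x%:C : C) (map snd zs) by rewrite -map_comp.
 by rewrite map_inj_uniq ?uniq_poles //; exact: complexI.
pose Z : {poly C} := \prod_(i <- zs) ('X - i.1%:C%:P).
pose D : {poly C} := \prod_(i <- zs) ('X - i.2%:C%:P).
have sZ : size Z = (size zs).+1 by rewrite size_prod_XsubC.
have sD : size D = (size zs).+1 by rewrite size_prod_XsubC.
have sN : (size (Z - D)%R <= size [seq i.2%:C | i <- zs])%N.
 rewrite size_map; apply/leq_sizeP => n; rewrite leq_eqVlt => /orP[/eqP <-|nz]; rewrite coefB.
  have := monic_prod_XsubC zs predT (fun p => p.1%:C : C).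
  have := monic_prod_XsubC zs predT (fun p => p.2%:C : C).
  by rewrite -/Z -/D !monicE !lead_coefE sZ sD => /eqP -> /eqP ->; rewrite subrr.
 by rewrite !nth_default ?sZ ?sD // subrr.
have ZE v : Z.[v] = \prod_(i <- zs) (v - i.1%:C).
 by rewrite horner_prod; apply: eq_bigr => i _; rewrite hornerXsubC.
have DE v : D.[v] = \prod_(i <- zs) (v - i.2%:C).
 by rewrite horner_prod; apply: eq_bigr => i _; rewrite hornerXsubC.
have := lagrange_pfrac ux wx sN; rewrite big_map hornerD hornerN ZE DE mulrBl divff; last first.
 by rewrite prodf_seq_neq0; apply/allP => i iz /=; rewrite subr_eq0 ow.
move/eqP; rewrite subr_eq => /eqP ->; rewrite addrC big_map; congr (_ + _).
apply: eq_big_seq => i iz; rewrite hornerD hornerN ZE DE.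
rewrite [X in _ - X](_ : _ = 0); last first.
 by apply/eqP; rewrite prodf_seq_eq0; apply/hasP; exists i => //=; rewrite subrr.
rewrite subr0 big_map (big_rem i iz) /=.
have -> : \prod_(j <- zs | j.2%:C != i.2%:C :> C) (i.2%:C - j.2%:C) =
  \prod_(j <- rem i zs) (i.2%:C - j.2%:C) :> C.
 rewrite rem_filter ?(cfg_uniq zsC) // big_filter [LHS]big_seq_cond [RHS]big_seq_cond.
 apply: eq_bigl => j; case jz: (j \in zs) => //=; rewrite (inj_eq CI).
 by apply/idP/idP => h; [apply: contraNneq h => ->|have [] := pole_ratio jz iz h].
have rE : (rsd i)%:C = (i.2%:C - i.1%:C) * \prod_(j <- rem i zs) ((i.2%:C - j.1%:C) / (i.2%:C - j.2%:C)) :> C.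
 rewrite /rsd rmorphM rmorphB rmorph_prod /=; congr (_ * _).
 by apply: eq_bigr => x _; rewrite fmorph_div /= !rmorphB.
rewrite rE prodf_div invfM; set A := \prod_(y <- _) _; set B := \prod_(j <- _) _.
by move: A B => A B; ring.
Qed.

(** The intervals whose pole survives cancellation. The set of survivors changes with chi and K,
    which is why poles and genuine poles are kept apart throughout. *)
Definition gen := [seq i <- zs | rsd i != 0].

Definition gS w : C := kap%:C * (1 + \sum_(i <- gen) (rsd i)%:C / (w - i.2%:C)).

Lemma mem_gen i : (i \in gen) = (rsd i != 0) && (i \in zs).
Proof. by rewrite mem_filter. Qed.

Lemma rawp_gS w : offr w -> rawp zs w = gS w.
Proof.
move=> ow; rewrite rawp_gform // /gS; congr (_ * (_ + _)).
rewrite /gen big_filter [RHS]big_mkcond /=; apply: eq_bigr => i _.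
by case: eqP => // ->; rewrite mul0r.
Qed.

Definition offg w := forall i, i \in gen -> w != i.2%:C.

Lemma cder_gS w : offg w ->
 cder gS w (kap%:C * \sum_(i <- gen) (rsd i)%:C * - (w - i.2%:C) ^- 2).
Proof.
move=> ow; rewrite /gS; apply: cder_scale; rewrite -[X in cder _ _ X]add0r.
apply: cderD (cder_cst _ _) _.
suff H s : {subset s <= gen} -> cder (fun w => \sum_(i <- s) (rsd i)%:C / (w - i.2%:C)) w
  (\sum_(i <- s) (rsd i)%:C * - (w - i.2%:C) ^- 2) by exact: H.
elim: s => [_|p s ih sl].
 by rewrite big_nil; under eq_fun do rewrite big_nil; exact: cder_cst.
rewrite big_cons; under eq_fun do rewrite big_cons.
have H2 := ih (fun q qs => sl q (mem_behead (s := p :: s) qs)).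
exact: cderD (cder_scale (rsd p)%:C (cder_inv (ow p (sl p (mem_head _ _))))) H2.
Qed.

Variable i0 : R * R.
Hypotheses (i0z : i0 \in zs) (i0M : isM i0) (i0max : forall i, i \in zs -> isM i -> i.1 <= i0.1).
Let c := i0.1.

Lemma pole_c i : i \in zs -> if isM i then i.2 < c else c < i.2.
Proof.
move=> iz; case: ifPn => [mi|pi]; first by move: (i0max iz mi); apply: lt_le_trans.
exact: lt_trans (cfg_MP zsC i0z iz i0M pi) (isMN iz pi).
Qed.

Lemma pole_neq_c i : i \in zs -> i.2 != c.
Proof. by move=> iz; have := pole_c iz; case: ifP => _ h; [rewrite lt_eqF|rewrite gt_eqF]. Qed.

(** As S(c) = 0, subtracting the expansion at c turns kap (1 + sum r/(w - p)) into the sum of (kap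
    r/(p - c)) (w - c)/(w - p). Genuine poles of sign - have r < 0 and p < c, those of sign + have r
    > 0 and p > c, so every weight is positive. *)
Definition lst : seq (R * R) := [seq (kap * rsd i / (i.2 - c), i.2) | i <- gen].

Lemma lstP (p : R * R) : p \in lst ->
 exists i, [/\ i \in zs, rsd i != 0, i \in gen & p = (kap * rsd i / (i.2 - c), i.2)].
Proof.
rewrite /lst => pl; have [i ig ->] := @mapP (R * R)%type (R * R)%type _ _ _ pl.
have := ig; rewrite mem_gen => /andP[ri iz]; exists i; split.
- exact: iz.
- exact: ri.
- exact: ig.
- by [].
Qed.

Lemma lst_pos p : p \in lst -> 0 < p.1 /\ 0 < p.2.
Proof.
move=> /lstP[i [iz ri _ ->]] /=; have [_ h _] := cfg_pos zsC iz.
split=> //; have := rsd_sign iz; have := pole_c iz; case: ifP => _ h1 h2.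
 rewrite -mulrA mulr_gt0 ?kap_gt0 // -mulrNN -invrN opprB mulr_gt0 ?invr_gt0 ?subr_gt0 //.
 by rewrite oppr_gt0 lt_neqAle ri.
by rewrite -mulrA mulr_gt0 ?kap_gt0 // mulr_gt0 ?invr_gt0 ?subr_gt0 // lt_neqAle eq_sym ri.
Qed.

Lemma lst_neq p : p \in lst -> p.2 != c.
Proof. by move=> /lstP[i [iz ri _ ->]] /=; exact: pole_neq_c. Qed.

Lemma lst_uniq : uniq (map snd lst).
Proof.
rewrite -map_comp; apply: (subseq_uniq _ uniq_poles); rewrite (eq_map (g := snd)) //.
by rewrite map_subseq // filter_subseq.
Qed.

Lemma gS_sS w : offg w -> gS w = sS lst c w.
Proof.
move=> ow.
have g0 : gS c%:C = 0.
 rewrite -rawp_gS => [|i iz]; last by rewrite (inj_eq CI) eq_sym pole_neq_c.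
 rewrite /rawp (big_rem i0 i0z) /= /fac i0M subrr mul0r mul0r //.
have k0 : kap%:C != 0 :> C by rewrite fmorph_eq0 gt_eqF // kap_gt0.
move/eqP: g0; rewrite /gS mulf_eq0 (negPf k0) /= addr_eq0 => /eqP ->.
rewrite -sumrN -big_split /= mulr_sumr /sS /lst big_map; apply: eq_big_seq => i ig /=.
have iz : i \in zs by move: ig; rewrite mem_gen => /andP[].
have d : w - i.2%:C != 0 by rewrite subr_eq0 ow.
have d2 : i.2%:C - c%:C != 0 :> C by rewrite subr_eq0 (inj_eq CI) pole_neq_c.
have -> : (kap * rsd i / (i.2 - c))%:C = kap%:C * (rsd i)%:C / (i.2%:C - c%:C).
 by rewrite -rmorphB -rmorphM -fmorph_div.
move: (kap%:C) ((rsd i)%:C) (i.2%:C) (c%:C) d d2 => K r p e d d2.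
have d3 : e - p != 0 by rewrite -opprB oppr_eq0.
by field; rewrite ?d ?d2 ?d3.
Qed.

End Configuration.

(** * Products close to 1, filled singularities, uniform limits *)

Lemma cabs_near1 (z : C) : cabs z <= 1 + cabs (z - 1).
Proof. by have := cabsD 1 (z - 1); rewrite addrC subrK cabs1. Qed.

Lemma prod_near1 (I : Type) (r : seq I) (f : I -> C) :
 cabs (\prod_(i <- r) f i - 1) <= expR (\sum_(i <- r) cabs (f i - 1)) - 1.
Proof.
elim: r => [|i r ih]; first by rewrite !big_nil subrr cabs0 expR0 subrr.
rewrite !big_cons; set P := \prod_(j <- r) f j in ih *; set S := \sum_(j <- r) _ in ih *.
have -> : f i * P - 1 = f i * (P - 1) + (f i - 1) by ring.
apply: cabsD_le; rewrite cabsM expRD.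
have h1 := cabs_near1 (f i); have h2 := expR_ge1Dx (cabs (f i - 1)); have h3 := cabs_ge0 (P - 1).
have h4 := cabs_ge0 (f i - 1); have h5 : 1 <= expR S by rewrite -expR0 ler_expR sumr_ge0 // => *; exact: cabs_ge0.
move: h1 h2 h3 h4 h5 ih; move: (cabs (f i)) (cabs (f i - 1)) (cabs (P - 1)) (expR _) (expR S).
by move=> a d p x y h1 h2 h3 h4 h5 ih; nra.
Qed.

Lemma geom_sum_le (t : R) N0 N : 0 <= t -> t < 1 -> \sum_(L <- iota N0 N) t ^+ L <= t ^+ N0 / (1 - t).
Proof.
move=> t0 t1; have d0 : 0 < 1 - t by rewrite subr_gt0.
rewrite ler_pdivlMr //.
suff -> : (\sum_(L <- iota N0 N) t ^+ L) * (1 - t) = t ^+ N0 - t ^+ (N0 + N).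
 by rewrite lerBlDr lerDl exprn_ge0.
elim: N => [|N ih]; first by rewrite big_nil mul0r addn0 subrr.
rewrite -addn1 iotaD big_cat /= big_seq1 mulrDl ih addn1 addnS exprS; ring.
Qed.

Lemma geom_small (t A e : R) : 0 <= t -> t < 1 -> 0 < e ->
 exists n0, forall n, (n0 <= n)%N -> t ^+ n * A <= e.
Proof.
move=> t0 t1 e0; have := @cvg_expr R t; rewrite ger0_norm // => /(_ t1) /cvgrPdist_lt.
have A0 : 0 < `|A| + 1 by rewrite ltr_wpDl.
move=> /(_ (e / (`|A| + 1))) [|n0 _ H]; first by rewrite divr_gt0.
exists n0 => n /H /=; rewrite sub0r normrN ger0_norm ?exprn_ge0 // ltr_pdivlMr // => /ltW.
apply: le_trans; rewrite ler_wpM2l ?exprn_ge0 // (le_trans (ler_norm _)) // lerDl //.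
Qed.

Lemma reduced_eq (f h : C -> C) (z : C) : {for z, continuous h} ->
 (exists2 d : R, 0 < d & forall y, y != z -> cabs (y - z) < d -> f y = h y) -> reduced f z = h z.
Proof.
move=> hc [d d0 fh]; apply: cvg_lim => //; apply/(cvg_cabsP (dnbhs_filter z)) => e e0.
have /cont_cabsP /(_ e e0) [d' d'0 H] := hc.
have : nbhs z [set y | cabs (y - z) < Num.min d d'].
 by apply/nbhs_cabsP; exists (Num.min d d'); rewrite // lt_min d0.
rewrite /dnbhs /within /=; apply: filterS => y /=; rewrite lt_min => /andP[yd yd'] yz.
by rewrite fh //; exact: H.
Qed.

(** The limit of a divergent filter is the default value 0, which is what [reduced] returns at a
    pole. *)
Lemma reduced_unbounded (f : C -> C) (z : C) :
 (forall X d : R, 0 < d -> exists y, [/\ y != z, cabs (y - z) < d & X <= cabs (f y)]) ->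
 reduced f z = 0.
Proof.
move=> H; rewrite /reduced; have nc : ~ cvg (f y @[y --> z^']).
 move=> /cvg_ex[l fl]; have /(cvg_cabsP (dnbhs_filter z)) /(_ 1 ltr01) := fl.
 rewrite /dnbhs /within /= => /nbhs_cabsP[d d0 Hd].
 have [y [yz yd yX]] := H (cabs l + 1) d d0.
 have := Hd y yd yz; have := cabsD (f y - l) l; rewrite subrK; move: yX => /=; lra.
by rewrite dvgP.
Qed.

Lemma cont_agree (f h : C -> C) (z : C) : {for z, continuous f} -> {for z, continuous h} ->
 (exists2 d : R, 0 < d & forall y, y != z -> cabs (y - z) < d -> f y = h y) -> f z = h z.
Proof. by move=> fc hc /(reduced_eq hc) <-; apply/esym/reduced_eq => //; exists 1. Qed.

Lemma punct_gap (s : seq R) (z : C) : exists2 d : R, 0 < d &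
 forall y a, a \in s -> y != z -> cabs (y - z) < d -> y != a%:C.
Proof.
have [|d d0 H] := @seq_pos_lb _ (fun a => cabs (z - a%:C)) [seq a <- s | z != a%:C].
 by move=> a; rewrite mem_filter => /andP[za _]; rewrite cabs_gt0 subr_eq0.
exists d => // y a as_ yz yd; have [E|za] := eqVneq z a%:C; first by rewrite -E.
apply/eqP => E; have := H a; rewrite mem_filter za as_ => /(_ isT).
by rewrite leNgt -E cabsBC yd.
Qed.

Lemma cont_eq_near (f h : C -> C) (z : C) : {for z, continuous h} ->
 (exists2 d : R, 0 < d & forall y, cabs (y - z) < d -> f y = h y) -> {for z, continuous f}.
Proof.
move=> /cont_cabsP hc [d d0 fh]; apply/cont_cabsP => e e0; have [d' d'0 H] := hc e e0.
exists (Num.min d d'); rewrite ?lt_min ?d0 // => y; rewrite lt_min => /andP[y1 y2].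
by rewrite !fh ?subrr ?cabs0 //; exact: H.
Qed.

Lemma uniform_continuous (F : nat -> C -> C) (G : C -> C) (z : C) (d : R) : 0 < d ->
 (forall e : R, 0 < e -> exists N, (forall y, cabs (y - z) < d -> cabs (F N y - G y) <= e) /\
   {for z, continuous (F N)}) -> {for z, continuous G}.
Proof.
move=> d0 H; apply/cont_cabsP => e e0.
have e3 : 0 < e / 4 by rewrite divr_gt0.
have [N [FG /cont_cabsP /(_ _ e3) [d' d'0 Fc]]] := H _ e3.
exists (Num.min d d'); rewrite ?lt_min ?d0 // => y; rewrite lt_min => /andP[y1 y2].
have h1 := FG y y1; have h2 := Fc y y2; have h3 : cabs (F N z - G z) <= e / 4 by apply: FG; rewrite subrr cabs0.
have -> : G y - G z = - (F N y - G y) + (F N y - F N z) + (F N z - G z) by ring.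
apply: le_lt_trans (cabsD _ _) _; have := cabsD (- (F N y - G y)) (F N y - F N z); rewrite cabsN; lra.
Qed.

Lemma cabs_cauchy (u : nat -> C) :
 (forall e : R, 0 < e -> exists N0, forall N, (N0 <= N)%N -> cabs (u N - u N0) <= e) ->
 exists l : C, u @ \oo --> l.
Proof.
move=> H.
have CR (f : nat -> R) : (forall e : R, 0 < e -> exists N0, forall N, (N0 <= N)%N -> `|f N - f N0| <= e) ->
  exists l : R, f @ \oo --> l.
 move=> Hf; exists (lim (f @ \oo)); apply: cauchy_cvg; apply/cauchy_ballP => e e0.
 have [N0 HN] := Hf (e / 4) (divr_gt0 e0 (ltr0n R 4)).
 exists ([set y | exists2 N, (N0 <= N)%N & y = f N], [set y | exists2 N, (N0 <= N)%N & y = f N]) => /=.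
  by split; exists N0 => // N /= hN; exists N.
 move=> [a b] /= [[N hN ->] [N' hN' ->]]; rewrite /ball /= /ball_.
 have := HN N hN; have := HN N' hN'; rewrite !ler_norml ltr_norml; lra.
have [a ha] := CR (fun N => Re (u N)) (fun e e0 => let: ex_intro N0 h := H e e0 in
  ex_intro _ N0 (fun N hN => le_trans (eq_ind _ (fun z => `|z| <= _) (Re_le_cabs (u N - u N0)) _ (cReB _ _)) (h N hN))).
have [b hb] := CR (fun N => Im (u N)) (fun e e0 => let: ex_intro N0 h := H e e0 in
  ex_intro _ N0 (fun N hN => le_trans (eq_ind _ (fun z => `|z| <= _) (Im_le_cabs (u N - u N0)) _ (cImB _ _)) (h N hN))).
exists (a +i* b); apply/cvg_cabsP => e e0.
move/cvgrPdist_lt: ha => /(_ (e / 2) (divr_gt0 e0 (ltr0n R 2))) ha.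
move/cvgrPdist_lt: hb => /(_ (e / 2) (divr_gt0 e0 (ltr0n R 2))) hb.
near=> N; apply: le_lt_trans (cabs_le_ReIm _) _; rewrite cReB cImB /= (splitr e) ltrD //.
 by rewrite distrC; near: N.
by rewrite distrC; near: N.
Unshelve. all: by end_near. Qed.

(** * Lower bounds read off the negative axis *)

Section StieltjesLower.
Variables (l : seq (R * R)) (c : R).
Hypotheses (lpos : forall p, p \in l -> 0 < p.1 /\ 0 < p.2) (c0 : 0 < c).

Lemma sS_neg (s : R) : 0 < s -> Re (sS l c (- s)%:C) = \sum_(p <- l) p.1 * ((s + c) / (s + p.2)).
Proof.
move=> s0; rewrite sS_real /=; apply: eq_big_seq => p pl; have [_ p2] := lpos pl.
have h : s + p.2 != 0 by rewrite gt_eqF // addr_gt0.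
have h' : - s - p.2 != 0 by rewrite -opprD oppr_eq0.
by congr (_ * _); field; rewrite ?h ?h'.
Qed.

Lemma sB_neg : sB l = Re (sS l c (- 1)%:C) / (1 + c).
Proof.
rewrite sS_neg // /sB mulr_suml; apply: eq_big_seq => p pl; have [_ p2] := lpos pl.
by field; rewrite !gt_eqF // addr_gt0.
Qed.

(** A pole beyond c/2 contributes to S(-e) at most a fixed multiple of its share of [sB]. *)
Lemma split_small (e a : R) : 0 < e -> 0 < a -> c / 2 < a -> (e + a)^-1 <= (1 + 2 / c) / (1 + a).
Proof.
move=> e0 a0 ca; rewrite ler_pdivlMr ?addr_gt0 // mulrC ler_pdivrMr ?addr_gt0 //.
have : c * (2 / c) = 2 by rewrite mulrCA divff ?mulr1 // gt_eqF.
have : 0 < 2 / c by rewrite divr_gt0.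
move: (2 / c) => k k0 ck; nra.
Qed.

(** S(-e)/(e + c) is the sum of p1/(e + p). Poles above c/2 are paid for by [sB]; for a pole below
    c/2, |w - c| >= c/2 and |w - p| <= e + p <= c give |w - c|^2/|w - p|^2 >= c/(4 (e + p)). A large
    value of S at -e thus makes M large on the whole disc |w| <= e. *)
Lemma sM_lower (e : R) (w : C) : 0 < e -> e <= c / 2 -> cabs w <= e -> offp l w ->
 c / 4 * (Re (sS l c (- e)%:C) / (e + c)) - c / 4 * (1 + 2 / c) * sB l <= sM l c w.
Proof.
move=> e0 ec we ow; rewrite sS_neg // /sB /sM mulr_suml !mulr_sumr -sumrB !big_seq.
apply: ler_sum => p pl; have [p1 p2] := lpos pl.
have ec0 : e + c != 0 by rewrite gt_eqF // addr_gt0.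
have ep0 : e + p.2 != 0 by rewrite gt_eqF // addr_gt0.
have -> : c / 4 * (p.1 * ((e + c) / (e + p.2)) / (e + c)) = p.1 * (c / 4 * (e + p.2)^-1).
 by field; rewrite ec0 ep0.
have -> : c / 4 * (1 + 2 / c) * (p.1 / (1 + p.2)) = p.1 * (c / 4 * ((1 + 2 / c) / (1 + p.2))) by ring.
rewrite -mulrBr ler_pM2l // -mulrBr.
have [pc|pc] := leP p.2 (c / 2); last first.
 apply: (@le_trans _ _ 0); last by rewrite divr_ge0 // exprn_ge0 ?cabs_ge0.
 by rewrite mulr_ge0_le0 ?divr_ge0 ?(ltW c0) // subr_le0 split_small.
apply: (@le_trans _ _ (c / 4 * (e + p.2)^-1)).
 rewrite ler_pM2l ?divr_gt0 // gerBl divr_ge0 ?addr_ge0 ?divr_ge0 ?(ltW c0) ?(ltW p2) //.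
have d0 : 0 < cabs (w - p.2%:C) by rewrite cabs_gt0 subr_eq0 ow.
have n1 : c / 2 <= cabs (w - c%:C).
 by have := cabsB_ge c%:C w; rewrite cabsR (gtr0_norm c0) cabsBC; lra.
have n2 : cabs (w - p.2%:C) <= e + p.2.
 by have := cabsD w (- p.2%:C); rewrite cabsN cabsR (gtr0_norm p2); lra.
have n3 : e + p.2 <= c by lra.
rewrite ler_pdivlMr ?exprn_gt0 //.
have n4 : cabs (w - p.2%:C) ^+ 2 <= (e + p.2) * c.
 by rewrite expr2; apply: ler_pM; rewrite ?cabs_ge0 // (le_trans n2).
have n5 : (c / 2) ^+ 2 <= cabs (w - c%:C) ^+ 2 by rewrite lerXn2r // nnegrE ?cabs_ge0 // divr_ge0 // ltW.
apply: le_trans n5; apply: le_trans (_ : c / 4 * (e + p.2)^-1 * ((e + p.2) * c) <= _).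
 by rewrite ler_pM2l // mulr_gt0 ?invr_gt0 ?divr_gt0 ?addr_gt0.
by rewrite le_eqVlt; apply/orP; left; apply/eqP; field.
Qed.

(** The same splitting at c/2: for smaller poles (p - c)^2 >= (c/2)^2, 1 + p <= 1 + c/2 and e/(e +
    p) <= 1. It makes the kernel inequality uniform in K. *)
Lemma sN_lower (e : R) : 0 < e ->
 (c / 2) ^+ 2 / (1 + c / 2) ^+ 4 * e * (Re (sS l c (- e)%:C) / (e + c) - (1 + 2 / c) * sB l) <= sN l c.
Proof.
move=> e0; rewrite sS_neg // /sB /sN mulr_suml !mulr_sumr -sumrB mulr_sumr !big_seq.
apply: ler_sum => p pl; have [p1 p2] := lpos pl.
have ec0 : e + c != 0 by rewrite gt_eqF // addr_gt0.
have ep0 : e + p.2 != 0 by rewrite gt_eqF // addr_gt0.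
have k0 : 0 < (c / 2) ^+ 2 / (1 + c / 2) ^+ 4.
 by rewrite divr_gt0 ?exprn_gt0 ?divr_gt0 // addr_gt0 // divr_gt0.
have -> : p.1 * ((e + c) / (e + p.2)) / (e + c) = p.1 * (e + p.2)^-1 by field; rewrite ec0 ep0.
rewrite [(1 + 2 / c) * _]mulrCA -mulrBr mulrCA ler_pM2l //.
have [pc|pc] := leP p.2 (c / 2); last first.
 apply: (@le_trans _ _ 0); last by rewrite divr_ge0 ?sqr_ge0 // exprn_ge0 // addr_ge0 // ltW.
 have ke : 0 <= (c / 2) ^+ 2 / (1 + c / 2) ^+ 4 * e := mulr_ge0 (ltW k0) (ltW e0).
 by rewrite mulr_ge0_le0 // subr_le0 split_small.
apply: (@le_trans _ _ ((c / 2) ^+ 2 / (1 + c / 2) ^+ 4)).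
 rewrite -[leRHS]mulr1 -[leLHS]mulrA ler_pM2l //.
 apply: (@le_trans _ _ (e * (e + p.2)^-1)).
  rewrite ler_pM2l // gerBl divr_ge0 ?addr_ge0 ?divr_ge0 ?(ltW c0) ?(ltW p2) //.
 by rewrite ler_pdivrMr ?addr_gt0 // mul1r lerDl ltW.
apply: ler_pM; rewrite ?sqr_ge0 ?invr_ge0 ?exprn_ge0 ?addr_ge0 ?divr_ge0 ?(ltW c0) //.
 by rewrite -[X in _ <= X]sqrrN opprB lerXn2r // ?nnegrE ?divr_ge0 ?(ltW c0) //; lra.
rewrite lef_pV2 ?posrE ?exprn_gt0 ?addr_gt0 ?divr_gt0 //.
by rewrite lerXn2r ?nnegrE ?addr_ge0 ?divr_ge0 ?(ltW c0) ?(ltW p2) // lerD2l.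
Qed.

End StieltjesLower.

(** * The product and its logarithmic derivative on the negative axis *)

Section NegativeAxis.
Implicit Types (zs : seq (R * R)) (i : R * R).

Definition fr i (s : R) : R :=
 if isM i then (s + i.1) / (s + i.2) else (1 + s / i.1) / (1 + s / i.2).
Definition pr zs (s : R) : R := \prod_(i <- zs) fr i s.

Lemma fac_neg i (s : R) : fac i (- s)%:C = (fr i s)%:C.
Proof.
rewrite /fac /fr; case: ifP => _; rewrite !rmorphM !fmorphV !rmorphD /= ?rmorphM ?fmorphV ?rmorphN ?rmorph1 /=.
 by rewrite -!opprD invrN mulrNN.
by rewrite !mulNr !opprK.
Qed.

Lemma rawp_neg zs (s : R) : rawp zs (- s)%:C = (pr zs s)%:C.
Proof. by rewrite /rawp /pr rmorph_prod; apply: eq_bigr => i _; rewrite fac_neg. Qed.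

Lemma fr_ge1 zs i (s : R) : cfg zs -> i \in zs -> 0 < s -> 1 <= fr i s.
Proof.
move=> zc iz s0; have [z0 p0 _] := cfg_pos zc iz; rewrite /fr; case: ifPn => h.
 rewrite ler_pdivlMr ?addr_gt0 // mul1r lerD2l; move: h; rewrite /isM; exact: ltW.
have := isMN zc iz h => lt.
rewrite ler_pdivlMr ?addr_gt0 ?divr_gt0 // mul1r lerD2l ler_pM2l // lef_pV2 ?posrE //; exact: ltW.
Qed.

Lemma pr_ge1 zs (s : R) : cfg zs -> 0 < s -> 1 <= pr zs s.
Proof.
move=> zc s0; rewrite /pr big_seq; elim/big_ind: _ => //.
 by move=> x y x1 y1; rewrite -[1]mulr1 ler_pM.
by move=> i iz; apply: fr_ge1 zc iz s0.
Qed.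

Lemma offr_neg zs (s : R) : cfg zs -> 0 < s -> offr zs (- s)%:C.
Proof.
move=> zc s0 i iz; have [z0 p0 _] := cfg_pos zc iz; rewrite (inj_eq CI) lt_eqF //.
by apply: lt_trans p0; rewrite oppr_lt0.
Qed.

Lemma cder_rawp zs (w : C) : cfg zs -> offr zs w -> (forall i, i \in zs -> w != i.1%:C) ->
 cder (rawp zs) w (rawp zs w * \sum_(i <- zs) ((w - i.1%:C)^-1 - (w - i.2%:C)^-1)).
Proof.
move=> zc ow nw.
have facd i : i \in zs -> cder (fac i) w (fac i w * ((w - i.1%:C)^-1 - (w - i.2%:C)^-1)).
 move=> iz; have a := ow i iz; have d := nw i iz.
 have d1 : w - i.2%:C != 0 by rewrite subr_eq0.
 have d2 : w - i.1%:C != 0 by rewrite subr_eq0.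
 have [z0 p0 _] := cfg_pos zc iz.
 have e1 : i.1%:C != 0 :> C by rewrite fmorph_eq0 gt_eqF.
 have e2 : i.2%:C != 0 :> C by rewrite fmorph_eq0 gt_eqF.
 have id1 (k : C) : cder (fun y : C => y - k) w 1.
  by rewrite -[1]addr0; apply: cderD; [exact: cder_id|exact: cder_cst].
 rewrite /fac; case: ifP => _.
  have H := cderM (id1 i.1%:C) (cder_inv a).
  suff <- : (w - i.1%:C) * - (w - i.2%:C) ^- 2 + (w - i.2%:C)^-1 * 1 =
   (w - i.1%:C) / (w - i.2%:C) * ((w - i.1%:C)^-1 - (w - i.2%:C)^-1) by [].
  by move: d1 d2; move: (i.1%:C) (i.2%:C) => z p d1 d2; field; rewrite d1 d2.
 have lin (k : C) : cder (fun y : C => 1 - y / k) w (- k^-1).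
  have := cderD (cder_cst 1 w) (cder_scale (- k^-1) (cder_id w)); rewrite add0r mulr1.
  by have -> : (fun y => 1 - y / k) = (fun y => 1 + - k^-1 * y) by apply/funext => y; rewrite mulNr mulrC.
 have n2 : 1 - w / i.2%:C != 0.
  by rewrite subr_eq0; apply: contraNneq a => E; apply/eqP; rewrite -[RHS]mul1r E divfK.
 have H := cderM (lin i.1%:C) (@cderV (fun y => 1 - y / i.2%:C) w _ n2 (lin i.2%:C)).
 suff <- : (1 - w / i.1%:C) * (- (1 - w / i.2%:C) ^- 2 * - (i.2%:C)^-1) + (1 - w / i.2%:C)^-1 * - (i.1%:C)^-1 =
   (1 - w / i.1%:C) / (1 - w / i.2%:C) * ((w - i.1%:C)^-1 - (w - i.2%:C)^-1) by [].
 move: d1 d2 e1 e2 n2; move: (i.1%:C) (i.2%:C) => z p d1 d2 e1 e2 n2.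
 have n3 : p - w != 0 by rewrite -opprB oppr_eq0.
 by field; rewrite ?d1 ?d2 ?e1 ?e2 ?n3.
suff H s : {subset s <= zs} -> cder (fun y => \prod_(i <- s) fac i y) w
  ((\prod_(i <- s) fac i w) * \sum_(i <- s) ((w - i.1%:C)^-1 - (w - i.2%:C)^-1)) by exact: H.
elim: s => [_|i s ih sl].
 by rewrite !big_nil mulr0; under eq_fun do rewrite big_nil; exact: cder_cst.
rewrite !big_cons; under eq_fun do rewrite big_cons.
have H2 := ih (fun q qs => sl q (mem_behead (s := i :: s) qs)).
have H1 := facd i (sl i (mem_head _ _)).
have := cderM H1 H2; congr (cder _ _ _).
by move: (fac i w) (\prod_(j <- s) _) (\sum_(j <- s) _) => f p q; ring.
Qed.

Lemma cder_unique (f : C -> C) (w a d : C) : cder f w a -> cder f w d -> a = d.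
Proof. by move=> /cder_der[_ <-] /cder_der[_ <-]. Qed.

Lemma cder_near (f h : C -> C) (w a : C) : cder f w a ->
 (exists2 d : R, 0 < d & forall y, cabs (y - w) < d -> h y = f y) -> cder h w a.
Proof.
move=> fa [d d0 H] e e0; have [r r0 Hr] := fa e e0.
exists (Num.min d r); first by rewrite lt_min d0.
move=> k; rewrite lt_min => /andP[k1 k2]; rewrite !H ?subrr ?cabs0 //; first exact: Hr.
by rewrite addrAC subrr add0r.
Qed.

Lemma prod_sub_le (T : eqType) (s1 s2 : seq T) (f : T -> R) : uniq s1 -> {subset s1 <= s2} ->
 (forall x, x \in s2 -> 1 <= f x) -> \prod_(x <- s1) f x <= \prod_(x <- s2) f x.
Proof.
elim: s1 s2 => [|x s1 ih] s2 /=.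
 move=> _ _ h; rewrite big_nil big_seq; elim/big_ind: _ => // a d a1 d1.
 by rewrite -[1]mulr1 ler_pM.
move=> /andP[xs us] sub h; have x2 : x \in s2 by apply: sub; rewrite mem_head.
rewrite big_cons (big_rem x x2) /= ler_pM2l ?(lt_le_trans ltr01 (h x x2)) //.
apply: ih => // [y ys1|y /mem_rem]; last exact: h.
have : y \in s2 by apply: sub; rewrite inE ys1 orbT.
by rewrite (perm_mem (perm_to_rem x2)) inE => /orP[/eqP E|//]; move: xs; rewrite -E ys1.
Qed.

End NegativeAxis.

(** * From moments to the value of a density, by the Poisson kernel *)

Section PoissonKernel.

(** Covers integration against nu as well as against a Lebesgue density: it sees only values on
    [-B, B] and has norm at most A there. *)
Record bounded_functional (I : (R -> R) -> R) (B A : R) : Prop := BoundedFunctional {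
 bf_lin : forall (a : R) (f g : R -> R), continuous f -> continuous g ->
  I (fun x => a * f x + g x) = a * I f + I g;
 bf_bound : forall (f : R -> R) (e : R), continuous f -> 0 <= e -> (forall x, - B <= x <= B -> `|f x| <= e) ->
  `|I f| <= A * e }.

Definition poly_approx (B : R) (f : R -> R) := forall e : R, 0 < e ->
 exists p : {poly R}, forall x, - B <= x <= B -> `|f x - p.[x]| <= e.

Lemma cont_poly (p : {poly R}) : continuous (fun x : R => p.[x]).
Proof. by move=> x; exact: continuous_horner. Qed.

Lemma bf_poly I (B A : R) (p : {poly R}) : bounded_functional I B A ->
 I (fun x => p.[x]) = \sum_(i < size p) p`_i * I (fun x => x ^+ i).
Proof.
move=> [lin _].
have cX (k : nat) : continuous (fun x : R => x ^+ k) by move=> x; exact: exprn_continuous.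
have I0 : I (fun=> 0) = 0.
 have c0 : continuous (fun _ : R => 0 : R) by move=> x; exact: cvg_cst.
 have E := lin (-1) _ _ c0 c0.
 have E0 : I (fun _ : R => -1 * 0 + 0) = 0 by rewrite E mulN1r addNr.
 rewrite -[RHS]E0.
 by congr I; apply/funext => x; rewrite mulr0 addr0.
have H N : I (fun x => \sum_(i < N) p`_i * x ^+ i) = \sum_(i < N) p`_i * I (fun x => x ^+ i).
 elim: N => [|N IH].
  by rewrite big_ord0 -[RHS]I0; congr I; apply/funext => x; rewrite big_ord0.
 rewrite big_ord_recr /= -IH addrC -lin //.
  by congr I; apply/funext => x; rewrite big_ord_recr /= addrC.
 have -> : (fun x => \sum_(i < N) p`_i * x ^+ i) = (fun x => (\poly_(i < N) p`_i).[x]).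
  by apply/funext => x; rewrite horner_poly.
 exact: cont_poly.
by rewrite -H; congr I; apply/funext => x; rewrite horner_coef.
Qed.

(** Replacing f by a polynomial costs at most A times the error for each functional, and a
    polynomial involves finitely many moments. *)
Lemma bf_limit I (J : nat -> (R -> R) -> R) (B A : R) (f : R -> R) : 0 < A -> bounded_functional I B A ->
 (forall K, bounded_functional (J K) B A) ->
 (forall k e, 0 < e -> exists K0, forall K, (K0 <= K)%N ->
  `|I (fun x => x ^+ k) - J K (fun x => x ^+ k)| <= e) ->
 continuous f -> poly_approx B f ->
 forall e, 0 < e -> exists K0, forall K, (K0 <= K)%N -> `|I f - J K f| <= e.
Proof.
move=> A0 bI bJ mom cf ap e e0.
have e3 : 0 < e / (3 * A) by rewrite divr_gt0 // mulr_gt0.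
have [p Hp] := ap _ e3.
have near L : bounded_functional L B A -> `|L f - L (fun x => p.[x])| <= e / 3.
 move=> bL; have cp : continuous (fun x => -1 * p.[x] + f x).
  by move=> x; apply: cvgD; [apply: cvgM; [exact: cvg_cst|exact: cont_poly]|exact: cf].
 have -> : L f - L (fun x => p.[x]) = L (fun x => -1 * p.[x] + f x).
  by rewrite (bf_lin bL) ?mulN1r 1?addrC //; exact: cont_poly.
 apply: le_trans (bf_bound bL cp (ltW e3) _) _; last by rewrite le_eqVlt; apply/orP; left; apply/eqP; field; rewrite gt_eqF.
 by move=> x xB; rewrite mulN1r addrC; exact: Hp.
have [K0 HK] : exists K0, forall K, (K0 <= K)%N -> `|I (fun x => p.[x]) - J K (fun x => p.[x])| <= e / 3.
 pose S := \sum_(i < size p) `|p`_i| + 1.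
 have S0 : 0 < S by rewrite ltr_wpDl // sumr_ge0.
 have eS : 0 < e / 3 / S by rewrite !divr_gt0.
 have [g Hg] : exists g : nat -> nat, forall k K, (g k <= K)%N -> `|I (fun x => x ^+ k) - J K (fun x => x ^+ k)| <= e / 3 / S.
  by have := choice (fun k => mom k _ eS) => -[g Hg]; exists g.
 exists (\max_(i < size p) g i)%N => K hK.
 rewrite (bf_poly _ bI) (bf_poly _ (bJ K)) -sumrB.
 apply: le_trans (ler_norm_sum _ _ _) _.
 apply: le_trans (_ : \sum_(i < size p) `|p`_i| * (e / 3 / S) <= _).
  apply: ler_sum => i _; rewrite -mulrBr normrM ler_wpM2l // Hg //.
  by apply: leq_trans hK; exact: (leq_bigmax i).
 rewrite -mulr_suml mulrA ler_pdivrMr // mulrC ler_wpM2l //; first by rewrite divr_ge0 // ltW.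
 by rewrite /S lerDl.
exists K0 => K hK; have h1 := near _ bI; have h2 := near _ (bJ K); have h3 := HK K hK.
have -> : I f - J K f = (I f - I (fun x => p.[x])) + (I (fun x => p.[x]) - J K (fun x => p.[x])) -
  (J K f - J K (fun x => p.[x])) by ring.
apply: le_trans (ler_normB _ _) _; apply: le_trans (lerD (ler_normD _ _) (lexx _)) _.
by move: h1 h2 h3; move: `|_| `|_| `|_| => a b d; lra.
Qed.

Definition pois (eta x0 x : R) : R := eta / ((x - x0) ^+ 2 + eta ^+ 2).

Lemma pois_den (eta x0 x : R) : 0 < eta -> 0 < (x - x0) ^+ 2 + eta ^+ 2.
Proof. by move=> e0; rewrite ltr_wpDl ?sqr_ge0 // exprn_gt0. Qed.

Lemma pois_ge0 (eta x0 x : R) : 0 < eta -> 0 <= pois eta x0 x.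
Proof. by move=> e0; rewrite divr_ge0 ?(ltW e0) // ltW // pois_den. Qed.

Lemma pois_cont (eta x0 : R) : 0 < eta -> continuous (pois eta x0).
Proof.
move=> e0 x; apply: cvgM; first exact: cvg_cst.
apply: cvgV; first by rewrite gt_eqF // pois_den.
apply: cvgD; last exact: cvg_cst.
have h : (y - x0) @[y --> x] --> x - x0 by apply: cvgB; [exact: cvg_id|exact: cvg_cst].
by rewrite expr2; exact: (@cvgM _ _ _ _ (fun y => y - x0) (fun y => y - x0) _ _ h h).
Qed.

(* Geometric series for [1 / (1 - y)], with [1 - y] a rescaling of the denominator of the kernel. *)
Lemma pois_approx (eta x0 B : R) : 0 < eta -> poly_approx B (pois eta x0).
Proof.
move=> e0 e ep.
pose T := (`|B| + `|x0|) ^+ 2 + eta ^+ 2 + 1.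
have T0 : 0 < T by rewrite ltr_wpDl // addr_ge0 ?sqr_ge0.
pose y x : R := 1 - ((x - x0) ^+ 2 + eta ^+ 2) / T.
pose Y : {poly R} := 1 - T^-1 *: (('X - x0%:P) ^+ 2 + (eta ^+ 2)%:P).
have YE x : Y.[x] = y x by rewrite /Y !hornerE /y mulrC.
pose q := 1 - eta ^+ 2 / T.
have q1 : q < 1 by rewrite /q ltrBlDr ltrDl divr_gt0 ?exprn_gt0.
have eT : eta ^+ 2 <= T by rewrite /T; have := sqr_ge0 (`|B| + `|x0|); lra.
have q0 : 0 <= q by rewrite /q subr_ge0 ler_pdivrMr // mul1r.
have yq x : - B <= x <= B -> 0 <= y x <= q.
 move=> /andP[x1 x2]; apply/andP; split; rewrite /y.
  rewrite subr_ge0 ler_pdivrMr // mul1r.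
  have h : `|x - x0| <= `|B| + `|x0|.
   apply: le_trans (ler_normB _ _) _; rewrite lerD2r ler_norml.
   have := ler_norm B; lra.
  have : (x - x0) ^+ 2 <= (`|B| + `|x0|) ^+ 2 by rewrite -(real_normK (num_real (x - x0))) lerXn2r ?nnegrE ?addr_ge0.
  by rewrite /T; lra.
 by rewrite /q lerD2l lerN2 ler_pM2r ?invr_gt0 // lerDr sqr_ge0.
have dq : 0 < 1 - q by rewrite subr_gt0.
have e' : 0 < e * (T * (1 - q)) / eta by rewrite divr_gt0 // mulr_gt0 // mulr_gt0.
have [N HN] := @geom_small q 1 _ q0 q1 e'.
exists ((eta / T) *: \sum_(i < N) Y ^+ i) => x xB.
have /andP[y0 yq1] := yq x xB.
have y1 : y x < 1 := le_lt_trans yq1 q1.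
have pE : pois eta x0 x = eta / T * (1 - y x)^-1.
 rewrite /pois /y opprB addrCA subrr addr0.
 by field; rewrite !gt_eqF ?pois_den.
rewrite pE hornerZ horner_sum.
have -> : \sum_(i < N) (Y ^+ i).[x] = (1 - y x ^+ N) / (1 - y x).
 have d1 : 1 - y x != 0 by rewrite gt_eqF // subr_gt0.
 apply: (mulIf d1); rewrite mulfVK // mulrC [RHS](_ : _ = 1 ^+ N - y x ^+ N); last by rewrite expr1n.
 rewrite subrXX; congr (_ * _); apply: eq_bigr => i _.
 by rewrite expr1n mul1r horner_exp YE.
have -> : eta / T / (1 - y x) - eta / T * ((1 - y x ^+ N) / (1 - y x)) = eta / T * (y x ^+ N / (1 - y x)).
 by ring.
have eT0 : 0 <= eta / T by rewrite divr_ge0 // ltW.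
rewrite normrM ger0_norm // normrM normrX (ger0_norm y0) ger0_norm; last by rewrite invr_ge0 subr_ge0 ltW.
have h1 : y x ^+ N / (1 - y x) <= e * (T * (1 - q)) / eta * (1 - q)^-1.
 have yN : y x ^+ N <= e * (T * (1 - q)) / eta.
  apply: le_trans (_ : q ^+ N <= _); first by rewrite lerXn2r ?nnegrE.
  by have := HN N (leqnn N); rewrite mulr1.
 have yi : (1 - y x)^-1 <= (1 - q)^-1 by rewrite lef_pV2 ?posrE ?subr_gt0 // lerD2l lerN2.
 by apply: ler_pM => //; [exact: exprn_ge0|rewrite invr_ge0 subr_ge0 ltW].
apply: le_trans (ler_wpM2l eT0 h1) _.
by rewrite le_eqVlt; apply/orP; left; apply/eqP; field; rewrite !gt_eqF.
Qed.

Lemma pois_int (eta x0 rho : R) : 0 < eta -> 0 < rho ->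
 \int[mu]_(x in `[x0 - rho, x0 + rho]) pois eta x0 x = 2 * atan (rho / eta).
Proof.
move=> e0 r0.
pose F x := atan ((x - x0) / eta).
have dF (x : R) : is_derive x 1 F (pois eta x0 x).
 have d1 : is_derive x 1 (fun y => (y - x0) / eta) (eta^-1).
  apply: rd_eq (rdM (rdD (is_derive_id x 1) (rdC (- x0) x)) (rdC eta^-1 x)) _.
  by rewrite mulr0 add0r addr0 mulr1.
 apply: rd_eq (rdcomp d1 (is_derive1_atan _)) _.
 by rewrite /pois; field; rewrite !gt_eqF ?pois_den //= addrC pois_den.
have cF (x : R) : {for x, continuous F}.
 by have [/derivable1_diffP/differentiable_continuous] := dF x.
have cF' : {within `[x0 - rho, x0 + rho], continuous F} by exact: continuous_subspaceT.
have lt : x0 - rho < x0 + rho by lra.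
rewrite /Rintegral (@continuous_FTC2 _ _ F) //.
- rewrite /= /F.
 have -> : x0 + rho - x0 = rho by ring.
 have -> : x0 - rho - x0 = - rho by ring.
 by rewrite mulNr atanN; ring.
- by apply: continuous_subspaceT; exact: pois_cont.
- move/(continuous_within_itvP _ lt): cF' => [_ c1 c2]; by split=> // x _; have [] := dF x.
- by move=> x _; rewrite derive1E; have [] := dF x.
Qed.

Lemma functional_lebesgue (h : R -> R) (Bs : R) : 0 <= Bs -> mbd h 0 Bs -> (forall x, 0 <= x <= Bs -> 0 <= h x <= pi) ->
 bounded_functional (fun f => \int[mu]_(x in `[0, Bs]) (f x * h x)) Bs (pi * Bs).
Proof.
move=> B0 mh hb; have mf (f : R -> R) : continuous f -> mbd (fun x => f x * h x) 0 Bs.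
 by move=> cf; apply: mbdM mh; apply: mbd_cont; exact: continuous_subspaceT.
split.
- move=> a f g cf cg; have i1 := mbd_int (mf f cf); have i2 := mbd_int (mf g cg).
 have ca : continuous (fun x => a * f x) by move=> x; apply: cvgM; [exact: cvg_cst|exact: cf].
 have i3 := mbd_int (mf _ ca).
 rewrite -RintegralZl //.
 have -> : \int[mu]_(x in `[0, Bs]) (a * (f x * h x)) = \int[mu]_(x in `[0, Bs]) (a * f x * h x).
  by apply: eq_Rintegral => x _; rewrite mulrA.
 rewrite -RintegralD //.
 by apply: eq_Rintegral => x _; rewrite mulrDl.
- move=> f e cf e0 fe; rewrite mulrAC -[X in _ * X](subr0 Bs).
 apply: Rint_bound => //; [by rewrite mulr_ge0 // pi_ge0|exact: mf|].
 move=> x /andP[x0 x1]; have /andP[h0 h1] : 0 <= h x <= pi by apply: hb; rewrite x0.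
 rewrite normrM [pi * e]mulrC (ger0_norm h0); apply: ler_pM => //; apply: fe.
 by rewrite x1 andbT; apply: le_trans x0; rewrite oppr_le0.
Qed.

Lemma functional_measure (nu : {finite_measure set R -> \bar R}) (B c : R) : 0 <= c ->
 nu (~` [set x | - B <= x <= B]) = 0%E ->
 bounded_functional (fun f => c * Rintegral nu setT f) B (c * fine (nu setT)).
Proof.
move=> c0 nu0; pose D := [set x : R | - B <= x <= B].
have mD : measurable D.
 have -> : D = `[- B, B]%classic by apply/seteqP; split=> x; rewrite /D /= in_itv.
 exact: measurable_itv.
have fin (A : set R) : measurable A -> (nu A < +oo)%E.
 by move=> mA; rewrite ltey_eq fin_num_measure.
have bd (f : R -> R) (e : R) : (forall x, - B <= x <= B -> `|f x| <= e) -> [bounded f x | x in D].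
 move=> fe; exists e; split; first exact: num_real.
 by move=> r er x Dx; apply: le_trans (fe x Dx) (ltW er).
have loc (f : R -> R) : continuous f -> exists e, forall x, - B <= x <= B -> `|f x| <= e.
 move=> cf; have [V HV] := @segment_bounded f (- B) B (continuous_subspaceT cf).
 by exists V.
have mf (f : R -> R) : continuous f -> measurable_fun setT f by exact: continuous_measurable_fun.
have EX f : continuous f -> nu.-integrable setT (EFin \o f).
 move=> cf; apply/(negligible_integrable (measurableC mD)) => //.
  by apply/measurable_EFinP; exact: mf.
 rewrite setTD setCK; have [e He] := loc f cf.
 apply: measurable_bounded_integrable => //; first exact: fin.
  by apply: measurable_funS (mf f cf).
 exact: bd He.
split.
- move=> a f g cf cg; rewrite mulrCA -mulrDr; congr (_ * _).
 have ca : continuous (fun x => a * f x) by move=> x; apply: cvgM; [exact: cvg_cst|exact: cf].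
 by rewrite -RintegralZl ?EX // -RintegralD ?EX.
- move=> f e cf e0 fe; rewrite normrM ger0_norm // -mulrA ler_wpM2l //.
 have -> : Rintegral nu setT f = Rintegral nu D f.
  rewrite /Rintegral (negligible_integral (measurableC mD) measurableT (EX f cf) nu0).
  by rewrite setTD setCK.
 have ID : nu.-integrable D (EFin \o f) by apply: integrableS (EX f cf).
 apply: le_trans (le_normr_Rintegral mD ID) _.
 apply: le_trans (_ : Rintegral nu D (fun=> e) <= _).
  apply: le_Rintegral => //; first exact: integrable_norm.
  by apply: finite_measure_integrable_cst.
 rewrite Rintegral_cst // mulrC ler_wpM2r // fine_le ?fin_num_measure //.
 by apply: le_measure; rewrite ?inE.
Qed.

Lemma Stieltjes_pois (nu : {measure set R -> \bar R}) (x eta : R) : 0 < eta ->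
 - Im (Stieltjes nu (x +i* eta)) = Rintegral nu setT (pois eta x).
Proof.
move=> e0; rewrite /Stieltjes /cintegral /=.
have -> : (fun s : R => Im ((x +i* eta - s%:C)^-1)) = (fun s => - pois eta x s).
 apply/funext => s; rewrite cImV cabs_sq cImB cReB /= subr0 /pois mulNr; congr (- (_ / _)).
 by congr (_ + _); rewrite -sqrrN opprB.
rewrite /Rintegral.
have -> : (fun s => (- pois eta x s)%:E) = (fun s => - (pois eta x s)%:E)%E by [].
rewrite integral_ge0N; first by rewrite fineN opprK.
by move=> s _; rewrite lee_fin; exact: pois_ge0.
Qed.

Lemma atan_near_pi2 (d : R) : 0 < d -> exists2 T : R, 0 < T & forall t, T <= t -> pi / 2 - d <= atan t.
Proof.
move=> d0; have := @cvgy_atan R => /cvgrPdist_le /(_ d d0) [T [_ HT]].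
exists (`|T| + 1); first by rewrite ltr_wpDl.
move=> t tT; have /HT : T < t by have := ler_norm T; lra.
by rewrite ler_norml => /andP[_]; lra.
Qed.

(** Within rho of x0 the density is close to L and the kernel has mass 2 atan(rho/eta); farther away
    the kernel is at most eta/rho^2. *)
Lemma poisson_concentrate (h : R -> R) (x0 Bs rho delta L eta : R) : 0 < eta -> 0 < rho -> 0 <= delta ->
 0 <= x0 - rho -> x0 + rho <= Bs -> mbd h 0 Bs -> (forall x, 0 <= x <= Bs -> 0 <= h x <= pi) ->
 (forall x, x0 - rho <= x <= x0 + rho -> `|h x - L| <= delta) ->
 `|\int[mu]_(x in `[0, Bs]) (pois eta x0 x * h x) - L * (2 * atan (rho / eta))| <=
  delta * (2 * atan (rho / eta)) + pi * (eta / rho ^+ 2) * Bs.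
Proof.
move=> e0 r0 d0 lo_ hi_ mh hb hL.
have cp := @pois_cont eta x0 e0.
have mp a b : mbd (pois eta x0) a b by apply: mbd_cont; exact: continuous_subspaceT.
have mbdS' (f : R -> R) (a b a' b' : R) : mbd f a b -> a <= a' -> b' <= b -> mbd f a' b'.
 move=> [mf [V fV]] aa bb; split.
  by apply: measurable_funS mf => // x /=; rewrite !in_itv /= => /andP[x1 x2]; rewrite (le_trans aa) // (le_trans x2).
 by exists V => s /andP[s1 s2]; apply: fV; rewrite (le_trans aa) // (le_trans s2).
have mk : mbd (fun x => pois eta x0 x * h x) 0 Bs by exact: mbdM.
have x0p : x0 - rho <= x0 + rho by lra.
rewrite (@Rint_cat _ 0 (x0 - rho) Bs) //; last by rewrite lo_ (le_trans x0p).
rewrite (@Rint_cat _ (x0 - rho) (x0 + rho) Bs) ?x0p //; last exact: mbdS' mk _ _.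
have far x : 0 <= x <= Bs -> rho <= `|x - x0| -> `|pois eta x0 x * h x| <= pi * (eta / rho ^+ 2).
 move=> xb xr; have /andP[h0 h1] := hb x xb; rewrite normrM (ger0_norm h0) ger0_norm ?pois_ge0 // mulrC.
 apply: ler_pM => //; first exact: pois_ge0.
 rewrite /pois ler_pM2l // lef_pV2 ?posrE ?exprn_gt0 ?pois_den //.
 apply: le_trans (_ : (x - x0) ^+ 2 <= _); last by rewrite lerDl sqr_ge0.
 by rewrite -[leRHS]real_normK ?num_real // lerXn2r ?nnegrE // ltW.
have pe : 0 <= pi * (eta / rho ^+ 2) by rewrite mulr_ge0 ?pi_ge0 // divr_ge0 ?exprn_ge0 // ltW.
have b1 : `|\int[mu]_(x in `[0, x0 - rho]) (pois eta x0 x * h x)| <= pi * (eta / rho ^+ 2) * (x0 - rho - 0).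
 apply: Rint_bound => //; first by apply: mbdS' mk _ _ => //; lra.
 move=> s /andP[s1 s2]; apply: far; first by rewrite s1 /=; lra.
 by rewrite distrC ger0_norm; lra.
have b2 : `|\int[mu]_(x in `[x0 + rho, Bs]) (pois eta x0 x * h x)| <= pi * (eta / rho ^+ 2) * (Bs - (x0 + rho)).
 apply: Rint_bound => //; first by apply: mbdS' mk _ _ => //; lra.
 move=> s /andP[s1 s2]; apply: far; first by rewrite s2 andbT; lra.
 by rewrite ger0_norm; lra.
have b3 : `|\int[mu]_(x in `[x0 - rho, x0 + rho]) (pois eta x0 x * h x) - L * (2 * atan (rho / eta))| <= delta * (2 * atan (rho / eta)).
 have ip := mbd_int (mp (x0 - rho) (x0 + rho)).
 have mk' : mbd (fun x => pois eta x0 x * h x) (x0 - rho) (x0 + rho) by exact: mbdS' mk _ _.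
 have ik := mbd_int mk'.
 have mc : mbd (fun x => L * pois eta x0 x) (x0 - rho) (x0 + rho).
  by apply: mbdM (mp _ _); apply: mbd_cont; apply: continuous_subspaceT => x; exact: cvg_cst.
 have md : mbd (fun x => delta * pois eta x0 x) (x0 - rho) (x0 + rho).
  by apply: mbdM (mp _ _); apply: mbd_cont; apply: continuous_subspaceT => x; exact: cvg_cst.
 rewrite -(pois_int x0 e0 r0) -!RintegralZl // -RintegralB //; last exact: mbd_int.
 have me : mbd (fun x => pois eta x0 x * h x - L * pois eta x0 x) (x0 - rho) (x0 + rho).
  case: mk' => q1 [V q2]; case: mc => q3 [W q4]; split; first exact: measurable_funB.
  by exists (V + W) => s sb; apply: le_trans (ler_normB _ _) _; rewrite lerD ?q2 ?q4.
 apply: le_trans (le_normr_Rintegral _ (mbd_int me)) _ => //.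
 apply: le_Rintegral => //; [exact: integrable_norm (mbd_int me)|exact: mbd_int|].
 move=> x /=; rewrite in_itv /= => xb; rewrite [L * _]mulrC -mulrBr normrM ger0_norm ?pois_ge0 // mulrC.
 by rewrite ler_wpM2r ?pois_ge0 // hL.
move: b1 b2 b3.
set f := fun x => pois eta x0 x * h x.
set i1 := \int[mu]_(x in `[0, x0 - rho]) f x; set i2 := \int[mu]_(x in `[x0 - rho, x0 + rho]) f x.
set i3 := \int[mu]_(x in `[x0 + rho, Bs]) f x; move: i1 i2 i3 => i1 i2 i3 b1 b3 b2.
have -> : i1 + (i2 + i3) - L * (2 * atan (rho / eta)) = i1 + i3 + (i2 - L * (2 * atan (rho / eta))) by ring.
apply: le_trans (ler_normD _ _) _; apply: le_trans (lerD (ler_normD _ _) (lexx _)) _.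
have pr : 0 <= pi * (eta / rho ^+ 2) * (2 * rho) by rewrite mulr_ge0 // mulr_ge0 // ltW.
move: b1 b2 b3 pr; move: (pi * _) (delta * _) => A1 A2 b1 b2 b3 pr.
apply: le_trans (lerD (lerD b1 b3) b2) _; move: pr; clear; move=> pr; nra.
Qed.

(** The width eta is fixed before K: the kernel is then one continuous function, to which
    convergence of moments applies, while h K is nearly constant on an interval around x0 that does
    not depend on K. L may vary with K and delta, which suits a density known only to be near 0 or
    near pi. In the application a = alpha pi/2. *)
Lemma poisson_slope (nu : {finite_measure set R -> \bar R}) (h : nat -> R -> R) (B0 x0 Bs a s : R) (Lset : set R) :
 nu (~` [set x | - B0 <= x <= B0]) = 0%E -> 0 < a -> 0 < x0 < Bs ->
 (forall K, mbd (h K) 0 Bs) -> (forall K x, 0 <= x <= Bs -> 0 <= h K x <= pi) ->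
 (forall k e, 0 < e -> exists K0, forall K, (K0 <= K)%N ->
  `|a * Rintegral nu setT (fun x => x ^+ k) - \int[mu]_(x in `[0, Bs]) (x ^+ k * h K x)| <= e) ->
 (- (pi^-1) * Im (Stieltjes nu (x0 +i* eta)) @[eta --> 0^'+] --> s) ->
 (forall L, Lset L -> 0 <= L <= pi) ->
 (forall delta, 0 < delta -> exists (rho : R) (K0 : nat), 0 < rho /\ forall K, (K0 <= K)%N ->
  exists2 L, Lset L & forall x, x0 - rho <= x <= x0 + rho -> `|h K x - L| <= delta) ->
 forall delta, 0 < delta -> exists2 L, Lset L & `|a * s - L| <= delta.
Proof.
move=> nu0 a0 /andP[x00 x0B] mh hb mom St Lb near delta d0.
have Bs0 : 0 < Bs by lra.
have d4 : 0 < delta / 8 by rewrite divr_gt0.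
have [rho0 [K1 [rho00 HK1]]] := near _ d4.
pose rho := Num.min rho0 (Num.min x0 (Bs - x0)).
have rho_gt0 : 0 < rho by rewrite !lt_min rho00 x00 subr_gt0.
have rl : rho <= rho0 by rewrite ge_min lexx.
have rx : rho <= x0 by rewrite !ge_min lexx !orbT.
have rB : rho <= Bs - x0 by rewrite !ge_min lexx !orbT.
have p0 := pi_gt0 R.
have [T T0 HT] := @atan_near_pi2 (delta / 16) ltac:(by rewrite divr_gt0).
have [e0 e00 He0] : exists2 e0 : R, 0 < e0 & forall eta, 0 < eta < e0 -> `|s - - (pi^-1) * Im (Stieltjes nu (x0 +i* eta))| <= delta / (8 * a).
 move/cvgrPdist_le: St => /(_ (delta / (8 * a)) ltac:(by rewrite divr_gt0 // mulr_gt0)).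
 move=> [d /= dd0 Hd]; exists d => // eta /andP[h1 h2]; apply: Hd => //=.
 by rewrite sub0r normrN gtr0_norm.
(* The three bounds serve the boundary value of the Stieltjes transform, the mass of the kernel
   within rho, and its mass outside. *)
pose eta := Num.min (e0 / 2) (Num.min (rho / T) (delta / 8 * rho ^+ 2 / Bs)).
have r2 : 0 < rho ^+ 2 by rewrite exprn_gt0.
have eta0 : 0 < eta by rewrite !lt_min !divr_gt0 // !mulr_gt0 // divr_gt0.
have et1 : eta < e0 by rewrite gt_min; apply/orP; left; lra.
have et2 : eta <= rho / T by rewrite !ge_min lexx !orbT.
have et3 : eta <= delta / 8 * rho ^+ 2 / Bs by rewrite !ge_min lexx !orbT.
have q1 : pi / 2 - delta / 16 <= atan (rho / eta) <= pi / 2.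
 rewrite (ltW (atan_ltpi2 _)) andbT; apply: HT; rewrite ler_pdivlMr // mulrC -ler_pdivlMr //.
have q2 : eta / rho ^+ 2 * Bs <= delta / 8.
 by move: et3; rewrite ler_pdivlMr // => q; rewrite mulrAC ler_pdivrMr.
have b1 := functional_measure (ltW a0) nu0.
pose A := a * fine (nu setT) + pi * Bs + 1.
have fn0 : 0 <= fine (nu setT) by exact: fine_ge0.
have A0 : 0 < A by rewrite ltr_wpDl // addr_ge0 // mulr_ge0 // ltW.
pose B := Num.max B0 Bs.
have enl (I : (R -> R) -> R) B' A' : bounded_functional I B' A' -> B' <= B -> 0 <= A' -> A' <= A -> bounded_functional I B A.
 move=> [q3 q4] BB A'0 AA; split=> // f e cf ee fe; apply: le_trans (q4 f e cf ee _) _.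
  by move=> x xb; apply: fe; move: xb BB; move: B => bb; lra.
 by rewrite ler_wpM2r.
have A1 : 0 <= a * fine (nu setT) by rewrite mulr_ge0 // ltW.
have A2 : 0 <= pi * Bs by rewrite mulr_ge0 // ltW.
have b1' : bounded_functional (fun f => a * Rintegral nu setT f) B A.
 by apply: enl b1 _ _ _ => //; rewrite /A ?le_max ?lexx //; lra.
have b2 K : bounded_functional (fun f => \int[mu]_(x in `[0, Bs]) (f x * h K x)) B A.
 apply: enl (functional_lebesgue (ltW Bs0) (mh K) (hb K)) _ _ _ => //; rewrite /A ?le_max ?lexx ?orbT //; lra.
have [K2 HK2] := bf_limit A0 b1' b2 mom (@pois_cont eta x0 eta0) (@pois_approx eta x0 B eta0) d4.
pose K := maxn K1 K2.
have [L LL HL] := HK1 K (leq_maxl _ _).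
exists L => //.
have H1 := HK2 K (leq_maxr _ _).
have H2 := @poisson_concentrate (h K) x0 Bs rho (delta / 8) L eta eta0 rho_gt0 (ltW d4) ltac:(lra) ltac:(lra) (mh K) (hb K)
 (fun x xb => HL x ltac:(move: xb rl; lra)).
have H3 := He0 eta ltac:(by rewrite eta0).
rewrite mulNr -mulrN Stieltjes_pois // in H3.
have /andP[L0 Lp] := Lb L LL.
move: H1 H2 H3; set P1 := Rintegral nu setT _; set P2 := Rintegral mu _ _; move: (atan _) q1 => t /andP[t1 t2] H1 H2 H3.
have H3' : `|pi * (a * s) - a * P1| <= pi * (delta / 8).
 have -> : pi * (a * s) - a * P1 = (pi * a) * (s - pi^-1 * P1).
  by rewrite mulrBr mulrA [pi * a]mulrC -!mulrA mulVKf // gt_eqF.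
 have pa : 0 < pi * a by rewrite mulr_gt0.
 rewrite normrM gtr0_norm //; apply: le_trans (ler_wpM2l (ltW pa) H3) _.
 by rewrite le_eqVlt; apply/orP; left; apply/eqP; field; rewrite gt_eqF.
have pi1 : 1 <= pi :> R by apply: le_trans (pi_ge2 R); rewrite ler1n.
have H4 : `|L * (2 * t) - pi * L| <= pi * (delta / 8).
 have -> : L * (2 * t) - pi * L = - (L * (pi - 2 * t)) by ring.
 rewrite normrN normrM (ger0_norm L0) ger0_norm; last by lra.
 by apply: ler_pM => //; lra.
have H2' : `|P2 - L * (2 * t)| <= delta / 8 * pi + pi * (delta / 8).
 apply: le_trans H2 _; apply: lerD; first by rewrite ler_wpM2l ?(ltW d4) //; lra.
 by rewrite -mulrA ler_wpM2l // ltW.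
have H5 : pi * `|a * s - L| <= pi * delta.
 rewrite -[pi in leLHS](ger0_norm (ltW p0)) -normrM mulrBr.
 have -> : pi * (a * s) - pi * L = (pi * (a * s) - a * P1) + (a * P1 - P2) + (P2 - L * (2 * t)) + (L * (2 * t) - pi * L) by ring.
 apply: le_trans (ler_normD _ _) _; apply: le_trans (lerD (ler_normD _ _) (lexx _)) _.
 apply: le_trans (lerD (lerD (ler_normD _ _) (lexx _)) (lexx _)) _.
 have h1 : delta / 8 <= pi * (delta / 8) by rewrite ler_peMl // ltW.
 have -> : pi * delta = 8 * (pi * (delta / 8)) by field.
 apply: le_trans (lerD (lerD (lerD H3' H1) H2') H4) _.
 rewrite [delta / 8 * pi]mulrC; have : 0 <= pi * (delta / 8) by rewrite mulr_ge0 // ltW.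
 move: h1; move: (pi * (delta / 8)) (delta / 8) => A3 A4; clear; lra.
by rewrite -(ler_pM2l p0).
Qed.

End PoissonKernel.

(** * Perturbation of the kernel form, arguments, and limits of Taylor bounds *)

Section KqLinear.
Variable c : R.
Implicit Types (w s : C) (m : R).

Lemma Kq_sub w1 w2 (s1 s2 : C) (m1 m2 : R) (t1 t2 : C) (n1 n2 : R) :
 Kq c w1 w2 s1 s2 m1 m2 = Kq c w1 w2 t1 t2 n1 n2 + Kq c w1 w2 (s1 - t1) (s2 - t2) (m1 - n1) (m2 - n2).
Proof.
rewrite /Kq.
have -> : (s1 * (w2 - c%:C) - s2 * (w1 - c%:C)) * conjc (w2 - w1) =
 (t1 * (w2 - c%:C) - t2 * (w1 - c%:C)) * conjc (w2 - w1) +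
 ((s1 - t1) * (w2 - c%:C) - (s2 - t2) * (w1 - c%:C)) * conjc (w2 - w1) by ring.
by rewrite cReD; ring.
Qed.

Lemma Kq_bound w1 w2 (s1 s2 : C) (m1 m2 : R) : Kq c w1 w2 s1 s2 m1 m2 <=
 cabs (w1 - w2) ^+ 2 * (m1 + m2) +
 2 * cabs (w1 - w2) * (cabs s1 * cabs (w2 - c%:C) + cabs s2 * cabs (w1 - c%:C)).
Proof.
rewrite /Kq; apply: lerD => //.
set z := _ * conjc _.
have h : - Re z <= cabs z by have := Re_le_cabs z; rewrite ler_norml => /andP[]; lra.
have : cabs z <= cabs (w1 - w2) * (cabs s1 * cabs (w2 - c%:C) + cabs s2 * cabs (w1 - c%:C)).
 rewrite /z cabsM cabsJ mulrC cabsBC ler_wpM2l ?cabs_ge0 //.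
 by apply: cabsD_le; rewrite cabsN !cabsM.
by rewrite -mulrA; move: h; move: (cabs z) (Re z) (cabs (w1 - w2) * _) => a b d; lra.
Qed.

(** Comparison with the same real value x at both points, where the form vanishes by [KqE]. *)
Lemma Kq_approx w1 w2 (s1 s2 : C) (m1 m2 x : R) : Kq c w1 w2 s1 s2 m1 m2 <=
 cabs (w1 - w2) ^+ 2 * ((m1 - x) + (m2 - x)) +
 2 * cabs (w1 - w2) * (cabs (s1 - x%:C) * cabs (w2 - c%:C) + cabs (s2 - x%:C) * cabs (w1 - c%:C)).
Proof. by rewrite (Kq_sub w1 w2 s1 s2 m1 m2 x%:C x%:C x x) KqE subrr mul0r add0r; exact: Kq_bound. Qed.

End KqLinear.

Lemma cabs_lip (z w : C) : `|cabs z - cabs w| <= cabs (z - w).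
Proof.
have h1 := cabsB_ge z w; have h2 := cabsB_ge w z; rewrite cabsBC in h2.
by rewrite ler_norml; apply/andP; split; lra.
Qed.

Lemma ang_near (w z : C) : 0 < Im w -> cabs (z - w) <= Im w / 2 ->
 `|ang z - ang w| <= 2 / Im w * cabs (z - w).
Proof.
move=> w0 zw.
have i0 (y : C) : cabs (y - w) <= Im w / 2 -> Im w / 2 <= Im y.
 by move=> h; have := Im_le_cabs (y - w); rewrite cImB ler_norml => /andP[]; lra.
have z0 := i0 z zw.
have sg s : 0 <= s <= 1 -> Im w / 2 <= Im (seg w z s).
 move=> s01; apply: i0; apply: le_trans zw.
 by have [] := @segE w z s s01 (ltW w0) ltac:(lra).
have sc_ s : 0 <= s <= 1 -> Im w / 2 <= cabs (seg w z s).
 by move=> /sg h; apply: le_trans (Im_le_cabs _); rewrite ger0_norm //; lra.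
apply: (@seg_MVT lg (fun s => (seg w z s)^-1) w z).
- move=> s s01; rewrite mulrC; apply: rder_lg; last exact: rder_line.
  by have := sg s s01; lra.
 by rewrite -cabs_gt0; have := sc_ s s01; lra.
- move=> s s01; rewrite cabsV -[2 / Im w]invf_div lef_pV2 ?posrE ?divr_gt0 //; first exact: sc_.
 by have := sc_ s s01; lra.
Qed.

(** Im z/|z| is the sine of the argument, so a small ratio puts the argument near an end of [0, pi].
    It is located through its cosine, from which [carg] is defined. *)
Lemma ang_extreme (z : C) (d : R) : 0 <= Im z -> z != 0 -> 0 < d < pi / 2 ->
 Im z < cabs z * sin d -> ang z <= d \/ pi - d <= ang z.
Proof.
move=> z0 zn /andP[d0 dp] lt; have p0 := pi_gt0 R.
have /andP[a0 a1] := ang_bound z0 zn.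
have [h|h] := leP (ang z) d; [by left|right].
rewrite leNgt; apply/negP => h2.
have cz : 0 < cabs z by rewrite cabs_gt0.
have R1 : -1 <= Re z / cabs z <= 1.
 by rewrite -ler_norml normrM normfV (ger0_norm (cabs_ge0 z)) ler_pdivrMr // mul1r Re_le_cabs.
have cE : cos (ang z) = Re z / cabs z by rewrite ang_carg // /carg z0 acosK.
have c1 : cos (ang z) < cos d by rewrite ltr_cos // in_itv /=; apply/andP; split; lra.
have c2 : - cos d < cos (ang z).
 have -> : - cos d = cos (pi - d) by rewrite cosB cospi sinpi; ring.
 by rewrite ltr_cos // in_itv /=; apply/andP; split; lra.
have sd : 0 < sin d by apply: sin_gt0_pihalf; rewrite d0.
rewrite cE in c1 c2; set r := Re z / cabs z in c1 c2 R1.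
have rE : Re z = r * cabs z by rewrite /r mulfVK // gt_eqF.
have sq : Im z ^+ 2 = cabs z ^+ 2 * (1 - r ^+ 2).
 by have := cabs_sq z; rewrite rE => E; rewrite mulrBr mulr1 {1}E; ring.
have sq2 : cabs z ^+ 2 * sin d ^+ 2 <= Im z ^+ 2.
 rewrite sq ler_wpM2l ?sqr_ge0 // sin2cos2 lerD2l lerN2.
 by move: c1 c2; clear; move: (cos d) r => a b; nra.
have : Im z ^+ 2 < (cabs z * sin d) ^+ 2 by rewrite ltrXn2r ?nnegrE // mulr_ge0 ?cabs_ge0 // ltW.
by rewrite exprMn ltNge sq2.
Qed.

(** Comparing the Taylor bounds for two values of K at one small step h shows that the coefficients
    D K form a Cauchy sequence. The limit then inherits a derivative and the same quadratic bound
    from mere pointwise convergence. *)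
Lemma quad_limit (F : nat -> C -> C) (G : C -> C) (D : nat -> C) (w0 : C) (d A : R) (K1 : nat) :
 0 < d -> 0 <= A ->
 (forall w, cabs (w - w0) < d -> forall e, 0 < e -> exists K0, forall K, (K0 <= K)%N -> cabs (G w - F K w) <= e) ->
 (forall K w, (K1 <= K)%N -> cabs (w - w0) < d ->
  cabs (F K w - F K w0 - (w - w0) * D K) <= A * cabs (w - w0) ^+ 2) ->
 exists dd, forall w, cabs (w - w0) < d -> cabs (G w - G w0 - (w - w0) * dd) <= A * cabs (w - w0) ^+ 2.
Proof.
move=> d0 A0 FG tay.
have w00 : cabs (w0 - w0) < d by rewrite subrr cabs0.
have [dd Hdd] : exists dd, D @ \oo --> (dd : C).
 apply: cabs_cauchy => e e0.
 (* Small enough that the Taylor error A h^2 is at most e h/8, the precision then asked of the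
    pointwise convergence. *)
 pose h := Num.min (d / 2) (e / (8 * (A + 1))).
 have h0 : 0 < h by rewrite lt_min !divr_gt0 // mulr_gt0 // ltr_wpDl.
 have hd : h < d by rewrite gt_min; apply/orP; left; lra.
 have he : A * h <= e / 8.
  apply: le_trans (_ : A * (e / (8 * (A + 1))) <= _); first by rewrite ler_wpM2l // ge_min lexx orbT.
  have -> : A * (e / (8 * (A + 1))) = e / 8 * (A / (A + 1)) by field; rewrite gt_eqF // ltr_wpDl.
  by rewrite ler_piMr ?divr_ge0 ?(ltW e0) // ler_pdivrMr ?ltr_wpDl // mul1r lerDl.
 pose w := w0 + h%:C.
 have wE : w - w0 = h%:C by rewrite /w; ring.
 have wd : cabs (w - w0) < d by rewrite wE cabsR gtr0_norm.
 have eh : 0 < e * h / 8 by rewrite divr_gt0 // mulr_gt0.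
 have [Ka HKa] := FG w wd _ eh; have [Kb HKb] := FG w0 w00 _ eh.
 exists (Ka + Kb + K1)%N => N hN.
 have est L : (Ka + Kb + K1 <= L)%N -> cabs (G w - G w0 - h%:C * D L) <= 3 * (e * h / 8).
  move=> hL; have h1 := HKa L ltac:(by rewrite (leq_trans _ hL) // -addnA leq_addr).
  have h2 := HKb L ltac:(by rewrite (leq_trans _ hL) // addnAC leq_addl).
  have h3 := tay L w ltac:(by rewrite (leq_trans _ hL) // leq_addl) wd.
  rewrite wE cabsR gtr0_norm // in h3.
  have -> : G w - G w0 - h%:C * D L = (G w - F L w) - (G w0 - F L w0) + (F L w - F L w0 - h%:C * D L) by ring.
  apply: cabsD_le; apply: le_trans (lerD (cabsD _ _) (lexx _)) _; rewrite cabsN.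
  have : A * h ^+ 2 <= e * h / 8 by rewrite expr2 mulrA [leRHS]mulrAC ler_wpM2r // ltW.
  by move: h1 h2 h3; lra.
 have q1 := est N hN; have q2 := est _ (leqnn _).
 rewrite -(ler_pM2l h0) -{1}(gtr0_norm h0) -cabsR -cabsM.
 have -> : h%:C * (D N - D (Ka + Kb + K1)%N) =
  (G w - G w0 - h%:C * D (Ka + Kb + K1)%N) - (G w - G w0 - h%:C * D N) by ring.
 apply: cabsD_le; rewrite cabsN; apply: le_trans (lerD q2 q1) _.
 by have := mulr_gt0 e0 h0; rewrite [h * e]mulrC; lra.
exists dd => w wd; apply/ler_addgt0Pr => e e0.
pose q := e / (3 * (1 + cabs (w - w0))).
have p1 : 0 < 1 + cabs (w - w0) by rewrite ltr_pwDl // cabs_ge0.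
have q0 : 0 < q by rewrite divr_gt0 // mulr_gt0.
have [Ka HKa] := FG w wd _ q0; have [Kb HKb] := FG w0 w00 _ q0.
move/cvg_cabsP: Hdd => /(_ q q0) [Kc _ HKc].
pose L := (Ka + Kb + Kc + K1)%N.
have h1 := HKa L ltac:(by rewrite /L -!addnA leq_addr).
have h2 := HKb L ltac:(by rewrite /L [(Ka + Kb)%N]addnC -!addnA leq_addr).
have h3 := HKc L ltac:(by rewrite /L /= addnAC leq_addl).
have h4 := tay L w ltac:(by rewrite /L leq_addl) wd.
have -> : G w - G w0 - (w - w0) * dd = (G w - F L w) - (G w0 - F L w0) + (w - w0) * (D L - dd) +
  (F L w - F L w0 - (w - w0) * D L) by ring.
apply: cabsD_le; rewrite addrC; apply: lerD => //.
apply: cabsD_le; apply: le_trans (lerD (cabsD _ _) (lexx _)) _; rewrite cabsN cabsM.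
have -> : e = q + q + (q + cabs (w - w0) * q + 2 * cabs (w - w0) * q) by rewrite /q; field; rewrite gt_eqF.
have h5 : cabs (w - w0) * cabs (D L - dd) <= cabs (w - w0) * q by rewrite ler_wpM2l ?cabs_ge0 // ltW.
have : 0 <= cabs (w - w0) * q by rewrite mulr_ge0 ?cabs_ge0 // ltW.
by rewrite -mulrA; move: h1 h2 h5; set c1 := cabs (w - w0) * q; set c2 := cabs (w - w0) * _; lra.
Qed.

Lemma complex_cluster (z : nat -> C) (Q : R) : (forall n, cabs (z n) <= Q) ->
 exists w0 : C, forall (d : R) N, 0 < d -> exists2 n, (N <= n)%N & cabs (z n - w0) < d.
Proof.
move=> zQ; pose A : set (R * R) := `[- Q, Q]%classic `*` `[- Q, Q]%classic.
have cA : compact A by apply: compact_setX; exact: segment_compact.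
pose f n : R * R := (Re (z n), Im (z n)).
have fA : (f @ \oo) A.
 exists 0%N => // n _; rewrite /A /f /=; split=> /=; rewrite in_itv /= -ler_norml.
  exact: le_trans (Re_le_cabs _) (zQ n).
 exact: le_trans (Im_le_cabs _) (zQ n).
have [p [_ cl]] := cA (f @ \oo) _ fA.
exists (p.1 +i* p.2) => d N d0.
have d2 : 0 < d / 2 by rewrite divr_gt0.
have U : (f @ \oo) [set q | exists2 n, (N <= n)%N & q = f n] by exists N => // n /= Nn; exists n.
have [q [[n Nn ->] [b1 b2]]] := cl _ _ U (nbhsx_ballx p (d / 2) d2).
exists n => //; apply: le_lt_trans (cabs_le_ReIm _) _; rewrite cReB cImB /=.
by move: b1 b2; rewrite /ball /= /f /= => b1 b2; rewrite [`|Re _ - _|]distrC [`|Im _ - _|]distrC; lra.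
Qed.

Lemma near_Im (w z : C) : `|Im z - Im w| <= cabs (z - w).
Proof. by rewrite -cImB Im_le_cabs. Qed.

(** * Contour integrals evaluated on arcs where the product is close to 1 *)

Section ArcIntegral.
Variable g : R -> C.
Hypotheses (gC1 : piecewise_C1 g) (gcl : g 0 = g 1) (gpos : positively_oriented g) (g0 : Int g 0).
Variable zs : seq (R * R).
Hypothesis zsC : cfg zs.

Let Pl := 0 :: map snd (gen zs).

(** Counterpart of [powdiv] built on the expansion kap (1 + sum r/(w - p)), for configurations
    without a zero c to factor out. *)
Fixpoint gpowdiv (k : nat) : C -> C :=
 if k is j.+1 then fun z => (kap zs)%:C * gpowdiv j z + 1%:C * \sum_(i <- gen zs) (kap zs * rsd zs i)%:C *
   (if i \in gen zs then gpowdiv j z * (z - i.2%:C)^-1 else gpowdiv j z)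
 else inv_prod [:: 0].

Lemma gpowdiv_pfrac k : pfrac Pl (gpowdiv k).
Proof.
elim: k => [|k ih] /=.
 by apply: Pfrac0 => a; rewrite inE => /eqP ->; rewrite mem_head.
apply: PfracL => //.
apply: (@pfrac_sum Pl _ (gen zs) (fun i => kap zs * rsd zs i)
 (fun i z => if i \in gen zs then gpowdiv k z * (z - i.2%:C)^-1 else gpowdiv k z)).
move=> i; case ig: (i \in gen zs); last exact: ih.
by apply: pfrac_inv => //; rewrite inE map_f ?orbT.
Qed.

Lemma gpowdivE k z : (forall a, a \in Pl -> z != a%:C) -> gpowdiv k z = gS zs z ^+ k / z.
Proof.
move=> hz; elim: k => [|k ih] /=.
 by rewrite /inv_prod big_seq1 subr0 expr0 mul1r.
rewrite ih exprS -[RHS]mulrA; move: (_ ^+ k / z) => X.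
rewrite {1}/gS rmorph1 mul1r mulrDr mulr1 mulrDl; congr (_ + _).
rewrite mulr_sumr mulr_suml; apply: eq_big_seq => i ig; rewrite ig rmorphM /=.
by rewrite -!mulrA; congr (_ * (_ * _)); rewrite mulrC.
Qed.

(** Along the half-circle z = r exp(it) the derivative of Im P - t is Re(f(z) z - 1), and t runs
    from 0 to pi. *)
Lemma arc_MVT (P f : C -> C) (r d : R) : 0 < r -> (forall a, a \in Pl -> a != r) -> primU Pl P f ->
 (forall z, cabs z = r -> cabs (f z * z - 1) <= d) ->
 `|Im (P (- r)%:C) - Im (P r%:C) - pi| <= d * pi.
Proof.
move=> r0 rP PU fd; have p0 := pi_gt0 R.
pose h t : C := (r * cos t) +i* (r * sin t).
have hr t : cabs (h t) = r.
 by rewrite /cabs /= !exprMn -mulrDr cos2Dsin2 mulr1 sqrtr_sqr gtr0_norm.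
have dh t : rder h t ('i * h t).
 apply: rder_ReIm; rewrite ?cReM ?cImM /=.
  apply: rd_eq (rdM (rdC r t) (is_derive_cos t)) _; ring.
 apply: rd_eq (rdM (rdC r t) (is_derive_sin t)) _; ring.
have hn t : h t != 0 by rewrite -cabs_gt0 hr.
have hP t a : 0 <= t <= pi -> a \in Pl -> h t != a%:C.
 move=> tp aP; apply/eqP => E; have := hr t; rewrite E cabsR => aR.
 move: aP; rewrite inE => /orP[/eqP a0|am]; first by move: r0; rewrite -aR a0 normr0 ltxx.
 have [i ig ai] := mapP am; have a0 : 0 < a.
  by move: ig; rewrite mem_gen => /andP[_ iz]; have [_ q _] := cfg_pos zsC iz; rewrite ai.
 by have := rP a; rewrite inE am orbT => /(_ isT); rewrite -aR gtr0_norm // eqxx.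
pose F t := Im (P (h t)) - t.
have dF t : 0 <= t <= pi -> is_derive t 1 F (Re (f (h t) * h t - 1)).
 move=> tp; have i0 : 0 <= Im (h t) by rewrite /= mulr_ge0 ?(ltW r0) // sin_ge0_pi.
 have := rder_Im (PU h t _ i0 (fun a => hP t a tp) (dh t)) => q.
 apply: rd_eq (rdD q (is_deriveN (is_derive_id t 1))) _.
 by rewrite mulrCA cImM cReB /=; ring.
have [||s s01 E] := @MVT_segment R F (fun t => Re (f (h t) * h t - 1)) 0 pi (ltW p0).
- by move=> s; rewrite in_itv /= => /andP[a b]; apply: dF; rewrite !ltW.
- apply: continuous_in_subspaceT => s; rewrite inE /= in_itv /= => s01.
 by have [/derivable1_diffP/differentiable_continuous] := dF s s01.
move: E; rewrite /F /h cos0 sin0 cospi sinpi !mulr0 mulr1 mulrN1 !subr0.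
have -> : Im (P (- r +i* 0)) - pi - Im (P (r +i* 0)) = Im (P (- r)%:C) - Im (P r%:C) - pi by ring.
move=> ->; rewrite normrM (gtr0_norm p0) ler_wpM2r ?(ltW p0) //.
by apply: le_trans (Re_le_cabs _) (fd _ (hr s)).
Qed.

Lemma arc_contour k (r d : R) : 0 < r ->
 (forall i, i \in gen zs -> (i.2 < r /\ Int g i.2%:C) \/ (r < i.2 /\ ~ curve g i.2%:C /\ ~ Int g i.2%:C)) ->
 (forall z, cabs z = r -> cabs (gS zs z ^+ k - 1) <= d) ->
 cabs (cint g (fun z => gS zs z ^+ k / z) - 2 * 'i * pi%:C) <= 2 * (d * pi).
Proof.
move=> r0 poles Sd.
have good a : a \in Pl -> - r < a /\ ((a < r /\ Int g a%:C) \/ (r < a /\ ~ curve g a%:C /\ ~ Int g a%:C)).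
 rewrite inE => /orP[/eqP ->|/mapP[i ig ->]]; first by split; [rewrite oppr_lt0|left].
 split; last exact: poles.
 move: ig; rewrite mem_gen => /andP[_ iz]; have [_ q _] := cfg_pos zsC iz.
 by apply: lt_trans q; rewrite oppr_lt0.
have [_ [P [PU PI]]] := pfrac_has_prim gC1 gcl gpos good (gpowdiv_pfrac k).
have -> : cint g (fun z => gS zs z ^+ k / z) = 2 * 'i * (Im (P (- r)%:C) - Im (P r%:C))%:C.
 rewrite -PI; apply: eq_cint => s s01; rewrite gpowdivE // => a aP.
 exact: (Pl_neq good aP s01 erefl).
have rP a : a \in Pl -> a != r.
 by move=> /good[_ [[h _]|[h _]]]; rewrite ?(lt_eqF h) ?(gt_eqF h).
have PU' : primU Pl P (fun z => gS zs z ^+ k / z).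
 by move=> h s v i0 hP dh; rewrite -gpowdivE //; exact: PU.
rewrite -mulrBr -rmorphB !cabsM cabsR cabs_i.
have -> : cabs (2 : C) = 2.
 have -> : (2 : C) = (2 : R)%:C by rewrite rmorph_nat.
 by rewrite cabsR ger0_norm.
rewrite mulr1 ler_pM2l //; apply: (@arc_MVT P (fun z => gS zs z ^+ k / z)) => // z zr.
rewrite mulfVK; first exact: Sd.
by rewrite -cabs_gt0 zr.
Qed.

(** The contour integral does not depend on the arc, and can be compared with arcs on which the
    product is as close to 1 as desired; hence an equality. *)
Lemma arcs_contour k : (forall d : R, 0 < d -> exists r : R, [/\ 0 < r,
  forall i, i \in gen zs -> (i.2 < r /\ Int g i.2%:C) \/ (r < i.2 /\ ~ curve g i.2%:C /\ ~ Int g i.2%:C) &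
  forall z, cabs z = r -> cabs (gS zs z - 1) <= d]) ->
 cint g (fun z => gS zs z ^+ k / z) = 2 * 'i * pi%:C.
Proof.
move=> H; apply: cabs_le0_eq; apply/ler_addgt0Pr => e e0; rewrite add0r.
have p0 := pi_gt0 R.
(* From |z^k - 1| <= k 2^k |z - 1| for |z| <= 2. *)
pose X := k%:R * 2 ^+ k + 1 : R.
have X0 : 0 < X by rewrite ltr_wpDl // mulr_ge0 ?exprn_ge0.
pose d := Num.min 1 (e / (2 * pi * X)).
have d0 : 0 < d by rewrite lt_min ltr01 divr_gt0 // !mulr_gt0.
have [r [r0 poles Sr]] := H d d0.
apply: le_trans (arc_contour r0 poles (d := k%:R * 2 ^+ k * d) _) _.
 move=> z zr; rewrite -[X in _ - X](expr1n _ k); have h := Sr z zr.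
 apply: le_trans (cabs_expB (M := 2) k _ _ _) _; rewrite ?ler1n ?cabs1 ?ler1n //.
  apply: le_trans (cabs_near1 _) _; have : d <= 1 by rewrite ge_min lexx.
  lra.
 by rewrite ler_wpM2l // mulr_ge0 ?exprn_ge0.
apply: le_trans (_ : 2 * pi * X * d <= _); last first.
 rewrite -ler_pdivlMl ?mulr_gt0 // mulrC; apply: le_trans (_ : e / (2 * pi * X) <= _) => //.
 by rewrite ge_min lexx orbT.
rewrite /X; have : 0 <= pi * d by rewrite mulr_ge0 // ltW.
move: (k%:R * 2 ^+ k) => Y q; have -> : 2 * pi * (Y + 1) * d = 2 * (Y * d * pi) + 2 * (pi * d) by ring.
by rewrite lerDl mulr_ge0.
Qed.

End ArcIntegral.

(** * Configurations of a single sign *)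

Section PureConfiguration.
Variable zs : seq (R * R).
Hypothesis zsC : cfg zs.

Lemma genP i : i \in gen zs -> i \in zs /\ 0 < i.2.
Proof. by rewrite mem_gen => /andP[_ iz]; have [_ q _] := cfg_pos zsC iz. Qed.

Lemma kap_minus : all isM zs -> kap zs = 1.
Proof. by move=> /allP H; rewrite /kap big_seq big1 // => i /H ->. Qed.

Lemma offg0 : offg zs 0.
Proof. by move=> i /genP[_ p0]; rewrite eq_sym (inj_eq CI) gt_eqF. Qed.

Lemma gS0 : ~~ has isM zs -> gS zs 0 = 1.
Proof.
move=> /hasPn H; rewrite -rawp_gS //; last first.
 by move=> i iz; have [_ q _] := cfg_pos zsC iz; rewrite eq_sym (inj_eq CI) gt_eqF.
by rewrite /rawp big_seq big1 // => i iz; rewrite /fac (negbTE (H i iz)) !mul0r subr0 divr1.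
Qed.

Lemma gS_infty (d : R) : all isM zs -> 0 < d -> exists r0 : R, forall z, r0 <= cabs z ->
 (forall i, i \in gen zs -> i.2 < r0) /\ offg zs z /\ cabs (gS zs z - 1) <= d.
Proof.
move=> aM d0; have [T HT] := seq_strict_ub (map snd (gen zs)).
pose A := \sum_(i <- gen zs) `|rsd zs i|.
have A0 : 0 <= A by rewrite sumr_ge0.
pose r0 := `|T| + A / d + 1.
have Ad : 0 <= A / d by rewrite divr_ge0 // ltW.
have far z i : r0 <= cabs z -> i \in gen zs -> A / d + 1 <= cabs (z - i.2%:C).
 move=> zr ig; have [_ p0] := genP ig; have := HT _ (map_f snd ig) => pT.
 have := cabsB_ge z i.2%:C; rewrite cabsR (gtr0_norm p0); have := ler_norm T.
 by move: zr; rewrite /r0; lra.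
exists r0 => z zr; split=> [i ig|].
 by have := HT _ (map_f snd ig); rewrite /r0; have := ler_norm T; lra.
split.
 move=> i ig; rewrite -subr_eq0 -cabs_gt0; apply: lt_le_trans (far z i zr ig); lra.
rewrite /gS (kap_minus aM) mul1r addrAC subrr add0r.
apply: le_trans (cabs_sum _ _ _) _.
apply: le_trans (_ : \sum_(i <- gen zs) `|rsd zs i| * (A / d + 1)^-1 <= _).
 rewrite big_seq [leRHS]big_seq; apply: ler_sum => i ig.
 have f := far z i zr ig; rewrite cabsM cabsR cabsV ler_wpM2l // lef_pV2 ?posrE //; lra.
rewrite -mulr_suml -/A ler_pdivrMr; last lra.
rewrite mulrDr mulr1 mulrC divfK ?gt_eqF //; lra.
Qed.

Lemma Im_gS (w : C) : Im (gS zs w) = - (kap zs * Im w * \sum_(i <- gen zs) rsd zs i / cabs (w - i.2%:C) ^+ 2).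
Proof.
rewrite /gS cImZ cImD Im_sum /= add0r -mulrA -mulrN; congr (_ * _).
rewrite mulr_sumr -sumrN; apply: eq_bigr => i _.
by rewrite cImZ cImV cImB /= subr0; ring.
Qed.

(** With one sign the residues all have the same sign, so Im S/Im w is a sum without cancellation.
    The weights q are to be chosen so that their total is known from a value on the negative
    axis. *)
Lemma Im_gS_lower (w : C) (k : R) (q : R * R -> R) : all isM zs \/ ~~ has isM zs ->
 (forall i, i \in gen zs -> k * q i <= (cabs (w - i.2%:C) ^+ 2)^-1) ->
 1 <= kap zs * \sum_(i <- gen zs) `|rsd zs i| * q i -> 0 <= k ->
 k * `|Im w| <= `|Im (gS zs w)|.
Proof.
move=> sg kq q1 k0; have kp := kap_gt0 zsC.
rewrite Im_gS normrN !normrM (gtr0_norm kp).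
have -> : `|\sum_(i <- gen zs) rsd zs i / cabs (w - i.2%:C) ^+ 2| = \sum_(i <- gen zs) `|rsd zs i| / cabs (w - i.2%:C) ^+ 2.
 case: sg => [/allP aM|/hasPn aM].
  have -> : \sum_(i <- gen zs) `|rsd zs i| / cabs (w - i.2%:C) ^+ 2 = - \sum_(i <- gen zs) rsd zs i / cabs (w - i.2%:C) ^+ 2.
   rewrite -sumrN; apply: eq_big_seq => i ig; have [iz _] := genP ig.
   by have := rsd_sign zsC iz; rewrite (aM i iz) => h; rewrite ler0_norm // mulNr.
  rewrite ler0_norm // big_seq sumr_le0 // => i ig; have [iz _] := genP ig.
  have := rsd_sign zsC iz; rewrite (aM i iz) => h.
  by rewrite mulr_le0_ge0 // invr_ge0 sqr_ge0.
 have -> : \sum_(i <- gen zs) `|rsd zs i| / cabs (w - i.2%:C) ^+ 2 = \sum_(i <- gen zs) rsd zs i / cabs (w - i.2%:C) ^+ 2.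
  apply: eq_big_seq => i ig; have [iz _] := genP ig.
  by have := rsd_sign zsC iz; rewrite (negbTE (aM i iz)) => h; rewrite ger0_norm.
 rewrite ger0_norm // big_seq sumr_ge0 // => i ig; have [iz _] := genP ig.
 have := rsd_sign zsC iz; rewrite (negbTE (aM i iz)) => h.
 by rewrite divr_ge0 // sqr_ge0.
have sle : k * \sum_(i <- gen zs) `|rsd zs i| * q i <= \sum_(i <- gen zs) `|rsd zs i| / cabs (w - i.2%:C) ^+ 2.
 rewrite mulr_sumr big_seq [leRHS]big_seq; apply: ler_sum => i ig.
 by rewrite mulrCA ler_wpM2l // kq.
have h1 := ler_wpM2l (ltW kp) sle.
have h2 : k <= kap zs * (k * \sum_(i <- gen zs) `|rsd zs i| * q i) by rewrite mulrCA ler_peMr.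
by rewrite mulrAC ler_wpM2r // (le_trans h2 h1).
Qed.

Lemma gS_neg (s : R) : 0 < s -> gS zs (- s)%:C = (pr zs s)%:C.
Proof. by move=> s0; rewrite -rawp_gS //; [exact: rawp_neg|exact: offr_neg]. Qed.

(** Here q = 1/e: S(-e) = 1 + sum |r|/(e + p) >= 2 bounds the sum of |r|/e from below by 1. *)
Lemma minus_lower (w : C) (e H : R) : all isM zs -> 0 < e -> 2 <= pr zs e -> 0 <= H ->
 (forall i, i \in zs -> i.2 <= H) -> w != 0 ->
 (forall i, i \in gen zs -> w != i.2%:C) ->
 e / (cabs w + H) ^+ 2 * `|Im w| <= `|Im (gS zs w)|.
Proof.
move=> aM e0 pr2 H0 pH w0 wp; have cw : 0 < cabs w by rewrite cabs_gt0.
have den : 0 < cabs w + H by rewrite ltr_pwDl.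
apply: (@Im_gS_lower w _ (fun=> e^-1)); first by left.
- move=> i ig; rewrite mulrAC divff ?gt_eqF // mul1r lef_pV2 ?posrE ?exprn_gt0 ?cabs_gt0 ?subr_eq0 ?wp //.
 rewrite lerXn2r ?nnegrE ?cabs_ge0 ?(ltW den) //; apply: cabsD_le.
 by have [iz p0] := genP ig; rewrite cabsN cabsR (gtr0_norm p0) lerD2l pH.
- rewrite (kap_minus aM) mul1r.
 have := gS_neg e0; rewrite /gS (kap_minus aM) mul1r => /(congr1 (@Re R)).
 rewrite cReD Re_sum /= => E.
 have : 1 <= \sum_(i <- gen zs) Re ((rsd zs i)%:C / ((- e)%:C - i.2%:C)) by move: pr2; rewrite -E; lra.
 move=> h; apply: le_trans h _; rewrite big_seq [leRHS]big_seq; apply: ler_sum => i ig.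
 have [iz p0] := genP ig; have := rsd_sign zsC iz; rewrite (allP aM i iz) => rs.
 rewrite -rmorphB -fmorphV -rmorphM /= ler0_norm // -opprD invrN mulrN -mulNr.
 by rewrite ler_wpM2l ?oppr_ge0 // lef_pV2 ?posrE ?addr_gt0 // lerDl ltW.
- by rewrite divr_ge0 ?sqr_ge0 // ltW.
Qed.

(** Here S(0) = 1, and S(-e) - S(0) = kap times the sum of r e/(p (e + p)), which dictates q. *)
Lemma plus_lower (w : C) (e L : R) : ~~ has isM zs -> 0 < e -> 2 <= pr zs e -> 0 <= L ->
 (forall i, i \in zs -> i.2^-1 <= L) -> w != 0 -> (forall i, i \in gen zs -> w != i.2%:C) ->
 (e * (1 + cabs w * L) ^+ 2)^-1 * `|Im w| <= `|Im (gS zs w)|.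
Proof.
move=> aM e0 pr2 L0 pL w0 wp; have cw : 0 < cabs w by rewrite cabs_gt0.
have den : 0 < 1 + cabs w * L by rewrite ltr_pwDl // mulr_ge0 // ltW.
apply: (@Im_gS_lower w _ (fun i => e / (i.2 * (e + i.2)))); first by right.
- move=> i ig; have [iz p0] := genP ig.
 have ep : 0 < e + i.2 by rewrite addr_gt0.
 have -> : (e * (1 + cabs w * L) ^+ 2)^-1 * (e / (i.2 * (e + i.2))) = ((1 + cabs w * L) ^+ 2 * (i.2 * (e + i.2)))^-1.
  by field; rewrite !gt_eqF.
 rewrite lef_pV2 ?posrE ?mulr_gt0 ?exprn_gt0 ?cabs_gt0 ?subr_eq0 ?wp //.
 apply: le_trans (_ : ((1 + cabs w * L) * i.2) ^+ 2 <= _); last first.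
  by rewrite exprMn ler_wpM2l ?sqr_ge0 // expr2 ler_wpM2l ?(ltW p0) // lerDr ltW.
 rewrite lerXn2r ?nnegrE ?cabs_ge0 ?mulr_ge0 ?(ltW den) ?(ltW p0) //.
 apply: cabsD_le; rewrite cabsN cabsR (gtr0_norm p0) mulrDl mul1r addrC lerD2l.
 rewrite -mulrA ler_peMr ?(ltW cw) // -ler_pdivrMr // div1r; exact: pL.
- have kp := kap_gt0 zsC.
 have := gS_neg e0; have := gS0 aM; rewrite /gS => /(congr1 (@Re R)) + /(congr1 (@Re R)).
 rewrite !cReZ !cReD !Re_sum /= => E0 Ee.
 have : 1 <= kap zs * (1 + \sum_(i <- gen zs) Re ((rsd zs i)%:C / ((- e)%:C - i.2%:C))) -
   kap zs * (1 + \sum_(i <- gen zs) Re ((rsd zs i)%:C / (0 - i.2%:C))) by rewrite E0 Ee; lra.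
 rewrite -mulrBr => h; apply: le_trans h _; rewrite ler_pM2l // opprD addrACA subrr add0r -sumrB.
 rewrite big_seq [leRHS]big_seq; apply: ler_sum => i ig.
 have [iz p0] := genP ig; have := rsd_sign zsC iz; rewrite (negbTE (hasPn aM i iz)) => rs.
 have -> : (0 : C) = (0 : R)%:C by [].
 rewrite -!rmorphB -!fmorphV -!rmorphM /= ger0_norm // -mulrBr ler_wpM2l //.
 have h1 : - e - i.2 != 0 by rewrite -opprD oppr_eq0 gt_eqF // addr_gt0.
 have h2 : e + i.2 != 0 by rewrite gt_eqF // addr_gt0.
 have h3 : i.2 != 0 by rewrite gt_eqF.
 by rewrite sub0r le_eqVlt; apply/orP; left; apply/eqP; field; rewrite ?h1 ?h2 ?h3.
- by rewrite invr_ge0 mulr_ge0 ?sqr_ge0 // ltW.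
Qed.

End PureConfiguration.

(** * Joint continuity in the column and the point *)

Section JointContinuity.
Variables (chi0 : R) (w0 : C).

Definition joint (f : R -> C -> C) := forall e : R, 0 < e -> exists2 d : R, 0 < d &
 forall chi w, `|chi - chi0| < d -> cabs (w - w0) < d -> cabs (f chi w - f chi0 w0) <= e.

Lemma joint_cst (k : C) : joint (fun _ _ => k).
Proof. by move=> e e0; exists 1 => // chi w _ _; rewrite subrr cabs0 ltW. Qed.

Lemma joint_var : joint (fun _ w => w).
Proof. by move=> e e0; exists e => // chi w _ /ltW. Qed.

Lemma joint_real (p : R -> R) : {for chi0, continuous p} -> joint (fun chi _ => (p chi)%:C).
Proof.
move=> /cvgrPdist_le cp e /cp[d /= d0 Hd]; exists d => // chi w cd _.
by rewrite -rmorphB cabsR distrC; apply: Hd; rewrite /= distrC.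
Qed.

Lemma joint_sub f h : joint f -> joint h -> joint (fun chi w => f chi w - h chi w).
Proof.
move=> jf jh e e0; have e2 : 0 < e / 2 by rewrite divr_gt0.
have [d1 d10 H1] := jf _ e2; have [d2 d20 H2] := jh _ e2.
exists (Num.min d1 d2) => [|chi w]; first by rewrite lt_min d10.
rewrite !lt_min => /andP[c1 c2] /andP[v1 v2].
have -> : f chi w - h chi w - (f chi0 w0 - h chi0 w0) = (f chi w - f chi0 w0) - (h chi w - h chi0 w0) by ring.
by apply: cabsD_le; rewrite cabsN [leRHS]splitr lerD ?H1 ?H2.
Qed.

Lemma joint_mul f h : joint f -> joint h -> joint (fun chi w => f chi w * h chi w).
Proof.
move=> jf jh e e0; set F := f chi0 w0; set H := h chi0 w0.
have Hp : 0 < cabs H + 1 by rewrite ltr_wpDl ?cabs_ge0.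
have Fp : 0 < cabs F + 1 by rewrite ltr_wpDl ?cabs_ge0.
have e1 : 0 < e / (2 * (cabs H + 1)) by rewrite divr_gt0 // mulr_gt0.
have e2 : 0 < Num.min 1 (e / (2 * (cabs F + 1))) by rewrite lt_min ltr01 divr_gt0 // mulr_gt0.
have [d1 d10 H1] := jf _ e1; have [d2 d20 H2] := jh _ e2.
exists (Num.min d1 d2) => [|chi w]; first by rewrite lt_min d10.
rewrite !lt_min => /andP[c1 c2] /andP[v1 v2].
have h1 := H1 chi w c1 v1; have := H2 chi w c2 v2; rewrite le_min => /andP[h2 h3].
rewrite -/F -/H in h1 h2 h3 *.
have -> : f chi w * h chi w - F * H = (f chi w - F) * h chi w + F * (h chi w - H) by ring.
apply: cabsD_le; rewrite !cabsM [leRHS]splitr; apply: lerD.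
 have hb : cabs (h chi w) <= cabs H + 1 by have := cabsB_ge (h chi w) H; lra.
 apply: le_trans (ler_pM (cabs_ge0 _) (cabs_ge0 _) h1 hb) _.
 by rewrite le_eqVlt; apply/orP; left; apply/eqP; field; rewrite gt_eqF.
have Fb : cabs F <= cabs F + 1 by rewrite lerDl.
apply: le_trans (ler_pM (cabs_ge0 _) (cabs_ge0 _) Fb h3) _.
by rewrite le_eqVlt; apply/orP; left; apply/eqP; field; rewrite gt_eqF.
Qed.

Lemma joint_inv f : f chi0 w0 != 0 -> joint f -> joint (fun chi w => (f chi w)^-1).
Proof.
move=> F0 jf e e0; set F := f chi0 w0.
have Fp : 0 < cabs F by rewrite cabs_gt0.
have d0 : 0 < Num.min (cabs F / 2) (e * cabs F ^+ 2 / 2) by rewrite lt_min !divr_gt0 // mulr_gt0 // exprn_gt0.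
have [d dp Hd] := jf _ d0; exists d => // chi w c1 v1.
have := Hd chi w c1 v1; rewrite le_min -/F => /andP[h1 h2].
have fb : cabs F / 2 <= cabs (f chi w) by have := cabsB_ge F (f chi w); rewrite cabsBC; lra.
have fn : f chi w != 0 by rewrite -cabs_gt0; apply: lt_le_trans fb; rewrite divr_gt0.
have -> : (f chi w)^-1 - F^-1 = (F - f chi w) / (F * f chi w).
 by field; rewrite F0 fn.
rewrite cabsM cabsV cabsM ler_pdivrMr ?mulr_gt0 ?cabs_gt0 // cabsBC.
apply: le_trans h2 _; rewrite -mulrA ler_wpM2l ?(ltW e0) // expr2 -mulrA ler_wpM2l ?(ltW Fp) //.
Qed.

Lemma joint_prod (I : eqType) (r : seq I) (f : I -> R -> C -> C) :
 (forall i, i \in r -> joint (f i)) -> joint (fun chi w => \prod_(i <- r) f i chi w).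
Proof.
elim: r => [|i r IH] H.
 by move=> e e0; exists 1 => // chi w _ _; rewrite !big_nil subrr cabs0 ltW.
have j1 := joint_mul (H i (mem_head _ _)) (IH (fun k kr => H k (ltac:(by rewrite inE kr orbT)))).
by move=> e /j1[d d0 Hd]; exists d => // chi w c1 v1; rewrite !big_cons; exact: Hd.
Qed.

Lemma joint_near f h (d : R) : 0 < d -> joint h ->
 (forall chi w, `|chi - chi0| < d -> cabs (w - w0) < d -> f chi w = h chi w) -> joint f.
Proof.
move=> d0 jh fh e /jh[d1 d10 H1]; exists (Num.min d d1) => [|chi w]; first by rewrite lt_min d0.
rewrite !lt_min => /andP[c1 c2] /andP[v1 v2]; rewrite !fh ?subrr ?normr0 ?cabs0 //; exact: H1.
Qed.

End JointContinuity.

(** * Multiplicity and counting of roots *)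

Section Multiplicity.
Implicit Types (f : C -> C) (x w : C).

Lemma derive1_shift f x w : derive1 (fun z => f z - x) w = derive1 f w.
Proof.
rewrite /derive1; suff -> : (fun h : C => h^-1 *: (f (h + w) - x - (f w - x))) = (fun h => h^-1 *: (f (h + w) - f w)) by [].
by apply/funext => h; rewrite opprB addrA subrK.
Qed.

Lemma root_mult_ge0 f x w : (0 <= root_mult f x w)%E.
Proof. by apply: ereal_sup_ubound; exists 0%N. Qed.

Lemma root_mult_simple f x w : f w = x -> derive1 f w != 0 -> root_mult f x w = 1%:E.
Proof.
move=> fw d0; apply/eqP; rewrite eq_le; apply/andP; split.
 apply: ge_ereal_sup => _ [k Hk <-]; rewrite lee_fin lern1 leqNgt; apply/negP => k1.
 by have := Hk 1%N k1; rewrite derive1n1 derive1_shift => /eqP; rewrite (negbTE d0).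
by apply: ereal_sup_ubound; exists 1%N => // j; rewrite ltnS leqn0 => /eqP ->; rewrite derive1n0 fw subrr.
Qed.

Lemma root_mult_multiple f x w : f w = x -> (1 < root_mult f x w)%E <-> derive1 f w = 0.
Proof.
move=> fw; split.
 by move=> h; apply/eqP/negPn/negP => d0; move: h; rewrite root_mult_simple // ltxx.
move=> d0; apply: (@lt_le_trans _ _ 2%:E); first by rewrite lte_fin ltr1n.
apply: ereal_sup_ubound; exists 2%N => // j; rewrite ltnS leq_eqVlt ltnS leqn0 => /orP[/eqP ->|/eqP ->].
 by rewrite derive1n1 derive1_shift.
by rewrite derive1n0 fw subrr.
Qed.

Lemma root_mult_double f x w : f w = x -> derive1 f w = 0 -> derive1 (derive1 f) w <> 0 ->
 root_mult f x w = 2%:E.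
Proof.
move=> fw d0 d2; apply/eqP; rewrite eq_le; apply/andP; split.
 apply: ge_ereal_sup => _ [k Hk <-]; rewrite lee_fin ler_nat leqNgt; apply/negP => k1.
 have E : derive1 (fun z => f z - x) = derive1 f by apply/funext => z; exact: derive1_shift.
 by apply: d2; have := Hk 2%N k1; rewrite derive1nS derive1n1 E.
clear d2; apply: ereal_sup_ubound; exists 2%N; last by [].
move=> j; rewrite ltnS leq_eqVlt ltnS leqn0 => /orP[/eqP ->|/eqP ->].
 by rewrite derive1n1 derive1_shift.
by rewrite derive1n0 fw subrr.
Qed.

Lemma root_count0 f x (A : set C) : (forall w, A w -> f w <> x) -> root_count f x A = 0%E.
Proof.
move=> H; rewrite /root_count; have -> : A `&` [set w | f w = x] = set0.
 by apply/seteqP; split=> w // [/H].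
by rewrite esum_set0.
Qed.

Lemma root_count1 f x (A : set C) w : A w -> f w = x -> (forall y, A y -> f y = x -> y = w) ->
 root_count f x A = root_mult f x w.
Proof.
move=> Aw fw H; rewrite /root_count; have -> : A `&` [set w | f w = x] = [set w].
 by apply/seteqP; split=> y /= => [[/H h /h]|->].
by rewrite esum_set1 // root_mult_ge0.
Qed.

Lemma esum_sub1 (S : set C) (a : C -> \bar R) w : (forall y, 0 <= a y)%E -> S `<=` [set w] ->
 (\esum_(y in S) a y <= a w)%E.
Proof.
move=> a0 /subset_set1[->|->]; first by rewrite esum_set0.
by rewrite esum_set1.
Qed.

Lemma root_count2 f x (A : set C) w v : (forall y, A y -> f y = x -> y = w \/ y = v) ->
 (root_count f x A <= root_mult f x w + root_mult f x v)%E.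
Proof.
move=> H; rewrite /root_count.
rewrite (esumID [set w]); last by move=> y _; exact: root_mult_ge0.
apply: leeD; apply: esum_sub1 => [y|y]; rewrite ?root_mult_ge0 //; first by case.
by case=> [[Ay fy]] ny; have [] := H y Ay fy.
Qed.

End Multiplicity.

(** Since f' = (log f)' f near w and f'(w) = 0, the difference quotient of f' at w is the one of
    [dlog f] times f(h + w); it converges because [f] is continuous at [w] and the other quotient
    converges. *)
Lemma fold_double (f : C -> C) (w x : C) : f w = x -> x != 0 -> {for w, continuous f} ->
 dlog f w = 0 -> derive1 (dlog f) w <> 0 -> root_mult f x w = 2%:E.
Proof.
move=> fw x0 fc dl; have d1 : derive1 f w = 0.
 by move: dl; rewrite /dlog fw => /eqP; rewrite mulf_eq0 invr_eq0 (negbTE x0) orbF => /eqP.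
move=> d2.
apply: (root_mult_double fw d1).
pose q h : C := h^-1 *: (dlog f (h + w) - dlog f w).
pose g h : C := h^-1 *: (derive1 f (h + w) - derive1 f w).
set L : C := derive1 (dlog f) w in d2.
(* The quotient converges: a divergent one would have the default limit 0, against the hypothesis on
   the derivative of [dlog f]. *)
have qL : q @ 0^' --> L.
 have [] := pselect (cvg (q @ 0^')); first by [].
 by move=> /dvgP E; exfalso; apply: d2; rewrite /L /derive1 -/q E.
clearbody L; have L0 : L != 0 by exact/eqP.
suff gL : g @ 0^' --> L * x.
 have -> : derive1 (derive1 f) w = L * x by rewrite {1}/derive1; apply: cvg_lim.
 by apply/eqP; exact: mulf_neq0 L0 x0.
have L1 : 0 < cabs L + 1 by rewrite ltr_wpDl ?cabs_ge0.
have X1 : 0 < cabs x + 1 by rewrite ltr_wpDl ?cabs_ge0.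
have x00 : 0 < cabs x by rewrite cabs_gt0.
apply/(cvg_cabsP (dnbhs_filter (0 : C))) => e e0.
have e1 : 0 < Num.min 1 (e / (4 * (cabs x + 1))) by rewrite lt_min ltr01 divr_gt0 // mulr_gt0.
have e2 : 0 < Num.min (Num.min 1 (cabs x / 2)) (e / (4 * (cabs L + 1))) by rewrite !lt_min ltr01 !divr_gt0 // mulr_gt0.
have /cont_cabsP/(_ _ e2)[d d0 Hd] := fc.
move/(cvg_cabsP (dnbhs_filter (0 : C))): qL => /(_ _ e1) near_q.
have near_d : \forall h \near (0 : C)^', cabs h < d.
 have : nbhs (0 : C) [set y | cabs y < d] by apply/nbhs_cabsP; exists d => // y; rewrite subr0.
 by rewrite /dnbhs /within /=; apply: filterS.
have FF := dnbhs_filter (0 : C).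
apply: filterS2 near_q near_d => h; rewrite lt_min => /andP[q1 q2] hd.
have := Hd (h + w); rewrite addrK => /(_ hd); rewrite fw !lt_min => /andP[/andP[f1 f2] f3].
have fn : f (h + w) != 0.
 by rewrite -cabs_gt0; have := cabsB_ge x (f (h + w)); rewrite cabsBC; lra.
have gq : g h = q h * f (h + w).
 by rewrite /g /q dl d1 !subr0 /dlog /GRing.scale /= -mulrA divfK.
have -> : g h - L * x = (q h - L) * f (h + w) + L * (f (h + w) - x) by rewrite gq; ring.
apply: le_lt_trans (cabsD _ _) _; rewrite !cabsM.
have fb : cabs (f (h + w)) <= cabs x + 1 by have := cabsB_ge (f (h + w)) x; lra.
have h1 := ler_pM (cabs_ge0 _) (cabs_ge0 _) (ltW q2) fb.
have Lb : cabs L <= cabs L + 1 by rewrite lerDl.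
have h2 := ler_pM (cabs_ge0 _) (cabs_ge0 _) Lb (ltW f3).
apply: le_lt_trans (lerD h1 h2) _.
rewrite (_ : _ + _ = e / 2); first by lra.
by field; rewrite !gt_eqF.
Qed.

End Analysis.

Section Model.
Context {R : realType}.
Variable M : model R.
Notation C := R[i].
Notation Re := complex.Re.
Notation Im := complex.Im.
Notation mu := (@lebesgue_measure R).
Notation cint := contour_integral.
Notation CI := (@complexI R).
Notation SI := (S_inf M).
Notation n := (period M).
Notation m := (pieces M).
Notation b := (sgn M).
Notation idx p j := ((1 <= p <= m)%N /\ (1 <= j <= n)%N).
Hypotheses (hM : wf_model M) (hsep : separation M).

(** * The intervals of the model and their separation *)

Section ModelIntervals.
Notation V := (knot M).
Notation tau := (tau M).
Notation u := (uu M).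
Notation v := (vv M).

Definition thet : R := Num.max u v.

(* Level 0 carries the intervals cut at chi; levels 2k-1 and 2k are the two
  families of scaled copies in [F_fun M k]. *)
Definition sc (s : bool) (L : nat) : R :=
 if s then u ^+ (2 * uphalf L) * v ^+ (2 * L./2) else u ^+ (2 * L./2) * v ^+ (2 * uphalf L).

Arguments sc : simpl never.

Definition lo (p j : nat) : R := expR (V p.-1) / tau j.
Definition hi (p j : nat) : R := expR (V p) / tau j.

(** A pair (zero, pole). Only the pole of a level-0 interval depends on chi. Copies of sign - are
    scaled by [sc] and accumulate at 0, those of sign + by its inverse and accumulate at
    infinity. *)
Definition ival (chi : R) (t : nat * (nat * nat)) : R * R :=
 let: (L, (p, j)) := t in
 if b p j then
  ((sc true L)^-1 * lo p j,
   (sc true L)^-1 * (expR (if L == 0%N then Num.min (V p) chi else V p) / tau j))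
 else
  (sc false L * hi p j,
   sc false L * (expR (if L == 0%N then Num.max (V p.-1) chi else V p.-1) / tau j)).

Arguments ival : simpl never.

Definition valid (chi : R) (t : nat * (nat * nat)) : bool :=
 (t.1 == 0%N) ==> (if b t.2.1 t.2.2 then V t.2.1.-1 < chi else chi < V t.2.1).

Definition ix (chi : R) (N0 N : nat) : seq (nat * (nat * nat)) :=
 [seq t <- [seq (L, pj) | L <- iota N0 N, pj <- [seq (p, j) | p <- iota 1 m, j <- iota 1 n]] | valid chi t].

Definition zl (chi : R) (N0 N : nat) : seq (R * R) := map (ival chi) (ix chi N0 N).

Lemma mem_ix chi N0 N L p j : (L, (p, j)) \in ix chi N0 N <->
 [/\ (N0 <= L < N0 + N)%N, idx p j & valid chi (L, (p, j))].
Proof.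
rewrite mem_filter; split.
 move=> /andP[vl /allpairsP[[L' pj] /= [LN pjn [EL E]]]]; move: pjn; rewrite -E -{}EL in LN *.
 move=> /allpairsP[[p' j'] /= [pm jn [Ep Ej]]]; rewrite -{}Ep -{}Ej in pm jn; move: LN pm jn; rewrite !mem_iota => LN pm jn.
 by rewrite !add1n !ltnS in pm jn; split.
move=> [LN [pm jn] ->] /=; apply/allpairsP; exists (L, (p, j)); split=> //=.
 by rewrite mem_iota.
apply/allpairsP; exists (p, j); split=> //=; by rewrite mem_iota add1n ltnS.
Qed.

Let u0 : 0 < u. Proof. by have [_ _ _ _ [_ /andP[]]] := hM. Qed.
Let v0 : 0 < v. Proof. by have [_ _ _ _ [_ _ /andP[]]] := hM. Qed.
Let u1 : u < 1. Proof. by have [_ _ _ _ [_ /andP[]]] := hM. Qed.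
Let v1 : v < 1. Proof. by have [_ _ _ _ [_ _ /andP[]]] := hM. Qed.

Lemma thet_gt0 : 0 < thet. Proof. by rewrite lt_max u0. Qed.
Lemma thet_lt1 : thet < 1. Proof. by rewrite gt_max u1. Qed.

Lemma sc_gt0 s L : 0 < sc s L.
Proof. by rewrite /sc; case: s; rewrite mulr_gt0 // exprn_gt0. Qed.

(** Each new level contributes u^2 or v^2, alternately. *)
Lemma scS s L : sc s L.+1 <= thet * sc s L.
Proof.
have sq (x : R) : 0 < x -> x < 1 -> x <= thet -> x ^+ 2 <= thet.
 by move=> x0 x1 xt; rewrite expr2 (le_trans _ xt) // ler_piMl // ltW.
have su : u ^+ 2 <= thet by apply: sq => //; rewrite le_max lexx.
have sv : v ^+ 2 <= thet by apply: sq => //; rewrite le_max lexx orbT.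
have E : sc s L.+1 = (if s == odd L then v ^+ 2 else u ^+ 2) * sc s L.
 rewrite /sc uphalf_half /= !uphalf_half; case: s; case: (odd L); rewrite /= ?add0n ?add1n ?mulnSr ?exprD.
 - by ring.
 - by ring.
 - by ring.
 - by ring.
by rewrite E ler_pM2r ?sc_gt0 //; case: ifP.
Qed.

Lemma sc_lt s L L' : (L < L')%N -> sc s L' <= thet * sc s L.
Proof.
elim: L' => // L' ih; rewrite ltnS leq_eqVlt => /orP[/eqP <-|/ih h]; first exact: scS.
apply: le_trans (scS s L') (le_trans _ h); rewrite ler_piMl ?ltW ?sc_gt0 //; exact: thet_lt1.
Qed.

Lemma sc_thet s L : sc s L <= thet ^+ L.
Proof.
elim: L => [|L ih]; first by rewrite /sc; case: s; rewrite /= !expr0 mulr1.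
by apply: le_trans (scS s L) _; rewrite exprS ler_pM2l // thet_gt0.
Qed.

Lemma sc0 s : sc s 0 = 1.
Proof. by rewrite /sc; case: s; rewrite /= !expr0 mulr1. Qed.

Lemma sc_le1 s L : sc s L <= 1.
Proof. by apply: le_trans (sc_thet s L) _; rewrite exprn_ile1 // ltW ?thet_gt0 ?thet_lt1. Qed.

Lemma tau_gt0 j : (1 <= j <= n)%N -> 0 < tau j.
Proof. by have [_ _ _ h _] := hM; exact: h. Qed.

Lemma lo_gt0 p j : (1 <= j <= n)%N -> 0 < lo p j.
Proof. by move=> jn; rewrite divr_gt0 ?expR_gt0 // tau_gt0. Qed.

Lemma hi_gt0 p j : (1 <= j <= n)%N -> 0 < hi p j.
Proof. by move=> jn; rewrite divr_gt0 ?expR_gt0 // tau_gt0. Qed.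

Lemma V_le p q : (p <= q <= m)%N -> V p <= V q.
Proof.
elim: q => [|q ih]; first by rewrite leqn0 => /andP[/eqP ->].
move=> /andP[]; rewrite leq_eqVlt => /orP[/eqP -> //|]; rewrite ltnS => pq qm.
have [_ _ h _ _] := hM; apply: le_trans (ih _) (ltW (h q qm)); by rewrite pq ltnW.
Qed.

Lemma V_lt p : (1 <= p <= m)%N -> V p.-1 < V p.
Proof. by case: p => [//|p] /andP[_ pm]; have [_ _ h _ _] := hM; exact: h. Qed.

Lemma hi_lt_lo p1 p2 j1 j2 : (1 <= j1 <= n)%N -> (1 <= j2 <= n)%N ->
 (tau j1)^-1 * tau j2 < expR (V p2.-1 - V p1) -> hi p1 j1 < lo p2 j2.
Proof.
move=> /tau_gt0 t1 /tau_gt0 t2; rewrite expRB ltr_pdivlMr ?expR_gt0 // => h.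
by rewrite /hi /lo ltr_pdivlMr // -mulrA mulrC.
Qed.

(** Distinct tau are separated by [sepA3]. Equal tau with equal p are excluded by [sepA1]; with
    distinct p the intervals inherit the order of the knots and may touch, hence the weak
    inequality. *)
Lemma same_sign_sep p1 p2 j1 j2 : idx p1 j1 -> idx p2 j2 -> b p1 j1 = b p2 j2 ->
 (p1, j1) != (p2, j2) -> hi p1 j1 <= lo p2 j2 \/ hi p2 j2 <= lo p1 j1.
Proof.
move=> [P1 J1] [P2 J2] bb ne; have [A1 _ A3 _ _] := hsep.
have [t12|t12|t12] := ltgtP (tau j1) (tau j2).
- by right; apply/ltW/hi_lt_lo => //; apply: A3.
- by left; apply/ltW/hi_lt_lo => //; apply: A3.
have T1 := tau_gt0 J1; have T2 := tau_gt0 J2.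
have [p12|p12|p12] := ltngtP p1 p2.
- left; rewrite /hi /lo t12 ler_pM2r ?invr_gt0 // ler_expR V_le //.
 by rewrite -ltnS (ltn_predK p12) p12 /=; case/andP: P2 => _; apply: leq_trans; exact: leq_pred.
- right; rewrite /hi /lo t12 ler_pM2r ?invr_gt0 // ler_expR V_le //.
 by rewrite -ltnS (ltn_predK p12) p12 /=; case/andP: P1 => _; apply: leq_trans; exact: leq_pred.
exfalso; move: ne bb; rewrite p12 xpair_eqE eqxx /= => /eqP jj bb.
by apply: (A1 p2 j1 j2).
Qed.

(** This is [sepB]: one step of scaling carries any interval strictly past every interval of the
    same sign. *)
Lemma scaled_sep p1 p2 j1 j2 : idx p1 j1 -> idx p2 j2 -> b p1 j1 = b p2 j2 ->
 thet * hi p1 j1 < lo p2 j2.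
Proof.
move=> [P1 J1] [P2 J2] bb; have [_ _ _ B1 B2] := hsep.
have h : thet < expR (V p2.-1 - V p1) * (tau j2)^-1 * tau j1.
 by case E: (b p1 j1); [apply: B2 => //; rewrite -bb|apply: B1 => //; rewrite -bb].
have T1 := tau_gt0 J1; have T2 := tau_gt0 J2.
rewrite /hi /lo mulrA ltr_pdivrMr // -ltr_pdivlMr ?expR_gt0 //.
apply: lt_le_trans h _; rewrite expRB le_eqVlt; apply/orP; left; apply/eqP.
by field; rewrite !gt_eqF ?expR_gt0.
Qed.

Lemma ival_cases chi L p j : idx p j -> valid chi (L, (p, j)) ->
 if b p j then [/\ ~~ isM (ival chi (L, (p, j))), (ival chi (L, (p, j))).1 = (sc true L)^-1 * lo p j,
    (ival chi (L, (p, j))).1 < (ival chi (L, (p, j))).2 &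
    (ival chi (L, (p, j))).2 <= (sc true L)^-1 * hi p j]
 else [/\ isM (ival chi (L, (p, j))), (ival chi (L, (p, j))).1 = sc false L * hi p j,
    (ival chi (L, (p, j))).2 < (ival chi (L, (p, j))).1 &
    sc false L * lo p j <= (ival chi (L, (p, j))).2].
Proof.
move=> [P J]; have T := tau_gt0 J; have Vl := V_lt P; rewrite /valid /ival /isM /hi /lo /=.
have s0 s : 0 < sc s L := sc_gt0 s L.
have i0 : 0 < (tau j)^-1 by rewrite invr_gt0.
have si s : 0 < (sc s L)^-1 by rewrite invr_gt0.
case: ifP => _ vl.
 have h1 : (sc true L)^-1 * (expR (V p.-1) / tau j) < (sc true L)^-1 * (expR (if L == 0%N then Num.min (V p) chi else V p) / tau j).
  rewrite ltr_pM2l // ltr_pM2r // ltr_expR; case: ifP vl => //= _; by rewrite lt_min Vl.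
 split=> //; first by rewrite -leNgt ltW.
 rewrite ler_pM2l // ler_pM2r // ler_expR; case: ifP => // _; by rewrite ge_min lexx.
have h1 : sc false L * (expR (if L == 0%N then Num.max (V p.-1) chi else V p.-1) / tau j) < sc false L * (expR (V p) / tau j).
 rewrite ltr_pM2l // ltr_pM2r // ltr_expR; case: ifP vl => //= _; by rewrite gt_max Vl.
split=> //; rewrite ler_pM2l // ler_pM2r // ler_expR; case: ifP => // _; by rewrite le_max lexx.
Qed.

Lemma ival_pos chi L p j : idx p j -> 0 < (ival chi (L, (p, j))).1 /\ 0 < (ival chi (L, (p, j))).2.
Proof.
move=> [P J]; have T := tau_gt0 J; have s0 s : 0 < sc s L := sc_gt0 s L.
by rewrite /ival; case: ifP => _ /=; split; repeat apply: mulr_gt0; rewrite ?invr_gt0 ?mulr_gt0 ?exprn_gt0 ?expR_gt0 ?u0 ?v0 ?T.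
Qed.

(** If p2 <= p1 this is [sepA2]. Otherwise the interval (p1, j2) serves as intermediary, its lower
    end being at most that of (p2, j2): with sign +, [sepA2] applies to it; with sign -,
    [scaled_sep] applies as soon as one level is positive. If both levels are 0, validity gives chi
    < V p1 <= V (p2 - 1) < chi. *)
Lemma cross_sep chi L1 L2 p1 j1 p2 j2 : idx p1 j1 -> idx p2 j2 -> b p1 j1 = false -> b p2 j2 = true ->
 valid chi (L1, (p1, j1)) -> valid chi (L2, (p2, j2)) ->
 sc false L1 * hi p1 j1 < (sc true L2)^-1 * lo p2 j2.
Proof.
move=> I1 I2 b1 b2 v1' v2'; have [P1 J1] := I1; have [P2 J2] := I2; have [_ A2 _ _ _] := hsep.
have h1 : sc false L1 * hi p1 j1 <= hi p1 j1 by rewrite ler_piMl ?sc_le1 // ltW // hi_gt0.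
have h2 : lo p2 j2 <= (sc true L2)^-1 * lo p2 j2.
 rewrite ler_peMl ?(ltW (lo_gt0 _ J2)) // -[leLHS]invr1 lef_pV2 ?sc_le1 // posrE ?ltr01 //; exact: sc_gt0.
have [p21|p12] := leqP p2 p1.
 by apply: le_lt_trans h1 (lt_le_trans _ h2); apply: hi_lt_lo => //; exact: A2.
have pp : (p1 <= p2.-1)%N by rewrite -ltnS (ltn_predK p12).
have lop : lo p1 j2 <= lo p2 j2.
 rewrite ler_pM2r ?invr_gt0 ?tau_gt0 // ler_expR V_le //; apply/andP; split.
  exact: leq_trans (leq_pred _) pp.
 by case/andP: P2 => _; apply: leq_trans; exact: leq_pred.
have I12 : idx p1 j2 by [].
case E: (b p1 j2).
 apply: le_lt_trans h1 (lt_le_trans _ (le_trans lop h2)); apply: hi_lt_lo => //; exact: A2.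
have B := scaled_sep I1 I12 (etrans b1 (esym E)).
have [L10|L10] := posnP L1; last first.
 apply: lt_le_trans (le_trans lop h2); apply: le_lt_trans B.
 rewrite ler_pM2r ?hi_gt0 //; have := sc_lt false L10; by rewrite sc0 mulr1.
have [L20|L20] := posnP L2; last first.
 apply: le_lt_trans h1 _; rewrite ltr_pdivlMl ?sc_gt0 //.
 apply: le_lt_trans (lt_le_trans B lop); rewrite ler_pM2r ?hi_gt0 //.
 by have := sc_lt true L20; rewrite sc0 mulr1.
move: v1' v2'; rewrite L10 L20 /valid /= b1 b2 => c1 c2.
have : V p1 <= V p2.-1 by rewrite V_le // pp /=; case/andP: P2 => _; apply: leq_trans; exact: leq_pred.
by move=> /(lt_le_trans c1) /lt_trans /(_ c2); rewrite ltxx.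
Qed.

(** At equal levels this is [same_sign_sep], because cutting at chi only shrinks intervals; at
    different levels it is [scaled_sep]. *)
Lemma ival_sep chi t t' : t != t' -> (exists L p j, t = (L, (p, j)) /\ idx p j /\ valid chi t) ->
 (exists L p j, t' = (L, (p, j)) /\ idx p j /\ valid chi t') ->
 isM (ival chi t) = isM (ival chi t') ->
 if isM (ival chi t) then (ival chi t).1 <= (ival chi t').2 \/ (ival chi t').1 <= (ival chi t).2
 else (ival chi t).2 <= (ival chi t').1 \/ (ival chi t').2 <= (ival chi t).1.
Proof.
wlog LL : t t' / (t.1 <= t'.1)%N.
 move=> H; have [|/ltnW h] := leqP t.1 t'.1; first exact: H.
 move=> tt' T T' E; rewrite E; have := H t' t h; rewrite eq_sym => /(_ tt' T' T (esym E)).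
 by case: ifP => _ [?|?]; [right|left|right|left].
move=> tt' [L [p [j [tE [I v_]]]]] [L' [p' [j' [tE' [I' v']]]]]; subst t t'; rewrite /= in LL.
have := ival_cases I v_; have := ival_cases I' v'.
case b': (b p' j'); case bb: (b p j) => -[m' a' c' d'] [m_ a_ c_ d_]; rewrite ?(negPf m') ?(negPf m_) ?m' ?m_ // => _.
- have [LE|Ll] := eqVneq L L'.
  subst L'; have ne : (p, j) != (p', j') by apply: contraNneq tt' => ->.
  have [h|h] := same_sign_sep I I' (etrans bb (esym b')) ne; [left|right].
   by rewrite a' (le_trans d_) // ler_pM2l ?invr_gt0 ?sc_gt0.
  by rewrite a_ (le_trans d') // ler_pM2l ?invr_gt0 ?sc_gt0.
 left; rewrite a' (le_trans d_) // ler_pdivrMl ?sc_gt0 // mulrCA ler_pdivlMl ?sc_gt0 //.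
 have Lt : (L < L')%N by rewrite ltn_neqAle Ll.
 have B := scaled_sep I I' (etrans bb (esym b')).
 apply: le_trans (_ : (thet * sc true L) * hi p j <= _).
  by rewrite ler_pM2r ?sc_lt // hi_gt0 //; case: I.
 by rewrite mulrAC mulrC ler_pM2l ?sc_gt0 // ltW.
- have [LE|Ll] := eqVneq L L'.
  subst L'; have ne : (p, j) != (p', j') by apply: contraNneq tt' => ->.
  have [h|h] := same_sign_sep I I' (etrans bb (esym b')) ne; [left|right].
   by rewrite a_ (le_trans _ d') // ler_pM2l ?sc_gt0.
  by rewrite a' (le_trans _ d_) // ler_pM2l ?sc_gt0.
 right; rewrite a' (le_trans _ d_) //.
 have Lt : (L < L')%N by rewrite ltn_neqAle Ll.
 have B := scaled_sep I' I (etrans b' (esym bb)).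
 apply: le_trans (_ : (thet * sc false L) * hi p' j' <= _).
  by rewrite ler_pM2r ?sc_lt // hi_gt0 //; case: I'.
 by rewrite mulrAC mulrC ler_pM2l ?sc_gt0 // ltW.
Qed.

Lemma ixP chi N0 N t : t \in ix chi N0 N -> exists L p j, t = (L, (p, j)) /\ idx p j /\ valid chi t.
Proof. by case: t => L [p j] /mem_ix[_ I v']; exists L, p, j. Qed.

Lemma uniq_ix chi N0 N : uniq (ix chi N0 N).
Proof.
rewrite filter_uniq // allpairs_uniq ?iota_uniq //; last by move=> [a x] [a' x'] _ _ /= [-> ->].
by rewrite allpairs_uniq ?iota_uniq // => -[a x] [a' x'] _ _ /= [-> ->].
Qed.

Lemma isM_ival chi t : (exists L p j, t = (L, (p, j)) /\ idx p j /\ valid chi t) ->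
 isM (ival chi t) = ~~ b t.2.1 t.2.2.
Proof.
move=> [L [p [j [-> [I v']]]]] /=; have := ival_cases I v'.
by case: ifP => _ [h _ _ _]; rewrite ?h ?(negPf h).
Qed.

Lemma ival_ne chi t : (exists L p j, t = (L, (p, j)) /\ idx p j /\ valid chi t) ->
 if isM (ival chi t) then (ival chi t).2 < (ival chi t).1 else (ival chi t).1 < (ival chi t).2.
Proof.
move=> [L [p [j [-> [I v']]]]]; have := ival_cases I v'.
by case: ifP => _ [h _ h' _]; rewrite ?h ?(negPf h).
Qed.

Lemma ival_inj chi N0 N : {in ix chi N0 N &, injective (ival chi)}.
Proof.
move=> t t' /ixP T /ixP T' E; apply/eqP/negPn/negP => ne.
have := ival_sep ne T T'; rewrite E => /(_ erefl); have := ival_ne T'.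
by case: ifP => _ h [] /(lt_le_trans h); rewrite ltxx.
Qed.

Lemma cfg_zl chi N0 N : cfg (zl chi N0 N).
Proof.
have zlP i : i \in zl chi N0 N -> exists2 t, t \in ix chi N0 N & i = ival chi t by move=> /mapP.
have ne i j : i \in zl chi N0 N -> j \in zl chi N0 N -> i != j -> isM i = isM j ->
  if isM i then i.1 <= j.2 \/ j.1 <= i.2 else i.2 <= j.1 \/ j.2 <= i.1.
 move=> /zlP[t tx ->] /zlP[t' tx' ->] tt'; have T := ixP tx; have T' := ixP tx'.
 have ne : t != t' by apply: contraNneq tt' => ->.
 exact: (ival_sep ne T T').
split.
- by rewrite map_inj_in_uniq ?uniq_ix //; exact: ival_inj.
- move=> i /zlP[t /ixP T ->]; have [L [p [j [tE [I v']]]]] := T.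
 have H := ival_ne T; rewrite tE in H *; have [h1 h2] := ival_pos chi L I; split=> //.
 by move: H; case: ifP => _ h; [rewrite gt_eqF|rewrite lt_eqF].
- by move=> i j iz jz mi mj ij; have := ne i j iz jz ij; rewrite mi mj; exact.
- by move=> i j iz jz mi mj ij; have := ne i j iz jz ij; rewrite (negPf mi) (negPf mj); exact.
move=> i j /zlP[t /ixP T ->] /zlP[t' /ixP T' ->]; rewrite (isM_ival T) (isM_ival T').
have [L [p [k [-> [I v_]]]]] := T; have [L' [p' [k' [-> [I' v']]]]] := T' => /= b1 /negPn b2.
have := ival_cases I v_; rewrite (negPf b1) => -[_ -> _ _].
have := ival_cases I' v'; rewrite b2 => -[_ -> _ _].
by apply: (cross_sep I I' _ b2 v_ v'); apply/negbTE.
Qed.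

End ModelIntervals.

Arguments sc : simpl never.
Arguments ival : simpl never.

(** * S as a product over levels, and bounds for its tails *)

Section ModelProduct.
Notation V := (knot M).
Notation tau := (tau M).

Definition LF (chi : R) (L : nat) (w : C) : C :=
 \prod_(1 <= p < m.+1) \prod_(1 <= j < n.+1)
  (if valid chi (L, (p, j)) then fac (ival chi (L, (p, j))) w else 1).

Lemma rawp_LF chi N0 N w : rawp (zl chi N0 N) w = \prod_(L <- iota N0 N) LF chi L w.
Proof.
rewrite /rawp big_map big_filter big_mkcond /= big_allpairs_dep /=; apply: eq_bigr => L _.
by rewrite big_allpairs_dep /= /LF /index_iota !subn1.
Qed.

Lemma fac_ival chi L p j w : idx p j -> valid chi (L, (p, j)) ->
 fac (ival chi (L, (p, j))) w =
 if b p j then (1 - w / (ival chi (L, (p, j))).1%:C) / (1 - w / (ival chi (L, (p, j))).2%:C)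
 else (w - (ival chi (L, (p, j))).1%:C) / (w - (ival chi (L, (p, j))).2%:C).
Proof.
move=> I v'; rewrite /fac isM_ival /=; last by exists L, p, j.
by case: (b p j).
Qed.

Lemma G_gt_scaled x (s : R) w : w != 0 -> s != 0 -> G_gt M x ((s^-1)%:C * w) =
 \prod_(1 <= p < m.+1) \prod_(1 <= j < n.+1) (if (x < V p) && ~~ b p j then
  (w - (s * hi p j)%:C) / (w - (s * (expR (Num.max (V p.-1) x) / tau j))%:C) else 1).
Proof.
move=> w0 s0; rewrite /G_gt big_mkcond; apply: eq_big_nat => p _; rewrite big_mkcond /=.
case: (x < V p) => /=; last by rewrite big1.
apply: eq_big_nat => j /andP[j1 jn]; case: ifP => // _.
have T : (tau j)%:C != 0 :> C by rewrite fmorph_eq0 gt_eqF // tau_gt0 // j1.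
have key (y : R) : 1 - y%:C * ((s^-1)%:C * w * (tau j)%:C)^-1 = (w - (s * (y / tau j))%:C) / w.
 have sc0 : s%:C != 0 :> C by rewrite fmorph_eq0.
 rewrite !(rmorphM, fmorphV) /=; move: T sc0 w0; move: (s%:C) (y%:C) ((tau j)%:C) => a d e e0 a0 w0.
 by field; rewrite ?a0 ?e0 ?w0.
by rewrite !key -[expR (V p) / tau j]/(hi p j) invfM invrK mulrACA mulVf // mulr1.
Qed.

Lemma G_lt_scaled x (s : R) w : s != 0 -> G_lt M x (s%:C * w) =
 \prod_(1 <= p < m.+1) \prod_(1 <= j < n.+1) (if (V p.-1 < x) && b p j then
  (1 - w / (s^-1 * lo p j)%:C) / (1 - w / (s^-1 * (expR (Num.min (V p) x) / tau j))%:C) else 1).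
Proof.
move=> s0; rewrite /G_lt big_mkcond; apply: eq_big_nat => p _; rewrite big_mkcond /=.
case: (V p.-1 < x) => /=; last by rewrite big1.
apply: eq_big_nat => j /andP[j1 jn]; case: ifP => // _.
have T : (tau j)%:C != 0 :> C by rewrite fmorph_eq0 gt_eqF // tau_gt0 // j1.
have sc0 : s%:C != 0 :> C by rewrite fmorph_eq0.
have key (y : R) : 1 - s%:C * w * (expR (- y))%:C * (tau j)%:C = 1 - w / (s^-1 * (expR y / tau j))%:C.
 have e0 : (expR y)%:C != 0 :> C by rewrite fmorph_eq0 gt_eqF // expR_gt0.
 rewrite expRN !(rmorphM, fmorphV) /=; move: T sc0 e0; move: (s%:C) ((expR y)%:C) ((tau j)%:C) => a d e e0 a0 d0.
 by field; rewrite ?a0 ?e0 ?d0.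
by rewrite !key.
Qed.

Lemma LF0 chi w : w != 0 -> LF chi 0 w = G_gt M chi w * G_lt M chi w.
Proof.
move=> w0; have := G_gt_scaled chi w0 (oner_neq0 R); rewrite invr1 rmorph1 mul1r => ->.
have := G_lt_scaled chi w (oner_neq0 R); rewrite rmorph1 mul1r => ->.
rewrite -big_split; apply: eq_big_nat => p /andP[p1 pm]; rewrite -big_split; apply: eq_big_nat => j /andP[j1 jn] /=.
have I : idx p j by rewrite p1 j1.
rewrite /valid /=; case: ifP => [vl|]; last by case: (b p j) => /= ->; rewrite ?andbF ?andbT mulr1.
rewrite fac_ival // /ival; case: (b p j) vl => /= ->; rewrite ?andbF ?andbT /= ?mul1r ?mulr1 sc0 ?invr1 ?mul1r //.
Qed.

Lemma LF_scaled chi L w : w != 0 -> (0 < L)%N ->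
 LF chi L w = G_gt M (V 0) (((sc false L)^-1)%:C * w) * G_lt M (V m) ((sc true L)%:C * w).
Proof.
move=> w0 L0; have s0 s : sc s L != 0 by rewrite gt_eqF // sc_gt0.
rewrite G_gt_scaled // G_lt_scaled //.
rewrite -big_split; apply: eq_big_nat => p /andP[p1 pm]; rewrite -big_split; apply: eq_big_nat => j /andP[j1 jn] /=.
have I : idx p j by rewrite p1 j1.
have V0 : V 0 < V p.
 by apply: le_lt_trans (V_lt (proj1 I)); apply: V_le; rewrite /= (leq_trans (leq_pred _)).
have Vm : V p.-1 < V m.
 by apply: lt_le_trans (V_lt (proj1 I)) _; apply: V_le; rewrite -ltnS pm leqnn.
have V0' : V 0 <= V p.-1 by apply: V_le; rewrite /= (leq_trans (leq_pred _)).
have Vm' : V p <= V m by apply: V_le; rewrite -ltnS pm leqnn.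
have vl : valid chi (L, (p, j)) by rewrite /valid /= (gtn_eqF L0).
rewrite vl fac_ival // /ival /= (gtn_eqF L0) V0 Vm (max_l V0') (min_l Vm').
by case: (b p j) => /=; rewrite ?mul1r ?mulr1.
Qed.

(** The last two factors of F form the odd level, the first two the even level. *)
Lemma F_fun_LF chi k w : w != 0 -> F_fun M k.+1 w = LF chi (2 * k).+1 w * LF chi (2 * k).+2 w.
Proof.
move=> w0; rewrite !LF_scaled //.
have h1 : ((2 * k).+1)./2 = k by rewrite mul2n /= uphalf_double.
have h2 : uphalf (2 * k).+1 = k.+1 by rewrite mul2n /= doubleK.
have h3 : ((2 * k).+2)./2 = k.+1 by rewrite mul2n /= doubleK.
have h4 : uphalf (2 * k).+2 = k.+1 by rewrite mul2n /= uphalf_double.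
rewrite /F_fun /sc h1 h2 h3 h4 !invfM (_ : (2 * k.+1 - 2 = 2 * k)%N); last by rewrite mulnS addKn.
set A := G_gt M _ _; set B := G_lt M _ _; set D := G_gt M _ _; set E := G_lt M _ _.
ring.
Qed.

Lemma S_raw_rawp chi K w : w != 0 -> S_raw M chi K w = rawp (zl chi 0 (2 * K).+1) w.
Proof.
move=> w0; rewrite /S_raw -LF0 // rawp_LF; elim: K => [|K ih].
 by rewrite big_geq // mulr1 /= big_seq1.
rewrite big_nat_recr // mulrA ih (F_fun_LF chi K w0).
have -> : (2 * K.+1).+1 = ((2 * K).+1 + 2)%N by rewrite mulnS add2n addn2.
by rewrite iotaD big_cat add0n /= !big_cons big_nil mulr1.
Qed.

Lemma rawp_cat chi N0 N N' w : rawp (zl chi N0 (N + N')) w = rawp (zl chi N0 N) w * rawp (zl chi (N0 + N) N') w.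
Proof. by rewrite !rawp_LF iotaD big_cat. Qed.

(** [Hi] bounds the zeros of sign - and [La] the inverses of the zeros of sign +, for every column
    and every level. Sums replace maxima for convenience. *)
Definition Hi : R := \sum_(1 <= p < m.+1) \sum_(1 <= j < n.+1) hi p j.
Definition La : R := \sum_(1 <= p < m.+1) \sum_(1 <= j < n.+1) (lo p j)^-1.

Lemma sum2_ge (f : nat -> nat -> R) p j : idx p j -> (forall p j, (1 <= j <= n)%N -> 0 <= f p j) ->
 f p j <= \sum_(1 <= p < m.+1) \sum_(1 <= j < n.+1) f p j.
Proof.
move=> [P J] f0; rewrite (bigD1_seq p) ?mem_index_iota ?iota_uniq //=.
rewrite (bigD1_seq j) ?mem_index_iota ?iota_uniq //= -addrA lerDl addr_ge0 //.
 by rewrite big_seq_cond sumr_ge0 // => k /andP[]; rewrite mem_index_iota => h _; exact: f0.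
rewrite sumr_ge0 // => q _; rewrite big_seq sumr_ge0 // => k; rewrite mem_index_iota; exact: f0.
Qed.

Lemma hi_le p j : idx p j -> hi p j <= Hi.
Proof. by move=> I; apply: sum2_ge => // q k J; rewrite ltW // hi_gt0. Qed.

Lemma lo_le p j : idx p j -> (lo p j)^-1 <= La.
Proof. by move=> I; apply: (@sum2_ge (fun p j => (lo p j)^-1)) => // q k J; rewrite invr_ge0 ltW // lo_gt0. Qed.

Lemma zlP chi N0 N i : i \in zl chi N0 N -> exists L p j,
 [/\ (N0 <= L < N0 + N)%N, idx p j, valid chi (L, (p, j)) & i = ival chi (L, (p, j))].
Proof.
rewrite /zl => iz; have [[L [p j]] tx ->] := @mapP _ (R * R)%type _ _ _ iz.
by have /mem_ix[h1 h2 h3] := tx; exists L, p, j.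
Qed.

Lemma Hi_ge0 : 0 <= Hi.
Proof.
rewrite /Hi big_seq sumr_ge0 // => p _; rewrite big_seq sumr_ge0 // => j; rewrite mem_index_iota => J.
by rewrite ltW // hi_gt0.
Qed.

Lemma La_ge0 : 0 <= La.
Proof.
rewrite /La big_seq sumr_ge0 // => p _; rewrite big_seq sumr_ge0 // => j; rewrite mem_index_iota => J.
by rewrite invr_ge0 ltW // lo_gt0.
Qed.

Let t0 : 0 <= thet := ltW thet_gt0.
Let t1 : thet < 1 := thet_lt1.

Lemma far_levels (r S : R) : 0 < r -> 0 < S -> exists2 L0, (0 < L0)%N & forall N1 N chi i, (L0 <= N1)%N ->
 i \in zl chi N1 N -> if isM i then i.1 <= r else S <= i.1.
Proof.
move=> r0 S0; have [n1 H1] := geom_small Hi t0 t1 r0.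
have Si : 0 < S^-1 by rewrite invr_gt0.
have [n2 H2] := geom_small La t0 t1 Si.
exists (maxn n1 n2).+1 => // N1 N chi i LN /zlP[L [p [j [/andP[NL _] I vl ->]]]].
have := ival_cases I vl; have [P J] := I.
have [h1 h2] : (n1 <= L)%N /\ (n2 <= L)%N.
 by split; apply: leq_trans (leq_trans LN NL); rewrite leqW // ?leq_maxl ?leq_maxr.
case: (b p j) => -[mi -> _ _]; rewrite ?mi ?(negPf mi).
 rewrite -[X in X <= _]invrK -[_ * _]invrK lef_pV2 ?posrE ?invr_gt0 //; last first.
  by rewrite mulr_gt0 ?invr_gt0 ?sc_gt0 ?lo_gt0.
 apply: le_trans (H2 L h2); rewrite invfM invrK; apply: ler_pM; rewrite ?invr_ge0 ?(ltW (sc_gt0 _ _)) ?(ltW (lo_gt0 _ _)) //.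
  exact: sc_thet.
 exact: lo_le.
apply: le_trans (H1 L h1); apply: ler_pM; rewrite ?(ltW (sc_gt0 _ _)) ?(ltW (hi_gt0 _ _)) //.
 exact: sc_thet.
exact: hi_le.
Qed.

(** For sign - the difference from 1 is at most the length of the interval over the distance from w
    to its pole, which is at least r/2. For sign + the same estimate holds after inversion. Both
    decay like thet^L. *)
Lemma fac_near1 (r S : R) chi L p j w : 0 < r -> 0 < S -> idx p j -> valid chi (L, (p, j)) ->
 (if isM (ival chi (L, (p, j))) then (ival chi (L, (p, j))).1 <= r / 2
  else 2 * S <= (ival chi (L, (p, j))).1) -> r <= cabs w <= S ->
 cabs (fac (ival chi (L, (p, j))) w - 1) <= (2 * Hi / r + 2 * S * La) * thet ^+ L.
Proof.
move=> r0 S0 I vl far /andP[rw wS]; have [P J] := I.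
rewrite (fac_ival w I vl) [leRHS]mulrDl; have := ival_cases I vl.
have [z0 p0] := ival_pos chi L I; have tL : 0 <= thet ^+ L by rewrite exprn_ge0.
have zn : (ival chi (L, (p, j))).1%:C != 0 :> C by rewrite fmorph_eq0 gt_eqF.
have pn : (ival chi (L, (p, j))).2%:C != 0 :> C by rewrite fmorph_eq0 gt_eqF.
have g1 : 0 <= 2 * Hi / r * thet ^+ L by rewrite mulr_ge0 // divr_ge0 ?mulr_ge0 ?Hi_ge0 ?(ltW r0).
have g2 : 0 <= 2 * S * La * thet ^+ L by rewrite mulr_ge0 // mulr_ge0 ?La_ge0 // mulr_ge0 // ltW.
case: (b p j) => -[mi zE lt _]; rewrite ?mi ?(negPf mi) in far.
 apply: le_trans (_ : 2 * S * La * thet ^+ L <= _); last by rewrite lerDr.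
 have zb : (ival chi (L, (p, j))).1^-1 <= La * thet ^+ L.
  rewrite zE invfM invrK mulrC; apply: ler_pM; rewrite ?invr_ge0 ?(ltW (sc_gt0 _ _)) ?(ltW (lo_gt0 _ _)) //.
   exact: lo_le.
  exact: sc_thet.
 move: lt far zb z0 p0 zn pn; move: (ival _ _).1 (ival _ _).2 => z q zq Sz zb z0 q0 zn qn.
 have d0 : 1 / 2 <= cabs (1 - w / q%:C).
  have := cabsB_ge 1 (w / q%:C); rewrite cabs1 cabsM cabsV cabsR (gtr0_norm q0) => h.
  apply: le_trans h; have : cabs w / q <= 1 / 2 by rewrite ler_pdivrMr //; lra.
  by lra.
 have dn : 1 - w / q%:C != 0 by rewrite -cabs_gt0 (lt_le_trans _ d0) // divr_gt0.
 have -> : (1 - w / z%:C) / (1 - w / q%:C) - 1 = w * (q^-1 - z^-1)%:C / (1 - w / q%:C).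
  rewrite rmorphB !fmorphV /=; move: dn qn zn; move: (q%:C) (z%:C) => Q Z dn qn zn.
  have dn' : Q - w != 0 by move: dn; apply: contraNneq => /subr0_eq <-; rewrite divff ?subrr.
  by field; rewrite qn zn dn'.
 rewrite !cabsM cabsV cabsR ler_pdivrMr; last by apply: lt_le_trans d0; rewrite divr_gt0.
 have a1 : `|q^-1 - z^-1| <= z^-1.
  have : q^-1 <= z^-1 by rewrite lef_pV2 ?posrE // ltW.
  have : 0 < q^-1 by rewrite invr_gt0.
  by rewrite ler_norml; lra.
 have a2 : cabs w * `|q^-1 - z^-1| <= S * (La * thet ^+ L).
  by apply: ler_pM; rewrite ?cabs_ge0 // (le_trans a1).
 apply: le_trans a2 _; have : 0 <= S * (La * thet ^+ L) by rewrite mulr_ge0 ?(ltW S0) // mulr_ge0 ?La_ge0.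
 move=> h; have -> : 2 * S * La * thet ^+ L * cabs (1 - w / q%:C) = (S * (La * thet ^+ L)) * (2 * cabs (1 - w / q%:C)) by ring.
 by rewrite ler_peMr //; lra.
apply: le_trans (_ : 2 * Hi / r * thet ^+ L <= _); last by rewrite lerDl.
have zb : (ival chi (L, (p, j))).1 <= Hi * thet ^+ L.
 rewrite zE mulrC; apply: ler_pM; rewrite ?(ltW (sc_gt0 _ _)) ?(ltW (hi_gt0 _ _)) //; first exact: hi_le.
 exact: sc_thet.
move: lt far zb z0 p0 zn pn; move: (ival _ _).1 (ival _ _).2 => z q zq Sz zb z0 q0 zn qn.
have d0 : r / 2 <= cabs (w - q%:C).
 have := cabsB_ge w q%:C; rewrite cabsR (gtr0_norm q0); lra.
have dp : 0 < cabs (w - q%:C) by apply: lt_le_trans d0; rewrite divr_gt0.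
have dn : w - q%:C != 0 by rewrite -cabs_gt0.
have -> : (w - z%:C) / (w - q%:C) - 1 = (q - z)%:C / (w - q%:C).
 rewrite rmorphB /=; move: dn; move: (q%:C) (z%:C) => Q Z dn; by field.
rewrite cabsM cabsV cabsR ler_pdivrMr //.
have a1 : `|q - z| <= Hi * thet ^+ L by apply: le_trans zb; rewrite ler_norml; lra.
apply: le_trans a1 _; have h0 : 0 <= Hi * thet ^+ L by rewrite mulr_ge0 ?Hi_ge0.
have -> : 2 * Hi / r * thet ^+ L * cabs (w - q%:C) = (Hi * thet ^+ L) * (2 / r * cabs (w - q%:C)) by ring.
rewrite ler_peMr //; move: d0; rewrite mulrAC ler_pdivlMr // mul1r; lra.
Qed.

Lemma tail_bound (r S : R) : 0 < r -> 0 < S -> exists (A : R) (L0 : nat), [/\ 0 <= A, (0 < L0)%N &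
 forall N1 N chi w, (L0 <= N1)%N -> r <= cabs w <= S ->
  cabs (rawp (zl chi N1 N) w - 1) <= expR (A * thet ^+ N1) - 1].
Proof.
move=> r0 S0; have [L0 L00 far] := far_levels (divr_gt0 r0 (ltr0n R 2)) (mulr_gt0 (ltr0n R 2) S0).
pose K := 2 * Hi / r + 2 * S * La.
have K0 : 0 <= K.
 rewrite /K addr_ge0 //; first by rewrite divr_ge0 ?mulr_ge0 ?Hi_ge0 ?(ltW r0).
 by rewrite mulr_ge0 ?La_ge0 // mulr_ge0 // ltW.
pose P := [seq (p, j) | p <- iota 1 m, j <- iota 1 n].
have d0 : 0 < 1 - thet by rewrite subr_gt0.
exists ((size P)%:R * K / (1 - thet)), L0; split=> //.
 by rewrite divr_ge0 ?mulr_ge0 // ltW.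
move=> N1 N chi w LN rw; apply: le_trans (prod_near1 _ _) _; rewrite lerD2r ler_expR.
rewrite big_map big_seq.
apply: le_trans (_ : \sum_(t <- ix chi N1 N) K * thet ^+ t.1 <= _).
 rewrite [leRHS]big_seq; apply: ler_sum => t tx; case: t tx => L [p j] tx.
 have /mem_ix[LL I vl] := tx; apply: fac_near1 => //.
 by apply: (far N1 N chi) => //; rewrite /zl map_f.
rewrite big_filter; apply: le_trans (_ : \sum_(t <- [seq (L, pj) | L <- iota N1 N, pj <- P]) K * thet ^+ t.1 <= _).
 rewrite [leRHS](bigID (valid chi)) /= lerDl sumr_ge0 // => t _.
 by rewrite mulr_ge0 // exprn_ge0.
rewrite big_allpairs_dep /= (eq_bigr (fun L => (size P)%:R * K * thet ^+ L)); last first.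
 by move=> L _; rewrite big_const_seq count_predT iter_addr_0 -mulrA mulr_natl.
rewrite -mulr_sumr -!mulrA ler_wpM2l // ler_wpM2l //.
rewrite [leRHS]mulrC; exact: geom_sum_le.
Qed.

End ModelProduct.

(** * Tails of the product and the limit function on annuli *)

Lemma zl_indep chi chi' N1 N : (0 < N1)%N -> zl chi N1 N = zl chi' N1 N.
Proof.
move=> N10; have E : ix chi N1 N = ix chi' N1 N.
 apply: eq_in_filter => t /allpairsPdep[L [pj [LN _ ->]]]; move: LN; rewrite mem_iota => /andP[LN _].
 by rewrite /valid /= gtn_eqF // (leq_trans N10).
rewrite /zl E; apply/eq_in_map => -[L [p j]] /mem_ix[/andP[LN _] _ _].
by rewrite /ival (gtn_eqF (leq_trans N10 LN)).
Qed.

Lemma rawp_cont (zs : seq (R * R)) (z : C) : cfg zs -> offr zs z -> {for z, continuous (rawp zs)}.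
Proof.
move=> zc oz; have [d d0 Hd] := @punct_gap R (map snd zs) z.
have og : offg zs z by move=> i; rewrite mem_gen => /andP[_ iz]; exact: oz.
apply: (cont_eq_near (cder_cont (cder_gS og))); exists d => // y yd.
apply: rawp_gS => // i iz; have [->|yz] := eqVneq y z; first exact: oz.
by apply: Hd => //; rewrite map_f.
Qed.

(** From level N1 on, the intervals of sign - lie below r/2 and those of sign + above 2 S, so on the
    annulus the tail is close to 1 and converges uniformly. It is independent of chi because chi
    only cuts level 0. On an annulus S_chi is thus a rational function times [T]. *)
Lemma annulus_tail (r S eps : R) : 0 < r -> 0 < S -> 0 < eps -> exists (N1 : nat) (T : C -> C), [/\ (0 < N1)%N,
 forall chi N i, i \in zl chi N1 N -> if isM i then i.1 <= r / 2 else 2 * S <= i.1,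
 forall z, r < cabs z < S -> {for z, continuous T},
 forall z chi N, r <= cabs z <= S -> cabs (T z - 1) <= eps /\ cabs (rawp (zl chi N1 N) z - 1) <= eps &
 forall e : R, 0 < e -> exists N2, forall chi N z, (N2 <= N)%N -> r <= cabs z <= S ->
  cabs (rawp (zl chi N1 N) z - T z) <= e].
Proof.
move=> r0 S0 eps0; have [L1 L10 far] := far_levels (divr_gt0 r0 (ltr0n R 2)) (mulr_gt0 (ltr0n R 2) S0).
have [A [L2 [A0 L20 tb]]] := tail_bound r0 S0.
have t0 : 0 <= thet := ltW thet_gt0.
have t1 : thet < 1 := thet_lt1.
have small (e : R) : 0 < e -> exists n0, forall k, (n0 <= k)%N -> expR (A * thet ^+ k) - 1 <= e.
 move=> e0; have [|n0 H] := geom_small A t0 t1 (_ : 0 < ln (1 + e)).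
  by rewrite ln_gt0 // ltrDl.
 exists n0 => k /H; rewrite mulrC lerBlDl => h.
 by rewrite -[leRHS]lnK ?posrE ?addr_gt0 // ler_expR.
(* The bound 1 besides eps keeps the partial tails below 2, as the Cauchy estimate below needs. *)
have [L3 H3] := small (Num.min eps 1) ltac:(by rewrite lt_min eps0 ltr01).
pose N1 := maxn L1 (maxn L2 L3).
have le1 : (L1 <= N1)%N by rewrite leq_maxl.
have le2 : (L2 <= N1)%N by rewrite /N1 maxnA leq_max leq_maxr.
have le3 : (L3 <= N1)%N by rewrite /N1 maxnA leq_maxr.
have N10 : (0 < N1)%N by apply: leq_trans le1.
pose P N z : C := rawp (zl 0 N1 N) z.
have PE chi N z : rawp (zl chi N1 N) z = P N z by rewrite /P (zl_indep chi 0).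
have Pb N z : r <= cabs z <= S -> cabs (P N z - 1) <= Num.min eps 1.
 move=> rz; apply: le_trans (tb N1 N 0 z le2 rz) _; exact: H3.
have P2 N z : r <= cabs z <= S -> cabs (P N z) <= 2.
 move=> rz; apply: le_trans (cabs_near1 _) _; have := Pb N z rz; rewrite le_min => /andP[_]; lra.
have Pc (e : R) : 0 < e -> exists N2, forall N N' z, (N2 <= N)%N -> (N <= N')%N -> r <= cabs z <= S ->
  cabs (P N' z - P N z) <= e.
 move=> e0; have [n0 H0] := small (e / 2) (divr_gt0 e0 (ltr0n R 2)).
 exists n0 => N N' z nN NN' rz; rewrite -(subnKC NN') /P rawp_cat.
 set a := rawp _ z; set d := rawp _ z; have -> : a * d - a = a * (d - 1) by ring.
 rewrite cabsM; have h1 : cabs a <= 2 := P2 N z rz.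
 have h2 : cabs (d - 1) <= e / 2.
  apply: le_trans (tb (N1 + N)%N (N' - N)%N 0 z _ rz) _; first by rewrite (leq_trans le2) // leq_addr.
  by apply: H0; rewrite (leq_trans nN) // leq_addl.
 by have := cabs_ge0 a; have := cabs_ge0 (d - 1); nra.
pose T z : C := if boolp.pselect (r <= cabs z <= S) is left _ then lim (P N z @[N --> \oo]) else 0.
have Tl z : r <= cabs z <= S -> P N z @[N --> \oo] --> T z.
 move=> rz; rewrite /T; case: boolp.pselect => // _.
 have [|l lP] := @cabs_cauchy R (fun N => P N z); last by apply: cvgP lP.
 by move=> e /Pc[N2 H]; exists N2 => N hN; apply: H.
have lim_le (f : nat -> C) (l c0 : C) (e : R) N2 : f @ \oo --> l ->
  (forall N, (N2 <= N)%N -> cabs (f N - c0) <= e) -> cabs (l - c0) <= e.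
 move=> fl H; apply/ler_addgt0Pr => x x0; have /cvg_cabsP /(_ x x0) fx := fl.
 have [N [h1 h2]] : exists N, (N2 <= N)%N /\ cabs (f N - l) < x.
  have [N h] := filter_ex (filterI (nbhs_infty_ge N2) fx); by exists N.
 have -> : l - c0 = - (f N - l) + (f N - c0) by ring.
 apply: cabsD_le; rewrite cabsN addrC lerD // ?H // ltW //.
have Tu (e : R) : 0 < e -> exists N2, forall N z, (N2 <= N)%N -> r <= cabs z <= S -> cabs (P N z - T z) <= e.
 move=> e0; have [N2 H] := Pc e e0; exists N2 => N z hN rz; rewrite cabsBC.
 by apply: (lim_le (fun N => P N z) _ _ _ N (Tl z rz)) => N' hN'; apply: H.
exists N1, T; split=> //.
- by move=> chi N i; exact: far.
- move=> z /andP[rz zS].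
 pose d := Num.min (cabs z - r) (S - cabs z).
 have d0 : 0 < d by rewrite lt_min !subr_gt0 rz.
 have rd y : cabs (y - z) < d -> r <= cabs y <= S.
  rewrite lt_min => /andP[h1 h2]; have := cabsD (y - z) z; have := cabsD (z - y) y.
  by rewrite !subrK (cabsBC z); move: h1 h2; lra.
 apply: (@uniform_continuous R P T z d d0) => e e0; have [N2 H] := Tu e e0.
 exists N2; split; first by move=> y /rd; exact: H.
 apply: rawp_cont; first exact: cfg_zl.
 move=> i iz; have := far N1 N2 0 i le1 iz.
 have [h1 h2 h3] := cfg_pos (cfg_zl 0 N1 N2) iz.
 move=> h; apply/eqP => zE; move: rz zS; rewrite zE cabsR gtr0_norm //.
 case: ifP h; rewrite /isM => k h; first by move: k h; lra.
 by have := isMN (cfg_zl 0 N1 N2) iz; rewrite /isM k => /(_ isT); move: h; lra.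
- move=> z chi N rz; rewrite PE; split.
  by apply: (lim_le (fun N => P N z) _ _ _ 0%N (Tl z rz)) => k _; have := Pb k z rz; rewrite le_min => /andP[].
 by have := Pb N z rz; rewrite le_min => /andP[].
- by move=> e /Tu[N2 H]; exists N2 => chi N z; rewrite PE; exact: H.
Qed.

Section LimitFunction.

(** Level 0 and the two levels of each of the K factors F. *)
Definition ZK (chi : R) (K : nat) := zl chi 0 (2 * K).+1.

Lemma punct_off zs (z : C) : exists2 d : R, 0 < d &
 forall y, y != z -> cabs (y - z) < d -> offr zs y /\ y != 0.
Proof.
have [d d0 Hd] := @punct_gap R (0 :: map snd zs) z; exists d => // y yz yd; split.
 by move=> i iz; apply: Hd => //; rewrite inE map_f ?orbT.
by apply: (Hd y 0) => //; rewrite mem_head.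
Qed.

Lemma S_K_gS chi K z : offg (ZK chi K) z -> S_K M chi K z = gS (ZK chi K) z.
Proof.
move=> oz; apply: reduced_eq; first exact: cder_cont (cder_gS oz).
have [d d0 Hd] := punct_off (ZK chi K) z; exists d => // y yz yd.
have [q1 q2] := Hd y yz yd; by rewrite S_raw_rawp // rawp_gS //; exact: cfg_zl.
Qed.

(** More levels bring more zeros, so a pole that is not cancelled among more levels is not cancelled
    among fewer. *)
Lemma gen_mono chi N1 N2 i : (N1 <= N2)%N -> i \in gen (zl chi 0 N2) -> i \in zl chi 0 N1 ->
 i \in gen (zl chi 0 N1).
Proof.
move=> N12; rewrite !mem_gen => /andP[ri i2] i1; rewrite i1 andbT.
move: ri; rewrite !rsd_neq0 //; try exact: cfg_zl.
move=> /allP H; apply/allP => j jz; apply: H; move: jz.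
move=> /zlP[L [p [k [/andP[_ LN] I vl ->]]]]; apply: map_f; apply/mem_ix; split=> //.
by rewrite add0n (leq_trans _ N12) // LN.
Qed.

Lemma zl_cat chi N1 N i : i \in zl chi 0 (N1 + N) -> i \in zl chi 0 N1 \/ i \in zl chi N1 N.
Proof.
move=> /zlP[L [p [j [/andP[_ LN] I vl ->]]]]; have [L1|L1] := ltnP L N1; [left|right];
 by apply: map_f; apply/mem_ix; split=> //; rewrite ?L1 ?LN.
Qed.

Section Annulus.
Variables (r S : R) (N1 : nat) (T : C -> C).
Hypotheses (r0 : 0 < r) (N10 : (0 < N1)%N).
Hypothesis far : forall chi N i, i \in zl chi N1 N -> if isM i then i.1 <= r / 2 else 2 * S <= i.1.
Hypothesis Tc : forall z, r < cabs z < S -> {for z, continuous T}.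
Hypothesis Tb : forall z chi N, r <= cabs z <= S ->
 cabs (T z - 1) <= 1 / 2 /\ cabs (rawp (zl chi N1 N) z - 1) <= 1 / 2.
Hypothesis Tu : forall e : R, 0 < e -> exists N2, forall chi N z, (N2 <= N)%N -> r <= cabs z <= S ->
  cabs (rawp (zl chi N1 N) z - T z) <= e.

Lemma tail_off chi N z : r < cabs z < S -> offr (zl chi N1 N) z.
Proof.
move=> /andP[rz zS] i iz; have := far iz; have [h1 h2 h3] := cfg_pos (cfg_zl chi N1 N) iz.
move=> h; apply/eqP => zE; move: rz zS; rewrite zE cabsR gtr0_norm //.
case: ifP h; rewrite /isM => k h; first by move: k h r0; lra.
by have := isMN (cfg_zl chi N1 N) iz; rewrite /isM k => /(_ isT); move: h r0; lra.
Qed.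

Lemma offg_full chi K z : (N1 <= (2 * K).+1)%N -> r < cabs z < S -> offg (zl chi 0 N1) z -> offg (ZK chi K) z.
Proof.
move=> NK rz oz i ig; have := ig; rewrite mem_gen => /andP[_]; rewrite /ZK -(subnKC NK) => /zl_cat[i1|i2].
 by apply: oz; exact: gen_mono ig i1.
exact: tail_off rz _ i2.
Qed.

Lemma near_annulus (z : C) : r < cabs z < S ->
 exists2 d : R, 0 < d & forall y, cabs (y - z) < d -> r < cabs y < S.
Proof.
move=> /andP[rz zS]; exists (Num.min (cabs z - r) (S - cabs z)); first by rewrite lt_min !subr_gt0 rz.
move=> y; rewrite lt_min => /andP[h1 h2]; have := cabsD (y - z) z; have := cabsD (z - y) y.
by rewrite !subrK (cabsBC z); move: h1 h2; lra.
Qed.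

(** The factorization of the raw product holds off finitely many points; both sides are continuous
    at cancelled poles, so it extends to them. *)
Lemma gS_split chi K z : (N1 <= (2 * K).+1)%N -> r < cabs z < S -> offg (zl chi 0 N1) z ->
 gS (ZK chi K) z = gS (zl chi 0 N1) z * rawp (zl chi N1 ((2 * K).+1 - N1)) z.
Proof.
move=> NK rz oz.
apply: (@cont_agree R (gS (ZK chi K)) (fun y => gS (zl chi 0 N1) y * rawp (zl chi N1 ((2 * K).+1 - N1)) y)).
- exact: cder_cont (cder_gS (offg_full NK rz oz)).
- apply: continuousM; first exact: cder_cont (cder_gS oz).
 by apply: rawp_cont; [exact: cfg_zl|exact: tail_off].
have [d d0 Hd] := punct_off (ZK chi K) z; exists d => // y yz yd; have [q1 _] := Hd y yz yd.
rewrite -!rawp_gS //; try exact: cfg_zl.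
 by rewrite /ZK -{1}(subnKC NK) rawp_cat.
move=> i /zlP[L [p [k [/andP[_ LN] I vl ->]]]]; apply: q1; apply: map_f; apply/mem_ix; split=> //.
by rewrite add0n (leq_trans _ NK) // LN.
Qed.

(** The error is relative to the finite part, which keeps the estimate uniform up to its poles. *)
Lemma gS_cvg chi (e : R) : 0 < e -> exists K0, forall K z, (K0 <= K)%N -> r < cabs z < S -> offg (zl chi 0 N1) z ->
 cabs (gS (ZK chi K) z - gS (zl chi 0 N1) z * T z) <= e * cabs (gS (zl chi 0 N1) z).
Proof.
move=> e0; have [N2 H] := Tu e0; exists (N1 + N2)%N => K y hK ry oy.
have NK : (N1 + N2 <= (2 * K).+1)%N by rewrite ltnW // ltnS (leq_trans hK) // mul2n -addnn leq_addl.
rewrite gS_split //; last by rewrite (leq_trans _ NK) // leq_addr.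
rewrite -mulrBr cabsM mulrC ler_wpM2r ?cabs_ge0 // H //; first by rewrite leq_subRL // (leq_trans _ NK) // leq_addr.
by case/andP: ry => h1 h2; rewrite !ltW.
Qed.

Lemma rawlim chi z : r < cabs z < S -> offr (zl chi 0 N1) z -> z != 0 ->
 limn (fun K => S_raw M chi K z) = gS (zl chi 0 N1) z * T z.
Proof.
move=> rz oz z0; apply: cvg_lim => //; apply/cvg_cabsP => e e0.
have og : offg (zl chi 0 N1) z by move=> i; rewrite mem_gen => /andP[_ iz]; exact: oz.
pose X := cabs (gS (zl chi 0 N1) z); have X0 : 0 <= X := cabs_ge0 _.
have e1 : 0 < e / (X + 1) by rewrite divr_gt0 // ltr_wpDl.
have [K0 H] := gS_cvg chi e1.
exists (N1 + K0)%N => // K /= hK.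
have NK : (N1 <= (2 * K).+1)%N.
 by rewrite ltnW // ltnS mul2n -addnn (leq_trans _ (leq_addl _ _)) // (leq_trans _ hK) // leq_addr.
have oK : offr (ZK chi K) z.
 move=> i; rewrite /ZK -(subnKC NK) => /zl_cat[]; [exact: oz|exact: tail_off].
rewrite S_raw_rawp // -/(ZK chi K) rawp_gS //; last exact: cfg_zl.
apply: le_lt_trans (H K z _ rz og) _; first by rewrite (leq_trans _ hK) // leq_addl.
by rewrite -/X mulrAC ltr_pdivrMr ?ltr_wpDl // ltr_pM2l // ltrDl.
Qed.

Lemma cont_lim chi z : r < cabs z < S -> offg (zl chi 0 N1) z ->
 {for z, continuous (fun y => gS (zl chi 0 N1) y * T y)}.
Proof. by move=> rz oz; apply: continuousM; [exact: cder_cont (cder_gS oz)|exact: Tc]. Qed.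

Lemma rawlim_near chi z : r < cabs z < S -> exists2 d : R, 0 < d & forall y, y != z -> cabs (y - z) < d ->
 [/\ r < cabs y < S, offg (zl chi 0 N1) y & limn (fun K => S_raw M chi K y) = gS (zl chi 0 N1) y * T y].
Proof.
move=> rz; have [d1 d10 H1] := near_annulus rz; have [d2 d20 H2] := punct_off (zl chi 0 N1) z.
exists (Num.min d1 d2); rewrite ?lt_min ?d10 // => y yz; rewrite lt_min => /andP[y1 y2].
have [q1 q2] := H2 y yz y2; split; first exact: H1.
 by move=> i; rewrite mem_gen => /andP[_ iz]; exact: q1.
by apply: rawlim => //; exact: H1.
Qed.

Lemma S_inf_gS chi z : r < cabs z < S -> offg (zl chi 0 N1) z ->
 SI chi z = gS (zl chi 0 N1) z * T z.
Proof.
move=> rz oz; rewrite /S_inf; apply: (reduced_eq (cont_lim rz oz)).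
by have [d d0 H] := rawlim_near chi rz; exists d => // y yz yd; have [_ _] := H y yz yd.
Qed.

Lemma S_inf_cont chi z : r < cabs z < S -> offg (zl chi 0 N1) z -> {for z, continuous (SI chi)}.
Proof.
move=> rz oz; apply: (cont_eq_near (cont_lim rz oz)).
have [d d0 H] := rawlim_near chi rz; exists d => // y yd; have [->|yz] := eqVneq y z; first exact: S_inf_gS.
by have [ry oy _] := H y yz yd; exact: S_inf_gS.
Qed.

Lemma gS_pole (zs : seq (R * R)) i : cfg zs -> i \in gen zs -> forall X : R, exists2 d : R, 0 < d & forall y, y != i.2%:C ->
 cabs (y - i.2%:C) < d -> X <= cabs (gS zs y).
Proof.
move=> zsC ig X; have ri : rsd zs i != 0 by move: ig; rewrite mem_gen => /andP[].
have iz : i \in zs by move: ig; rewrite mem_gen => /andP[].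
have ug : uniq (gen zs) by rewrite filter_uniq // (cfg_uniq zsC).
pose rest y : C := 1 + \sum_(j <- rem i (gen zs)) (rsd zs j)%:C / (y - j.2%:C).
have [|d1 d10 H1] := @seq_pos_lb R _ (fun j : R * R => cabs (i.2%:C - j.2%:C)) (rem i (gen zs)).
 move=> j; rewrite mem_rem_uniq // inE => /andP[ji jg]; rewrite cabs_gt0 subr_eq0 (inj_eq CI).
 have jz : j \in zs by move: jg; rewrite mem_gen => /andP[].
 by have ij : i != j by [rewrite eq_sym]; have [] := pole_ratio zsC iz jz ij.
pose B := 1 + \sum_(j <- rem i (gen zs)) `|rsd zs j| / (d1 / 2).
have k0 := kap_gt0 zsC.
have restB y : cabs (y - i.2%:C) < d1 / 2 -> cabs (rest y) <= B.
 move=> yd; apply: cabsD_le; rewrite cabs1 lerD2l; apply: le_trans (cabs_sum _ _ _) _.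
 rewrite !big_seq; apply: ler_sum => j jr; rewrite cabsM cabsV cabsR ler_wpM2l //.
 have h := H1 j jr; have h2 := cabsD (i.2%:C - y) (y - j.2%:C).
 rewrite (_ : i.2%:C - y + (y - j.2%:C) = i.2%:C - j.2%:C) in h2; last by ring.
 rewrite (cabsBC i.2%:C y) in h2.
 have h3 : d1 / 2 <= cabs (y - j.2%:C) by lra.
 by rewrite lef_pV2 // posrE ?divr_gt0 // (lt_le_trans _ h3) // divr_gt0.
have rp : 0 < `|rsd zs i| by rewrite normr_gt0.
pose Y := `|X| / kap zs + `|B|; have Y0 : 0 <= Y by rewrite addr_ge0 // divr_ge0 // ltW.
have Yp : 0 < Y + 1 by rewrite ltr_wpDl.
exists (Num.min (d1 / 2) (`|rsd zs i| / (Y + 1))); first by rewrite lt_min !divr_gt0.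
move=> y yi; rewrite lt_min => /andP[y1 y2].
have c0 : 0 < cabs (y - i.2%:C) by rewrite cabs_gt0 subr_eq0.
have -> : gS zs y = (kap zs)%:C * (rest y + (rsd zs i)%:C / (y - i.2%:C)).
 by rewrite /gS (big_rem i ig) /= /rest; congr (_ * _); rewrite [_ / _ + _]addrC addrA.
rewrite cabsM cabsR gtr0_norm //.
have h1 : Y + 1 <= cabs ((rsd zs i)%:C / (y - i.2%:C)).
 by rewrite cabsM cabsV cabsR ler_pdivlMr // mulrC -ler_pdivlMr // ltW.
have h2 := restB y y1.
have h3 := cabsD (- rest y) (rest y + (rsd zs i)%:C / (y - i.2%:C)).
rewrite addrA addNr add0r cabsN in h3.
have h4 : `|X| / kap zs <= cabs (rest y + (rsd zs i)%:C / (y - i.2%:C)).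
 by have := ler_norm B; rewrite /Y in h1; lra.
rewrite ler_pdivrMr // in h4; rewrite mulrC; apply: le_trans h4; exact: ler_norm.
Qed.

Lemma S_inf_pole chi i : i \in gen (zl chi 0 N1) -> r < i.2 < S -> forall X : R, exists2 d : R, 0 < d &
 forall y, y != i.2%:C -> cabs (y - i.2%:C) < d -> X <= cabs (SI chi y) /\
  X <= cabs (limn (fun K => S_raw M chi K y)).
Proof.
move=> ig ri X; have rz : r < cabs (i.2%:C : C) < S.
 by rewrite cabsR gtr0_norm //; case/andP: ri => h _; exact: lt_trans h.
have [d1 d10 H1] := gS_pole (cfg_zl chi 0 N1) ig (2 * `|X|).
have [d2 d20 H2] := rawlim_near chi rz; exists (Num.min d1 d2); rewrite ?lt_min ?d10 // => y yi.
rewrite lt_min => /andP[y1 y2]; have [ry oy E] := H2 y yi y2.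
rewrite E S_inf_gS // cabsM; suff h : X <= cabs (gS (zl chi 0 N1) y) * cabs (T y) by [].
have h1 := H1 y yi y1.
have [|h2 _] := @Tb y chi 0%N; first by case/andP: ry => *; rewrite !ltW.
have h3 := cabsD (1 - T y) (T y); rewrite subrK cabs1 (cabsBC 1) in h3.
have h4 : 1 / 2 <= cabs (T y) by lra.
have := ler_norm X; have := normr_ge0 X; move: h1 h4; move: (cabs (gS _ _)) (cabs (T y)) (`|X|) => a t x; nra.
Qed.

(** The default value of [reduced]: a solution of S = x with x nonzero is therefore never a genuine
    pole. *)
Lemma S_inf_pole0 chi i : i \in gen (zl chi 0 N1) -> r < i.2 < S -> SI chi i.2%:C = 0.
Proof.
move=> ig ri; apply: reduced_unbounded => X d d0; have [d' d'0 H] := S_inf_pole ig ri X.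
pose t := Num.min d d' / 2; have t0 : 0 < t by rewrite divr_gt0 // lt_min d0.
have tm : t < Num.min d d' by rewrite /t; move: t0; rewrite /t; lra.
have E : (i.2 + t)%:C - i.2%:C = t%:C :> C by rewrite rmorphD /=; ring.
have yi : (i.2 + t)%:C != i.2%:C :> C by rewrite (inj_eq CI) gt_eqF // ltrDl.
move: tm; rewrite lt_min => /andP[td td'].
exists (i.2 + t)%:C; rewrite E cabsR gtr0_norm //; split=> //.
by have [] := H (i.2 + t)%:C yi; rewrite ?E ?cabsR ?gtr0_norm.
Qed.

End Annulus.

End LimitFunction.

(** * Position of the poles with respect to the contour, and convergence on it *)

Section ContourLimit.
Variable D : discretization R.
Notation V := (knot M).

Lemma zl_mem chi N L p j : (L < N)%N -> idx p j -> valid chi (L, (p, j)) ->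
 ival chi (L, (p, j)) \in zl chi 0 N.
Proof. by move=> LN I vl; apply: map_f; apply/mem_ix; split. Qed.

Lemma sc_refl k : sc false (2 * k) = refl_scale M k k /\ sc true (2 * k) = refl_scale M k k.
Proof.
have E : (2 * k)./2 = k by rewrite mul2n doubleK.
have F : uphalf (2 * k) = k by rewrite mul2n uphalf_double.
by rewrite /sc E F.
Qed.

Lemma sc_refl_odd k : sc false (2 * k).+1 = refl_scale M k k.+1 /\ sc true (2 * k).+1 = refl_scale M k.+1 k.
Proof.
have E : ((2 * k).+1)./2 = k by rewrite mul2n /= uphalf_double.
have F : uphalf (2 * k).+1 = k.+1 by rewrite mul2n /= doubleK.
by rewrite /sc E F.
Qed.

(** A genuine pole differs from the zeros of sign - at its own level, which are exactly the points
    removed in [D_inf]. Odd levels give the scales (k - 1, k), even ones (k, k). *)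
Lemma gen_D chi N i : i \in gen (zl chi 0 N) -> isM i -> D_inf M chi i.2.
Proof.
have zC := cfg_zl chi 0 N; move=> ig mi; have := ig; rewrite mem_gen => /andP[ri iz]; move: ri; rewrite rsd_neq0 // => /allP nz.
have [L [p [j [/andP[_ LN] I vl iE]]]] := zlP iz.
have nzero q k : idx q k -> b q k = false -> valid chi (L, (q, k)) -> i.2 <> sc false L * hi q k.
 move=> I' b' vl' E; have := nz _ (zl_mem LN I' vl'); have := ival_cases I' vl'.
 by rewrite b' => -[_ -> _ _]; rewrite E eqxx.
have bF : b p j = false.
 by move: mi; rewrite iE isM_ival //=; [move/negbTE|exists L, p, j].
have iE2 : i.2 = sc false L * (expR (if L == 0%N then Num.max (V p.-1) chi else V p.-1) / tau M j).
 by rewrite iE /ival bF.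
have [L0|L0] := posnP L.
 left; subst L; rewrite sc0 mul1r /= in iE2; move: vl; rewrite /valid /= bF => vl.
 split; first by exists p, j.
 move=> [q [k [I' cq b' E]]]; apply: (nzero q k I' b'); rewrite ?sc0 ?mul1r //.
 by rewrite /valid /= b'.
rewrite (gtn_eqF L0) in iE2.
have vlL q k : valid chi (L, (q, k)) by rewrite /valid /= (gtn_eqF L0).
right; have LE := odd_double_half L; case oL: (odd L) LE => LE.
 exists (L./2).+1 => //; right; have [e1 _] := sc_refl_odd L./2; rewrite mul2n -add1n LE in e1.
 rewrite -[(L./2).+1.-1]/(L./2) -/(R51 M L./2 (L./2).+1).
 split; first by exists p, j; split=> //; rewrite iE2 e1 mulrA.
 by move=> [q [k [I' b' E]]]; apply: (nzero q k I' b' (vlL _ _)); rewrite E e1 /hi mulrA.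
exists L./2; first by rewrite /= half_gt0; move: L0 oL; case: (L) => [|[|]].
left; have [e1 _] := sc_refl L./2; rewrite mul2n -[(L./2).*2]add0n LE in e1.
split; first by exists p, j; split=> //; rewrite iE2 e1 mulrA.
by move=> [q [k [I' b' E]]]; apply: (nzero q k I' b' (vlL _ _)); rewrite E e1 /hi mulrA.
Qed.

Lemma pole_E chi N i : i \in zl chi 0 N -> ~~ isM i -> E_set M chi i.2.
Proof.
move=> iz mi; have [L [p [j [/andP[_ LN] I vl iE]]]] := zlP iz.
have bT : b p j = true.
 by move: mi; rewrite iE isM_ival //= ?negbK //; exists L, p, j.
have iE2 : i.2 = (sc true L)^-1 * (expR (if L == 0%N then Num.min (V p) chi else V p) / tau M j).
 by rewrite iE /ival bT.
have [L0|L0] := posnP L.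
 left; left; subst L; rewrite sc0 invr1 mul1r /= in iE2; move: vl; rewrite /valid /= bT => vl.
 by exists p, j.
rewrite (gtn_eqF L0) in iE2.
right; have LE := odd_double_half L; case oL: (odd L) LE => LE.
 exists (L./2).+1 => //; left; right; have [_ e1] := sc_refl_odd L./2; rewrite mul2n -add1n LE in e1.
 by exists p, j; split=> //; rewrite iE2 e1 mulrA.
exists L./2; first by rewrite /= half_gt0; move: L0 oL; case: (L) => [|[|]].
left; left; left; have [_ e1] := sc_refl L./2; rewrite mul2n -[(L./2).*2]add0n LE in e1.
by exists p, j; split=> //; rewrite iE2 e1 mulrA.
Qed.

Variables (chi : R) (col : R -> int) (gam : R -> C) (U : set C) (Lg : C -> C).
Hypothesis adm : admissible M D chi col gam U Lg.

Let gC1 : piecewise_C1 gam. Proof. by have [[[]]] := adm. Qed.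

Lemma curve_U s : 0 <= s <= 1 -> U (gam s).
Proof.
move=> s01; have [_ _ [[_ [Phi [Psi [_ _ PU _ PC]]]] _ _] _ _] := adm.
have : curve gam (gam s) by exists s.
rewrite -PC => -[z /= zE <-]; rewrite -PU; exists z => //=; rewrite zE; apply/andP; split; lra.
Qed.

Lemma curve_annulus : exists r S, [/\ 0 < r, 0 < S & forall s, 0 <= s <= 1 -> r < cabs (gam s) < S].
Proof.
have [[_ _ g0] _ _ _ _] := adm; have [n0 _] := g0.
have [d d0 H] := off_curve_dist gC1 n0.
have [/segment_bounded [A HA] /segment_bounded [B HB]] := curve_cont gC1.
exists (d / 2), (`|A| + `|B| + 1); split; first by rewrite divr_gt0.
 by rewrite ltr_wpDl // addr_ge0.
move=> s s01; have h := H s s01; rewrite subr0 in h.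
have h1 := HA s s01; have h2 := HB s s01; have h3 := cabs_le_ReIm (gam s).
by have := ler_norm A; have := ler_norm B; lra.
Qed.

(** Holomorphy on [U] makes S continuous on the curve, whereas S blows up at a genuine pole. *)
Lemma curve_off (r S : R) (N1 : nat) (T : C -> C) (i : R * R) (s : R) : 0 < r ->
 (forall chi N i, i \in zl chi N1 N -> if isM i then i.1 <= r / 2 else 2 * S <= i.1) ->
 (forall z, r < cabs z < S -> {for z, continuous T}) ->
 (forall z chi N, r <= cabs z <= S ->
   cabs (T z - 1) <= 1 / 2 /\ cabs (rawp (zl chi N1 N) z - 1) <= 1 / 2) ->
 (forall e : R, 0 < e -> exists N2, forall chi N z, (N2 <= N)%N -> r <= cabs z <= S ->
  cabs (rawp (zl chi N1 N) z - T z) <= e) ->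
 (forall s, 0 <= s <= 1 -> r < cabs (gam s) < S) ->
 i \in gen (zl chi 0 N1) -> 0 <= s <= 1 -> gam s <> i.2%:C.
Proof.
move=> r0 far Tc Tb Tu rS ig s01 E; have [_ _ _ [hol _ _] _] := adm.
have rs := rS s s01; rewrite E cabsR in rs.
have iz : i \in zl chi 0 N1 by move: ig; rewrite mem_gen => /andP[].
have [z0 p0 _] := cfg_pos (cfg_zl _ _ _) iz; rewrite gtr0_norm // in rs.
have := hol (gam s) (curve_U s01); move=> /derivable1_diffP/differentiable_continuous /cont_cabsP /(_ 1 ltr01).
rewrite E => -[d d0 Hd].
have [d' d'0 Hd'] := S_inf_pole r0 far Tc Tb Tu ig rs (cabs (SI chi i.2%:C) + 1).
pose t := Num.min d d' / 2; have t0 : 0 < t by rewrite divr_gt0 // lt_min d0.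
have tm : t < Num.min d d' by rewrite /t; move: t0; rewrite /t; lra.
have E' : (i.2 + t)%:C - i.2%:C = t%:C :> C by rewrite rmorphD /=; ring.
have yi : (i.2 + t)%:C != i.2%:C :> C by rewrite (inj_eq CI) gt_eqF // ltrDl.
move: tm; rewrite lt_min => /andP[td td'].
have h1 := Hd (i.2 + t)%:C; rewrite E' cabsR gtr0_norm // in h1.
have h2 : cabs (SI chi i.2%:C) + 1 <= cabs (SI chi (i.2 + t)%:C).
 by have [] := Hd' (i.2 + t)%:C yi; rewrite ?E' ?cabsR ?gtr0_norm.
have h3 := cabsD (SI chi (i.2 + t)%:C - SI chi i.2%:C) (SI chi i.2%:C).
rewrite subrK in h3; exact: jump_absurd (h1 td) h2 h3.
Qed.

(** Genuine poles of sign - belong to [D_inf], hence lie inside. Poles of sign + belong to [E_set],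
    hence are not in [Int]; genuine ones are off the curve by [curve_off], as those of far levels
    lie outside the annulus of the curve. *)
Lemma curve_poles : exists K0, forall K i, (K0 <= K)%N -> i \in gen (ZK chi K) ->
 if isM i then Int gam i.2%:C else ~ curve gam i.2%:C /\ ~ Int gam i.2%:C.
Proof.
have [r [S [r0 S0 rS]]] := curve_annulus; have half0 : 0 < 1 / 2 :> R by rewrite divr_gt0.
have [N1 [T [N10 far Tc Tb Tu]]] := annulus_tail r0 S0 half0.
have [_ [DI EI] _ _ _] := adm.
exists N1 => K i hK ig; have := ig; rewrite mem_gen => /andP[_ iz].
case: ifPn => mi; first by apply: DI; exact: gen_D ig mi.
have NC := EI _ (pole_E iz mi); split; last by move=> h; apply: NC; exact: subset_closure.
move=> [s s01 E]; have rs := rS s s01; rewrite E cabsR in rs.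
have [z0 p0 _] := cfg_pos (cfg_zl _ _ _) iz; rewrite gtr0_norm // in rs.
have NK : (N1 <= (2 * K).+1)%N by rewrite ltnW // ltnS mul2n -addnn (leq_trans hK) // leq_addl.
have ig1 : i \in gen (zl chi 0 N1).
 apply: (gen_mono NK ig); move: iz; rewrite /ZK -(subnKC NK) => /zl_cat[] // /far.
 rewrite (negPf mi); move: ig; rewrite mem_gen => /andP[_ iz].
 by have := isMN (cfg_zl _ _ _) iz mi; case/andP: rs => _; lra.
exact: (curve_off r0 far Tc Tb Tu rS ig1 s01 E).
Qed.

Lemma ccontX (f : C -> C) k : ccont gam f -> ccont gam (fun z => f z ^+ k).
Proof.
move=> fc; elim: k => [|k ih].
 under eq_fun do rewrite expr0; exact: ccont_cst.
under eq_fun do rewrite exprS; exact: ccontM fc ih.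
Qed.

Lemma contour_cvg k (e : R) : 0 < e -> exists K0, forall K, (K0 <= K)%N ->
 cabs (cint gam (fun z => gS (ZK chi K) z ^+ k / z) -
    cint gam (fun z => SI chi z ^+ k / z)) <= e.
Proof.
move=> e0; have [r [S [r0 S0 rS]]] := curve_annulus; have half0 : 0 < 1 / 2 :> R by rewrite divr_gt0.
have [N1 [T [N10 far Tc Tb Tu]]] := annulus_tail r0 S0 half0.
have og s : 0 <= s <= 1 -> offg (zl chi 0 N1) (gam s).
 by move=> s01 i ig; apply/eqP; exact: (curve_off r0 far Tc Tb Tu rS ig s01).
have [V V0 HV] := cint_bound gC1.
have [[_ _ [n0 _]] _ _ _ _] := adm.
have gc : ccont gam (gS (zl chi 0 N1)) by move=> s s01; exact: cder_cont (cder_gS (og s s01)).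
have [/segment_bounded [A HA] /segment_bounded [B HB]] := ccont_within gC1 gc.
pose X := `|A| + `|B|; have X0 : 0 <= X by rewrite addr_ge0.
have HX s : 0 <= s <= 1 -> cabs (gS (zl chi 0 N1) (gam s)) <= X.
 move=> s01; apply: le_trans (cabs_le_ReIm _) _; rewrite /X lerD //.
  by apply: le_trans (HA s s01) _; exact: ler_norm.
 by apply: le_trans (HB s s01) _; exact: ler_norm.
(* Dominates S_chi (at most 2 X) and its approximants (at most 3 X) on the curve, for the Lipschitz
   bound of the k-th power. *)
pose Q := 1 + 3 * X; have Q1 : 1 <= Q by rewrite /Q lerDl mulr_ge0.
have Q0 : 0 <= Q by apply: le_trans Q1.
pose c1 := V * (k%:R * Q ^+ k * X / r) + 1.
have c0 : 0 < c1 by rewrite ltr_wpDl // mulr_ge0 // divr_ge0 ?(ltW r0) // mulr_ge0 // mulr_ge0 // exprn_ge0.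
have e1 : 0 < Num.min 1 (e / c1) by rewrite lt_min ltr01 divr_gt0.
have [K1 HK] := gS_cvg r0 far Tu chi e1.
exists (N1 + K1)%N => K hK.
have NK : (N1 <= (2 * K).+1)%N.
 by rewrite ltnW // ltnS mul2n -addnn (leq_trans _ (leq_addl _ _)) // (leq_trans _ hK) // leq_addr.
have close s : 0 <= s <= 1 -> cabs (gS (ZK chi K) (gam s) - SI chi (gam s)) <= Num.min 1 (e / c1) * X.
 move=> s01; rewrite (S_inf_gS r0 far Tc Tu (rS s s01) (og s s01)).
 apply: le_trans (HK K (gam s) _ (rS s s01) (og s s01)) _; first by rewrite (leq_trans _ hK) // leq_addl.
 by rewrite ler_wpM2l ?(ltW e1) // HX.
have SB s : 0 <= s <= 1 -> cabs (SI chi (gam s)) <= 2 * X.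
 move=> s01; rewrite (S_inf_gS r0 far Tc Tu (rS s s01) (og s s01)) cabsM.
 have [|h2 _] := @Tb (gam s) chi 0%N; first by case/andP: (rS s s01) => *; rewrite !ltW.
 have h3 := cabs_near1 (T (gam s)); have h4 := HX s s01; have := cabs_ge0 (gS (zl chi 0 N1) (gam s)).
 by move: h2 h3 h4 X0; move: (cabs (gS _ _)) (cabs (T _)) (cabs (T _ - 1)) => g t d; nra.
have GB s : 0 <= s <= 1 -> cabs (gS (ZK chi K) (gam s)) <= 3 * X.
 move=> s01; have := cabsD (gS (ZK chi K) (gam s) - SI chi (gam s)) (SI chi (gam s)).
 rewrite subrK; have := close s s01; have := SB s s01.
 have : Num.min 1 (e / c1) * X <= 1 * X by rewrite ler_wpM2r // ge_min lexx.
 by lra.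
have cinv : ccont gam (fun z : C => z^-1).
 by have := ccont_inv n0; under eq_fun do rewrite subr0.
have cf : ccont gam (fun z => gS (ZK chi K) z ^+ k / z).
 apply: ccontM cinv; apply: ccontX => s s01; apply: cder_cont; apply: cder_gS.
 exact: (offg_full r0 far NK (rS s s01) (og s s01)).
have ch : ccont gam (fun z => SI chi z ^+ k / z).
 apply: ccontM cinv; apply: ccontX => s s01.
 exact: (S_inf_cont r0 far Tc Tu (rS s s01) (og s s01)).
have -> : cint gam (fun z => gS (ZK chi K) z ^+ k / z) -
    cint gam (fun z => SI chi z ^+ k / z) =
 cint gam (fun z => 1 * (gS (ZK chi K) z ^+ k / z) + (-1) * (SI chi z ^+ k / z)).
 by rewrite (cint_lin gC1) // mul1r mulN1r.
pose mm := k%:R * Q ^+ k * (Num.min 1 (e / c1) * X) / r.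
have mm0 : 0 <= mm.
 by rewrite /mm divr_ge0 ?(ltW r0) // mulr_ge0 ?mulr_ge0 ?exprn_ge0 ?(ltW e1).
apply: le_trans (HV _ mm mm0 _ _) _.
- have c1' : ccont gam (fun=> 1) := @ccont_cst _ gam 1.
 have c2' : ccont gam (fun=> - 1) := @ccont_cst _ gam (- 1).
 exact: (ccontD (ccontM c1' cf) (ccontM c2' ch)).
- move=> s s01; rewrite mul1r mulN1r -mulrBl cabsM cabsV /mm.
 have [rs _] := andP (rS s s01).
 apply: ler_pM; rewrite ?cabs_ge0 ?invr_ge0 ?cabs_ge0 //; last first.
  by rewrite lef_pV2 ?posrE // ?(ltW rs) // (lt_trans r0).
 apply: le_trans (cabs_expB k Q1 _ _) _.
 + by apply: le_trans (GB s s01) _; rewrite /Q lerDr.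
 + by apply: le_trans (SB s s01) _; rewrite /Q; move: X0; lra.
 + by rewrite ler_wpM2l ?close // mulr_ge0 // exprn_ge0.
rewrite /mm; apply: le_trans (_ : V * (k%:R * Q ^+ k * X / r) * (e / c1) <= _).
 have -> : V * (k%:R * Q ^+ k * (Num.min 1 (e / c1) * X) / r) =
   V * (k%:R * Q ^+ k * X / r) * Num.min 1 (e / c1) by ring.
 rewrite ler_wpM2l //; first by rewrite mulr_ge0 // divr_ge0 ?(ltW r0) // mulr_ge0 // mulr_ge0 // exprn_ge0.
 by rewrite ge_min lexx orbT.
rewrite mulrA ler_pdivrMr // mulrC ler_pM2l // /c1 lerDl //.
Qed.

Lemma cexpD (a d : C) : cexp (a + d) = cexp a * cexp d.
Proof.
rewrite /cexp cReD cImD expRD cosD sinD rmorphM /=; case: a => ar ai; case: d => dr di /=.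
by apply: complexP; rewrite ?cReM ?cImM /=; ring.
Qed.

Lemma cexpMn (z : C) k : cexp (k%:R * z) = cexp z ^+ k.
Proof.
elim: k => [|k ih].
 rewrite mul0r expr0 /cexp /= expR0 cos0 sin0 mul1r.
 by apply: complexP.
by rewrite -natr1 mulrDl mul1r cexpD ih exprSr.
Qed.

Lemma cexp_Lg k : cint gam (fun w => cexp (k%:R * Lg w) / w) =
 cint gam (fun z => SI chi z ^+ k / z).
Proof.
have [_ _ _ _ [_ H]] := adm; apply: eq_cint => s s01.
by rewrite cexpMn H //; exact: curve_U.
Qed.

End ContourLimit.

(** * Values on the negative axis, uniformly in K and chi *)

Section ModelBounds.
Let t0 : 0 <= thet := ltW thet_gt0.
Let t1 : thet < 1 := thet_lt1.
Let d0 : 0 < 1 - thet. Proof. by rewrite subr_gt0. Qed.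

(** The number of pairs (p, j) times the sum of all thet^L. *)
Definition cnt : R := (size [seq (p, j) | p <- iota 1 m, j <- iota 1 n])%:R / (1 - thet).

Lemma cnt_ge0 : 0 <= cnt. Proof. by rewrite divr_ge0 // ltW. Qed.

Lemma ix_sum_le (chi A : R) N0 N : 0 <= A -> \sum_(t <- ix chi N0 N) A * thet ^+ t.1 <= cnt * A.
Proof.
move=> A0; rewrite big_filter; pose P := [seq (p, j) | p <- iota 1 m, j <- iota 1 n].
apply: le_trans (_ : \sum_(t <- [seq (L, pj) | L <- iota N0 N, pj <- P]) A * thet ^+ t.1 <= _).
 rewrite [leRHS](bigID (valid chi)) /= lerDl sumr_ge0 // => t _.
 by rewrite mulr_ge0 // exprn_ge0.
rewrite big_allpairs_dep /= (eq_bigr (fun L => (size P)%:R * A * thet ^+ L)); last first.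
 by move=> L _; rewrite big_const_seq count_predT iter_addr_0 -mulrA mulr_natl.
rewrite -mulr_sumr /cnt -/P mulrAC [leRHS]mulrAC mulrAC ler_wpM2l ?mulr_ge0 //.
apply: le_trans (geom_sum_le N0 N t0 t1) _.
by rewrite ler_piMl ?invr_ge0 ?(ltW d0) // exprn_ile1 // ltW.
Qed.

Lemma fr_ub (chi s : R) L p j : 0 < s -> idx p j -> valid chi (L, (p, j)) ->
 fr (ival chi (L, (p, j))) s - 1 <= (Hi / s + s * La) * thet ^+ L.
Proof.
move=> s0 I vl; have H := ival_cases I vl; have [z0 p0] := ival_pos chi L I; have [P J] := I.
have tL : 0 <= thet ^+ L by rewrite exprn_ge0.
have g1 : 0 <= Hi / s * thet ^+ L by rewrite mulr_ge0 // divr_ge0 ?Hi_ge0 ?(ltW s0).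
have g2 : 0 <= s * La * thet ^+ L by rewrite mulr_ge0 // mulr_ge0 ?La_ge0 ?(ltW s0).
rewrite /fr [leRHS]mulrDl; move: H; case: (b p j) => -[mi zE lt _]; rewrite ?mi ?(negPf mi).
 have zb : (ival chi (L, (p, j))).1^-1 <= La * thet ^+ L.
  rewrite zE invfM invrK mulrC; apply: ler_pM; rewrite ?invr_ge0 ?(ltW (sc_gt0 _ _)) ?(ltW (lo_gt0 _ _)) //.
   exact: lo_le.
  exact: sc_thet.
 move: lt zb z0 p0; move: (ival _ _).1 (ival _ _).2 => z q zq zb z0 q0.
 apply: le_trans (_ : s * (La * thet ^+ L) <= _); last by rewrite mulrA lerDr.
 have h : 0 < s / q by rewrite divr_gt0.
 have h' : 0 < s / z by rewrite divr_gt0.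
 apply: le_trans (_ : s / z <= _); last by rewrite ler_pM2l.
 by rewrite lerBlDr ler_pdivrMr ?addr_gt0 //; nra.
have zb : (ival chi (L, (p, j))).1 <= Hi * thet ^+ L.
 rewrite zE mulrC; apply: ler_pM; rewrite ?(ltW (sc_gt0 _ _)) ?(ltW (hi_gt0 _ _)) //; first exact: hi_le.
 exact: sc_thet.
move: lt zb z0 p0; move: (ival _ _).1 (ival _ _).2 => z q zq zb z0 q0.
apply: le_trans (_ : Hi * thet ^+ L / s <= _); last by rewrite mulrAC lerDl.
apply: le_trans (_ : z / s <= _); last by rewrite ler_pM2r ?invr_gt0.
have h' : 0 < z / s by rewrite divr_gt0.
have zs : z / s * s = z by rewrite divfK // gt_eqF.
by rewrite lerBlDr ler_pdivrMr ?addr_gt0 //; nra.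
Qed.

(** Each factor is at most the exponential of its excess over 1, and these excesses decay
    geometrically with the level. *)
Lemma pr_ub (chi s : R) N0 N : 0 < s -> pr (zl chi N0 N) s <= expR (cnt * (Hi / s + s * La)).
Proof.
move=> s0; have A0 : 0 <= Hi / s + s * La.
 by rewrite addr_ge0 ?mulr_ge0 ?invr_ge0 ?Hi_ge0 ?La_ge0 ?(ltW s0).
apply: le_trans (_ : expR (\sum_(i <- zl chi N0 N) (fr i s - 1)) <= _).
 rewrite /pr expR_sum big_seq [leRHS]big_seq; apply: ler_prod => i iz.
 have := fr_ge1 (cfg_zl _ _ _) iz s0 => f1; rewrite (le_trans ler01 f1) /=.
 by have := expR_ge1Dx (fr i s - 1); rewrite addrC subrK.
rewrite ler_expR /zl big_map; apply: le_trans (ix_sum_le chi N0 N A0).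
rewrite big_seq [leRHS]big_seq; apply: ler_sum => -[L [p j]] /mem_ix[_ I vl]; exact: fr_ub.
Qed.

Lemma zl_zero_bound (chi : R) N i : i \in zl chi 0 N -> isM i -> exists t, [/\ t \in ix chi 0 N, i = ival chi t & i.1 <= Hi * thet ^+ t.1].
Proof.
move=> /zlP[L [p [j [LN I vl iE]]]] mi; exists (L, (p, j)); split=> //; first by apply/mem_ix.
have := ival_cases I vl; have [P J] := I; rewrite -iE.
case: (b p j) => -[mi' zE _ _]; first by rewrite mi in mi'.
rewrite zE mulrC; apply: ler_pM; rewrite ?(ltW (sc_gt0 _ _)) ?(ltW (hi_gt0 _ _)) //; first exact: hi_le.
exact: sc_thet.
Qed.

Lemma pow_big (x X : R) : 1 < x -> exists N, X <= x ^+ N.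
Proof.
move=> x1; have x0 : 0 < x by apply: lt_trans x1.
have i1 : x^-1 < 1 by rewrite invf_lt1.
have i0 : 0 < x^-1 by rewrite invr_gt0.
have [N H] := geom_small X (ltW i0) i1 ltr01.
exists N; have := H N (leqnn N); rewrite exprVn mulrC ler_pdivrMr ?exprn_gt0 // mul1r //.
Qed.

Lemma sub_idx_prod (chi s : R) N p j : 0 < s -> idx p j ->
 \prod_(L <- iota 1 N) fr (ival chi (L, (p, j))) s <= pr (zl chi 0 N.+1) s.
Proof.
move=> s0 I; rewrite /pr /zl big_map.
apply: le_trans (_ : \prod_(t <- [seq (L, (p, j)) | L <- iota 1 N]) fr (ival chi t) s <= _).
 by rewrite big_map.
apply: prod_sub_le.
- by rewrite map_inj_uniq ?iota_uniq // => a a' [].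
- move=> t /mapP[L]; rewrite mem_iota add1n => /andP[L1 LN] ->; apply/mem_ix; split=> //.
 by rewrite /valid /= gtn_eqF.
- move=> t tx; apply: (fr_ge1 (cfg_zl chi 0 N.+1)) => //; exact: map_f.
Qed.

Lemma lo_lt_hi p j : idx p j -> lo p j < hi p j.
Proof. by move=> [P J]; rewrite ltr_pM2r ?invr_gt0 ?tau_gt0 // ltr_expR V_lt. Qed.

(** The mean of 1 and hi/lo: the gain guaranteed by one scaled copy at a suitable point. *)
Definition ratio p j : R := (lo p j + hi p j) / (2 * lo p j).

Lemma ratio_gt1 p j : idx p j -> 1 < ratio p j.
Proof.
move=> I; have := lo_lt_hi I; have := lo_gt0 p (proj2 I) => l0 lh.
rewrite /ratio; move: (lo p j) (hi p j) l0 lh => l h l0 lh.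
by rewrite ltr_pdivlMr ?mulr_gt0 // mul1r mulr2n mulrDl mul1r ltrD2l.
Qed.

(** Equality holds at the threshold, and the factor is monotone in s, decreasing for sign - and
    increasing for sign +. *)
Lemma fr_lb (chi s : R) L p j : 0 < s -> idx p j -> (0 < L)%N ->
 (if b p j then hi p j <= s * sc true L else s <= sc false L * lo p j) ->
 ratio p j <= fr (ival chi (L, (p, j))) s.
Proof.
move=> s0 I L0 hs; have vl : valid chi (L, (p, j)) by rewrite /valid /= gtn_eqF.
have := ival_cases I vl => H.
have l0 := lo_gt0 p (proj2 I); have h0 := hi_gt0 p (proj2 I); have lh := lo_lt_hi I.
rewrite /fr isM_ival /=; last by exists L, p, j.
rewrite /ival (gtn_eqF L0) -/(hi p j) -/(lo p j).
case: (b p j) hs => /= hs; have := sc_gt0.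
 move=> /(_ true L); move: hs; move: (sc true L) => q hs q0.
 rewrite /ratio; move: (lo p j) (hi p j) l0 h0 lh hs => l h l0 h0 lh hs.
 have -> : (1 + s / (q^-1 * l)) / (1 + s / (q^-1 * h)) = h / l * ((l + s * q) / (h + s * q)).
  by field; rewrite !gt_eqF // addr_gt0 // mulr_gt0.
 move: (s * q) hs => x hs; have x0 : 0 < x by apply: lt_le_trans hs.
 rewrite ler_pdivrMr ?mulr_gt0 //.
 have -> : h / l * ((l + x) / (h + x)) * (2 * l) = (2 * h * (l + x)) / (h + x).
  by field; rewrite !gt_eqF // addr_gt0.
 by rewrite ler_pdivlMr ?addr_gt0 //; nra.
move=> /(_ false L); move: hs; move: (sc false L) => q hs q0.
rewrite /ratio; move: (lo p j) (hi p j) l0 h0 lh hs => l h l0 h0 lh hs.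
have ql : 0 < q * l by rewrite mulr_gt0.
rewrite ler_pdivrMr ?mulr_gt0 // mulrAC ler_pdivlMr ?addr_gt0 //.
have h1 : 0 <= q * (h - l) by rewrite mulr_ge0 ?(ltW q0) // subr_ge0 ltW.
have h2 : 0 <= q * l - s by rewrite subr_ge0.
have := mulr_ge0 h1 h2.
nra.
Qed.

Lemma prod_const_lb (f : nat -> R) (x : R) N : 0 <= x -> (forall L, (1 <= L <= N)%N -> x <= f L) ->
 x ^+ N <= \prod_(L <- iota 1 N) f L.
Proof.
move=> x0 H; elim: N H => [|N ih] H; first by rewrite big_nil.
rewrite -addn1 iotaD big_cat big_seq1 /= exprD expr1; apply: ler_pM; rewrite ?exprn_ge0 //.
 by apply: ih => L /andP[a h]; apply: H; rewrite a leqW.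
by apply: H; rewrite add1n leqnn.
Qed.

Lemma sc_mono s L N : (L <= N)%N -> sc s N <= sc s L.
Proof.
rewrite leq_eqVlt => /orP[/eqP -> //|/(sc_lt s) h]; apply: le_trans h _.
by rewrite ler_piMl ?(ltW t1) // ltW // sc_gt0.
Qed.

Lemma pr_mono (chi s : R) N N' : 0 < s -> (N <= N')%N -> pr (zl chi 0 N) s <= pr (zl chi 0 N') s.
Proof.
move=> s0 NN; apply: prod_sub_le; first exact: cfg_uniq (cfg_zl _ _ _).
- move=> i /zlP[L [p [j [/andP[_ LN] I vl ->]]]]; apply: map_f; apply/mem_ix; split=> //.
 by rewrite add0n (leq_trans _ NN).
- by move=> i iz; exact: fr_ge1 (cfg_zl _ _ _) iz s0.
Qed.

(** The N copies of one interval of sign - at levels 1 to N each gain [ratio] at the lower end of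
    the last copy, and [ratio] to the power N exceeds X. *)
Lemma pr_small_large p j (X S : R) : idx p j -> b p j = false -> 0 < S -> exists (e : R) (N : nat),
 [/\ 0 < e, e <= S & forall chi N', (N < N')%N -> X <= pr (zl chi 0 N') e].
Proof.
move=> I bF S0; have [N1 H1] := pow_big X (ratio_gt1 I); have l0 := lo_gt0 p (proj2 I).
have [N2 H2] := geom_small (lo p j) t0 t1 S0.
pose N := maxn N1 N2; exists (sc false N * lo p j), N; split.
- by rewrite mulr_gt0 ?sc_gt0.
- by apply: le_trans (H2 N (leq_maxr _ _)); rewrite ler_pM2r // sc_thet.
move=> chi N' NN; apply: le_trans (pr_mono chi _ NN); last by rewrite mulr_gt0 ?sc_gt0.
apply: le_trans (sub_idx_prod chi N _ I); last by rewrite mulr_gt0 ?sc_gt0.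
have r1 := ltW (ratio_gt1 I).
apply: le_trans H1 (le_trans (_ : _ <= ratio p j ^+ N) _).
 by rewrite ler_weXn2l // leq_maxl.
apply: prod_const_lb; first by apply: le_trans r1.
move=> L /andP[L1 LN]; apply: fr_lb => //; first by rewrite mulr_gt0 ?sc_gt0.
by rewrite bF ler_pM2r // sc_mono.
Qed.

(** Mirror image for sign +, towards infinity. The inequality with [4 * cnt * Hi] prepares
    [logder_neg]: the last copy is long enough to outweigh all intervals of sign -. *)
Lemma pr_large_large p j (X S : R) : idx p j -> b p j = true -> 0 < S -> exists (e : R) (N : nat),
 [/\ S <= e, 4 * cnt * Hi <= (sc true N)^-1 * (hi p j - lo p j) /\ (0 < N)%N, (sc true N)^-1 * hi p j <= e &
  forall chi N', (N < N')%N -> X <= pr (zl chi 0 N') e].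
Proof.
move=> I bT S0; have [N1 H1] := pow_big X (ratio_gt1 I); have h0 := hi_gt0 p (proj2 I).
have lh := lo_lt_hi I; have d1 : 0 < hi p j - lo p j by rewrite subr_gt0.
have [N2 H2] := geom_small (4 * cnt * Hi) t0 t1 d1.
pose N := (maxn N1 N2).+1; have s0 := sc_gt0 true N.
have e0 : 0 < Num.max S ((sc true N)^-1 * hi p j) by rewrite lt_max S0.
exists (Num.max S ((sc true N)^-1 * hi p j)), N; split.
- by rewrite le_max lexx.
- split=> //; rewrite ler_pdivlMl //; apply: le_trans (H2 N _); last by rewrite leqW // leq_maxr.
 by rewrite ler_wpM2r ?sc_thet // mulr_ge0 ?Hi_ge0 // mulr_ge0 // cnt_ge0.
- by rewrite le_max lexx orbT.
move=> chi N' NN; apply: le_trans (pr_mono chi e0 NN).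
apply: le_trans (sub_idx_prod chi N e0 I).
have r1 := ltW (ratio_gt1 I).
apply: le_trans H1 (le_trans (_ : _ <= ratio p j ^+ N) _).
 by rewrite ler_weXn2l // leqW // leq_maxl.
apply: prod_const_lb; first by apply: le_trans r1.
move=> L /andP[L1 LN]; apply: fr_lb => //.
rewrite bT -ler_pdivrMr ?sc_gt0 // mulrC; apply: le_trans (_ : (sc true N)^-1 * hi p j <= _).
 by rewrite ler_pM2r // lef_pV2 ?posrE ?sc_gt0 // sc_mono.
by rewrite le_max lexx orbT.
Qed.

End ModelBounds.

(** * Both signs present *)

Section Mixed.
Variables (pm jm pp jp : nat).
Hypotheses (Im_ : idx pm jm) (bm : b pm jm = false).
Hypotheses (Ip : idx pp jp) (bp : b pp jp = true).

Section MixedUniform.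
Let t0 : 0 <= thet := ltW thet_gt0.
Let t1 : thet < 1 := thet_lt1.

Lemma seq_argmax (T : eqType) (f : T -> R) (s : seq T) x0 : x0 \in s ->
 exists2 x, x \in s & forall y, y \in s -> f y <= f x.
Proof.
elim: s x0 => [//|a s ih] x0; have [->|sN] := eqVneq s [::].
 by move=> _; exists a; rewrite ?mem_head // => y; rewrite inE => /eqP ->.
have [y ys] : exists y, y \in s by case: (s) sN => // y s' _; exists y; rewrite mem_head.
have [x xs xm] := ih y ys => _; have [ax|xa] := leP (f a) (f x).
 by exists x; rewrite ?inE ?xs ?orbT // => z; rewrite inE => /orP[/eqP -> //|/xm].
exists a; rewrite ?mem_head // => z; rewrite inE => /orP[/eqP -> //|/xm h].
exact: le_trans h (ltW xa).
Qed.

(** Two levels suffice: level 1 has a copy of every interval of sign -, whichever are cut off at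
    level 0, and higher levels only have smaller ones. The zero c is therefore the same for all K,
    and stays between [cmin] and [Hi] as chi varies. *)
Definition top_zero chi (i0 : R * R) := [/\ isM i0, i0 \in zl chi 0 2 &
 forall N i, i \in zl chi 0 N -> isM i -> i.1 <= i0.1].

Definition cmin : R := sc false 1 * hi pm jm.

Lemma cmin_gt0 : 0 < cmin.
Proof. by rewrite mulr_gt0 ?sc_gt0 // hi_gt0 //; case: Im_. Qed.

Lemma ival_zero chi L p j : idx p j -> b p j = false -> (ival chi (L, (p, j))).1 = sc false L * hi p j.
Proof. by move=> I bF; rewrite /ival bF. Qed.

Lemma exists_top chi : exists i0, top_zero chi i0 /\ cmin <= i0.1 <= Hi.
Proof.
have vl1 p j : valid chi (1%N, (p, j)) by rewrite /valid.
have tm : ival chi (1%N, (pm, jm)) \in [seq i <- zl chi 0 2 | isM i].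
 rewrite mem_filter isM_ival /= ?bm; last by exists 1%N, pm, jm.
 by apply: map_f; apply/mem_ix.
have [i0] := seq_argmax (fun i : R * R => i.1) tm; rewrite mem_filter => /andP[mi0 iz0] mx.
exists i0; split; last first.
 have [t [_ _]] := zl_zero_bound iz0 mi0 => h; apply/andP; split.
  by have := mx _ tm; rewrite ival_zero.
 by apply: le_trans h _; rewrite ler_piMr ?Hi_ge0 // exprn_ile1 // ltW.
split=> // N i iz mi; have [L [p [j [LN I vl iE]]]] := zlP iz.
have bF : b p j = false by move: mi; rewrite iE isM_ival /=; [move/negbTE|exists L, p, j].
have [L2|L2] := ltnP L 2.
 by apply: mx; rewrite mem_filter mi iE; apply: map_f; apply/mem_ix.
apply: le_trans (mx (ival chi (1%N, (p, j))) _); last first.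
 rewrite mem_filter isM_ival /= ?bF; last by exists 1%N, p, j.
 by apply: map_f; apply/mem_ix.
rewrite iE !ival_zero // ler_pM2r ?hi_gt0 //; last by case: I.
by rewrite sc_mono // ltnW.
Qed.

Lemma top_mem chi i0 K : top_zero chi i0 -> (0 < K)%N -> i0 \in ZK chi K.
Proof.
move=> [_ iz _] K0; have [L [p [j [/andP[_ L2] I vl ->]]]] := zlP iz.
apply: map_f; apply/mem_ix; split=> //; rewrite add0n (leq_trans L2) // add0n ltnS mul2n -addnn.
by rewrite (leq_trans K0) // leq_addr.
Qed.

Definition lK chi i0 K := lst (ZK chi K) i0.

Section OneColumn.
Variables (chi : R) (i0 : R * R) (K : nat).
Hypotheses (ti0 : top_zero chi i0) (K0 : (0 < K)%N).
Let c := i0.1.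
Let l := lK chi i0 K.
Let i0z := top_mem ti0 K0.
Let i0M : isM i0. Proof. by case: ti0. Qed.
Let i0max i : i \in ZK chi K -> isM i -> i.1 <= i0.1. Proof. by case: ti0 => _ _; exact. Qed.

Lemma c_gt0 : 0 < c.
Proof. by have [h _ _] := cfg_pos (cfg_zl _ _ _) i0z. Qed.

Lemma l_pos p : p \in l -> 0 < p.1 /\ 0 < p.2.
Proof. exact: (lst_pos (cfg_zl _ _ _) i0z i0M i0max). Qed.

Lemma l_neq p : p \in l -> p.2 != c.
Proof. exact: (lst_neq (cfg_zl _ _ _) i0z i0M i0max). Qed.

Lemma l_uniq : uniq (map snd l).
Proof. exact: (lst_uniq (cfg_zl _ _ _)). Qed.

Lemma l_sS w : offg (ZK chi K) w -> gS (ZK chi K) w = sS l c w.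
Proof. exact: (gS_sS (cfg_zl _ _ _) i0z i0M i0max). Qed.

Lemma l_neg (s : R) : 0 < s -> sS l c (- s)%:C = (pr (ZK chi K) s)%:C.
Proof.
move=> s0; have o := offr_neg (cfg_zl chi 0 (2 * K).+1) s0.
rewrite -rawp_neg (rawp_gS (cfg_zl _ _ _) o) l_sS // => i; rewrite mem_gen => /andP[_ iz]; exact: o.
Qed.

Lemma l_offp (s : R) : 0 < s -> offp l (- s)%:C.
Proof.
move=> s0 p /l_pos[_ p2]; rewrite (inj_eq CI) lt_eqF //.
by apply: lt_trans p2; rewrite oppr_lt0.
Qed.

(** The sum is the logarithmic derivative of the product at the real point -S. The copy of sign + at
    level N alone gives at most -cnt Hi/S^2, the 4 coming from (S + z)(S + p) <= 4 S^2; all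
    intervals of sign - together give at most cnt Hi/S^2. *)
Lemma logder_neg (S : R) N : 0 < S -> (0 < N < (2 * K).+1)%N ->
 4 * cnt * Hi <= (sc true N)^-1 * (hi pp jp - lo pp jp) ->
 (sc true N)^-1 * hi pp jp <= S ->
 \sum_(i <- ZK chi K) ((i.1 - i.2) / ((S + i.1) * (S + i.2))) <= 0.
Proof.
move=> S0 /andP[N0 NK] h1 h2; rewrite /ZK /zl big_map.
pose g t := ((ival chi t).1 - (ival chi t).2) / ((S + (ival chi t).1) * (S + (ival chi t).2)).
have tx : (N, (pp, jp)) \in ix chi 0 (2 * K).+1.
 by apply/mem_ix; split=> //; rewrite /valid /= gtn_eqF.
rewrite (big_rem _ tx) /= -/(g _).
have gt1 : g (N, (pp, jp)) <= - (cnt * (Hi / S ^+ 2)).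
 have vl : valid chi (N, (pp, jp)) by rewrite /valid /= gtn_eqF.
 have [z0 p0] := ival_pos chi N Ip; rewrite /g; move: z0 p0; rewrite /ival bp (gtn_eqF N0) /= => z0 p0.
 rewrite -[expR _ / _]/(hi pp jp) in p0 h2 *.
 set z := _ * lo pp jp in z0 *; set q := _ * hi pp jp in p0 h2 *.
 have zq : z <= q by rewrite ler_pM2l ?invr_gt0 ?sc_gt0 // ltW // lo_lt_hi.
 have h3 : 4 * cnt * Hi <= q - z by rewrite -mulrBr.
 rewrite ler_pdivrMr ?mulr_gt0 ?addr_gt0 // mulNr -lerN2 opprK opprB.
 apply: le_trans h3; have cH : 0 <= cnt * Hi by rewrite mulr_ge0 ?Hi_ge0 ?cnt_ge0.
 have -> : cnt * (Hi / S ^+ 2) * ((S + z) * (S + q)) = cnt * Hi * ((S + z) * (S + q) / S ^+ 2) by ring.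
 have -> : 4 * cnt * Hi = cnt * Hi * 4 by ring.
 rewrite ler_wpM2l // ler_pdivrMr ?exprn_gt0 //; nra.
have rest : \sum_(t <- rem (N, (pp, jp)) (ix chi 0 (2 * K).+1)) g t <= cnt * (Hi / S ^+ 2).
 have A0 : 0 <= Hi / S ^+ 2 by rewrite divr_ge0 ?Hi_ge0 // exprn_ge0 // ltW.
 apply: le_trans (ix_sum_le chi 0 (2 * K).+1 A0).
 rewrite [leRHS](big_rem _ tx) /= -[leLHS]add0r lerD //.
  by rewrite mulr_ge0 // exprn_ge0.
 rewrite big_seq [leRHS]big_seq; apply: ler_sum => -[L [p j]] /mem_rem /mem_ix[_ I vl].
 have [z0 p0] := ival_pos chi L I; rewrite /g /=.
 have tL : 0 <= Hi / S ^+ 2 * thet ^+ L by rewrite mulr_ge0 // exprn_ge0.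
 have := ival_cases I vl; case: (b p j) => -[mi zE lt _].
  apply: le_trans tL; rewrite mulr_le0_ge0 ?subr_le0 ?(ltW lt) // invr_ge0 mulr_ge0 ?addr_ge0 ?(ltW S0) ?(ltW z0) ?(ltW p0) //.
 have zb : (ival chi (L, (p, j))).1 <= Hi * thet ^+ L.
  rewrite zE mulrC; apply: ler_pM; rewrite ?(ltW (sc_gt0 _ _)) ?(ltW (hi_gt0 _ _)) //; try by case: I.
   exact: hi_le.
  exact: sc_thet.
 move: z0 p0 lt zb; move: (ival _ _).1 (ival _ _).2 => z q z0 q0 lt zb.
 rewrite ler_pdivrMr ?mulr_gt0 ?addr_gt0 //.
 have X0 : 0 <= Hi * thet ^+ L by apply: le_trans zb; exact: ltW.
 apply: le_trans (_ : Hi * thet ^+ L <= _); first by lra.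
 have -> : Hi / S ^+ 2 * thet ^+ L * ((S + z) * (S + q)) = Hi * thet ^+ L * ((S + z) * (S + q) / S ^+ 2) by ring.
 by rewrite ler_peMr // ler_pdivlMr ?exprn_gt0 // mul1r; nra.
by have := lerD gt1 rest; rewrite addNr.
Qed.

(** At a real point to the left of c, M <= S(t) means S'(t) <= 0, which is the sign of the
    logarithmic derivative since the product is positive there. *)
Lemma onG_neg (S : R) : 0 < S -> \sum_(i <- ZK chi K) ((i.1 - i.2) / ((S + i.1) * (S + i.2))) <= 0 ->
 onG l c (- S)%:C (pr (ZK chi K) S).
Proof.
move=> S0 sg; have ol := l_offp S0; split=> //; first exact: l_neg.
have := sM_S_real c ol; rewrite l_neg //= => E; rewrite -subr_ge0 E.
rewrite mulr_le0 //; first by have := c_gt0; lra.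
have H1 := cder_sS c ol.
have oS := offr_neg (cfg_zl chi 0 (2 * K).+1) S0.
have nz i : i \in ZK chi K -> (- S)%:C != i.1%:C :> C.
 move=> iz; have [z0 _ _] := cfg_pos (cfg_zl _ _ _) iz; rewrite (inj_eq CI) lt_eqF //.
 by apply: lt_trans z0; rewrite oppr_lt0.
have H2 := cder_rawp (cfg_zl chi 0 (2 * K).+1) oS nz.
have H3 : cder (sS l c) (- S)%:C (rawp (ZK chi K) (- S)%:C *
  \sum_(i <- ZK chi K) (((- S)%:C - i.1%:C)^-1 - ((- S)%:C - i.2%:C)^-1)).
 apply: (cder_near H2); have [d d0 Hd] := punct_off (ZK chi K) (- S)%:C; exists d => // y yd.
 have oy : offr (ZK chi K) y.
  by have [->|yz] := eqVneq y (- S)%:C; [exact: oS|have [] := Hd y yz yd].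
 rewrite (rawp_gS (cfg_zl _ _ _) oy) l_sS // => i; rewrite mem_gen => /andP[_ iz]; exact: oy.
rewrite (cder_unique H1 H3) rawp_neg cReZ mulr_ge0_le0 //.
 by apply: le_trans (pr_ge1 (cfg_zl _ _ _) S0).
rewrite Re_sum; apply: le_trans sg; rewrite le_eqVlt; apply/orP; left; apply/eqP; apply: eq_big_seq => i iz.
have [z0 p0 _] := cfg_pos (cfg_zl _ _ _) iz.
rewrite -!rmorphB -!fmorphV -rmorphB /=.
have h1 : - S - i.1 != 0 by rewrite -opprD oppr_eq0 gt_eqF // addr_gt0.
have h2 : - S - i.2 != 0 by rewrite -opprD oppr_eq0 gt_eqF // addr_gt0.
have h3 : S + i.1 != 0 by rewrite gt_eqF // addr_gt0.
have h4 : S + i.2 != 0 by rewrite gt_eqF // addr_gt0.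
by field; rewrite ?h1 ?h2 ?h3 ?h4.
Qed.

End OneColumn.

(** The end point -S0 and the bounds on its level come from the growth of the product towards minus
    infinity, due to sign +. The radius r0 of a disc where M exceeds Y, and the bound sg for [sN],
    come from its growth towards 0, due to sign -. *)
Lemma mixed_uniform (Y : R) : exists (r0 S0 sg Bs B1 : R) (K0 : nat),
 [/\ 0 < r0, 0 < S0, 0 < sg, (0 < K0)%N &
 forall chi i0 K, top_zero chi i0 -> cmin <= i0.1 <= Hi -> (K0 <= K)%N ->
 [/\ sB (lK chi i0 K) <= B1, sg <= sN (lK chi i0 K) i0.1,
  forall w, offp (lK chi i0 K) w -> cabs w <= r0 -> Y < sM (lK chi i0 K) i0.1 w,
  onG (lK chi i0 K) i0.1 (- S0)%:C (pr (ZK chi K) S0) &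
  Y <= pr (ZK chi K) S0 <= Bs /\ forall x, ~ onG (lK chi i0 K) i0.1 0 x]].
Proof.
have [S0 [Na [S1 [h4 Na0] hS pS]]] := pr_large_large (`|Y| + 1) Ip bp ltr01.
have S00 : 0 < S0 by apply: lt_le_trans S1.
pose Bs := expR (cnt * (Hi / S0 + S0 * La)).
pose B1 := expR (cnt * (Hi / 1 + 1 * La)).
have B10 : 0 < B1 := expR_gt0 _.
have cm := cmin_gt0; have Hi0 := Hi_ge0.
(* Above Y and above every end level, so that M > Y' near 0 also keeps the point 0 off the path. *)
pose Y' := `|Y| + Bs + 1.
(* The first summand is for [sM_lower], where c/(4 (e + c)) >= 1/6 as e <= c/2; the second is for
   [sN_lower]. *)
pose X := 6 * (Y' + (Hi / 4 + 1 / 2) * B1 + 1) + 2 * Hi * ((1 + 2 / cmin) * B1 + 1).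
have c20 : 0 < cmin / 2 by rewrite divr_gt0.
have [e [Nb [e0 ec pe]]] := pr_small_large X Im_ bm c20.
pose k := (cmin / 2) ^+ 2 / (1 + Hi / 2) ^+ 4.
have k0 : 0 < k by rewrite divr_gt0 ?exprn_gt0 // ltr_wpDr // divr_ge0.
exists e, S0, (k * e), Bs, B1, (Na + Nb + 1)%N; split=> //.
- by rewrite mulr_gt0.
- by rewrite addn1.
move=> chi i0 K ti /andP[c1 c2] hK.
have K0 : (0 < K)%N by apply: leq_trans hK; rewrite addn1.
have NK (N : nat) : (N <= Na + Nb)%N -> (N < (2 * K).+1)%N.
 by move=> h; rewrite ltnS mul2n -addnn (leq_trans h) // (leq_trans _ (leq_addr _ _)) // (leq_trans _ hK) // leq_addr.
have NaK : (Na < (2 * K).+1)%N by apply: NK; rewrite leq_addr.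
have NbK : (Nb < (2 * K).+1)%N by apply: NK; rewrite leq_addl.
have c0 : 0 < i0.1 by apply: lt_le_trans c1.
have lp := l_pos ti K0.
have sBE : sB (lK chi i0 K) <= B1.
 have -> : sB (lK chi i0 K) = pr (ZK chi K) 1 / (1 + i0.1).
  exact: etrans (sB_neg lp c0) (congr1 (fun z : C => Re z / (1 + i0.1)) (l_neg ti K0 ltr01)).
 rewrite ler_pdivrMr ?addr_gt0 //.
 apply: le_trans (pr_ub chi 0 (2 * K).+1 ltr01) _; rewrite -/B1.
 by rewrite ler_peMr ?(ltW B10) // lerDl ltW.
have sB0 := sB_ge0 lp.
have prX : X <= pr (ZK chi K) e by apply: pe.
have ice : 2 / i0.1 <= 2 / cmin by rewrite ler_pM2l // lef_pV2 ?posrE.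
have ic0 : 0 < 2 / i0.1 by rewrite divr_gt0.
have ic00 : 0 < 2 / cmin by rewrite divr_gt0.
have ici : i0.1 * (2 / i0.1) = 2 by rewrite mulrCA divff ?mulr1 // gt_eqF.
have Y'0 : 0 <= Y' by rewrite !addr_ge0 // expR_ge0.
have q5 : 0 <= 6 * (Y' + (Hi / 4 + 1 / 2) * B1 + 1).
 have h : 0 <= (Hi / 4 + 1 / 2) * B1 by rewrite mulr_ge0 ?(ltW B10) // addr_ge0 // divr_ge0.
 by move: Y'0 h; move: (_ * B1) => a; lra.
have Mlarge w : offp (lK chi i0 K) w -> cabs w <= e -> Y' < sM (lK chi i0 K) i0.1 w.
 move=> ow we; have ec' : e <= i0.1 / 2 by apply: le_trans ec _; rewrite ler_pM2r.
 apply: lt_le_trans (sM_lower lp c0 e0 ec' we ow); rewrite (l_neg ti K0 e0) /=.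
 have q1 : X / 6 <= i0.1 / 4 * (pr (ZK chi K) e / (e + i0.1)).
  have -> : i0.1 / 4 * (pr (ZK chi K) e / (e + i0.1)) = (i0.1 / (4 * (e + i0.1))) * pr (ZK chi K) e.
   by field; rewrite gt_eqF // addr_gt0.
  have q2 : 1 / 6 <= i0.1 / (4 * (e + i0.1)).
   by rewrite ler_pdivlMr ?mulr_gt0 ?addr_gt0 //; move: ec' c0 e0; lra.
  have X0 : 0 <= X.
   apply: addr_ge0; first exact: q5.
   by apply: mulr_ge0; [rewrite mulr_ge0|rewrite addr_ge0 // mulr_ge0 ?addr_ge0 // ltW].
  by rewrite [X / 6]mulrC -[6^-1]div1r; apply: ler_pM.
 have q3 : i0.1 / 4 * (1 + 2 / i0.1) * sB (lK chi i0 K) <= (Hi / 4 + 1 / 2) * B1.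
  have -> : i0.1 / 4 * (1 + 2 / i0.1) = i0.1 / 4 + (i0.1 * (2 / i0.1)) / 4 by ring.
  by rewrite ici; apply: ler_pM => //; [rewrite addr_ge0 // divr_ge0 // ltW|move: c2; lra].
 have q4 : 0 <= 2 * Hi * ((1 + 2 / cmin) * B1 + 1).
  by rewrite !mulr_ge0 // addr_ge0 // mulr_ge0 ?addr_ge0 // ltW.
 move: q1 q3; rewrite /X; move: (i0.1 / 4 * _) (i0.1 / 4 * _ * _) ((Hi / 4 + _) * B1) q4 => a d f q4; lra.
have onS : onG (lK chi i0 K) i0.1 (- S0)%:C (pr (ZK chi K) S0).
 by apply: onG_neg => //; apply: (@logder_neg chi K S0 Na) => //; rewrite Na0 NaK.
have pb : pr (ZK chi K) S0 <= Bs by exact: pr_ub.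
split=> //.
- apply: le_trans (sN_lower lp c0 e0); rewrite (l_neg ti K0 e0) /=.
 have kk : k <= (i0.1 / 2) ^+ 2 / (1 + i0.1 / 2) ^+ 4.
  have hc : 0 <= i0.1 / 2 by rewrite divr_ge0 // ltW.
  have hH : 0 <= Hi / 2 by rewrite divr_ge0.
  apply: ler_pM; rewrite ?sqr_ge0 ?invr_ge0 ?exprn_ge0 ?addr_ge0 //.
   by rewrite lerXn2r ?nnegrE ?(ltW c20) // ler_pM2r.
  rewrite lef_pV2 ?posrE ?exprn_gt0 ?ltr_wpDr // lerXn2r ?nnegrE ?addr_ge0 // lerD2l.
  by rewrite ler_pM2r.
 have Hi1 : 0 < Hi by apply: lt_le_trans c2.
 have q4 : 0 <= (1 + 2 / cmin) * B1 + 1 by rewrite addr_ge0 // mulr_ge0 ?addr_ge0 // ltW.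
 have q1 : (1 + 2 / cmin) * B1 + 1 <= pr (ZK chi K) e / (e + i0.1).
  rewrite ler_pdivlMr ?addr_gt0 //; apply: le_trans prX; rewrite /X.
  apply: le_trans (_ : 2 * Hi * ((1 + 2 / cmin) * B1 + 1) <= _); last by rewrite lerDr.
  by rewrite mulrC ler_wpM2r //; move: ec c1 c2; lra.
 have q2 : (1 + 2 / i0.1) * sB (lK chi i0 K) <= (1 + 2 / cmin) * B1.
  by apply: ler_pM; rewrite ?addr_ge0 ?(ltW ic0) // lerD2l.
 rewrite -[leLHS]mulr1; apply: ler_pM => //; first by rewrite mulr_ge0 ?(ltW k0) ?(ltW e0).
  exact: ler_wpM2r (ltW e0) _ _ kk.
 by move: q1 q2; move: (pr _ _ / _) (_ * sB _) (_ * B1) => a d f; lra.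
- move=> w ow we; apply: lt_trans (Mlarge w ow we); have := ler_norm Y; have := expR_gt0 (cnt * (Hi / S0 + S0 * La)).
 by rewrite /Y' /Bs; lra.
- split.
  rewrite pb andbT; have := pS chi (2 * K).+1 NaK; have := ler_norm Y; lra.
 (* A point of level x at 0 would have x above the end level while being closer to c than the end
    point, against [onG_ineq]. *)
 move=> x h0; have [_ o0' Sx Mx] := h0.
 have := Mlarge 0 o0'; rewrite cabs0 => /(_ (ltW e0)) => M0.
 have xB : pr (ZK chi K) S0 < x.
  by apply: le_lt_trans pb _; apply: lt_le_trans Mx; apply: le_lt_trans M0; rewrite /Y'; have := normr_ge0 Y; lra.
 have d1 : cabs ((- S0)%:C - i0.1%:C : C) = - (- S0 - i0.1).
  by rewrite -rmorphB cabsR ltr0_norm //; move: S00 c0; lra.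
 have d2 : cabs (0 - i0.1%:C : C) = - - i0.1 by rewrite sub0r cabsN cabsR opprK ger0_norm // ltW.
 have := onG_ineq lp h0 onS; rewrite d1 d2 => h1.
 have h2 : (pr (ZK chi K) S0 - x) * ((- (- S0 - i0.1)) ^+ 2 - (- - i0.1) ^+ 2) < 0.
  by rewrite nmulr_rlt0 ?subr_lt0 //; nra.
 have h3 : 0 < (1 + cabs (0 : C)) ^+ 2 * (1 + cabs ((- S0)%:C : C)) ^+ 2.
  by rewrite mulr_gt0 // exprn_gt0 // ltr_pwDl ?cabs_ge0.
 have h5 : (pr (ZK chi K) S0 - x) * ((- (- S0 - i0.1)) ^+ 2 - (- - i0.1) ^+ 2) *
   ((1 + cabs (0 : C)) ^+ 2 * (1 + cabs ((- S0)%:C : C)) ^+ 2) < 0 by rewrite pmulr_llt0.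
 have := le_lt_trans h1 h5; rewrite ltNge mulr_ge0 ?(sN_ge0 _ lp) // exprn_ge0 // cabs_ge0 //.
Qed.

End MixedUniform.

(** The relative error of the tail becomes absolute wherever one of the two functions is bounded by
    X; since the tail is within 1/2 of 1, the finite part is then bounded too. K0 is uniform in
    chi. *)
Lemma annulus_close (r S : R) : 0 < r -> 0 < S -> exists N1 : nat, [/\ (0 < N1)%N,
 forall chi N i, i \in zl chi N1 N -> if isM i then i.1 <= r / 2 else 2 * S <= i.1,
 forall chi z, r < cabs z < S -> offg (zl chi 0 N1) z -> {for z, continuous (SI chi)} /\
  forall K, (N1 <= (2 * K).+1)%N -> offg (ZK chi K) z &
 forall X e, 0 < e -> exists K0, forall chi K z, (K0 <= K)%N -> r < cabs z < S ->
  offg (zl chi 0 N1) z -> cabs (gS (ZK chi K) z) <= X \/ cabs (SI chi z) <= X ->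
  cabs (SI chi z - gS (ZK chi K) z) <= e].
Proof.
move=> r0 S0.
have [N1 [T [N10 far Tc Tb Tu]]] := annulus_tail r0 S0 (ltac:(lra) : 0 < 1 / 2 :> R).
exists N1; split=> //.
- move=> chi z zr oz; split; first exact: (S_inf_cont r0 far Tc Tu).
 by move=> K NK; exact: (offg_full r0 far NK).
- move=> X e e0.
 pose e' := e / (2 * (`|X| + 1)).
 have X1 : 0 < `|X| + 1 by rewrite ltr_wpDl.
 have e'0 : 0 < e' by rewrite divr_gt0 // mulr_gt0.
 have [N2 HN2] := Tu e' e'0.
 exists (N1 + N2)%N => chi K z hK zr oz zX.
 have NK : (N1 <= (2 * K).+1)%N.
  by apply: leqW; rewrite mul2n -addnn (leq_trans _ (leq_addr _ _)) // (leq_trans _ hK) // leq_addr.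
 have N2K : (N2 <= (2 * K).+1 - N1)%N.
  by rewrite leq_subRL // leqW // mul2n -addnn (leq_trans hK) // leq_addr.
 rewrite (S_inf_gS r0 far Tc Tu zr oz) (gS_split r0 far NK zr oz) -mulrBr cabsM.
 have zr' : r <= cabs z <= S by case/andP: zr => /ltW -> /ltW ->.
 have h1 := HN2 chi _ z N2K zr'.
 have [t1 t2] := Tb z chi ((2 * K).+1 - N1)%N zr'.
 rewrite (S_inf_gS r0 far Tc Tu zr oz) (gS_split r0 far NK zr oz) in zX.
 set g := gS (zl chi 0 N1) z in zX *; set q := rawp _ _ in h1 t2 zX *.
 have half (y : C) : cabs (y - 1) <= 1 / 2 -> 1 / 2 <= cabs y.
  move=> h; have := cabsB_ge 1 (1 - y); rewrite (_ : 1 - (1 - y) = y); last by ring.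
  by rewrite cabs1 [cabs (1 - y)]cabsBC; lra.
 have gX : cabs g <= 2 * (`|X| + 1).
  have q1 (y : C) : 1 / 2 <= cabs y -> cabs g * cabs y <= X -> cabs g <= 2 * (`|X| + 1).
   by move=> h /(le_trans (ler_wpM2l (cabs_ge0 g) h)); have := ler_norm X; lra.
  by case: zX; rewrite cabsM => zX; apply: (q1 _ _ zX); exact: half.
 rewrite cabsBC in h1; apply: le_trans (ler_pM (cabs_ge0 _) (cabs_ge0 _) gX h1) _.
 by rewrite /e' le_eqVlt; apply/orP; left; apply/eqP; field; rewrite gt_eqF.
Qed.

(** * Roots of the limit function in the upper half-plane *)

Section MixedLimit.

Lemma offg_nonreal zs (w : C) : Im w != 0 -> offg zs w.
Proof. by move=> w0 i _; apply: contraNneq w0 => ->. Qed.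

Lemma nonreal_range (w : C) : Im w != 0 -> 0 < cabs w / 2 /\ cabs w / 2 < cabs w < 2 * cabs w.
Proof.
move=> w0; have : 0 < cabs w by rewrite cabs_gt0; apply: contraNneq w0 => ->.
by move=> h; split; [lra|apply/andP; split; lra].
Qed.

Lemma S_inf_approx chi (w : C) (e : R) : Im w != 0 -> 0 < e ->
 exists K0, forall K, (K0 <= K)%N -> cabs (SI chi w - gS (ZK chi K) w) <= e.
Proof.
move=> w0 e0; have [r0 wr] := nonreal_range w0.
have [N1 [_ _ _ H]] := annulus_close r0 (ltac:(by move: r0; lra) : 0 < 2 * cabs w).
have [K0 HK] := H (cabs (SI chi w)) e e0.
by exists K0 => K hK; apply: HK => //; [exact: offg_nonreal|right].
Qed.

Lemma gSJ (zs : seq (R * R)) (w : C) : gS zs (conjc w) = conjc (gS zs w).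
Proof.
rewrite /gS [conjc (_ * _)]rmorphM /= [conjc (1 + _)]rmorphD /= rmorph_sum.
rewrite !oppr0; congr (_ * (_ + _)).
by apply: eq_bigr => i _; rewrite [RHS]rmorphM /= conjc_inv cjBR oppr0.
Qed.

Lemma S_infJ chi (w : C) : Im w != 0 -> SI chi (conjc w) = conjc (SI chi w).
Proof.
move=> w0; have w0' : Im (conjc w) != 0 by rewrite cImJ oppr_eq0.
apply: cabs_le0_eq; apply/ler_addgt0Pr => e e0; rewrite add0r.
have e2 : 0 < e / 2 by rewrite divr_gt0.
have [Ka HKa] := S_inf_approx chi w0 e2; have [Kb HKb] := S_inf_approx chi w0' e2.
have := HKa (Ka + Kb)%N (leq_addr _ _); have := HKb (Ka + Kb)%N (leq_addl _ _).
set K := (Ka + Kb)%N => h1 h2.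
have -> : SI chi (conjc w) - conjc (SI chi w) =
 (SI chi (conjc w) - gS (ZK chi K) (conjc w)) - conjc (SI chi w - gS (ZK chi K) w).
 by rewrite rmorphB gSJ /=; ring.
by apply: cabsD_le; rewrite cabsN cabsJ; lra.
Qed.

Variables (chi : R) (i0 : R * R).
Hypotheses (ti0 : top_zero chi i0) (cb : cmin <= i0.1 <= Hi).
Let c := i0.1.

Lemma sS_approx (w : C) (e : R) : Im w != 0 -> 0 < e ->
 exists K0, forall K, (K0 <= K)%N -> cabs (SI chi w - sS (lK chi i0 K) c w) <= e.
Proof.
move=> w0 e0; have [K0 HK] := S_inf_approx chi w0 e0; exists K0.+1 => K hK.
rewrite -(l_sS ti0 (leq_ltn_trans (leq0n _) hK)); last exact: offg_nonreal.
by apply: HK; exact: ltnW.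
Qed.

(** [sM] off the axis as a function of the point and the value alone; in this form it makes sense
    for the limit, which has no finite pole expansion. *)
Definition Mof (c : R) (w s : C) : R := Re s - (Re w - c) * Im s / Im w.

Lemma Mof_lip (w s t : C) : Im w != 0 ->
 `|Mof c w s - Mof c w t| <= (1 + `|Re w - c| / `|Im w|) * cabs (s - t).
Proof.
move=> w0; have -> : Mof c w s - Mof c w t = Re (s - t) - (Re w - c) / Im w * Im (s - t).
 by rewrite /Mof cReB cImB; ring.
apply: le_trans (ler_normB _ _) _; rewrite [leRHS]mulrDl mul1r lerD ?Re_le_cabs //.
by rewrite !normrM normfV ler_wpM2l ?Im_le_cabs // divr_ge0.
Qed.

Lemma Mof_real (w : C) (x : R) : Mof c w x%:C = x.
Proof. by rewrite /Mof /= mulr0 mul0r subr0. Qed.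

(** The limit of [sN_Kq], with [sN] replaced by its uniform lower bound: [Kq] is linear and [Mof]
    Lipschitz in the values. *)
Lemma mixed_Kq : exists2 sg, 0 < sg & forall w1 w2, Im w1 != 0 -> Im w2 != 0 ->
 cabs (w1 - conjc w2) ^+ 2 * cabs (w1 - w2) ^+ 2 * sg <=
 Kq c w1 w2 (SI chi w1) (SI chi w2) (Mof c w1 (SI chi w1)) (Mof c w2 (SI chi w2)) *
  ((1 + cabs w1) ^+ 2 * (1 + cabs w2) ^+ 2).
Proof.
have [r0 [S0 [sg [Bs [B1 [K0 [_ _ sg0 K00 unif]]]]]]] := mixed_uniform 0.
exists sg => // w1 w2 n1 n2; apply/ler_addgt0Pr => e e0.
set P := (1 + cabs w1) ^+ 2 * _.
have P0 : 0 < P by rewrite mulr_gt0 // exprn_gt0 // ltr_pwDl // cabs_ge0.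
pose a1 := 1 + `|Re w1 - c| / `|Im w1|; pose a2 := 1 + `|Re w2 - c| / `|Im w2|.
pose D := cabs (w1 - w2).
pose Z := D ^+ 2 * (a1 + a2) + 2 * D * (cabs (w2 - c%:C) + cabs (w1 - c%:C)) + 1.
have a10 : 0 <= a1 by rewrite addr_ge0 // divr_ge0.
have a20 : 0 <= a2 by rewrite addr_ge0 // divr_ge0.
have D0 : 0 <= D := cabs_ge0 _.
have Z0 : 0 < Z.
 rewrite ltr_wpDl // addr_ge0 ?mulr_ge0 ?sqr_ge0 ?addr_ge0 ?cabs_ge0 //.
pose q := e / (P * Z).
have q0 : 0 < q by rewrite divr_gt0 // mulr_gt0.
have [Ka HKa] := sS_approx n1 q0; have [Kb HKb] := sS_approx n2 q0.
pose K := (Ka + Kb + K0)%N.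
have h1 := HKa K ltac:(by rewrite /K -addnA leq_addr).
have h2 := HKb K ltac:(by rewrite /K addnAC leq_addl).
have KK : (0 < K)%N by rewrite /K (leq_trans K00) // leq_addl.
have [_ sgK _ _ _] := unif chi i0 K ti0 cb ltac:(by rewrite /K leq_addl).
have lp := l_pos ti0 KK.
have := @sN_Kq _ _ c lp w1 w2 (offp_nonreal n1) (offp_nonreal n2).
rewrite !sM_nonreal // -/(Mof c w1 _) -/(Mof c w2 _) -/P => ineq.
apply: le_trans (_ : cabs (w1 - conjc w2) ^+ 2 * cabs (w1 - w2) ^+ 2 * sN (lK chi i0 K) c <= _).
 by rewrite ler_wpM2l // mulr_ge0 ?sqr_ge0.
apply: le_trans ineq _.
rewrite (Kq_sub c w1 w2 _ _ _ _ (SI chi w1) (SI chi w2) (Mof c w1 (SI chi w1)) (Mof c w2 (SI chi w2))).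
rewrite mulrDl lerD2l; apply: le_trans (_ : q * Z * P <= _); last first.
 by rewrite /q le_eqVlt; apply/orP; left; apply/eqP; field; rewrite !gt_eqF.
rewrite ler_wpM2r ?(ltW P0) //; apply: le_trans (Kq_bound _ _ _ _ _ _ _) _.
have m1 := Mof_lip (sS (lK chi i0 K) c w1) (SI chi w1) n1.
have m2 := Mof_lip (sS (lK chi i0 K) c w2) (SI chi w2) n2.
rewrite cabsBC in h1; rewrite cabsBC in h2.
have {}m1 : Mof c w1 (sS (lK chi i0 K) c w1) - Mof c w1 (SI chi w1) <= a1 * q.
 exact: le_trans (ler_norm _) (le_trans m1 (ler_wpM2l a10 h1)).
have {}m2 : Mof c w2 (sS (lK chi i0 K) c w2) - Mof c w2 (SI chi w2) <= a2 * q.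
 exact: le_trans (ler_norm _) (le_trans m2 (ler_wpM2l a20 h2)).
have -> : q * Z = D ^+ 2 * (a1 * q + a2 * q) + 2 * D * (q * cabs (w2 - c%:C) + q * cabs (w1 - c%:C)) + q.
 by rewrite /Z; ring.
rewrite -[leLHS]addr0; apply: lerD (ltW q0); apply: lerD.
 by rewrite ler_wpM2l ?sqr_ge0 // lerD.
apply: ler_wpM2l; first exact: mulr_ge0 (ler0n _ 2) D0.
exact: (lerD (ler_wpM2r (cabs_ge0 _) h1) (ler_wpM2r (cabs_ge0 _) h2)).
Qed.

Lemma conj_gap (w1 w2 : C) : `|Im w1 + Im w2| <= cabs (w1 - conjc w2).
Proof. by have := Im_le_cabs (w1 - conjc w2); rewrite cImB cImJ opprK. Qed.

(** At equal real values the form vanishes, whereas the left side of [mixed_Kq] is positive for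
    distinct points of the upper half-plane. *)
Lemma upper_root_uniq (w1 w2 : C) (x : R) : 0 < Im w1 -> 0 < Im w2 ->
 SI chi w1 = x%:C -> SI chi w2 = x%:C -> w1 = w2.
Proof.
move=> u1 u2 E1 E2; have [sg sg0 H] := mixed_Kq.
have := H w1 w2 ltac:(by rewrite gt_eqF) ltac:(by rewrite gt_eqF).
rewrite E1 E2 !Mof_real KqE subrr !mul0r => h.
have g : 0 < cabs (w1 - conjc w2) by apply: lt_le_trans (conj_gap _ _); rewrite gtr0_norm addr_gt0.
apply: cabs_le0_eq; rewrite leNgt; apply/negP => h2.
by move: h; rewrite leNgt !mulr_gt0 // exprn_gt0.
Qed.

(** The poles are real, so a disc of radius |Im w|/2 stays away from all of them in the sense of
    [kfar], uniformly in K, and [sB] is uniformly bounded; [quad_limit] concludes. *)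
Lemma S_inf_taylor (w : C) : Im w != 0 -> exists (d A : R) (dd : C), [/\ 0 < d, 0 <= A &
 forall y, cabs (y - w) < d -> cabs (SI chi y - SI chi w - (y - w) * dd) <= A * cabs (y - w) ^+ 2].
Proof.
move=> w0; have [r0 [S0 [sg [Bs [B1 [K0 [_ _ _ K00 unif]]]]]]] := mixed_uniform 0.
pose d := `|Im w| / 2; have d0 : 0 < d by rewrite divr_gt0 // normr_gt0.
pose Rw := cabs w + d; pose k := d / (1 + Rw + d).
have Rw0 : 0 <= Rw by rewrite addr_ge0 ?cabs_ge0 // ltW.
have den : 0 < 1 + Rw + d by rewrite ltr_wpDl // addr_ge0.
have k0 : 0 < k by rewrite divr_gt0.
have kd : k * (1 + Rw + d) = d by rewrite /k mulfVK // gt_eqF.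
have k1 : k <= 1 by rewrite /k ler_pdivrMr // mul1r lerDr addr_ge0.
have ball y : cabs (y - w) < d -> d <= `|Im y| /\ cabs y <= Rw.
 move=> yw; split.
  have := Im_le_cabs (y - w); rewrite cImB => h.
  have := ler_distD (Im y) (Im w) 0; rewrite !subr0 distrC => h2.
  by move: h h2 yw; rewrite /d; move: `|Im w| `|_| `|_| (cabs _) => a1 a2 a3 a4; lra.
 by have := cabsB_ge y w; rewrite /Rw; lra.
have kf K y : (0 < K)%N -> cabs (y - w) < d -> kfar (lK chi i0 K) k y.
 move=> KK yw p pl; have [h1 h2] := ball y yw; have [_ p0] := l_pos ti0 KK pl.
 have g1 : d <= cabs (y - p.2%:C).
  by apply: le_trans h1 _; have := Im_le_cabs (y - p.2%:C); rewrite cImB /= subr0.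
 have g2 : p.2 - Rw <= cabs (y - p.2%:C).
  have := cabsB_ge p.2%:C y; rewrite cabsR (gtr0_norm p0) cabsBC; lra.
 have [pr|pr] := leP p.2 (Rw + d).
  by apply: le_trans g1; rewrite -kd ler_pM2l //; lra.
 apply: le_trans g2; have -> : 1 + p.2 = (1 + Rw + d) + (p.2 - (Rw + d)) by ring.
 by rewrite mulrDr kd; have : k * (p.2 - (Rw + d)) <= 1 * (p.2 - (Rw + d)); [rewrite ler_wpM2r //; lra|lra].
have B10 : 0 <= B1.
 have [h _ _ _ _] := unif chi i0 K0 ti0 cb (leqnn _).
 exact: le_trans (sB_ge0 (l_pos ti0 K00)) h.
pose A := (1 + `|c|) / k ^+ 3 * B1.
have kA : 0 <= (1 + `|c|) / k ^+ 3 by rewrite divr_ge0 ?addr_ge0 // exprn_ge0 // ltW.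
have A0 : 0 <= A by rewrite mulr_ge0.
have ap y : cabs (y - w) < d -> forall e, 0 < e ->
  exists K0, forall K, (K0 <= K)%N -> cabs (SI chi y - sS (lK chi i0 K) c y) <= e.
 by move=> yw e e0; have [h _] := ball y yw; apply: sS_approx => //; rewrite -normr_gt0 (lt_le_trans d0).
have ty K y : (K0 <= K)%N -> cabs (y - w) < d ->
  cabs (sS (lK chi i0 K) c y - sS (lK chi i0 K) c w - (y - w) * sD (lK chi i0 K) c w) <= A * cabs (y - w) ^+ 2.
 move=> hK yw; have KK : (0 < K)%N by exact: leq_trans hK.
 have [h _ _ _ _] := unif chi i0 K ti0 cb hK.
 apply: le_trans (sS_taylor c (l_pos ti0 KK) k0 (kf K w KK _) (kf K y KK yw)) _.
  by rewrite subrr cabs0.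
 by rewrite ler_wpM2r ?sqr_ge0 // ler_wpM2l.
have [dd Hdd] := @quad_limit R (fun K => sS (lK chi i0 K) c) (SI chi) (fun K => sD (lK chi i0 K) c w) w d A K0 d0 A0 ap ty.
by exists d, A, dd.
Qed.

Lemma quad_cder (f : C -> C) (w dd : C) (d A : R) : 0 < d -> 0 <= A ->
 (forall y, cabs (y - w) < d -> cabs (f y - f w - (y - w) * dd) <= A * cabs (y - w) ^+ 2) -> cder f w dd.
Proof.
move=> d0 A0 H e e0; exists (Num.min d (e / (A + 1))).
 by rewrite lt_min d0 divr_gt0 // ltr_wpDl.
move=> h; rewrite lt_min => /andP[h1 h2].
have hE : w + h - w = h by ring.
have := H (w + h); rewrite hE => /(_ h1) q; rewrite mulrC in q; apply: le_trans q _.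
rewrite expr2 mulrA ler_wpM2r ?cabs_ge0 //.
have A1 : 0 < A + 1 by rewrite ltr_wpDl.
apply: le_trans (_ : A * (e / (A + 1)) <= _); first by rewrite ler_wpM2l // ltW.
by rewrite mulrCA ler_piMr ?(ltW e0) // ler_pdivrMr // mul1r lerDl.
Qed.

(** With a vanishing derivative, S(w + h) = x + O(h^2) would make the kernel form O(h^3), whereas
    [mixed_Kq] bounds it below by a multiple of (2 Im w)^2 h^2. *)
Lemma nonreal_root_simple (w : C) (x : R) : Im w != 0 -> SI chi w = x%:C ->
 exists2 dd, dd != 0 & cder (SI chi) w dd.
Proof.
move=> w0 Sw; have [d [A [dd [d0 A0 H]]]] := S_inf_taylor w0.
exists dd; last exact: quad_cder d0 A0 H.
apply/eqP => dd0; rewrite dd0 in H.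
have [sg sg0 Kin] := mixed_Kq.
pose a2 := 1 + (cabs w + 1 + `|c|) / `|Im w|.
have iw : 0 < `|Im w| by rewrite normr_gt0.
have a20 : 0 <= a2 by rewrite addr_ge0 // divr_ge0 // !addr_ge0 // cabs_ge0.
pose P := (1 + cabs w) ^+ 2 * (2 + cabs w) ^+ 2.
have P0 : 0 < P by rewrite mulr_gt0 // exprn_gt0 // ltr_pwDl // cabs_ge0.
pose Z := (a2 * A + 2 * (A * cabs (w - c%:C))) * P.
have Z0 : 0 <= Z.
 apply: mulr_ge0 (ltW P0); apply: addr_ge0; first exact: mulr_ge0.
 by apply: mulr_ge0 => //; apply: mulr_ge0 => //; exact: cabs_ge0.
pose T := (2 * `|Im w|) ^+ 2 * sg.
have T0 : 0 < T by rewrite mulr_gt0 // exprn_gt0 // mulr_gt0.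
pose h := Num.min (Num.min (d / 2) 1) (T / (2 * (Z + 1))).
have Z1 : 0 < Z + 1 by rewrite ltr_wpDl.
have h0 : 0 < h.
 by rewrite !lt_min ltr01 andbT; apply/andP; split; [rewrite divr_gt0|apply: divr_gt0 => //; apply: mulr_gt0].
have h1 : h <= 1 by rewrite !ge_min lexx !orbT.
have hd : h < d by rewrite !gt_min; apply/orP; left; apply/orP; left; lra.
have hT : h <= T / (2 * (Z + 1)) by rewrite ge_min lexx orbT.
pose y := w + h%:C.
have yE : y - w = h%:C by rewrite /y; ring.
have iy : Im y = Im w by rewrite /y cImD /= addr0.
have := H y; rewrite yE mulr0 subr0 cabsR (gtr0_norm h0) Sw => /(_ hd) Sy.
have n2 : Im y != 0 by rewrite iy.
have := Kin w y w0 n2; rewrite [cabs (w - y)]cabsBC yE cabsR (gtr0_norm h0) => K1.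
have K2 := Kq_approx c w y (SI chi w) (SI chi y) (Mof c w (SI chi w)) (Mof c y (SI chi y)) x.
rewrite Sw Mof_real !subrr cabs0 mul0r !add0r [cabs (w - y)]cabsBC yE cabsR (gtr0_norm h0) in K2.
have m2 := Mof_lip (SI chi y) x%:C n2; rewrite Mof_real in m2.
have ya : 1 + `|Re y - c| / `|Im y| <= a2.
 rewrite iy lerD2l ler_pM2r ?invr_gt0 //.
 apply: le_trans (ler_normB _ _) _; rewrite lerD2r /y cReD /=.
 by apply: le_trans (ler_normD _ _) _; rewrite (gtr0_norm h0); have := Re_le_cabs w; lra.
have {}m2 : Mof c y (SI chi y) - x <= a2 * (A * h ^+ 2).
 have ya0 : 0 <= 1 + `|Re y - c| / `|Im y| by rewrite addr_ge0 // divr_ge0.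
 exact: le_trans (ler_norm _) (le_trans m2 (ler_pM ya0 (cabs_ge0 _) ya Sy)).
have hh : h ^+ 2 <= h by rewrite expr2 ler_piMr // ltW.
have K3 : Kq c w y x%:C (SI chi y) x (Mof c y (SI chi y)) <= h ^+ 2 * (h * (a2 * A + 2 * (A * cabs (w - c%:C)))).
 apply: le_trans K2 _.
 have -> : h ^+ 2 * (h * (a2 * A + 2 * (A * cabs (w - c%:C)))) =
  h ^+ 2 * (a2 * (A * h)) + 2 * h * (A * h ^+ 2 * cabs (w - c%:C)) by ring.
 apply: lerD.
  rewrite ler_wpM2l ?sqr_ge0 //; apply: le_trans m2 _; rewrite ler_wpM2l //; exact: ler_wpM2l.
 by rewrite ler_wpM2l ?mulr_ge0 ?(ltW h0) // ler_wpM2r ?cabs_ge0.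
rewrite Sw Mof_real in K1.
have cy : cabs y <= cabs w + 1.
 by rewrite /y; apply: cabsD_le; rewrite cabsR (gtr0_norm h0); lra.
have P1 : (1 + cabs w) ^+ 2 * (1 + cabs y) ^+ 2 <= P.
 rewrite /P ler_wpM2l ?sqr_ge0 // lerXn2r ?nnegrE ?addr_ge0 ?cabs_ge0 //; lra.
have Pn : 0 <= (1 + cabs w) ^+ 2 * (1 + cabs y) ^+ 2 by rewrite mulr_ge0 ?sqr_ge0.
have q0 : 0 <= h * (a2 * A + 2 * (A * cabs (w - c%:C))).
 apply: mulr_ge0 (ltW h0) _; apply: addr_ge0; first exact: mulr_ge0.
 by apply: mulr_ge0 => //; apply: mulr_ge0 => //; exact: cabs_ge0.
have K4 : h ^+ 2 * T <= h ^+ 2 * (h * Z).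
 apply: le_trans (_ : cabs (w - conjc y) ^+ 2 * h ^+ 2 * sg <= _).
  rewrite /T mulrA [h ^+ 2 * _]mulrC ler_wpM2r ?(ltW sg0) // ler_wpM2r ?sqr_ge0 //.
  rewrite lerXn2r ?nnegrE ?cabs_ge0 //.
  by apply: le_trans (conj_gap _ _); rewrite iy -mulr2n normrMn mulr_natl.
 apply: le_trans K1 _; apply: le_trans (ler_wpM2r Pn K3) _.
 have -> : h ^+ 2 * (h * Z) = h ^+ 2 * (h * (a2 * A + 2 * (A * cabs (w - c%:C)))) * P by rewrite /Z; ring.
 by rewrite ler_wpM2l // mulr_ge0 // sqr_ge0.
have h20 : 0 < h ^+ 2 by rewrite exprn_gt0.
rewrite ler_pM2l // in K4.
have : h * Z <= T / 2.
 apply: le_trans (ler_wpM2r Z0 hT) _.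
 have -> : T / (2 * (Z + 1)) * Z = T / 2 * (Z / (Z + 1)) by field; rewrite gt_eqF.
 by rewrite ler_piMr ?divr_ge0 ?(ltW T0) // ler_pdivrMr // mul1r lerDl.
by move: K4 T0; lra.
Qed.

End MixedLimit.

(** * Moments of the limit measure and the slope *)

Section MomentLimit.
Variable D : discretization R.
Variables (chi : R) (col : R -> int) (gam : R -> C) (U : set C) (Lg : C -> C).
Variable nu : {finite_measure set R -> \bar R}.
Hypotheses (adm : admissible M D chi col gam U Lg) (lim : limit_measure M D chi col gam Lg nu).

(** With j = k + 1, the contour integral is alpha j pi i times a moment of nu in the limit and 2 i j
    times J at finite K, whence the factor alpha pi/2. *)
Lemma moment_limit k (e : R) : 0 < e -> exists K0, forall K J, (K0 <= K)%N ->
 cint gam (fun z => gS (ZK chi K) z ^+ k.+1 / z) = 2 * 'i * (k.+1%:R * J)%:C ->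
 `|alpha M * pi / 2 * Rintegral nu setT (fun x => x ^+ k) - J| <= e.
Proof.
move=> e0; have [K0 HK] := contour_cvg adm k.+1 e0.
have al : 0 < alpha M by have [_ _ _ _ []] := hM.
have p0 := pi_gt0 R.
exists K0 => K J hK EJ; have [_ _ mom] := lim.
have := mom k.+1 isT; rewrite (cexp_Lg adm) /=; set m := Rintegral _ _ _; set I := cint _ _ => Em.
have k0 : (k.+1%:R : C) != 0 by rewrite pnatr_eq0.
have IE : I = (alpha M)%:C * k.+1%:R * pi%:C * 'i * m%:C.
 rewrite Em mulrA divff ?mul1r // !mulf_neq0 ?k0 ?complexiE ?neq0Ci //.
  by rewrite (inj_eq CI) gt_eqF.
 by rewrite (inj_eq CI) gt_eqF.
have := HK K hK; rewrite -/I EJ IE.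
have -> : 2 * 'i * (k.+1%:R * J)%:C - (alpha M)%:C * k.+1%:R * pi%:C * 'i * m%:C =
 'i * (2 * k.+1%:R * (J - alpha M * pi / 2 * m))%:C :> C.
 by rewrite !(rmorphM, rmorphB, fmorphV, rmorph_nat) /=; field.
rewrite cabsM cabsR cabs_i.
rewrite mul1r normrM ger0_norm ?mulr_ge0 // distrC => h.
have : 1 * `|alpha M * pi / 2 * m - J| <= 2 * k.+1%:R * `|alpha M * pi / 2 * m - J|.
 by rewrite ler_wpM2r // -natrM ler1n muln_gt0.
by rewrite mul1r => h2; exact: le_trans h2 h.
Qed.

(** [g] chooses the truncation attached to each index, so that densities available only for large K
    can be indexed from 0. *)
Lemma slope_limit (x0 Bs s B1 : R) (h : nat -> R -> R) (g : nat -> nat) (Lset : set R) :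
 0 < x0 < Bs -> (forall n, n <= g n)%N ->
 (forall n, mbd (h n) 0 Bs) -> (forall n x, 0 <= x <= Bs -> 0 <= h n x <= pi) ->
 (forall n k, cint gam (fun z => gS (ZK chi (g n)) z ^+ k.+1 / z) =
  2 * 'i * (k.+1%:R * Rintegral (@lebesgue_measure R) `[0, Bs]%classic (fun x => x ^+ k * h n x))%:C) ->
 (- (pi^-1) * Im (Stieltjes nu (x0 +i* eta)) @[eta --> 0^'+] --> s) ->
 (forall L, Lset L -> 0 <= L <= pi) ->
 (forall delta, 0 < delta -> exists (rho : R) (n0 : nat), 0 < rho /\ forall n, (n0 <= n)%N ->
  exists2 L, Lset L & forall x, x0 - rho <= x <= x0 + rho -> `|h n x - L| <= delta) ->
 forall delta, 0 < delta -> exists2 L, Lset L & `|alpha M * pi / 2 * s - L| <= delta.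
Proof.
move=> xb gn mh hb mom St Lb near.
have al : 0 < alpha M by have [_ _ _ _ []] := hM.
have [[B nuB] _ _] := lim.
apply: (poisson_slope nuB _ xb mh hb _ St Lb near).
 by rewrite divr_gt0 // mulr_gt0 // pi_gt0.
move=> k e e0; have [K0 HK] := moment_limit k e0; exists K0 => n hn.
by apply: (HK (g n)); [exact: leq_trans hn (gn n)|exact: mom].
Qed.

End MomentLimit.

(** * Paths for large K and their densities *)

Section MixedPaths.

Record column_path chi i0 K (S0 : R) (w : R -> C) (B : R) : Prop := ColumnPath {
 cp_start : w 0 = i0.1%:C;
 cp_end : w B = (- S0)%:C;
 cp_endG : onG (lK chi i0 K) i0.1 (- S0)%:C B;
 cp_no0 : forall x, ~ onG (lK chi i0 K) i0.1 0 x;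
 cp_onG : forall x, 0 <= x <= B -> onG (lK chi i0 K) i0.1 (w x) x }.

(** Below level Y the path avoids the disc of radius r0, because M <= x <= Y on the path and M > Y
    in the disc; it stays within c + S0 of c by [path_radius]. *)
Lemma mixed_paths (Y : R) : 0 < Y -> exists (Rad r0 Bs S0 sg : R) (K0 : nat),
 [/\ 0 < r0, 0 < S0, 0 < sg, (0 < K0)%N & forall chi i0 K, top_zero chi i0 ->
  cmin <= i0.1 <= Hi -> (K0 <= K)%N -> exists w B,
  [/\ column_path chi i0 K S0 w B, Y <= B <= Bs, sg <= sN (lK chi i0 K) i0.1 &
   forall x, 0 <= x <= Y -> r0 < cabs (w x) <= Rad]].
Proof.
move=> Y0; have [r0 [S0 [sg [Bs [B1 [K0 [r00 S00 sg0 K00 unif]]]]]]] := mixed_uniform Y.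
exists (2 * Hi + S0), r0, Bs, S0, sg, K0; split=> // chi i0 K ti cb hK.
have KK : (0 < K)%N by exact: leq_trans hK.
have [_ sgK Mr eG [/andP[YB BB] no]] := unif chi i0 K ti cb hK.
have B0 : 0 < pr (ZK chi K) S0 by exact: lt_le_trans YB.
have c0 := c_gt0 ti KK.
have lp := l_pos ti KK.
have ln := l_neq ti KK.
have lu := l_uniq chi i0 K.
have e0 : - S0 < 0 by rewrite oppr_lt0.
have [w [w0 wB wG]] := path_exists lp ln lu B0 eG.
exists w, (pr (ZK chi K) S0); split=> //; first by rewrite YB.
move=> x /andP[x0 xY]; have xB : 0 <= x <= pr (ZK chi K) S0 by rewrite x0 (le_trans xY).
have [_ ow _ Mw] := wG x xB; apply/andP; split.
 rewrite ltNge; apply/negP => wr; have := Mr _ ow wr.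
 by rewrite ltNge (le_trans Mw).
have := path_radius lp c0 e0 eG wB wG xB; rewrite opprK => h.
have := cabsB_ge (w x) i0.1%:C; rewrite cabsR gtr0_norm //; case/andP: cb => _; lra.
Qed.

Section OnePath.
Variables (chi : R) (i0 : R * R) (K : nat) (S0 B : R) (w : R -> C).
Hypotheses (ti0 : top_zero chi i0) (K0 : (0 < K)%N) (S00 : 0 < S0) (B0 : 0 < B) (cp : column_path chi i0 K S0 w B).

Let lp := l_pos ti0 K0.
Let ln := l_neq ti0 K0.
Let lu := l_uniq chi i0 K.
Let c0 := c_gt0 ti0 K0.
Let e0 : - S0 < 0. Proof. by rewrite oppr_lt0. Qed.

(** The end level B varies with K, whereas the functionals must live on one interval [0, Bs]. Beyond
    B the density is 0, the argument having reached pi. *)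
Definition dens (x : R) : R := if x <= B then pi - ang (w x) else 0.

Lemma cp_ang_cont : {within `[0, B], continuous (fun x => ang (w x))}.
Proof.
apply: within_epsP => x xB t t0.
exact: (ang_cont lp ln c0 B0 e0 (cp_endG cp) (cp_no0 cp) (cp_end cp) (cp_onG cp) xB t0).
Qed.

Lemma cp_neq0 x : 0 <= x <= B -> w x != 0.
Proof.
by move=> xB; apply/eqP => w0; have := cp_onG cp xB; rewrite w0; exact: (cp_no0 cp).
Qed.

Lemma dens_bound x : 0 <= x -> 0 <= dens x <= pi.
Proof.
move=> x0; rewrite /dens; case: ifP => xB; last by rewrite lexx pi_ge0.
have xB' : 0 <= x <= B by rewrite x0.
have [i0_ _ _ _] := cp_onG cp xB'.
by have /andP[] := ang_bound i0_ (cp_neq0 xB'); lra.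
Qed.

Lemma dens_mbd Bs : B <= Bs -> mbd dens 0 Bs.
Proof.
move=> BB; apply: (@mbd_cat _ _ 0 B Bs); first by rewrite (ltW B0).
- apply: (@mbd_oo _ _ (fun x => pi - ang (w x))).
  by apply: wcontB cp_ang_cont; apply: continuous_subspaceT => x; exact: cvg_cst.
 by move=> s /andP[_ sB]; rewrite /dens (ltW sB).
- apply: (@mbd_oo _ _ (fun=> 0)); first by apply: continuous_subspaceT => x; exact: cvg_cst.
 by move=> s /andP[sB _]; rewrite /dens leNgt sB.
Qed.

Lemma dens_int Bs k : B <= Bs -> \int[mu]_(x in `[0, B]) (x ^+ k * (pi - ang (w x))) =
 \int[mu]_(x in `[0, Bs]) (x ^+ k * dens x).
Proof.
move=> BB; have md := dens_mbd BB.
have mk a d : mbd (fun x : R => x ^+ k) a d.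
 by apply: mbd_cont; apply: continuous_subspaceT; exact: exprn_continuous.
have mp := mbdM (mk 0 Bs) md.
have mbdr (f : R -> R) (a d a' d' : R) : mbd f a d -> a <= a' -> d' <= d -> mbd f a' d'.
 move=> [mf [V fV]] aa bb; split.
  by apply: measurable_funS mf => // x /=; rewrite !in_itv /= => /andP[x1 x2]; rewrite (le_trans aa) // (le_trans x2).
 by exists V => s /andP[s1 s2]; apply: fV; rewrite (le_trans aa) // (le_trans s2).
rewrite (@Rint_cat _ _ 0 B Bs) ?(ltW B0) //.
rewrite [X in _ + X](_ : _ = 0); last first.
 have -> : \int[mu]_(x in `[B, Bs]) (x ^+ k * dens x) = \int[mu]_(x in `[B, Bs]) 0.
  apply: Rint_oo => //; first exact: mbdr mp (ltW B0) (lexx _).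
   by apply: mbd_cont; apply: continuous_subspaceT => x; exact: cvg_cst.
  by move=> s /andP[sB _]; rewrite /dens leNgt sB mulr0.
 by rewrite Rintegral_cst // mul0r.
rewrite addr0; apply: eq_Rintegral => x; rewrite inE /= in_itv /= => /andP[_ xB].
by rewrite /dens xB.
Qed.

Variables (D : discretization R) (col : R -> int) (gam : R -> C) (U : set C) (Lg : C -> C).
Hypothesis adm : admissible M D chi col gam U Lg.
Hypothesis poles : forall i, i \in gen (ZK chi K) ->
 if isM i then Int gam i.2%:C else ~ curve gam i.2%:C /\ ~ Int gam i.2%:C.

Lemma path_moment Bs k : B <= Bs ->
 cint gam (fun z => gS (ZK chi K) z ^+ k.+1 / z) =
 2 * 'i * (k.+1%:R * \int[mu]_(x in `[0, Bs]) (x ^+ k * dens x))%:C.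
Proof.
move=> BB; rewrite -(dens_int k BB).
have [[[gC1 gcl _] gpos gI0] _ _ _ _] := adm.
have i0z := top_mem ti0 K0.
have [i0M _ i0max] := ti0.
have lg_ p : p \in lK chi i0 K -> (p.2 < i0.1 /\ Int gam p.2%:C) \/
  (i0.1 < p.2 /\ ~ curve gam p.2%:C /\ ~ Int gam p.2%:C).
 move=> /lstP[i [iz _ ig ->]] /=; have := poles ig.
 have := pole_c (cfg_zl chi 0 (2 * K).+1) i0z i0M (fun i iz => i0max _ i iz) iz.
 by case: ifP => _ h1 h2; [left|right].
transitivity (cint gam (fun z => sS (lK chi i0 K) i0.1 z ^+ k.+1 / z)); last first.
 exact: (contour_moment lp ln c0 B0 e0 (cp_endG cp) (cp_no0 cp) (cp_start cp) (cp_end cp) (cp_onG cp) gC1 gcl gpos gI0 lg_ (ltn0Sn k)).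
apply: eq_cint => s s01; rewrite (l_sS ti0 K0) // => i ig.
apply/eqP => gE; have cu : curve gam i.2%:C by exists s.
by have := poles ig; case: ifP => _ => [[nc _]|[]].
Qed.

End OnePath.

End MixedPaths.

(** * The slope at a point when both signs are present *)

Section MixedSlope.

Lemma S_inf_gap chi (x0 eta Q : R) : 0 < eta ->
 (forall z, eta <= Im z -> cabs z <= Q -> SI chi z <> x0%:C) ->
 exists2 mu : R, 0 < mu & forall z, eta <= Im z -> cabs z <= Q -> mu <= cabs (SI chi z - x0%:C).
Proof.
move=> e0 nr; apply: contrapT => nomu.
have H k : exists z : C, [/\ eta <= Im z, cabs z <= Q & cabs (SI chi z - x0%:C) < k.+1%:R^-1].
 apply: contrapT => nz; apply: nomu; exists k.+1%:R^-1; first by rewrite invr_gt0.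
 by move=> z ze zQ; rewrite leNgt; apply/negP => lt; apply: nz; exists z.
have [z Hz] := choice H.
have [w0 cl] := @complex_cluster R z Q (fun k => let: And3 _ h _ := Hz k in h).
have iw : eta <= Im w0.
 apply/ler_addgt0Pr => d d0; have [k _ kd] := cl d 0%N d0.
 have [h _ _] := Hz k; have := near_Im w0 (z k); rewrite ler_norml => /andP[_]; lra.
have wQ : cabs w0 <= Q.
 apply/ler_addgt0Pr => d d0; have [k _ kd] := cl d 0%N d0.
 have [_ h _] := Hz k; have := cabsB_ge w0 (z k); rewrite cabsBC; lra.
apply: (nr w0 iw wQ); apply: cabs_le0_eq; apply/ler_addgt0Pr => d d0; rewrite add0r.
have d2 : 0 < d / 2 by rewrite divr_gt0.
have iw0 : Im w0 != 0 by rewrite gt_eqF //; lra.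
have [r0 wr] := nonreal_range iw0.
have [N1 [_ _ cont _]] := annulus_close r0 (ltac:(by move: r0; lra) : 0 < 2 * cabs w0).
have [/cont_cabsP cS _] := cont chi w0 wr (offg_nonreal iw0).
have [t t0 Ht] := cS _ d2.
have h12 : (1 : R) < 2 by rewrite ltr1n.
have [N HN] := pow_big (2 / d) h12.
have [k kN kd] := cl t (2 ^ N)%N t0.
have [_ _ h] := Hz k; have h2 := Ht _ kd.
have h3 : k.+1%:R^-1 <= d / 2.
 rewrite -[d / 2]invf_div lef_pV2 ?posrE ?ltr0n ?divr_gt0 //; apply: le_trans HN _.
 by rewrite -natrX ler_nat leqW.
have sub3 (a x y : C) : a - x = (y - x) - (y - a) by ring.
rewrite (sub3 _ _ (SI chi (z k))).
apply: cabsD_le; rewrite cabsN.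
by apply: le_trans (lerD (ltW (lt_le_trans h h3)) (ltW h2)) _; rewrite -splitr.
Qed.

(** On the compact region S_chi stays at distance mu from x0 ([S_inf_gap]). A solution of S_{chi,K}
    = x with x near x0 would have a bounded value, so that [annulus_close] applies at it and
    contradicts the gap. *)
Lemma level_avoids chi (x0 eta Q : R) : 0 < eta ->
 (forall z, eta <= Im z -> cabs z <= Q -> SI chi z <> x0%:C) ->
 exists (rho : R) (K1 : nat), 0 < rho /\ forall K x z, (K1 <= K)%N -> `|x - x0| <= rho ->
  eta <= Im z -> cabs z <= Q -> gS (ZK chi K) z <> x%:C.
Proof.
move=> e0 nr; have [mu mu0 Hmu] := S_inf_gap e0 nr.
have r0 : 0 < eta / 2 by rewrite divr_gt0.
have Q0 : 0 < `|Q| + 1 by rewrite ltr_wpDl.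
have [N1 [_ _ _ H]] := annulus_close r0 Q0.
have mu4 : 0 < mu / 4 by rewrite divr_gt0.
have [K1 HK] := H (`|x0| + mu) _ mu4.
exists (mu / 4), K1; split=> // K x z hK xx iz zQ Ez.
have iz0 : Im z != 0 by rewrite gt_eqF //; lra.
have zr : eta / 2 < cabs z < `|Q| + 1.
 apply/andP; split; last by have := ler_norm Q; lra.
 by have := Im_le_cabs z; have := ler_norm (Im z); lra.
have xa : cabs (gS (ZK chi K) z) <= `|x0| + mu.
 rewrite Ez cabsR; have -> : x = x0 + (x - x0) by ring.
 by apply: le_trans (ler_normD _ _) _; rewrite lerD2l; lra.
have := HK chi K z hK zr (offg_nonreal iz0) (or_introl xa).
rewrite Ez => h; have := Hmu z iz zQ.
have -> : SI chi z - x0%:C = (SI chi z - x%:C) + (x - x0)%:C by rewrite rmorphB /=; ring.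
by move=> h2; have := le_trans h2 (cabsD _ _); rewrite cabsR; lra.
Qed.

(** wp solves the equation approximately at level x0 and w solves it at a nearby level, so the
    kernel form is O(rho), while it dominates |w - wp|^4 sg. The resulting rho is uniform in the
    column and in K. *)
Lemma path_near_root (wp : C) (x0 Rad sg e : R) : 0 < Im wp -> 0 <= Rad -> 0 < sg -> 0 < e ->
 exists2 rho : R, 0 < rho & forall chi i0 K w x, top_zero chi i0 -> cmin <= i0.1 <= Hi ->
  (0 < K)%N -> sg <= sN (lK chi i0 K) i0.1 -> cabs (sS (lK chi i0 K) i0.1 wp - x0%:C) <= rho ->
  `|x - x0| <= rho -> onG (lK chi i0 K) i0.1 w x -> cabs w <= Rad -> cabs (w - wp) <= e.
Proof.
move=> u0 Rad0 sg0 e0; have Hi0 := Hi_ge0.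
pose W := cabs wp; have W0 : 0 <= W := cabs_ge0 wp.
pose a1 := 1 + (W + Hi) / Im wp.
have a10 : 0 <= a1 by rewrite addr_ge0 // divr_ge0 ?addr_ge0 // ltW.
pose D0 := W + Rad.
have D00 : 0 <= D0 by rewrite addr_ge0.
pose P := (1 + W) ^+ 2 * (1 + Rad) ^+ 2.
have P0 : 0 < P by rewrite mulr_gt0 // exprn_gt0 // ltr_pwDl.
pose Z := (D0 ^+ 2 * (a1 + 1) + 2 * D0 * ((Rad + Hi) + (W + Hi))) * P.
have Z0 : 0 <= Z.
 apply: mulr_ge0 (ltW P0); apply: addr_ge0; first by apply: mulr_ge0 (sqr_ge0 _) _; exact: addr_ge0.
 by apply: mulr_ge0; [exact: mulr_ge0|apply: addr_ge0; exact: addr_ge0].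
exists (e ^+ 4 * sg / (Z + 1)).
 by rewrite divr_gt0 ?ltr_wpDl // mulr_gt0 // exprn_gt0.
move=> chi i0 K w x ti cb K0 sgK; set rho := _ / _.
move=> s1 xx [iw ow Sw Mw] wR.
have rho0 : 0 <= rho by apply: le_trans s1; exact: cabs_ge0.
have lp := l_pos ti K0.
have nw : Im wp != 0 by rewrite gt_eqF.
have c0 := c_gt0 ti K0.
have := @sN_Kq _ _ i0.1 lp wp w (offp_nonreal nw) ow.
rewrite Sw; set l := lK chi i0 K; set D := cabs (wp - w) => ineq.
have D_ge : 0 <= D := cabs_ge0 _.
have DD : D <= D0 by apply: cabsD_le; rewrite cabsN lerD2l.
have kq := Kq_approx i0.1 wp w (sS l i0.1 wp) x%:C (sM l i0.1 wp) (sM l i0.1 w) x0.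
have m1 : sM l i0.1 wp - x0 <= a1 * rho.
 rewrite sM_nonreal // -/(Mof i0.1 wp _).
 have := @Mof_lip i0 wp (sS l i0.1 wp) x0%:C nw; rewrite (Mof_real i0 wp x0) => h.
 have A1 : 0 <= 1 + `|Re wp - i0.1| / `|Im wp| by rewrite addr_ge0 // divr_ge0.
 suff A2 : 1 + `|Re wp - i0.1| / `|Im wp| <= a1 by exact: le_trans (ler_norm _) (le_trans h (ler_pM A1 (cabs_ge0 _) A2 s1)).
 rewrite lerD2l (gtr0_norm u0) ler_pM2r ?invr_gt0 //; apply: le_trans (ler_normB _ _) _.
 by rewrite (gtr0_norm c0); have := Re_le_cabs wp; case/andP: cb => _; rewrite -/W; lra.
have m2 : sM l i0.1 w - x0 <= rho by have := ler_norm (x - x0); lra.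
have cH : i0.1 <= Hi by case/andP: cb.
have d1 : cabs (w - i0.1%:C) <= Rad + Hi.
 by apply: cabsD_le; rewrite cabsN cabsR (gtr0_norm c0); lra.
have d2 : cabs (wp - i0.1%:C) <= W + Hi.
 by apply: cabsD_le; rewrite cabsN cabsR (gtr0_norm c0) -/W; lra.
have x1 : cabs (x%:C - x0%:C : C) <= rho by rewrite -rmorphB cabsR.
have kq2 : Kq i0.1 wp w (sS l i0.1 wp) x%:C (sM l i0.1 wp) (sM l i0.1 w) <=
  rho * (D0 ^+ 2 * (a1 + 1) + 2 * D0 * ((Rad + Hi) + (W + Hi))).
 apply: le_trans kq _; rewrite -/D.
 have -> : rho * (D0 ^+ 2 * (a1 + 1) + 2 * D0 * (Rad + Hi + (W + Hi))) =
  D0 ^+ 2 * (a1 * rho + rho) + 2 * D0 * (rho * (Rad + Hi) + rho * (W + Hi)) by ring.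
 apply: lerD.
  apply: le_trans (ler_wpM2l (sqr_ge0 D) (lerD m1 m2)) _.
  apply: ler_wpM2r; first exact: addr_ge0 (mulr_ge0 a10 rho0) rho0.
  by rewrite lerXn2r ?nnegrE.
 have q1 : cabs (sS l i0.1 wp - x0%:C) * cabs (w - i0.1%:C) + cabs (x%:C - x0%:C : C) * cabs (wp - i0.1%:C) <=
   rho * (Rad + Hi) + rho * (W + Hi).
  by apply: lerD; apply: ler_pM => //; exact: cabs_ge0.
 apply: le_trans (ler_wpM2l (mulr_ge0 (ler0n _ 2) D_ge) q1) _.
 apply: ler_wpM2r; last by rewrite ler_wpM2l.
 by apply: addr_ge0; apply: mulr_ge0 => //; exact: addr_ge0.
have Pw : (1 + cabs wp) ^+ 2 * (1 + cabs w) ^+ 2 <= P.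
 rewrite /P ler_wpM2l ?sqr_ge0 // lerXn2r ?nnegrE ?addr_ge0 ?cabs_ge0 //; lra.
have Pn : 0 <= (1 + cabs wp) ^+ 2 * (1 + cabs w) ^+ 2 by rewrite mulr_ge0 ?sqr_ge0.
have kq3 : D ^+ 4 * sg <= rho * Z.
 apply: le_trans (_ : cabs (wp - conjc w) ^+ 2 * cabs (wp - w) ^+ 2 * sN l i0.1 <= _).
  have -> : D ^+ 4 = D ^+ 2 * D ^+ 2 by rewrite -exprD.
  apply: ler_pM sgK => //; [by rewrite mulr_ge0 ?sqr_ge0|exact: ltW|].
  rewrite ler_wpM2r ?sqr_ge0 // lerXn2r ?nnegrE ?cabs_ge0 //.
  by apply: cabs_conj_ge => //; exact: ltW.
 apply: le_trans ineq _; apply: le_trans (ler_wpM2r Pn kq2) _.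
 have -> : rho * Z = rho * (D0 ^+ 2 * (a1 + 1) + 2 * D0 * ((Rad + Hi) + (W + Hi))) * P by rewrite /Z; ring.
 apply: ler_wpM2l Pw; apply: mulr_ge0 => //.
 apply: addr_ge0; first by apply: mulr_ge0 (sqr_ge0 _) _; exact: addr_ge0.
 by apply: mulr_ge0; [exact: mulr_ge0|apply: addr_ge0; exact: addr_ge0].
rewrite cabsBC -/D leNgt; apply/negP => eD.
have : e ^+ 4 * sg <= rho * Z.
 by apply: le_trans kq3; rewrite ler_wpM2r ?(ltW sg0) // lerXn2r ?nnegrE ?(ltW e0) ?(ltW eD).
have E : rho * (Z + 1) = e ^+ 4 * sg by rewrite /rho mulfVK // gt_eqF // ltr_wpDl.
have E0 : 0 < e ^+ 4 * sg by rewrite mulr_gt0 // exprn_gt0.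
have r0 : 0 < rho by rewrite divr_gt0 // ltr_wpDl.
by rewrite -E mulrDr mulr1 gerDl leNgt r0.
Qed.

Lemma between_limits (s : R) (T : set R) : (forall L, ~ T L -> exists2 d : R, 0 < d & forall L', T L' -> d < `|L - L'|) ->
 (forall delta, 0 < delta -> exists2 L, T L & `|s - L| <= delta) -> T s.
Proof.
move=> cl H; apply: contrapT => /cl[d d0 Hd]; have [L /Hd h h2] := H d d0.
by move: h; rewrite ltNge h2.
Qed.

Variables (D : discretization R) (chi : R) (col : R -> int) (gam : R -> C) (U : set C) (Lg : C -> C).
Variable nu : {finite_measure set R -> \bar R}.
Hypotheses (adm : admissible M D chi col gam U Lg) (lim : limit_measure M D chi col gam Lg nu).
Variables (x0 s : R).
Hypotheses (x00 : 0 < x0) (St : - (pi^-1) * Im (Stieltjes nu (x0 +i* eta)) @[eta --> 0^'+] --> s).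

(** Reduces the slope to the behaviour of the paths at levels near x0: there pi minus the argument
    must come close to [Lset], on a neighbourhood independent of K. *)
Lemma mixed_slope (Lset : set R) : (forall L, Lset L -> 0 <= L <= pi) ->
 (forall i0 (Rad r0 Bs S0 sg : R), top_zero chi i0 -> cmin <= i0.1 <= Hi ->
   0 < r0 -> 0 < S0 -> 0 < sg -> forall delta, 0 < delta ->
   exists (rho : R) (K1 : nat), 0 < rho /\ forall K w B, (K1 <= K)%N -> (0 < K)%N ->
    column_path chi i0 K S0 w B -> x0 + 1 <= B -> sg <= sN (lK chi i0 K) i0.1 ->
    (forall x, 0 <= x <= x0 + 1 -> r0 < cabs (w x) <= Rad) ->
    exists2 L, Lset L & forall x, x0 - rho <= x <= x0 + rho -> 0 <= x <= x0 + 1 -> `|pi - ang (w x) - L| <= delta) ->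
 forall delta, 0 < delta -> exists2 L, Lset L & `|alpha M * pi / 2 * s - L| <= delta.
Proof.
move=> Lb near; have Y0 : 0 < x0 + 1 by rewrite addr_gt0.
have [Rad [r0 [Bs [S0 [sg [K0 [r00 S00 sg0 K00 P]]]]]]] := mixed_paths Y0.
have [i0 [ti cb]] := exists_top chi.
have [Kp HKp] := curve_poles adm.
pose g k := (k + K0 + Kp)%N.
have gK k : (K0 <= g k)%N by rewrite /g addnAC leq_addl.
have gP k : (Kp <= g k)%N by rewrite /g leq_addl.
have [wB HwB] := choice (fun k => let: ex_intro w (ex_intro B h) := P chi i0 (g k) ti cb (gK k) in
 ex_intro (fun p : (R -> C) * R => [/\ column_path chi i0 (g k) S0 p.1 p.2, x0 + 1 <= p.2 <= Bs,
   sg <= sN (lK chi i0 (g k)) i0.1 & forall x, 0 <= x <= x0 + 1 -> r0 < cabs (p.1 x) <= Rad]) (w, B) h).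
have gk k : (k <= g k)%N by rewrite /g -addnA leq_addr.
have g0 k : (0 < g k)%N by exact: leq_trans (gK k).
have YB : x0 + 1 <= Bs by have [_ /andP[h1 h2] _ _] := HwB 0%N; exact: le_trans h2.
have B0 k : 0 < (wB k).2 by have [_ /andP[h1 h2] _ _] := HwB k; exact: lt_le_trans h1.
apply: (@slope_limit D chi col gam U Lg nu adm lim x0 Bs s 0 (fun k => dens (wB k).2 (wB k).1) g Lset) => //.
- by rewrite x00 /=; move: YB; lra.
- move=> k; have [cp /andP[_ h] _ _] := HwB k.
 exact: (dens_mbd ti (g0 k) S00 (B0 k) cp h).
- move=> k x /andP[x_0 _]; have [cp _ _ _] := HwB k.
 exact: (dens_bound cp x_0).
- move=> k j; have [cp /andP[_ h] _ _] := HwB k.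
 by apply: (path_moment ti (g0 k) S00 (B0 k) cp adm _ j h) => i ig; apply: HKp ig.
- move=> delta d0; have [rho [K1 [rho0 H]]] := near i0 Rad r0 Bs S0 sg ti cb r00 S00 sg0 delta d0.
 pose rh := Num.min rho (Num.min x0 1).
 exists rh, K1; split; first by rewrite !lt_min rho0 x00 ltr01.
 move=> k hk; have [cp /andP[h1 _] h3 h4] := HwB k.
 have [L LL HL] := H (g k) _ _ (leq_trans hk (gk k)) (g0 k) cp h1 h3 h4.
 exists L => // x /andP[x1 x2].
 have r1 : rh <= rho by rewrite ge_min lexx.
 have r2 : rh <= x0 by rewrite !ge_min lexx !orbT.
 have r3 : rh <= 1 by rewrite !ge_min lexx !orbT.
 have -> : dens (wB k).2 (wB k).1 x = pi - ang ((wB k).1 x) by rewrite /dens (_ : x <= _) //; lra.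
 by apply: HL; apply/andP; split; lra.
Qed.

Lemma slope_root (wp : C) : 0 < Im wp -> SI chi wp = x0%:C ->
 alpha M * pi / 2 * s = pi - ang wp.
Proof.
move=> u0 Sw; have ab := ang_upper u0.
apply: (@between_limits _ [set pi - ang wp]).
 move=> L /= nL; exists (`|L - (pi - ang wp)| / 2); first by rewrite divr_gt0 // normr_gt0 subr_eq0; exact/eqP.
 by move=> L' ->; have : 0 < `|L - (pi - ang wp)| by [rewrite normr_gt0 subr_eq0; exact/eqP]; lra.
apply: mixed_slope => [L ->|]; first by lra.
move=> i0 Rad r0 Bs S0 sg ti cb r00 S00 sg0 delta d0.
have nw : Im wp != 0 by rewrite gt_eqF.
pose e := Num.min (Im wp / 2) (delta * Im wp / 2).
have e0 : 0 < e by rewrite lt_min !divr_gt0 // mulr_gt0.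
have [rho rho0 H] := @path_near_root wp x0 `|Rad| sg e u0 (normr_ge0 _) sg0 e0.
have [K1 HK1] := sS_approx ti nw rho0.
exists rho, K1; split=> // K w B hK K0 cp YB sgK wb; exists (pi - ang wp) => // x xr xY.
have xB : 0 <= x <= B by move: xY YB; lra.
have h1 := HK1 K hK; rewrite Sw cabsBC in h1.
have wx : cabs (w x) <= `|Rad| by have /andP[_ h] := wb x xY; apply: le_trans h (ler_norm _).
have xx : `|x - x0| <= rho by rewrite ler_norml; move: xr; lra.
have := H chi i0 K (w x) x ti cb K0 sgK h1 xx (cp_onG cp xB) wx.
rewrite le_min => /andP[d1 d2].
have -> : pi - ang (w x) - (pi - ang wp) = - (ang (w x) - ang wp) by ring.
rewrite normrN; apply: le_trans (ang_near u0 d1) _.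
have : 2 / Im wp * cabs (w x - wp) <= 2 / Im wp * (delta * Im wp / 2) by rewrite ler_wpM2l // divr_ge0 // ltW.
by move/le_trans; apply; rewrite le_eqVlt; apply/orP; left; apply/eqP; field; rewrite gt_eqF.
Qed.

(** Without an upper root the ratio Im w/|w| is small along the paths at levels near x0
    ([level_avoids]), so the argument is near 0 or near pi at each of them, and by continuity it
    stays at the same end. *)
Lemma slope_noroot : (forall w, 0 < Im w -> SI chi w <> x0%:C) ->
 alpha M * pi / 2 * s = 0 \/ alpha M * pi / 2 * s = pi.
Proof.
move=> nr; have p0 := pi_gt0 R.
apply: (@between_limits _ [set L | L = 0 \/ L = pi]).
 move=> L /= nL; have n1 : 0 < `|L - 0| by rewrite normr_gt0 subr_eq0; apply/eqP => E; apply: nL; left.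
 have n2 : 0 < `|L - pi| by rewrite normr_gt0 subr_eq0; apply/eqP => E; apply: nL; right.
 exists (Num.min `|L - 0| `|L - pi| / 2); first by rewrite divr_gt0 // lt_min n1 n2.
 by move=> L' [->|->]; have : Num.min `|L - 0| `|L - pi| <= `|L - 0| by [rewrite ge_min lexx];
  have : Num.min `|L - 0| `|L - pi| <= `|L - pi| by [rewrite ge_min lexx orbT]; lra.
apply: mixed_slope => [L [->|->]|]; [by rewrite lexx ltW|by rewrite lexx ltW|].
move=> i0 Rad r0 Bs S0 sg ti cb r00 S00 sg0 delta d0.
pose d := Num.min delta (pi / 4).
have dd : 0 < d < pi / 2 by rewrite lt_min d0 gt_min; apply/andP; split; [lra|apply/orP; right; lra].
have [/andP[d_0 dp]] := (dd, dd) => _.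
have ddel : d <= delta by rewrite ge_min lexx.
have d4 : d <= pi / 4 by rewrite ge_min lexx orbT.
have pd : pi / 2 < pi - d by rewrite ltrBrDl -ltrBrDr [X in _ < X - _]splitr addrK.
have sd : 0 < sin d by exact: sin_gt0_pihalf.
have eta0 : 0 < r0 * sin d by rewrite mulr_gt0.
have [rho [K1 [rho0 HK]]] := @level_avoids chi x0 (r0 * sin d) Rad eta0
 (fun z iz zQ => nr z (lt_le_trans eta0 iz)).
exists rho, K1; split=> // K w B hK K0 cp YB sgK wb.
have B0 : 0 < B by move: x00 YB; lra.
have ext x : x0 - rho <= x <= x0 + rho -> 0 <= x <= x0 + 1 -> ang (w x) <= d \/ pi - d <= ang (w x).
 move=> xr xY; have xB : 0 <= x <= B by move: xY YB; lra.
 have [iw ow Sw Mw] := cp_onG cp xB; have wn := cp_neq0 cp xB.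
 apply: (ang_extreme iw wn dd).
 have /andP[w1 w2] := wb x xY.
 apply: lt_trans (_ : r0 * sin d < _); last by rewrite ltr_pM2r.
 rewrite ltNge; apply/negP => iz.
 have nz : Im (w x) != 0 by rewrite gt_eqF // (lt_le_trans eta0).
 apply: (HK K x (w x) hK _ iz w2); first by rewrite ler_norml; move: xr; lra.
 by rewrite (l_sS ti K0) //; exact: offg_nonreal.
have cang := cp_ang_cont ti K0 S00 B0 cp.
have same x y : x0 - rho <= x <= x0 + rho -> 0 <= x <= x0 + 1 -> x0 - rho <= y <= x0 + rho -> 0 <= y <= x0 + 1 ->
  ang (w x) <= d -> ang (w y) <= d.
 move=> xr xY yr yY ax; case: (ext y yr yY) => // ay; exfalso.
 (* A change of end would produce the argument pi/2 at an intermediate level. *)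
 have key u v : x0 - rho <= u <= x0 + rho -> 0 <= u <= x0 + 1 -> x0 - rho <= v <= x0 + rho -> 0 <= v <= x0 + 1 ->
   u <= v -> Num.min (ang (w u)) (ang (w v)) <= pi / 2 <= Num.max (ang (w u)) (ang (w v)) -> False.
  move=> ur uY vr vY uv mid.
  have cuv : {within `[u, v], continuous (fun x => ang (w x))}.
   apply: continuous_subspaceW cang => z /=; rewrite !in_itv /= => /andP[z1 z2].
   by apply/andP; split; move: uY vY YB; lra.
  have [z] := IVT uv cuv mid; rewrite in_itv /= => /andP[z1 z2] az.
  have zr : x0 - rho <= z <= x0 + rho by case/andP: ur => h1 _; case/andP: vr => _ h2; rewrite (le_trans h1 z1) (le_trans z2 h2).
  have zY : 0 <= z <= x0 + 1 by case/andP: uY => h1 _; case/andP: vY => _ h2; rewrite (le_trans h1 z1) (le_trans z2 h2).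
  by case: (ext z zr zY); rewrite az leNgt ?dp ?pd.
 have m1 : ang (w x) <= pi / 2 by exact: le_trans ax (ltW dp).
 have m2 : pi / 2 <= ang (w y) by exact: le_trans (ltW pd) ay.
 have [xy|/ltW yx] := leP x y.
  by apply: (key x y) => //; rewrite ge_min m1 le_max m2 orbT.
 by apply: (key y x) => //; rewrite ge_min m1 le_max m2 orbT.
have x0r : x0 - rho <= x0 <= x0 + rho by lra.
have x0Y : 0 <= x0 <= x0 + 1 by move: x00; lra.
case: (ext x0 x0r x0Y) => a0.
 exists pi; first by right.
 move=> x xr xY; have := same x0 x x0r x0Y xr xY a0.
 have xB : 0 <= x <= B by move: xY YB; lra.
 have [iw _ _ _] := cp_onG cp xB; have /andP[a1 a2] := ang_bound iw (cp_neq0 cp xB).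
 move=> a3; have -> : pi - ang (w x) - pi = - ang (w x) by ring.
 by rewrite normrN ger0_norm //; exact: le_trans a3 ddel.
exists 0; first by left.
move=> x xr xY; have xB : 0 <= x <= B by move: xY YB; lra.
have [iw _ _ _] := cp_onG cp xB; have /andP[a1 a2] := ang_bound iw (cp_neq0 cp xB).
case: (ext x xr xY) => a3.
 by have := le_trans a0 (same x x0 xr xY x0r x0Y a3); rewrite leNgt (lt_trans dp pd).
by rewrite subr0 ger0_norm ?subr_ge0 //; apply: le_trans ddel; rewrite lerBlDr -lerBlDl.
Qed.

End MixedSlope.

(** * A single sign *)

Section PureModel.
Variable sg : bool.
Hypothesis pure : forall p j, idx p j -> b p j = sg.

Lemma pure_isM chi N0 N i : i \in zl chi N0 N -> isM i = ~~ sg.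
Proof.
move=> /zlP[L [p [j [_ Ij vl ->]]]]; rewrite isM_ival //; last by exists L, p, j.
by rewrite /= (pure Ij).
Qed.

Lemma pure_all chi N0 N : sg = false -> all isM (zl chi N0 N).
Proof. by move=> s0; apply/allP => i /pure_isM ->; rewrite s0. Qed.

Lemma pure_has chi N0 N : sg = true -> ~~ has isM (zl chi N0 N).
Proof. by move=> s0; apply/hasPn => i /pure_isM ->; rewrite s0. Qed.

Lemma pole_hi chi N i : i \in zl chi 0 N -> isM i -> i.2 <= Hi.
Proof.
move=> /zlP[L [p [j [_ Ij vl ->]]]]; rewrite isM_ival; last by exists L, p, j.
move=> /= nb; have := ival_cases Ij vl; rewrite (negbTE nb) => -[_ z1 pz _].
apply: le_trans (ltW pz) _; rewrite z1; apply: le_trans (hi_le Ij).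
by have [_ q] := Ij; rewrite ler_piMl ?sc_le1 // ltW // hi_gt0.
Qed.

Lemma pole_lo chi N i : i \in zl chi 0 N -> ~~ isM i -> i.2^-1 <= La.
Proof.
move=> /zlP[L [p [j [_ Ij vl ->]]]]; rewrite isM_ival; last by exists L, p, j.
rewrite negbK /= => bj; have := ival_cases Ij vl; rewrite bj => -[_ z1 zp _].
have [z0 p0] := ival_pos chi L Ij.
apply: le_trans (lo_le Ij); have [_ q] := Ij; have l0 := lo_gt0 p q.
rewrite lef_pV2 ?posrE //; apply: le_trans (ltW zp); rewrite z1.
by rewrite ler_peMl ?(ltW l0) // invf_ge1 ?sc_gt0 // sc_le1.
Qed.

(** |Im S_{chi,K}(w)| >= k |Im w| with k independent of K, so the limit cannot be real. *)
Lemma pure_nonreal chi (w : C) (x : R) : Im w != 0 -> SI chi w <> x%:C.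
Proof.
move=> w0 Sw; have w00 : w != 0 by apply: contraNneq w0 => ->.
have I1 : idx 1 1 by have [-> -> _ _ _] := hM.
have cw : 0 < cabs w by rewrite cabs_gt0.
have iw : 0 < `|Im w| by rewrite normr_gt0.
have [k [K1 [k0 low]]] : exists (k : R) (K1 : nat), 0 < k /\ forall K, (K1 <= K)%N ->
  k * `|Im w| <= `|Im (gS (ZK chi K) w)|.
 have [s0|s0] := boolP sg.
  have [e [N [e1 _ _ pe]]] := pr_large_large 2 I1 (etrans (pure I1) s0) ltr01.
  have e0 : 0 < e by exact: lt_le_trans e1.
  exists (e * (1 + cabs w * La) ^+ 2)^-1, N; split.
   by rewrite invr_gt0 mulr_gt0 // exprn_gt0 // ltr_pwDl // mulr_ge0 ?(ltW cw) // La_ge0.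
  move=> K NK; have NK' : (N < (2 * K).+1)%N by rewrite ltnS mul2n -addnn (leq_trans NK) // leq_addr.
  apply: (plus_lower (cfg_zl chi 0 (2 * K).+1) (pure_has chi 0 _ s0) e0 (pe chi _ NK') La_ge0 _ w00).
   by move=> i iz; apply: (pole_lo iz); rewrite (pure_isM iz) s0.
  exact: offg_nonreal.
 have [e [N [e0 _ pe]]] := pr_small_large 2 I1 (etrans (pure I1) (negbTE s0)) ltr01.
 exists (e / (cabs w + Hi) ^+ 2), N; split.
  by rewrite divr_gt0 // exprn_gt0 // ltr_pwDl // Hi_ge0.
 move=> K NK; have NK' : (N < (2 * K).+1)%N by rewrite ltnS mul2n -addnn (leq_trans NK) // leq_addr.
 apply: (minus_lower (cfg_zl chi 0 (2 * K).+1) (pure_all chi 0 _ (negbTE s0)) e0 (pe chi _ NK') Hi_ge0 _ w00).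
  by move=> i iz; apply: (pole_hi iz); rewrite (pure_isM iz) s0.
 exact: offg_nonreal.
have e0 : 0 < k * `|Im w| / 2 by rewrite divr_gt0 // mulr_gt0.
have [K2 HK2] := S_inf_approx chi w0 e0.
have h1 := low (K1 + K2)%N (leq_addr _ _); have h2 := HK2 (K1 + K2)%N (leq_addl _ _).
have := Im_le_cabs (SI chi w - gS (ZK chi (K1 + K2)) w).
rewrite Sw in h2 *; rewrite cImB /= sub0r normrN => h3.
have := le_trans h1 (le_trans h3 h2); rewrite leNgt => /negP; apply.
by rewrite ltr_pdivrMr // ltr_pMr ?mulr_gt0 // ltr1n.
Qed.

Lemma S_K0_plus chi K : sg = true -> S_K M chi K 0 = 1.
Proof.
move=> s1; rewrite S_K_gS //; last exact: offg0 (cfg_zl _ _ _).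
exact: (gS0 (cfg_zl chi 0 _) (pure_has chi 0 _ s1)).
Qed.

Lemma cinfty_filter : ProperFilter (@cinfty R).
Proof.
split.
 by move=> [B HB]; have := HB (`|B| + 1)%:C; rewrite cabsR ger0_norm ?addr_ge0 // => /(_ ltac:(by have := ler_norm B; lra)).
split.
- by exists 0.
- move=> P Q [A HA] [B HB]; exists (Num.max A B) => z; rewrite gt_max => /andP[zA zB].
 by split; [exact: HA|exact: HB].
- by move=> P Q PQ [A HA]; exists A => z /HA /PQ.
Qed.

Lemma C_K_minus chi K : sg = false -> C_K M chi K = 1.
Proof.
move=> s0; have FF := cinfty_filter; apply: cvg_lim => //.
apply/cvg_cabsP => e e0; have e2 : 0 < e / 2 by rewrite divr_gt0.
have [r0 Hr] := gS_infty (cfg_zl chi 0 (2 * K).+1) (pure_all chi 0 _ s0) e2.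
exists r0 => z /ltW /Hr[_ [oz Sz]]; rewrite S_K_gS //; apply: le_lt_trans Sz _; lra.
Qed.

Variables (D : discretization R) (chi : R) (col : R -> int) (gam : R -> C) (U : set C) (Lg : C -> C).
Variable nu : {finite_measure set R -> \bar R}.
Hypotheses (adm : admissible M D chi col gam U Lg) (lim : limit_measure M D chi col gam Lg nu).

(** For sign - all genuine poles are inside and S tends to 1 at infinity, which calls for large
    circles; for sign + they are all outside and S(0) = 1, which calls for small ones. *)
Lemma pure_contour : exists K0, forall K k, (K0 <= K)%N ->
 cint gam (fun z => gS (ZK chi K) z ^+ k / z) = 2 * 'i * pi%:C.
Proof.
have [[[gC1 gcl _] gpos gI0] _ _ _ _] := adm.
have [Kp HKp] := curve_poles adm.
exists Kp => K k hK; apply: (arcs_contour gC1 gcl gpos gI0 (cfg_zl chi 0 (2 * K).+1)) => d d0.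
have [s0|s0] := boolP sg; last first.
 have [r0 Hr] := gS_infty (cfg_zl chi 0 (2 * K).+1) (pure_all chi 0 _ (negbTE s0)) d0.
 pose r := `|r0| + 1; have r_0 : 0 < r by rewrite ltr_wpDl.
 have rr : r0 <= r by have := ler_norm r0; rewrite /r; lra.
 exists r; split=> //.
  move=> i ig; left; have iz := (genP (cfg_zl _ _ _) ig).1; have := HKp K i hK ig.
  rewrite (pure_isM iz) s0 => ?; split=> //.
  by have [h _] := Hr r%:C ltac:(by rewrite cabsR gtr0_norm); exact: lt_le_trans (h i ig) rr.
 by move=> z zr; have [_ [_ h]] := Hr z ltac:(by rewrite zr).
have /cont_cabsP/(_ d d0)[t t0 Ht] := cder_cont (cder_gS (offg0 (cfg_zl chi 0 (2 * K).+1))).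
pose r := Num.min (t / 2) (1 / (La + 1) / 2).
have La1 : 0 < La + 1 by rewrite ltr_wpDl // La_ge0.
have r0 : 0 < r by rewrite lt_min !divr_gt0.
exists r; split=> //.
 move=> i ig; right; have iz := (genP (cfg_zl _ _ _) ig).1; have := HKp K i hK ig.
 rewrite (pure_isM iz) s0 => ?; split=> //.
 have p0 := (genP (cfg_zl _ _ _) ig).2.
 have := pole_lo iz (ltac:(by rewrite (pure_isM iz) s0)) => pl.
 have q1 : (La + 1)^-1 <= i.2 by rewrite -[i.2]invrK lef_pV2 ?posrE ?invr_gt0 //; lra.
 have q2 : r <= 1 / (La + 1) / 2 by rewrite ge_min lexx orbT.
 have : 0 < (La + 1)^-1 by rewrite invr_gt0.
 by move: q1 q2; rewrite div1r; lra.
move=> z zr; have := Ht z; rewrite subr0 zr (gS0 (cfg_zl _ _ _)) ?pure_has // => h.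
apply: ltW; apply: h; have : r <= t / 2 by rewrite ge_min lexx.
lra.
Qed.

(** The density is pi on [0, 1] and 0 beyond, with its only jump at 1, so it is constant near x0. *)
Lemma pure_slope (x0 s : R) : 0 < x0 -> x0 != 1 ->
 (- (pi^-1) * Im (Stieltjes nu (x0 +i* eta)) @[eta --> 0^'+] --> s) ->
 alpha M * pi / 2 * s = 0 \/ alpha M * pi / 2 * s = pi.
Proof.
move=> x00 x01 St; have p0 := pi_gt0 R.
pose h (x : R) : R := if x <= 1 then pi else 0.
pose Bs := x0 + 1.
have Bs1 : 1 <= Bs by rewrite lerDr ltW.
have [K0 HK] := pure_contour.
have mh : mbd h 0 Bs.
 apply: (@mbd_cat _ _ 0 1 Bs); first by rewrite ler01.
  apply: (@mbd_oo _ _ (fun=> pi)); first by apply: continuous_subspaceT => x; exact: cvg_cst.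
  by move=> x /andP[_ x1]; rewrite /h (ltW x1).
 apply: (@mbd_oo _ _ (fun=> 0)); first by apply: continuous_subspaceT => x; exact: cvg_cst.
 by move=> x /andP[x1 _]; rewrite /h leNgt x1.
have hint k : k.+1%:R * \int[mu]_(x in `[0, Bs]) (x ^+ k * h x) = pi.
 have cX : {within `[0, 1], continuous (fun x : R => x ^+ k.+1)} by apply: continuous_subspaceT; exact: exprn_continuous.
 have ck (a d : R) : {within `[a, d], continuous (fun x : R => x ^+ k)} by apply: continuous_subspaceT; exact: exprn_continuous.
 have mp := mbdM (mbd_cont (ck 0 Bs)) mh.
 rewrite (@Rint_cat _ _ 0 1 Bs) ?ler01 //.
 have -> : \int[mu]_(x in `[1, Bs]) (x ^+ k * h x) = \int[mu]_(x in `[1, Bs]) 0.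
  apply: Rint_oo => //.
  - case: mp => [mf [V fV]]; split.
    by apply: measurable_funS mf => // x /=; rewrite !in_itv /= => /andP[x1 ->]; rewrite (le_trans ler01).
   by exists V => x /andP[x1 x2]; apply: fV; rewrite x2 (le_trans ler01).
  - by apply: mbd_cont; apply: continuous_subspaceT => x; exact: cvg_cst.
  - by move=> x /andP[x1 _]; rewrite /h leNgt x1 mulr0.
 rewrite Rintegral_cst // mul0r addr0.
 have E2 : \int[mu]_(x in `[0, 1]) (k.+1%:R * x ^+ k) = 1.
  rewrite /Rintegral (@continuous_FTC2 _ _ (fun x : R => x ^+ k.+1)) //.
  - by rewrite /= expr0n expr1n subr0.
  - by apply: continuous_subspaceT => x; apply: cvgM; [exact: cvg_cst|exact: exprn_continuous].
  - move/(continuous_within_itvP _ ltr01): cX => [_ c1 c2]; split=> // x _.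
   by have [] := rd_exp k.+1 x.
  - by move=> x _; rewrite derive1E; have [] := rd_exp k.+1 x.
 have i1 : mu.-integrable `[0, 1] (EFin \o (fun x : R => x ^+ k)) by exact: mbd_int (mbd_cont (ck 0 1)).
 rewrite RintegralZl // in E2.
 have -> : \int[mu]_(x in `[0, 1]) (x ^+ k * h x) = pi * \int[mu]_(x in `[0, 1]) (x ^+ k).
  rewrite -RintegralZl //; apply: eq_Rintegral => x; rewrite inE /= in_itv /= => /andP[_ x1].
  by rewrite /h x1 mulrC.
 by rewrite mulrCA E2 mulr1.
apply: (@between_limits _ [set L | L = 0 \/ L = pi]).
 move=> L /= nL; have n1 : 0 < `|L - 0| by rewrite normr_gt0 subr_eq0; apply/eqP => E; apply: nL; left.
 have n2 : 0 < `|L - pi| by rewrite normr_gt0 subr_eq0; apply/eqP => E; apply: nL; right.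
 exists (Num.min `|L - 0| `|L - pi| / 2); first by rewrite divr_gt0 // lt_min n1 n2.
 by move=> L' [->|->]; have : Num.min `|L - 0| `|L - pi| <= `|L - 0| by [rewrite ge_min lexx];
  have : Num.min `|L - 0| `|L - pi| <= `|L - pi| by [rewrite ge_min lexx orbT]; lra.
apply: (@slope_limit D chi col gam U Lg nu adm lim x0 Bs s 0 (fun=> h) (fun j => j + K0)%N) => //.
- by rewrite x00 /Bs ltrDl ltr01.
- by move=> j; rewrite leq_addr.
- by move=> _ x _; rewrite /h; case: ifP => _; rewrite ?lexx ltW.
- by move=> j k; rewrite HK ?leq_addl // hint.
- by move=> L [->|->]; rewrite lexx ltW.
- move=> d d0; exists (`|x0 - 1| / 2), 0%N; split; first by rewrite divr_gt0 // normr_gt0 subr_eq0.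
 move=> j _; have [lt|gt|E] := ltgtP x0 1; last by rewrite E eqxx in x01.
  exists pi; first by right.
  move=> x /andP[_]; rewrite ler0_norm ?subr_le0 ?(ltW lt) // => x2.
  by rewrite /h (_ : x <= 1) ?subrr ?normr0 ?(ltW d0) //; lra.
 exists 0; first by left.
 move=> x /andP[x2 _]; rewrite ger0_norm ?subr_ge0 ?(ltW gt) // in x2.
 by rewrite /h [x <= 1]leNgt (_ : 1 < x) ?subrr ?normr0 ?(ltW d0) //=; lra.
Qed.

End PureModel.

(** * Dependence on the column *)

Section MovingColumn.
Notation V := (knot M).

Variable chi0 : R.
Hypothesis reg : regular_col M chi0.

Lemma knot_neq p : (p <= m)%N -> chi0 != V p.
Proof.
move=> hpm; have [/andP[h0 hm] hV] := reg; apply/eqP => E.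
case: p hpm E => [|p] hpm E; first by move: h0; rewrite E ltxx.
move: hpm; rewrite leq_eqVlt => /orP[/eqP pE|hpm]; first by move: hm; rewrite E pE ltxx.
by apply: (hV p.+1) => //; rewrite hpm.
Qed.

Lemma knot_gap : exists2 d : R, 0 < d & forall p chi, (p <= m)%N -> `|chi - chi0| < d ->
 (V p < chi) = (V p < chi0) /\ (chi < V p) = (chi0 < V p).
Proof.
have [d d0 Hd] := @seq_pos_lb R _ (fun p => `|chi0 - V p|) (iota 0 m.+1)
 (fun p hpm => ltac:(by rewrite normr_gt0 subr_eq0 knot_neq //; move: hpm; rewrite mem_iota add0n ltnS)).
exists d => // p chi hpm cd.
have := Hd p; rewrite mem_iota add0n ltnS hpm => /(_ isT) h.
have := le_lt_trans (lexx _) (lt_le_trans cd h) => lt1.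
have [gt|lt|E] := ltgtP chi0 (V p); last by move: (knot_neq hpm); rewrite E eqxx.
 have E : `|chi0 - V p| = V p - chi0 by rewrite distrC gtr0_norm ?subr_gt0.
 rewrite E ltr_norml in lt1; case/andP: lt1 => l1 l2.
 by split; [apply/negbTE; rewrite -leNgt|]; lra.
have E : `|chi0 - V p| = chi0 - V p by rewrite gtr0_norm ?subr_gt0.
rewrite E ltr_norml in lt1; case/andP: lt1 => l1 l2.
by split; [|apply/negbTE; rewrite -leNgt]; lra.
Qed.

Lemma valid_near : exists2 d : R, 0 < d & forall chi L p j, idx p j -> `|chi - chi0| < d ->
 valid chi (L, (p, j)) = valid chi0 (L, (p, j)).
Proof.
have [d d0 Hd] := knot_gap; exists d => // chi L p j [/andP[p1 hpm] _] cd.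
rewrite /valid /=; case: eqP => //= _; case: (b p j).
 by have [-> _] := Hd p.-1 chi (leq_trans (leq_pred p) hpm) cd.
by have [_ ->] := Hd p chi hpm cd.
Qed.

Lemma ival1 chi t : (ival chi t).1 = (ival chi0 t).1.
Proof. by case: t => L [p j]; rewrite /ival; case: (b p j). Qed.

Lemma ival2_cont t : {for chi0, continuous (fun chi => (ival chi t).2)}.
Proof.
case: t => L [p j]; rewrite /ival.
have cmin_ (v : R) : Num.min v chi @[chi --> chi0] --> Num.min v chi0.
 by apply: (@continuous_min R R (fun=> v) id chi0); [exact: cvg_cst|exact: cvg_id].
have cmax_ (v : R) : Num.max v chi @[chi --> chi0] --> Num.max v chi0.
 by apply: (@continuous_max R R (fun=> v) id chi0); [exact: cvg_cst|exact: cvg_id].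
case: (b p j) => /=; apply: cvgM; try exact: cvg_cst; apply: cvgM; try exact: cvg_cst.
 case: (L == 0%N); last exact: cvg_cst.
 exact: (continuous_comp (cmin_ (V p)) (@continuous_expR R _)).
case: (L == 0%N); last exact: cvg_cst.
exact: (continuous_comp (cmax_ (V p.-1)) (@continuous_expR R _)).
Qed.

Lemma joint_fac w0 L p j : idx p j -> w0 != (ival chi0 (L, (p, j))).2%:C ->
 joint chi0 w0 (fun chi w => if valid chi (L, (p, j)) then fac (ival chi (L, (p, j))) w else 1).
Proof.
move=> Ij wp; have [d d0 Hd] := valid_near.
have [z0 p0] := ival_pos chi0 L Ij.
case vl : (valid chi0 (L, (p, j))); last first.
 apply: (joint_near d0 (joint_cst _ _ 1)) => chi w cd _.
 by rewrite (Hd chi L p j Ij cd) vl.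
have hjp := joint_real w0 (@ival2_cont (L, (p, j))).
have jz := joint_cst chi0 w0 (ival chi0 (L, (p, j))).1%:C.
have jv := joint_var chi0 w0.
have j1 := joint_cst chi0 w0 1.
have pn : (ival chi0 (L, (p, j))).2%:C != 0 :> C by rewrite (inj_eq CI) gt_eqF.
have zn : (ival chi0 (L, (p, j))).1%:C != 0 :> C by rewrite (inj_eq CI) gt_eqF.
case bj : (b p j).
 apply: (joint_near d0 (joint_mul (joint_sub j1 (joint_mul jv (joint_inv zn jz)))
   (joint_inv _ (joint_sub j1 (joint_mul jv (joint_inv pn hjp)))))).
  by rewrite subr_eq0 eq_sym -subr_eq0 -(inj_eq (mulIf pn)) mul0r mulrBl mul1r mulfVK // subr_eq0.
 by move=> chi w cd _; rewrite (Hd chi L p j Ij cd) vl fac_ival ?(Hd chi L p j Ij cd) // bj ival1.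
apply: (joint_near d0 (joint_mul (joint_sub jv jz) (joint_inv _ (joint_sub jv hjp)))).
 by rewrite subr_eq0.
by move=> chi w cd _; rewrite (Hd chi L p j Ij cd) vl fac_ival ?(Hd chi L p j Ij cd) // bj ival1.
Qed.

(** The inverse of a factor remains continuous at the pole and fails only at the zero; it is used at
    poles of the product. *)
Lemma joint_fac_inv w0 L p j : idx p j -> (valid chi0 (L, (p, j)) -> w0 != (ival chi0 (L, (p, j))).1%:C) ->
 joint chi0 w0 (fun chi w => (if valid chi (L, (p, j)) then fac (ival chi (L, (p, j))) w else 1)^-1).
Proof.
move=> Ij wz; have [d d0 Hd] := valid_near.
have [z0 p0] := ival_pos chi0 L Ij.
case vl : (valid chi0 (L, (p, j))) wz; last first.
 move=> _; apply: (joint_near d0 (joint_cst _ _ 1)) => chi w cd _.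
 by rewrite (Hd chi L p j Ij cd) vl invr1.
move=> /(_ isT) wz.
have hjp := joint_real w0 (@ival2_cont (L, (p, j))).
have jz := joint_cst chi0 w0 (ival chi0 (L, (p, j))).1%:C.
have jv := joint_var chi0 w0.
have j1 := joint_cst chi0 w0 1.
have pn : (ival chi0 (L, (p, j))).2%:C != 0 :> C by rewrite (inj_eq CI) gt_eqF.
have zn : (ival chi0 (L, (p, j))).1%:C != 0 :> C by rewrite (inj_eq CI) gt_eqF.
case bj : (b p j).
 apply: (joint_near d0 (joint_mul (joint_sub j1 (joint_mul jv (joint_inv pn hjp)))
   (joint_inv _ (joint_sub j1 (joint_mul jv (joint_inv zn jz)))))).
  by rewrite subr_eq0 eq_sym -subr_eq0 -(inj_eq (mulIf zn)) mul0r mulrBl mul1r mulfVK // subr_eq0.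
 by move=> chi w cd _; rewrite (Hd chi L p j Ij cd) vl fac_ival ?(Hd chi L p j Ij cd) // bj ival1 invf_div.
apply: (joint_near d0 (joint_mul (joint_sub jv hjp) (joint_inv _ (joint_sub jv jz)))).
 by rewrite subr_eq0.
by move=> chi w cd _; rewrite (Hd chi L p j Ij cd) vl fac_ival ?(Hd chi L p j Ij cd) // bj ival1 invf_div.
Qed.

Lemma joint_rawp w0 N : Im w0 != 0 -> joint chi0 w0 (fun chi w => rawp (zl chi 0 N) w).
Proof.
move=> iw; have J : joint chi0 w0 (fun chi w => \prod_(L <- iota 0 N) \prod_(p <- index_iota 1 m.+1)
  \prod_(j <- index_iota 1 n.+1) (if valid chi (L, (p, j)) then fac (ival chi (L, (p, j))) w else 1)).
 apply: joint_prod => L _; apply: joint_prod => p; rewrite mem_index_iota ltnS => p1.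
 apply: joint_prod => j; rewrite mem_index_iota ltnS => j1.
 by apply: joint_fac => //; apply: contraNneq iw => ->.
by apply: (joint_near ltr01 J) => chi w _ _; rewrite rawp_LF.
Qed.

(** [annulus_close] is uniform in chi, so joint continuity is inherited from one finite product; the
    latter's value bounds the approximant at nearby points, where the estimate is then applied
    again. *)
Lemma S_inf_joint w0 : Im w0 != 0 -> joint chi0 w0 SI.
Proof.
move=> iw e e0; have [r0 wr] := nonreal_range iw.
have S0 : 0 < 2 * cabs w0 by move: r0; lra.
have [N1 [_ _ _ H]] := annulus_close r0 S0.
have e3 : 0 < e / 3 by rewrite divr_gt0.
have e31 : 0 < Num.min 1 (e / 3) by rewrite lt_min ltr01.
pose X := cabs (SI chi0 w0) + 2.
have [K0 HK] := H X _ e31.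
have wX : cabs (SI chi0 w0) <= X by rewrite lerDl.
have h0 := HK chi0 K0 w0 (leqnn _) wr (offg_nonreal iw) (or_intror wX).
have [d d0 Hd] := joint_rawp (2 * K0).+1 iw e31.
pose dd := Num.min d (Num.min (`|Im w0|) (cabs w0 / 2)).
have dd0 : 0 < dd by rewrite !lt_min d0 r0 normr_gt0 iw.
exists dd => // chi w; rewrite !lt_min => /andP[c1 _] /and3P[v1 v2 v3].
have iw' : Im w != 0.
 by apply: contraTneq v2 => E; rewrite -leNgt; have := near_Im w0 w; rewrite E sub0r normrN.
have wr' : cabs w0 / 2 < cabs w < 2 * cabs w0.
 by have := cabs_lip w w0; rewrite ler_norml => /andP[q1 q2]; apply/andP; split; lra.
have := Hd chi w c1 v1.
rewrite !(rawp_gS (cfg_zl _ _ _)); try (by move=> i _; apply: contraNneq iw => ->); try (by move=> i _; apply: contraNneq iw' => ->).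
rewrite -!/(ZK _ K0) => h1.
move: h0 h1; rewrite !le_min => /andP[h01 h02] /andP[h11 h12].
have gX : cabs (gS (ZK chi K0) w) <= X.
 have q1 := cabsB_ge (gS (ZK chi K0) w) (gS (ZK chi0 K0) w0).
 have q2 := cabsB_ge (gS (ZK chi0 K0) w0) (SI chi0 w0); rewrite cabsBC in q2.
 by rewrite /X; move: q1 q2 h01 h11; lra.
have := HK chi K0 w (leqnn _) wr' (offg_nonreal iw') (or_introl gX).
rewrite le_min => /andP[_ h2].
have tri (a1 a2 a3 a4 : C) : a1 - a4 = (a1 - a2) + (a2 - a3) - (a4 - a3) by ring.
rewrite (tri _ (gS (ZK chi K0) w) (gS (ZK chi0 K0) w0)).
apply: cabsD_le; rewrite cabsN; apply: le_trans (lerD (cabsD _ _) (lexx _)) _.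
apply: le_trans (lerD (lerD h2 h12) h02) _.
by rewrite le_eqVlt; apply/orP; left; apply/eqP; field.
Qed.

End MovingColumn.

(** * Upper roots accumulating at a real point *)

Section RealCluster.
Notation V := (knot M).
Variable chi0 : R.
Hypothesis reg : regular_col M chi0.

(* A pole moving with chi cannot meet a zero at chi0: it would enter another interval of
  the same sign when chi moves on to the suitable side. *)
Lemma cancelled_pole_fixed L p j L' p' j' : idx p j -> idx p' j' ->
 valid chi0 (L, (p, j)) -> valid chi0 (L', (p', j')) ->
 (ival chi0 (L, (p, j))).2 = (ival chi0 (L', (p', j'))).1 ->
 exists2 d : R, 0 < d & forall chi, `|chi - chi0| < d -> (ival chi (L, (p, j))).2 = (ival chi0 (L, (p, j))).2.
Proof.
move=> Ij Ij' vl vl' E; have [d1 d10 Hk] := knot_gap reg; have [d2 d20 Hv] := valid_near reg.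
pose d := Num.min d1 d2; have d0 : 0 < d by rewrite lt_min d10.
have dd (chi : R) : `|chi - chi0| < d -> `|chi - chi0| < d1 /\ `|chi - chi0| < d2.
 by rewrite lt_min => /andP[].
have tauj : 0 < tau M j by apply: tau_gt0; case: Ij.
have [[/andP[p1 hpm] Ij2] _] := (Ij, Ij).
have s1 : 0 < (sc true L)^-1 by rewrite invr_gt0 sc_gt0.
have s2 : 0 < sc false L by rewrite sc_gt0.
have [L0|L0] := eqVneq L 0%N; last first.
 by exists 1 => // chi _; rewrite /ival (negbTE L0); case: (b p j).
have mem chi : `|chi - chi0| < d -> ival chi (L, (p, j)) \in zl chi 0 (maxn L L').+1 /\
  ival chi (L', (p', j')) \in zl chi 0 (maxn L L').+1.
 move=> /dd[_ cd]; split; apply: zl_mem; rewrite ?ltnS ?leq_maxl ?leq_maxr ?(Hv chi _ _ _ Ij cd) ?(Hv chi _ _ _ Ij' cd) //.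
have tt : (L, (p, j)) <> (L', (p', j')).
 by move=> q; rewrite -q in E; have [_ _ /eqP ne] := cfg_pos (cfg_zl chi0 0 (maxn L L').+1) (mem chi0 (ltac:(by rewrite subrr normr0))).1; apply: ne.
have neq chi : `|chi - chi0| < d -> ival chi (L, (p, j)) != ival chi (L', (p', j')).
 move=> cd; apply/eqP => q; apply: tt; have [_ cd2] := dd chi cd.
 apply: (ival_inj (chi := chi) (N0 := 0) (N := (maxn L L').+1) _ _ q);
  by apply/mem_ix; rewrite /= add0n ltnS ?leq_maxl ?leq_maxr ?(Hv chi _ _ _ Ij cd2) ?(Hv chi _ _ _ Ij' cd2).
have z1 chi t : (ival chi t).1 = (ival chi0 t).1 by exact: ival1.
have ctr : `|chi0 - chi0| < d by rewrite subrr normr0.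
have [m1 m2] := mem chi0 ctr.
have isMc chi (cd : `|chi - chi0| < d) : isM (ival chi (L, (p, j))) = ~~ b p j /\ isM (ival chi (L', (p', j'))) = ~~ b p' j'.
 have [_ cd2] := dd chi cd; split.
  by rewrite isM_ival //; exists L, p, j; rewrite (Hv chi _ _ _ Ij cd2).
 by rewrite isM_ival //; exists L', p', j'; rewrite (Hv chi _ _ _ Ij' cd2).
have [i1 i2] := isMc chi0 ctr.
have same : b p j = b p' j'.
 case bj : (b p j) i1; case bj' : (b p' j') i2 => //= i2 i1.
  have := cfg_MP (cfg_zl chi0 0 _) m2 m1 i2 (negbT i1).
  have := isMN (cfg_zl chi0 0 _) m1 (negbT i1); rewrite E => h1 h2.
  by have := lt_trans h1 h2; rewrite ltxx.
 have := cfg_MP (cfg_zl chi0 0 _) m1 m2 i1 (negbT i2); rewrite -E => h.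
 by have := lt_trans h i1; rewrite /isM ltxx.
have [bj|bj] := boolP (b p j).
 have [lt|ge] := ltP (V p) chi0.
  exists d => // chi /dd[cd _]; have [h1 _] := Hk p chi hpm cd.
  by rewrite /ival bj L0 eqxx !min_l // ltW // h1.
 have lt0 : chi0 < V p by rewrite lt_neqAle ge (knot_neq reg hpm).
 pose chi := chi0 + d / 2.
 have cd : `|chi - chi0| < d by rewrite /chi addrAC subrr add0r gtr0_norm ?divr_gt0 //; lra.
 have [cd1 cd2] := dd chi cd.
 have [_ h1] := Hk p chi hpm cd1.
 have ltv : chi < V p by rewrite h1.
 have [q1 q2] := mem chi cd; have [k1 k2] := isMc chi cd.
 have := cfg_PP (cfg_zl chi 0 _) q1 q2 (ltac:(by rewrite k1 bj)) (ltac:(by rewrite k2 -same bj)) (neq chi cd).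
 have a1 : (ival chi0 (L, (p, j))).2 < (ival chi (L, (p, j))).2.
  rewrite /ival bj L0 eqxx /= !min_r ?(ltW ltv) ?(ltW lt0) // ltr_pM2l; last by rewrite L0 in s1.
  by rewrite ltr_pM2r ?invr_gt0 // ltr_expR /chi ltrDl divr_gt0.
 have a2 := isMN (cfg_zl chi 0 _) q2 (ltac:(by rewrite k2 -same bj)).
 have a3 := isMN (cfg_zl chi0 0 _) m1 (ltac:(by rewrite i1 bj)).
 rewrite !z1 in a2 *; case=> h; first by have := lt_le_trans a1 h; rewrite E ltxx.
 by have := lt_le_trans a2 (le_trans h (ltW a3)); rewrite E ltxx.
have hpm' : (p.-1 <= m)%N := leq_trans (leq_pred p) hpm.
have [lt|ge] := ltP chi0 (V p.-1).
 exists d => // chi /dd[cd _]; have [_ h1] := Hk p.-1 chi hpm' cd.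
 by rewrite /ival (negbTE bj) L0 eqxx !max_l // ltW // h1.
have lt0 : V p.-1 < chi0 by rewrite lt_neqAle ge eq_sym (knot_neq reg hpm').
pose chi := chi0 - d / 2.
have cd : `|chi - chi0| < d by rewrite /chi addrAC subrr add0r normrN gtr0_norm ?divr_gt0 //; lra.
have [cd1 cd2] := dd chi cd.
have [h1 _] := Hk p.-1 chi hpm' cd1.
have ltv : V p.-1 < chi by rewrite h1.
have [q1 q2] := mem chi cd; have [k1 k2] := isMc chi cd.
have := cfg_MM (cfg_zl chi 0 _) q1 q2 (ltac:(by rewrite k1 bj)) (ltac:(by rewrite k2 -same bj)) (neq chi cd).
have a1 : (ival chi (L, (p, j))).2 < (ival chi0 (L, (p, j))).2.
 rewrite /ival (negbTE bj) L0 eqxx /= !max_r ?(ltW ltv) ?(ltW lt0) // ltr_pM2l; last by rewrite L0 in s2.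
 by rewrite ltr_pM2r ?invr_gt0 // ltr_expR /chi ltrBlDr ltrDl divr_gt0.
have a2 : isM (ival chi (L', (p', j'))) by rewrite k2 -same bj.
have a3 : isM (ival chi0 (L, (p, j))) by rewrite i1 bj.
rewrite /isM in a2 a3; rewrite !z1 in a2 *; case=> h.
 by rewrite E in a3; have := lt_trans (le_lt_trans h a2) a3; rewrite ltxx.
by have := le_lt_trans h a1; rewrite E ltxx.
Qed.

Lemma rawp_neq0 (zs : seq (R * R)) (w : C) : cfg zs -> Im w != 0 -> rawp zs w != 0.
Proof.
move=> zc iw; rewrite /rawp prodf_seq_neq0; apply/allP => i iz /=.
have [z0 p0 _] := cfg_pos zc iz.
have nr (r : R) : w != r%:C by apply: contraNneq iw => ->.
have nz : i.1%:C != 0 :> C by rewrite (inj_eq CI) gt_eqF.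
have np : i.2%:C != 0 :> C by rewrite (inj_eq CI) gt_eqF.
rewrite /fac; case: ifP => _; rewrite mulf_neq0 ?invr_neq0 ?subr_eq0 ?nr //.
 by rewrite eq_sym -(inj_eq (mulIf nz)) mulfVK // mul1r nr.
by rewrite eq_sym -(inj_eq (mulIf np)) mulfVK // mul1r nr.
Qed.

(** No zero sits at a genuine pole, so the inverse of the product is jointly continuous there; it
    vanishes at (chi0, i.2). *)
Lemma genuine_repels N (i : R * R) (X : R) : i \in gen (zl chi0 0 N) -> exists2 d : R, 0 < d &
 forall chi w, `|chi - chi0| < d -> cabs (w - i.2%:C) < d -> Im w != 0 -> X < cabs (rawp (zl chi 0 N) w).
Proof.
move=> ig; have := ig; rewrite mem_gen => /andP[ri iz].
have nz := ri; rewrite (rsd_neq0 (cfg_zl _ _ _) iz) in nz.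
have J : joint chi0 i.2%:C (fun chi w => \prod_(L <- iota 0 N) \prod_(p <- index_iota 1 m.+1)
  \prod_(j <- index_iota 1 n.+1) (if valid chi (L, (p, j)) then fac (ival chi (L, (p, j))) w else 1)^-1).
 apply: joint_prod => L; rewrite mem_iota add0n => LN; apply: joint_prod => p; rewrite mem_index_iota ltnS => p1.
 apply: joint_prod => j; rewrite mem_index_iota ltnS => j1.
 apply: (joint_fac_inv reg) => // vl.
 have := allP nz _ (zl_mem (chi := chi0) (ltac:(by case/andP: LN) : (L < N)%N) (conj p1 j1) vl).
 by rewrite (inj_eq CI).
have Je chi w : \prod_(L <- iota 0 N) \prod_(p <- index_iota 1 m.+1)
  \prod_(j <- index_iota 1 n.+1) (if valid chi (L, (p, j)) then fac (ival chi (L, (p, j))) w else 1)^-1 =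
  (rawp (zl chi 0 N) w)^-1.
 rewrite rawp_LF -prodfV; apply: eq_bigr => L _; rewrite /LF -prodfV; apply: eq_bigr => p _.
 by rewrite -prodfV.
have R0 : rawp (zl chi0 0 N) i.2%:C = 0.
 have iM : i \in zl chi0 0 N by [].
 rewrite /rawp (big_rem i) //= /fac; case: ifP => _; rewrite ?subrr ?divff ?subrr ?invr0 ?mulr0 ?mul0r //.
 by have [_ p0 _] := cfg_pos (cfg_zl _ _ _) iz; rewrite (inj_eq CI) gt_eqF.
have X1 : 0 < (`|X| + 1)^-1 by rewrite invr_gt0 ltr_wpDl.
have [d d0 Hd] := J _ X1; exists d => // chi w c1 v1 iw.
have := Hd chi w c1 v1; rewrite !Je R0 invr0 subr0 cabsV => h.
have r0 := rawp_neq0 (cfg_zl chi 0 N) iw.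
rewrite lef_pV2 ?posrE ?cabs_gt0 ?ltr_wpDl // in h.
by have := ler_norm X; lra.
Qed.

Lemma gen_up chi N1 N2 (i : R * R) : (N1 <= N2)%N -> i \in gen (zl chi 0 N1) ->
 (forall N j, j \in zl chi N1 N -> j.1 != i.2) -> i \in gen (zl chi 0 N2).
Proof.
move=> N12; rewrite !mem_gen => /andP[ri iz] far.
have iz2 : i \in zl chi 0 N2.
 move: iz => /zlP[L [p [j [LN Ij vl ->]]]]; apply: zl_mem => //.
 by case/andP: LN => _ h; apply: leq_trans h N12.
rewrite iz2 andbT (rsd_neq0 (cfg_zl _ _ _) iz2); apply/allP => j jz.
rewrite (rsd_neq0 (cfg_zl _ _ _) iz) in ri.
rewrite -(subnKC N12) in jz; case/zl_cat: jz => jz; first exact: (allP ri).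
by rewrite eq_sym; exact: far jz.
Qed.

Lemma seq_unif (T : eqType) (s : seq T) (P : T -> R -> Prop) :
 (forall t a c, 0 < c -> c <= a -> P t a -> P t c) ->
 (forall t, t \in s -> exists2 a : R, 0 < a & P t a) -> exists2 a : R, 0 < a & forall t, t \in s -> P t a.
Proof.
move=> mono; elim: s => [|t s IH] H; first by exists 1.
have [a a0 Ha] := IH (fun t ts => H t (ltac:(by rewrite inE ts orbT))).
have [c c0 Hc] := H t (mem_head _ _).
have m0 : 0 < Num.min a c by rewrite lt_min a0.
exists (Num.min a c) => // t'; rewrite inE => /orP[/eqP ->|ts].
 by apply: mono Hc => //; rewrite ge_min lexx orbT.
by apply: mono (Ha _ ts) => //; rewrite ge_min lexx.
Qed.

Lemma pole_far (z : C) (p eta Rw : R) : 0 < p -> 0 < eta -> 0 <= Rw -> cabs z <= Rw ->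
 eta <= cabs (z - p%:C) -> eta / (1 + Rw + eta) * (1 + p) <= cabs (z - p%:C).
Proof.
move=> p0 e0 Rw0 zR g1; set k := eta / _.
have den : 0 < 1 + Rw + eta by rewrite ltr_wpDl // addr_ge0.
have kd : k * (1 + Rw + eta) = eta by rewrite /k mulfVK // gt_eqF.
have k0 : 0 < k by rewrite divr_gt0.
have k1 : k <= 1 by rewrite /k ler_pdivrMr // mul1r lerDr addr_ge0.
have g2 : p - Rw <= cabs (z - p%:C).
 by have := cabsB_ge p%:C z; rewrite cabsR (gtr0_norm p0) cabsBC; lra.
have [pr|pr] := leP p (Rw + eta).
 by apply: le_trans g1; rewrite -kd ler_pM2l //; lra.
apply: le_trans g2; have -> : 1 + p = (1 + Rw + eta) + (p - (Rw + eta)) by ring.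
by rewrite mulrDr kd; have : k * (p - (Rw + eta)) <= 1 * (p - (Rw + eta)); [rewrite ler_wpM2r //; lra|lra].
Qed.

(** Poles move continuously with chi, so only those equal to t at chi0 matter. They are cancelled at
    chi0, and by [cancelled_pole_fixed] such a pole stays on the zero that cancels it, so it is not
    genuine for nearby chi either. *)
Lemma noncancelled_gap N1 (t : R) : t%:C != 0 :> C ->
 (forall i, i \in gen (zl chi0 0 N1) -> i.2 != t) ->
 exists2 d : R, 0 < d & forall chi i, `|chi - chi0| < d -> i \in gen (zl chi 0 N1) -> d <= `|i.2 - t|.
Proof.
move=> t0 ng; have [dv dv0 Hv] := valid_near reg.
pose P tt a := forall chi, `|chi - chi0| < a -> ival chi tt \in gen (zl chi 0 N1) -> a <= `|(ival chi tt).2 - t|.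
have U tt : tt \in ix chi0 0 N1 -> exists2 a : R, 0 < a & P tt a.
 move=> /[dup] /ixP[L [p [j [-> [Ij vl]]]]] tix.
 have LN : (L < N1)%N by move/mem_ix: tix => [/andP[_]].
 have iz := zl_mem (chi := chi0) LN Ij vl.
 have [E|ne] := eqVneq (ival chi0 (L, (p, j))).2 t; last first.
  have n0 : 0 < `|(ival chi0 (L, (p, j))).2 - t| / 2 by rewrite divr_gt0 // normr_gt0 subr_eq0.
  have /cvgrPdist_lt/(_ _ n0)[a /= a0 Ha] := ival2_cont (chi0 := chi0) (t := (L, (p, j))).
  exists (Num.min a (`|(ival chi0 (L, (p, j))).2 - t| / 2)); first by rewrite lt_min a0.
  move=> chi; rewrite lt_min => /andP[c1 _] _; rewrite ge_min; apply/orP; right.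
  have := Ha chi; rewrite /= distrC => /(_ c1).
  have := ler_distD (ival chi (L, (p, j))).2 (ival chi0 (L, (p, j))).2 t.
  by move: `|_| `|_| `|_| => q1 q2 q3; lra.
 have nig : ival chi0 (L, (p, j)) \notin gen (zl chi0 0 N1).
  by apply/negP => /ng; rewrite E eqxx.
 rewrite mem_gen iz andbT (rsd_neq0 (cfg_zl _ _ _) iz) -has_predC in nig.
 have /hasP[q qz /=] := nig; rewrite negbK => /eqP Eq.
 move: qz => /zlP[L' [p' [j' [LN' Ij' vl' qE]]]].
 have Eq' : (ival chi0 (L, (p, j))).2 = (ival chi0 (L', (p', j'))).1 by rewrite Eq qE.
 have [a a0 Ha] := cancelled_pole_fixed Ij Ij' vl vl' Eq'.
 exists (Num.min a dv); first by rewrite lt_min a0.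
 move=> chi; rewrite lt_min => /andP[c1 c2] ig; exfalso.
 have := ig; rewrite mem_gen => /andP[ri iz']; rewrite (rsd_neq0 (cfg_zl _ _ _) iz') in ri.
 have jz : ival chi (L', (p', j')) \in zl chi 0 N1.
  by apply: zl_mem => //; rewrite (Hv chi).
 by have := allP ri _ jz; rewrite (Ha chi c1) (ival1 chi0) Eq' eqxx.
have mono tt a c : 0 < c -> c <= a -> P tt a -> P tt c.
 by move=> c0 ca H chi cc ig; apply: le_trans ca (H chi (lt_le_trans cc ca) ig).
have [d d0 Hd] := seq_unif mono U.
exists (Num.min d dv); first by rewrite lt_min d0.
move=> chi i; rewrite lt_min => /andP[c1 c2] ig; rewrite ge_min; apply/orP; left.
have := ig; rewrite mem_gen => /andP[_ /zlP[L [p [j [LN Ij vl iE]]]]].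
rewrite iE; rewrite iE in ig; apply: Hd => //; apply/mem_ix; split=> //.
by rewrite -(Hv chi).
Qed.

(** The conjugate of w is a root as well, and Taylor's bound between the two gives |S'(w)| <= (2 A +
    1) Im w: a root close to the axis is almost double. The error q of the approximation by finite K
    is absorbed into (Im w)^2 and e. *)
Lemma root_quadratic (chi x k B1 : R) (i0 : R * R) (K1 : nat) (w y : C) : top_zero chi i0 ->
 0 < k -> 0 <= B1 -> (0 < K1)%N ->
 (forall K, (K1 <= K)%N -> sB (lK chi i0 K) <= B1) ->
 (forall K z, (K1 <= K)%N -> z \in [:: w; conjc w; y] -> kfar (lK chi i0 K) k z) ->
 0 < Im w -> Im y != 0 -> SI chi w = x%:C ->
 forall A, A = (1 + `|i0.1|) / k ^+ 3 * B1 ->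
 cabs (SI chi y - x%:C) <= A * cabs (y - w) ^+ 2 + cabs (y - w) * ((2 * A + 1) * Im w).
Proof.
move=> ti k0 B10 K10 sb kf iw iy Sw A AE.
have A0 : 0 <= A by rewrite AE mulr_ge0 // divr_ge0 ?addr_ge0 // exprn_ge0 // ltW.
apply/ler_addgt0Pr => e e0.
pose q := Num.min (Im w ^+ 2) (e / 2).
have q0 : 0 < q by rewrite lt_min exprn_gt0 // divr_gt0.
have q1 : q <= Im w ^+ 2 by rewrite ge_min lexx.
have q2 : q <= e / 2 by rewrite ge_min lexx orbT.
have nw : Im w != 0 by rewrite gt_eqF.
have nwc : Im (conjc w) != 0 by rewrite cImJ oppr_eq0.
have [Ka HKa] := sS_approx ti nw q0.
have [Kb HKb] := sS_approx ti nwc q0.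
have [Kc HKc] := sS_approx ti iy q0.
pose K := (Ka + Kb + Kc + K1)%N.
have h1 := HKa K ltac:(by rewrite /K -!addnA leq_addr).
have h2 := HKb K ltac:(by rewrite /K [(Ka + Kb)%N]addnC -!addnA leq_addr).
have h3 := HKc K ltac:(by rewrite /K addnAC leq_addl).
have hK : (K1 <= K)%N by rewrite /K leq_addl.
have KK : (0 < K)%N by exact: leq_trans hK.
have kw : kfar (lK chi i0 K) k w by apply: kf => //; rewrite mem_head.
have kwc : kfar (lK chi i0 K) k (conjc w) by apply: kf => //; rewrite !inE eqxx orbT.
have ky : kfar (lK chi i0 K) k y by apply: kf => //; rewrite !inE eqxx !orbT.
have lp := l_pos ti KK.
have AA : (1 + `|i0.1|) / k ^+ 3 * sB (lK chi i0 K) <= A.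
 by rewrite AE ler_wpM2l ?sb // divr_ge0 ?addr_ge0 // exprn_ge0 // ltW.
have t1 := le_trans (sS_taylor i0.1 lp k0 kw kwc) (ler_wpM2r (sqr_ge0 _) AA).
have t2 := le_trans (sS_taylor i0.1 lp k0 kw ky) (ler_wpM2r (sqr_ge0 _) AA).
rewrite (S_infJ chi nw) Sw in h2; rewrite Sw in h1.
have xJ : conjc (x%:C : C) = x%:C by rewrite /= oppr0.
rewrite xJ in h2.
set sw := sS _ _ w in h1 t1 t2; set swc := sS _ _ (conjc w) in h2 t1; set sy := sS _ _ y in h3 t2.
set Dk := sD _ _ w in t1 t2.
have cw : cabs (conjc w - w) = 2 * Im w.
 have -> : conjc w - w = (- (2 * Im w))%:C * 'i.
  by apply: complexP; rewrite ?cReB ?cImB ?cReJ ?cImJ ?cReZ ?cImZ /=; ring.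
 rewrite cabsM cabsR cabs_i.
 by rewrite mulr1 normrN ger0_norm // mulr_ge0 // ltW.
have Db : cabs Dk <= (2 * A + 1) * Im w.
 have h4 : cabs ((conjc w - w) * Dk) <= A * cabs (conjc w - w) ^+ 2 + q + q.
  have -> : (conjc w - w) * Dk = - (swc - sw - (conjc w - w) * Dk) - (x%:C - swc) + (x%:C - sw) by ring.
  apply: cabsD_le; apply: le_trans (lerD (cabsD _ _) (lexx _)) _; rewrite !cabsN.
  by apply: lerD h1; apply: lerD.
 rewrite cabsM cw in h4.
 have y2 : 0 < 2 * Im w by rewrite mulr_gt0.
 rewrite -(ler_pM2l y2); apply: le_trans h4 _.
 have -> : 2 * Im w * ((2 * A + 1) * Im w) = A * (2 * Im w) ^+ 2 + Im w ^+ 2 + Im w ^+ 2 by ring.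
 exact: (lerD (lerD (lexx _) q1) q1).
have -> : SI chi y - x%:C = (SI chi y - sy) + (sy - sw - (y - w) * Dk) + (y - w) * Dk - (x%:C - sw).
 by move: (SI chi y) => u; ring.
apply: cabsD_le; rewrite cabsN; apply: le_trans (lerD (cabsD _ _) (lexx _)) _.
apply: le_trans (lerD (lerD (cabsD _ _) (lexx _)) (lexx _)) _.
have h5 : cabs ((y - w) * Dk) <= cabs (y - w) * ((2 * A + 1) * Im w) by rewrite cabsM ler_wpM2l ?cabs_ge0.
apply: le_trans (lerD (lerD (lerD h3 t2) h5) h1) _.
by move: q2; move: (A * _) (cabs _ * _) => u1 u2; lra.
Qed.

Definition accum (x0 : R) (w0 : C) := forall d : R, 0 < d -> exists chi x w,
 [/\ `|chi - chi0| < d, `|x - x0| < d, cabs (w - w0) < d, 0 < Im w & SI chi w = x%:C].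

Lemma accum_nonreal x0 w0 : accum x0 w0 -> Im w0 != 0 -> SI chi0 w0 = x0%:C.
Proof.
move=> ac iw; apply: cabs_le0_eq; apply/ler_addgt0Pr => e e0; rewrite add0r.
have e2 : 0 < e / 2 by rewrite divr_gt0.
have [d d0 Hd] := S_inf_joint reg iw e2.
have m0 : 0 < Num.min d (e / 2) by rewrite lt_min d0.
have [chi [x [w [+ + + _ Sw]]]] := ac _ m0; rewrite !lt_min => /andP[c1 _] /andP[_ x1] /andP[w1 _].
have := Hd chi w c1 w1; rewrite Sw => h.
have tri (a1 a2 a3 : C) : a1 - a3 = - (a2 - a1) + (a2 - a3) by ring.
rewrite (tri _ x%:C); apply: cabsD_le; rewrite cabsN -rmorphB cabsR.
by rewrite [leRHS]splitr lerD // ltW.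
Qed.

(** Limit of [root_quadratic] along roots tending to t: Im w tends to 0 and the linear term
    disappears. [genuine_repels] shows that t is not a genuine pole, and [noncancelled_gap] supplies
    the distance to poles, uniform in chi. The bound is obtained at nonreal y, where S is jointly
    continuous, and extended to real y by continuity at the fixed column. *)
Lemma accum_real x0 (t : R) : t != 0 -> accum x0 t%:C -> exists (d A : R), [/\ 0 < d, 0 <= A &
 forall y, cabs (y - t%:C) < d -> cabs (SI chi0 y - x0%:C) <= A * cabs (y - t%:C) ^+ 2].
Proof.
move=> tn ac; have at0 : 0 < `|t| by rewrite normr_gt0.
have r0 : 0 < `|t| / 2 by rewrite divr_gt0.
have S0 : 0 < 2 * `|t| by rewrite mulr_gt0.
have [N1 [_ far cont H]] := annulus_close r0 S0.
have Hi0 := Hi_ge0.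
have ann (y : C) : cabs (y - t%:C) < `|t| / 2 -> `|t| / 2 < cabs y < 2 * `|t|.
 by move=> h; have := cabs_lip y t%:C; rewrite cabsR ler_norml => /andP[h1 h2]; apply/andP; split; lra.
have farpole chi N i : i \in zl chi N1 N -> `|t| / 2 <= `|i.2 - t| /\ i.1 != t.
 move=> iz; have [z0 p0 _] := cfg_pos (cfg_zl _ _ _) iz; have := far chi N i iz.
 have tt := ler_norm t; case: ifP => isM_ h.
  have lt : i.2 <= `|t| / 4 by apply: le_trans (ltW isM_) _; lra.
  split; first by have := lerB_dist t i.2; rewrite (gtr0_norm p0) distrC; lra.
  by apply/eqP => E; move: h; rewrite -E gtr0_norm //; lra.
 have := isMN (cfg_zl _ _ _) iz (negbT isM_) => h2.
 split; first by have := ler_norm (i.2 - t); lra.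
 by apply/eqP => E; move: h; rewrite -E gtr0_norm //; lra.
have ng i : i \in gen (zl chi0 0 N1) -> i.2 != t.
 move=> ig; apply/eqP => Et.
 have [K0 HK] := H (`|x0| + 1) _ ltr01.
 pose K := (K0 + N1)%N.
 have NK : (N1 <= (2 * K).+1)%N.
  by apply: leqW; rewrite mul2n -addnn (leq_trans _ (leq_addr _ _)) // /K leq_addl.
 have ig2 : i \in gen (zl chi0 0 (2 * K).+1).
  by apply: gen_up ig _ => // N j /farpole[_]; rewrite Et.
 have [d d0 Hd] := genuine_repels (`|x0| + 2) ig2.
 have m0 : 0 < Num.min d (Num.min 1 (`|t| / 2)) by rewrite !lt_min d0 ltr01.
 have [chi [x [w [+ + + iw Sw]]]] := ac _ m0.
 rewrite !lt_min => /andP[c1 _] /and3P[_ x1 _] /and3P[w1 _ w2].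
 have nw : Im w != 0 by rewrite gt_eqF.
 have xb : cabs (SI chi w) <= `|x0| + 1.
  rewrite Sw cabsR; have := ler_normD x0 (x - x0); rewrite addrC subrK => q.
  by apply: le_trans q _; rewrite lerD2l ltW.
 have := HK chi K w (leq_addr _ _) (ann w w2) (offg_nonreal nw) (or_intror xb) => h1.
 have := Hd chi w c1; rewrite Et => /(_ w1 nw).
 rewrite (rawp_gS (cfg_zl _ _ _)); last by move=> j _; apply: contraNneq nw => ->.
 have := cabsB_ge (gS (ZK chi K) w) (SI chi w); rewrite cabsBC -/(ZK chi K).
 by move: xb h1; lra.
have tC : t%:C != 0 :> C by rewrite (inj_eq CI).
have [d1 d10 Hd1] := noncancelled_gap tC ng.
have [r1 [Sx [sg [Bs [B1 [Km [_ _ _ Km0 unif]]]]]]] := mixed_uniform 0.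
pose d := Num.min d1 (`|t| / 2); have d0 : 0 < d by rewrite lt_min d10.
have dd1 : d <= d1 by rewrite ge_min lexx.
have dt : d <= `|t| / 2 by rewrite ge_min lexx orbT.
pose eta := d / 2; have eta0 : 0 < eta by rewrite divr_gt0.
pose Rw := `|t| + d; have Rw0 : 0 <= Rw by rewrite addr_ge0 // ltW.
pose k := eta / (1 + Rw + eta).
have den : 0 < 1 + Rw + eta by rewrite ltr_wpDl // addr_ge0.
have k0 : 0 < k by rewrite divr_gt0.
pose K1 := (Km + N1)%N.
have kf chi i0 K z : top_zero chi i0 -> `|chi - chi0| < d1 -> (K1 <= K)%N -> cabs (z - t%:C) < eta ->
  kfar (lK chi i0 K) k z.
 move=> ti cd hK zt p pl; have KK : (0 < K)%N by rewrite (leq_trans _ hK) // /K1 (leq_trans Km0) // leq_addr.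
 have [_ p0] := l_pos ti KK pl.
 have NK : (N1 <= (2 * K).+1)%N.
  by apply: leqW; rewrite mul2n -addnn (leq_trans _ (leq_addr _ _)) // (leq_trans _ hK) // /K1 leq_addl.
 have gp : d <= `|p.2 - t|.
  have [i [iz _ ig ->]] := lstP pl; move: iz ig; rewrite /ZK -(subnKC NK) /= => iz ig.
  case/zl_cat: (iz) => iz'.
   by apply: le_trans dd1 _; apply: Hd1 cd _; exact: (gen_mono (leq_addr _ _) ig iz').
  by have [h _] := farpole _ _ _ iz'; exact: le_trans dt h.
 have zR : cabs z <= Rw.
  by have := cabsB_ge z t%:C; rewrite cabsR /Rw; move: zt; rewrite /eta; lra.
 apply: pole_far => //.
 have -> : z - p.2%:C = (t - p.2)%:C + (z - t%:C) by rewrite rmorphB; ring.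
 have := cabsB_ge (t - p.2)%:C (- (z - t%:C)); rewrite opprK cabsN cabsR distrC.
 by move: zt gp; rewrite /eta; lra.
have B10 : 0 <= B1.
 have [i0 [ti cb]] := exists_top chi0.
 have [h _ _ _ _] := unif chi0 i0 Km ti cb (leqnn _).
 exact: le_trans (sB_ge0 (l_pos ti Km0)) h.
pose A := (1 + Hi) / k ^+ 3 * B1.
have A0 : 0 <= A by rewrite mulr_ge0 // divr_ge0 ?addr_ge0 // exprn_ge0 // ltW.
have nonr y : Im y != 0 -> cabs (y - t%:C) < eta -> cabs (SI chi0 y - x0%:C) <= A * cabs (y - t%:C) ^+ 2.
 move=> iy yt; apply/ler_addgt0Pr => e e0; set a := cabs (y - t%:C).
 have a0 : 0 <= a := cabs_ge0 _.
 pose Q := 2 * A * a + A + (a + 1) * (2 * A + 1) + 1.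
 have Q1 : 0 <= 2 * A * a by apply: mulr_ge0 a0; exact: mulr_ge0.
 have Q2 : 0 <= (a + 1) * (2 * A + 1) by apply: mulr_ge0; apply: addr_ge0 => //; exact: mulr_ge0.
 have Q0 : 0 < Q by rewrite /Q; move: Q1 Q2 A0; move: (2 * A * a) ((a + 1) * _) => u1 u2; lra.
 have e2 : 0 < e / 2 by rewrite divr_gt0.
 have [dj dj0 Hj] := S_inf_joint reg iy e2.
 pose del := Num.min (Num.min 1 (e / (2 * Q))) (Num.min dj (Num.min d1 eta)).
 have del0 : 0 < del by rewrite !lt_min ltr01 dj0 d10 eta0 divr_gt0 // mulr_gt0.
 have del1 : del <= 1 by rewrite !ge_min lexx.
 have delQ : del * Q <= e / 2.
  have h : del <= e / (2 * Q) by rewrite !ge_min lexx orbT.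
  apply: le_trans (ler_wpM2r (ltW Q0) h) _.
  by rewrite le_eqVlt; apply/orP; left; apply/eqP; field; rewrite gt_eqF.
 have [chi [x [w [c1 x1 w1 iw Sw]]]] := ac _ del0.
 have [cj cd1] : `|chi - chi0| < dj /\ `|chi - chi0| < d1.
  by move: c1; rewrite !lt_min => /andP[_ /and3P[]].
 have wt : cabs (w - t%:C) < eta by move: w1; rewrite !lt_min => /andP[_ /and3P[]].
 have [i0 [ti cb]] := exists_top chi.
 have wct : cabs (conjc w - t%:C) < eta by rewrite -cjBR cabsJ.
 have K10 : (0 < K1)%N by rewrite /K1 (leq_trans Km0) // leq_addr.
 have sb K : (K1 <= K)%N -> sB (lK chi i0 K) <= B1.
  by move=> hK; have [h _ _ _ _] := unif chi i0 K ti cb (leq_trans (leq_addr _ _) hK).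
 have kff K z : (K1 <= K)%N -> z \in [:: w; conjc w; y] -> kfar (lK chi i0 K) k z.
  by move=> hK; rewrite !inE => /or3P[] /eqP ->; apply: kf.
 have q0 := root_quadratic ti k0 B10 K10 sb kff iw iy Sw erefl.
 set A' := (1 + `|i0.1|) / k ^+ 3 * B1 in q0.
 have c0 : 0 < i0.1 by apply: lt_le_trans cmin_gt0 _; case/andP: cb.
 have AA : A' <= A.
  rewrite /A' /A gtr0_norm // ler_wpM2r // ler_wpM2r ?invr_ge0 ?exprn_ge0 ?(ltW k0) // lerD2l.
  by case/andP: cb.
 have yw : cabs (y - w) <= a + del.
  have -> : y - w = (y - t%:C) - (w - t%:C) by ring.
  by apply: cabsD_le; rewrite cabsN lerD2l ltW.
 have yw0 := cabs_ge0 (y - w).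
 have iwd : Im w <= del.
  have := near_Im t%:C w; rewrite /= subr0 gtr0_norm // => h; exact: le_trans h (ltW w1).
 have q1 : cabs (SI chi y - x%:C) <= A * (a + del) ^+ 2 + (a + del) * ((2 * A + 1) * del).
  apply: le_trans q0 _; apply: lerD.
   apply: le_trans (ler_wpM2r (sqr_ge0 _) AA) _; rewrite ler_wpM2l // lerXn2r ?nnegrE //.
   by rewrite addr_ge0 // ltW.
  have A'0 : 0 <= A' by rewrite mulr_ge0 // divr_ge0 ?addr_ge0 // exprn_ge0 // ltW.
  apply: ler_pM => //; first by rewrite mulr_ge0 ?(ltW iw) // addr_ge0 // mulr_ge0.
  apply: ler_pM => //; [by rewrite addr_ge0 // mulr_ge0|exact: ltW|].
  by rewrite lerD2r ler_wpM2l.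
 have q2 := Hj chi y cj (ltac:(by rewrite subrr cabs0)).
 have tri (a1 a2 a3 : C) : a1 - a3 = - (a2 - a1) + (a2 - a3) by ring.
 have tri2 (a1 a2 a3 a4 : C) : a1 - a4 = - (a2 - a1) + (a2 - a3) + (a3 - a4) by ring.
 rewrite (tri2 _ (SI chi y) x%:C); apply: cabsD_le.
 apply: le_trans (lerD (cabsD _ _) (lexx _)) _; rewrite cabsN -rmorphB cabsR.
 apply: le_trans (lerD (lerD q2 q1) (ltW x1)) _.
 have del00 := ltW del0.
 have q3 : A * (a + del) ^+ 2 + (a + del) * ((2 * A + 1) * del) + del <= A * a ^+ 2 + del * Q.
  rewrite -subr_ge0 (_ : _ - _ = A * (del * (1 - del)) + (2 * A + 1) * (del * (1 - del))); last by rewrite /Q; ring.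
  have h : 0 <= del * (1 - del) by rewrite mulr_ge0 // subr_ge0.
  by apply: addr_ge0; apply: mulr_ge0 => //; apply: addr_ge0 => //; exact: mulr_ge0.
 apply: le_trans (_ : e / 2 + (A * a ^+ 2 + del * Q) <= _); first by rewrite -!addrA lerD2l addrA.
 by rewrite [e in leRHS]splitr addrCA lerD2l lerD2l.
exists eta, A; split=> // y yt; have [iy|iy] := eqVneq (Im y) 0; last exact: nonr.
have ya : cabs (y - t%:C) < `|t| / 2 by apply: lt_le_trans yt _; rewrite /eta; lra.
have oy : offg (zl chi0 0 N1) y.
 move=> i ig; apply/eqP => E; have h := Hd1 chi0 i (ltac:(by rewrite subrr normr0)) ig.
 by move: yt; rewrite E -rmorphB cabsR /eta => h2; have := le_lt_trans (le_trans dd1 h) h2; lra.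
have [/cont_cabsP cy _] := cont chi0 y (ann y ya) oy.
apply/ler_addgt0Pr => e e0.
have e2 : 0 < e / 2 by rewrite divr_gt0.
have [dc dc0 Hc] := cy _ e2.
set a := cabs (y - t%:C) in yt *; have a0 : 0 <= a := cabs_ge0 _.
have AQ : 0 < A * (2 * a + 1) + 1 by rewrite ltr_wpDl // mulr_ge0 // addr_ge0 // mulr_ge0.
pose s := Num.min (Num.min 1 (e / 2 / (A * (2 * a + 1) + 1))) (Num.min dc (eta - a)) / 2.
have s2 : 0 < Num.min (Num.min 1 (e / 2 / (A * (2 * a + 1) + 1))) (Num.min dc (eta - a)).
 by rewrite !lt_min ltr01 dc0 subr_gt0 yt andbT /= andbT divr_gt0.
have s0 : 0 < s by rewrite divr_gt0.
have sl : s < Num.min (Num.min 1 (e / 2 / (A * (2 * a + 1) + 1))) (Num.min dc (eta - a)) by rewrite ltr_pdivrMr // ltr_pMr // ltr1n.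
have [sl1 sl2 sl3 sl4] : [/\ s < 1, s < e / 2 / (A * (2 * a + 1) + 1), s < dc & s < eta - a].
 by move: sl; rewrite !lt_min => /andP[/andP[-> ->] /andP[-> ->]].
pose z := y + s%:C * 'i.
have zE : z - y = s%:C * 'i by rewrite /z; ring.
have ci : cabs (s%:C * 'i : C) = s.
 by rewrite cabsM cabsR gtr0_norm // (_ : cabs ('i : C) = 1) ?mulr1 // /cabs /= expr0n expr1n add0r sqrtr1.
have iz : Im z != 0 by rewrite /z cImD iy add0r cImZ /= mulr1 gt_eqF.
have za : cabs (z - t%:C) <= a + s.
 have -> : z - t%:C = (y - t%:C) + s%:C * 'i by rewrite /z; ring.
 by apply: cabsD_le; rewrite ci.
have za' : a + s < eta by rewrite [a + s]addrC -ltrBrDr.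
have h1 := nonr z iz (le_lt_trans za za').
have h2 := Hc z (ltac:(by rewrite zE ci)).
have tri (a1 a2 a3 : C) : a1 - a3 = - (a2 - a1) + (a2 - a3) by ring.
rewrite (tri _ (SI chi0 z)); apply: cabsD_le; rewrite cabsN.
apply: le_trans (lerD (ltW h2) h1) _.
have h3 : A * cabs (z - t%:C) ^+ 2 <= A * (a + s) ^+ 2.
 by rewrite ler_wpM2l // lerXn2r ?nnegrE ?cabs_ge0 // addr_ge0 // ltW.
have h4 : A * (a + s) ^+ 2 <= A * a ^+ 2 + s * (A * (2 * a + 1) + 1).
 rewrite -subr_ge0 (_ : _ - _ = A * (s * (1 - s)) + s); last by ring.
 by rewrite addr_ge0 ?(ltW s0) // mulr_ge0 // mulr_ge0 ?(ltW s0) // subr_ge0 ltW.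
have h5 : s * (A * (2 * a + 1) + 1) <= e / 2 by rewrite -ler_pdivlMr // ltW.
apply: le_trans (lerD (lexx _) (le_trans h3 h4)) _.
by rewrite [e in leRHS]splitr addrCA lerD2l addrC lerD2r.
Qed.

End RealCluster.

(** * Stability of the presence and of the absence of an upper root *)

Section RootPersistence.

(** An upper root is a limit of points of the paths ([path_near_root]), and these lie in the annulus
    of [mixed_paths]. *)
Lemma mixed_root_bounds (Y : R) : 0 < Y -> exists (r Q : R), 0 < r /\ forall chi x w, 0 <= x <= Y ->
 0 < Im w -> SI chi w = x%:C -> r <= cabs w <= Q.
Proof.
move=> Y0; have [Rad [r0 [Bs [S0 [sg [K0 [r00 S00 sg0 K00 P]]]]]]] := mixed_paths Y0.
exists r0, (`|Rad| + 1); split=> // chi x w xY iw Sw.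
have [i0 [ti cb]] := exists_top chi.
have nw : Im w != 0 by rewrite gt_eqF.
have near e : 0 < e -> exists y : C, [/\ cabs (y - w) <= e, r0 < cabs y & cabs y <= Rad].
 move=> e0; have [rho rho0 H] := path_near_root x iw (normr_ge0 Rad) sg0 e0.
 have [K1 HK1] := sS_approx ti nw rho0.
 have [v [B [cp /andP[YB _] sgK vb]]] := P chi i0 (K0 + K1)%N ti cb (leq_addr _ _).
 have KK : (0 < K0 + K1)%N by rewrite (leq_trans K00) // leq_addr.
 have xB : 0 <= x <= B by case/andP: xY => -> h; exact: le_trans h YB.
 have /andP[v1 v2] := vb x xY.
 have h1 := HK1 _ (leq_addl K0 K1); rewrite Sw cabsBC in h1.
 exists (v x); split=> //.
 apply: (H chi i0 (K0 + K1)%N (v x) x ti cb KK sgK h1 _ (cp_onG cp xB) (le_trans v2 (ler_norm _))).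
 by rewrite subrr normr0 ltW.
apply/andP; split.
 apply/ler_addgt0Pr => e e0; have [y [ye y1 _]] := near e e0.
 have := cabsB_ge y w; lra.
have [y [ye _ y2]] := near 1 ltr01; have := cabsB_ge w y; rewrite cabsBC; have := ler_norm Rad; lra.
Qed.

Variable chi0 : R.
Hypothesis reg : regular_col M chi0.

(** If (chi, x) had no upper root, [level_avoids] would keep the path for large K out of the region
    Im z >= Im wp/2, whereas [path_near_root] puts it within Im wp/2 of wp. *)
Lemma upper_persist (x0 : R) (wp : C) : 0 < x0 -> 0 < Im wp -> SI chi0 wp = x0%:C ->
 exists2 d : R, 0 < d & forall chi x, `|chi - chi0| < d -> `|x - x0| < d ->
  exists w, 0 < Im w /\ SI chi w = x%:C.
Proof.
move=> x00 iw Sw; have Y0 : 0 < x0 + 1 by rewrite addr_gt0.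
have [Rad [r0 [Bs [S0 [sg [K0 [r00 S00 sg0 K00 P]]]]]]] := mixed_paths Y0.
have nw : Im wp != 0 by rewrite gt_eqF.
have eta0 : 0 < Im wp / 2 by rewrite divr_gt0.
have [rho rho0 H] := path_near_root x0 iw (normr_ge0 Rad) sg0 eta0.
have rho2 : 0 < rho / 2 by rewrite divr_gt0.
have [d1 d10 H1] := S_inf_joint reg nw rho2.
exists (Num.min (Num.min d1 rho) (Num.min 1 x0)); first by rewrite !lt_min d10 rho0 ltr01.
move=> chi x; rewrite !lt_min => /andP[/andP[c1 _] _] /andP[/andP[_ x1] /andP[x2 x3]].
apply: contrapT => nr.
have [i0 [ti cb]] := exists_top chi.
have [rh [K1 [rh0 HK1]]] := @level_avoids chi x (Im wp / 2) `|Rad| eta0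
 (fun z iz _ Sz => nr (ex_intro _ z (conj (lt_le_trans eta0 iz) Sz))).
have [K2 HK2] := sS_approx ti nw rho2.
pose K := (K0 + K1 + K2)%N.
have hK0 : (K0 <= K)%N by rewrite /K -addnA leq_addr.
have [v [B [cp /andP[YB _] sgK vb]]] := P chi i0 K ti cb hK0.
have KK : (0 < K)%N by exact: leq_trans hK0.
have xY : 0 <= x <= x0 + 1.
 move: x2 x3; rewrite !ltr_norml => /andP[_ q2] /andP[q3 _].
 by apply/andP; split; apply: ltW; [rewrite ltrBrDr addNr in q3|rewrite addrC -ltrBlDr].
have xB : 0 <= x <= B by case/andP: xY => -> h; exact: le_trans h YB.
have /andP[_ v2] := vb x xY.
have h1 := HK2 K (leq_addl _ _); have h2 := H1 chi wp c1 (ltac:(by rewrite subrr cabs0)); rewrite Sw in h2.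
have h3 : cabs (sS (lK chi i0 K) i0.1 wp - x0%:C) <= rho.
 have tri (a1 a2 a3 : C) : a1 - a3 = - (a2 - a1) + (a2 - a3) by ring.
 rewrite (tri _ (SI chi wp)); apply: cabsD_le.
 by rewrite cabsN [rho]splitr lerD.
have vR : cabs (v x) <= `|Rad| := le_trans v2 (ler_norm _).
have h4 := H chi i0 K (v x) x ti cb KK sgK h3 (ltW x1) (cp_onG cp xB) vR.
have iv : Im wp / 2 <= Im (v x).
 by have := near_Im wp (v x); rewrite ler_norml => /andP[q _]; move: q h4; lra.
have nv : Im (v x) != 0 by rewrite gt_eqF // (lt_le_trans eta0).
have [_ ov Sv _] := cp_onG cp xB.
apply: (HK1 K x (v x)) iv vR _; [by rewrite /K addnAC leq_addl|by rewrite subrr normr0 ltW|].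
by rewrite (l_sS ti KK) //; exact: offg_nonreal.
Qed.

(** Otherwise upper roots for parameters tending to (chi0, x0) would cluster, away from 0 by
    [mixed_root_bounds]. A nonreal cluster point is an upper root ([accum_nonreal]), and a real one
    has vanishing derivative ([accum_real]). *)
Lemma no_upper_near (x0 : R) : 0 < x0 -> (forall w, 0 < Im w -> SI chi0 w <> x0%:C) ->
 (forall t : R, SI chi0 t%:C = x0%:C -> ~ cder (SI chi0) t%:C 0) ->
 exists2 d : R, 0 < d & forall chi x, `|chi - chi0| < d -> `|x - x0| < d ->
  forall w, 0 < Im w -> SI chi w <> x%:C.
Proof.
move=> x00 nr nm; apply: contrapT => nd; have Y0 : 0 < x0 + 1 by rewrite addr_gt0.
have [r [Q [r0 bd]]] := mixed_root_bounds Y0.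
pose del := Num.min 1 x0; have del0 : 0 < del by rewrite lt_min ltr01.
have dk k : 0 < del / k.+1%:R by rewrite divr_gt0.
have dk1 k : del / k.+1%:R <= del by rewrite ler_pdivrMr // ler_peMr ?(ltW del0) // ler1n.
have ex k : exists q : R * R * C, [/\ `|q.1.1 - chi0| < del / k.+1%:R, `|q.1.2 - x0| < del / k.+1%:R, 0 < Im q.2 &
  SI q.1.1 q.2 = q.1.2%:C].
 apply: contrapT => nq; apply: nd; exists (del / k.+1%:R) => // chi x c1 x1 w iw Sw.
 by apply: nq; exists (chi, x, w).
have [q Hq] := choice ex.
have qb k : r <= cabs (q k).2 <= Q.
 have [_ x1 iw Sw] := Hq k; apply: (bd _ (q k).1.2) iw Sw.
 have x2 : `|(q k).1.2 - x0| < del := lt_le_trans x1 (dk1 k).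
 move: x2; rewrite !lt_min !ltr_norml => /andP[/andP[_ q2] /andP[q3 _]].
 by apply/andP; split; apply: ltW; [rewrite ltrBrDr addNr in q3|rewrite addrC -ltrBlDr].
have [w0 cl] := @complex_cluster R (fun k => (q k).2) Q (fun k => let: conj _ h := andP (qb k) in h).
have rw : r <= cabs w0.
 apply/ler_addgt0Pr => e e0; have [k _ kd] := cl e 0%N e0.
 by have /andP[h _] := qb k; have := cabsB_ge (q k).2 w0; lra.
have iw0 : 0 <= Im w0.
 apply/ler_addgt0Pr => e e0; have [k _ kd] := cl e 0%N e0.
 by have [_ _ h _] := Hq k; have := near_Im w0 (q k).2; rewrite ler_norml => /andP[_]; lra.
have ac : accum chi0 x0 w0.
 move=> d d0; have h12 : (1 : R) < 2 by rewrite ltr1n.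
 have [N HN] := pow_big (d^-1) h12.
 have [k kN kd] := cl d (2 ^ N)%N d0.
 have [c1 x1 iw Sw] := Hq k.
 have dd : del / k.+1%:R <= d.
  apply: le_trans (_ : 1 / k.+1%:R <= _); first by rewrite ler_pM2r ?invr_gt0 // ge_min lexx.
  rewrite div1r -[d]invrK lef_pV2 ?posrE ?invr_gt0 //; apply: le_trans HN _.
  by rewrite -natrX ler_nat leqW.
 by exists (q k).1.1, (q k).1.2, (q k).2; split=> //; [exact: lt_le_trans c1 dd|exact: lt_le_trans x1 dd].
have [i0|i0] := eqVneq (Im w0) 0; last first.
 apply: (nr w0); first by rewrite lt_neqAle eq_sym i0.
 exact: accum_nonreal ac i0.
have wE : w0 = (Re w0)%:C by apply: complexP; rewrite ?i0.
have t0 : Re w0 != 0.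
 by apply: contraTneq rw => h; rewrite wE h cabs0 -ltNge.
rewrite wE in ac; have [d [A [d0 A0 H]]] := accum_real reg t0 ac.
have S0 : SI chi0 (Re w0)%:C = x0%:C.
 apply: cabs_le0_eq; have := H (Re w0)%:C; rewrite subrr cabs0 expr0n mulr0; exact.
apply: (nm _ S0); apply: (quad_cder d0 A0) => y yd.
by rewrite mulr0 subr0 S0; exact: H.
Qed.

End RootPersistence.

End Mixed.

(** * The value at 0, and continuity at real roots *)

Lemma rawlim_approx chi (z : C) : z != 0 -> (forall N, offr (zl chi 0 N) z) -> forall e, 0 < e ->
 exists K0, forall K, (K0 <= K)%N -> cabs (rawp (ZK chi K) z - limn (fun K => S_raw M chi K z)) <= e.
Proof.
move=> z0 oz e e0; have cz : 0 < cabs z by rewrite cabs_gt0.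
have r0 : 0 < cabs z / 2 by rewrite divr_gt0.
have S0 : 0 < 2 * cabs z by rewrite mulr_gt0.
have zr : cabs z / 2 < cabs z < 2 * cabs z by apply/andP; split; lra.
have h12 : 0 < 1 / 2 :> R by lra.
have [N1 [T [N10 far Tc Tb Tu]]] := annulus_tail r0 S0 h12.
rewrite (rawlim r0 far Tu zr (oz N1) z0).
set g0 := gS (zl chi 0 N1) z.
have q0 : 0 < e / (cabs g0 + 1) by rewrite divr_gt0 // ltr_wpDl // cabs_ge0.
have [K0 HK] := gS_cvg r0 far Tu chi q0; exists K0 => K hK.
have og : offg (zl chi 0 N1) z by move=> i; rewrite mem_gen => /andP[_]; exact: oz.
rewrite (rawp_gS (cfg_zl _ _ _)); last exact: oz.
apply: le_trans (HK K z hK zr og) _; rewrite -/g0 mulrAC ler_pdivrMr ?ltr_wpDl ?cabs_ge0 //.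
by rewrite ler_wpM2l ?(ltW e0) // lerDl.
Qed.

(** S is unbounded along the negative axis near 0, so 0 is the default value of [reduced]. *)
Lemma S_inf_zero_minus chi p j : idx p j -> b p j = false -> SI chi 0 = 0.
Proof.
move=> Ij bj; apply: reduced_unbounded => X d d0.
have d2 : 0 < d / 2 by rewrite divr_gt0.
have [e [N [e0 ed pe]]] := pr_small_large (`|X| + 1) Ij bj d2.
have en : (- e)%:C != 0 :> C by rewrite (inj_eq CI) oppr_eq0 gt_eqF.
exists (- e)%:C; split=> //; first by rewrite subr0 cabsR normrN gtr0_norm //; lra.
have [K0 HK] := rawlim_approx en (fun N => offr_neg (cfg_zl chi 0 N) e0) ltr01.
have NK : (N < (2 * (K0 + N)).+1)%N by rewrite ltnS mul2n -addnn (leq_trans _ (leq_addr _ _)) // leq_addl.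
have := HK (K0 + N)%N (leq_addr _ _); have := pe chi _ NK.
rewrite rawp_neg /ZK; set P := pr _ _ => h1 h2.
set l := limn _ in h2 *; have := cabsB_ge P%:C l; rewrite cabsR.
by have := ler_norm P; have := ler_norm X; lra.
Qed.

Lemma plus_near1 chi N (y : C) : (forall p j, idx p j -> b p j = true) -> cabs y * La <= 1 / 2 ->
 offr (zl chi 0 N) y /\ cabs (rawp (zl chi 0 N) y - 1) <= expR (cnt * (2 * (cabs y * La))) - 1.
Proof.
move=> pure yL; have La0 := La_ge0.
have bnd L p j : idx p j -> valid chi (L, (p, j)) -> let i := ival chi (L, (p, j)) in
  [/\ isM i = false, 0 < i.1, i.1 < i.2, i.1^-1 <= thet ^+ L * La & cabs y <= i.2 / 2].
 move=> Ij vl i; have := ival_cases Ij vl; rewrite pure // => -[nM z1 zp _].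
 have [z0 p0] := ival_pos chi L Ij; have [_ Ij2] := Ij.
 have l0 : 0 < lo p j := lo_gt0 p Ij2.
 have zi : i.1^-1 <= thet ^+ L * La.
  rewrite /i z1 invfM invrK; apply: ler_pM (sc_thet true L) (lo_le Ij).
   by rewrite ltW // sc_gt0.
  by rewrite invr_ge0 ltW.
 split=> //; first exact: negbTE.
 have zi2 : i.1^-1 <= La.
  by apply: le_trans zi _; rewrite ler_piMl // exprn_ile1 // ltW ?thet_gt0 ?thet_lt1.
 have : cabs y / i.1 <= 1 / 2 by apply: le_trans yL; rewrite ler_wpM2l // cabs_ge0.
 by rewrite ler_pdivrMr // => h; apply: le_trans h _; rewrite mulrC mul1r ler_pM2r ?invr_gt0 // ltW.
split.
 move=> i /zlP[L [p [j [_ Ij vl ->]]]]; have [_ z0 zp _ yb] := bnd L p j Ij vl.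
 apply/eqP => E; move: yb; rewrite E cabsR gtr0_norm ?(lt_trans z0) // leNgt.
 by rewrite ltr_pdivrMr // ltr_pMr ?ltr1n // (lt_trans z0).
apply: le_trans (prod_near1 _ _) _; rewrite lerD2r ler_expR.
rewrite big_map; apply: le_trans (_ : \sum_(t <- ix chi 0 N) (2 * (cabs y * La)) * thet ^+ t.1 <= _); last first.
 by apply: ix_sum_le => //; rewrite mulr_ge0 // mulr_ge0 // cabs_ge0.
rewrite big_seq [leRHS]big_seq; apply: ler_sum => t /ixP[L [p [j [-> [Ij vl]]]]] /=.
have [nM z0 zp zi yb] := bnd L p j Ij vl; set i := ival _ _ in nM z0 zp zi yb *.
have p0 : 0 < i.2 by apply: lt_trans zp.
have pn : i.2%:C != 0 :> C by rewrite (inj_eq CI) gt_eqF.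
have zn : i.1%:C != 0 :> C by rewrite (inj_eq CI) gt_eqF.
have yp : i.2%:C - y != 0.
 rewrite subr_eq0 eq_sym; apply/eqP => E; move: yb; rewrite E cabsR gtr0_norm // leNgt.
 by rewrite ltr_pdivrMr // ltr_pMr ?ltr1n.
have -> : fac i y - 1 = y * (i.1 - i.2)%:C / (i.1%:C * (i.2%:C - y)).
 rewrite /fac nM rmorphB /=; have yd : 1 - y / i.2%:C = (i.2%:C - y) / i.2%:C by rewrite mulrBl divff.
 rewrite yd; field; rewrite zn pn yp //.
rewrite !cabsM cabsV cabsM !cabsR distrC (gtr0_norm z0) gtr0_norm ?subr_gt0 //.
have h1 : i.2 / 2 <= cabs (i.2%:C - y).
 by have := cabsB_ge i.2%:C y; rewrite cabsR gtr0_norm //; lra.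
have h2 : (i.2 - i.1) / cabs (i.2%:C - y) <= 2.
 rewrite ler_pdivrMr; last by apply: lt_le_trans h1; rewrite divr_gt0.
 by lra.
have -> : cabs y * (i.2 - i.1) / (i.1 * cabs (i.2%:C - y)) = cabs y * i.1^-1 * ((i.2 - i.1) / cabs (i.2%:C - y)).
 by rewrite invfM; ring.
have -> : 2 * (cabs y * La) * thet ^+ L = cabs y * (thet ^+ L * La) * 2 by ring.
apply: ler_pM => //; first by rewrite mulr_ge0 ?cabs_ge0 // invr_ge0 ltW.
 by rewrite divr_ge0 ?cabs_ge0 // subr_ge0 ltW.
by rewrite ler_wpM2l // cabs_ge0.
Qed.

Lemma S_inf_zero_plus chi : (forall p j, idx p j -> b p j = true) -> SI chi 0 = 1.
Proof.
move=> pure; apply: cvg_lim => //; apply/(cvg_cabsP (dnbhs_filter (0 : C))) => e e0.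
have La0 := La_ge0; have cn := cnt_ge0.
have e2 : 0 < e / 2 by rewrite divr_gt0.
have le0 : 0 < ln (1 + e / 2) by apply: ln_gt0; rewrite ltrDl.
pose T := 2 * (cnt * La) + La + 1.
have cL : 0 <= 2 * (cnt * La) by rewrite mulr_ge0 // mulr_ge0.
have T0 : 0 < T by rewrite ltr_wpDl // addr_ge0.
pose d := Num.min (1 / 2) (ln (1 + e / 2)) / T.
have d0 : 0 < d by rewrite divr_gt0 // lt_min le0 andbT divr_gt0.
have : nbhs (0 : C) [set y | cabs y < d] by apply/nbhs_cabsP; exists d => // y; rewrite subr0.
rewrite /dnbhs /within /=; apply: filterS => y /= yd y0.
have yT : cabs y * T <= Num.min (1 / 2) (ln (1 + e / 2)) by rewrite -ler_pdivlMr // ltW.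
have cy := cabs_ge0 y.
have k1 : 0 <= cabs y * (2 * (cnt * La)) by rewrite mulr_ge0.
have k2 : 0 <= cabs y * La by rewrite mulr_ge0.
have yTE : cabs y * T = cabs y * (2 * (cnt * La)) + cabs y * La + cabs y by rewrite /T; ring.
have yL : cabs y * La <= 1 / 2.
 by move: yT; rewrite le_min yTE => /andP[h _]; move: h k1 cy; move: (cabs y * (2 * _)) => u1; lra.
have yc : cnt * (2 * (cabs y * La)) <= ln (1 + e / 2).
 have -> : cnt * (2 * (cabs y * La)) = cabs y * (2 * (cnt * La)) by ring.
 by move: yT; rewrite le_min yTE => /andP[_ h]; move: h k2 cy; move: (cabs y * La) => u1; lra.
have e4 : 0 < e / 4 by rewrite divr_gt0.
have [K0 HK] := rawlim_approx y0 (fun N => (plus_near1 chi N pure yL).1) e4.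
have h1 := HK K0 (leqnn _); have [_ h2] := plus_near1 chi (2 * K0).+1 pure yL.
have h3 : cabs (rawp (ZK chi K0) y - 1) <= e / 2.
 apply: le_trans h2 _; rewrite lerBlDl; apply: le_trans (_ : expR (ln (1 + e / 2)) <= _).
  by rewrite ler_expR.
 by rewrite lnK // posrE; lra.
set l := limn _ in h1 *.
have -> : l - 1 = (rawp (ZK chi K0) y - 1) - (rawp (ZK chi K0) y - l) by ring.
by apply: le_lt_trans (cabsD _ _) _; rewrite cabsN; lra.
Qed.

(** At a genuine pole the value is the default 0, different from x, so w is not one. *)
Lemma S_inf_regular chi (w x : R) : w != 0 -> x != 0 -> SI chi w%:C = x%:C ->
 {for w%:C, continuous (SI chi)}.
Proof.
move=> w0 x0 Sw; have aw : 0 < `|w| by rewrite normr_gt0.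
have r0 : 0 < `|w| / 2 by rewrite divr_gt0.
have S0 : 0 < 2 * `|w| by rewrite mulr_gt0.
have wr : `|w| / 2 < cabs (w%:C : C) < 2 * `|w| by rewrite cabsR; apply/andP; split; lra.
have h12 : 0 < 1 / 2 :> R by lra.
have [N1 [T [N10 far Tc Tb Tu]]] := annulus_tail r0 S0 h12.
have [og|ng] := pselect (offg (zl chi 0 N1) w%:C).
 exact: (S_inf_cont r0 far Tc Tu wr og).
have [i ig wi] : exists2 i, i \in gen (zl chi 0 N1) & w = i.2.
 apply: contrapT => ne; apply: ng => i ig; apply/eqP => /CI E.
 by apply: ne; exists i.
have p0 : 0 < i.2 by have := ig; rewrite mem_gen => /andP[_ iz]; have [_ q _] := cfg_pos (cfg_zl _ _ _) iz.
have ir : `|w| / 2 < i.2 < 2 * `|w| by move: wr; rewrite cabsR wi gtr0_norm.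
have := S_inf_pole0 r0 far Tc Tb Tu ig ir; rewrite -wi Sw => /CI E.
by rewrite E eqxx in x0.
Qed.

Section Characteristic.

Lemma mixed_or_pure :
 (exists pm jm pp jp, [/\ idx pm jm, b pm jm = false, idx pp jp & b pp jp = true]) \/
 exists sg, forall p j, idx p j -> b p j = sg.
Proof.
have [[pm [jm [i1 b1]]]|no1] := pselect (exists p j, idx p j /\ b p j = false); last first.
 right; exists true => p j ij; apply/negPn/negP => /negbTE h.
 by apply: no1; exists p, j.
have [[pp [jp [i2 b2]]]|no2] := pselect (exists p j, idx p j /\ b p j = true).
 by left; exists pm, jm, pp, jp.
right; exists false => p j ij; apply/negbTE/negP => h.
by apply: no2; exists p, j.
Qed.

Lemma upper_unique chi (x : R) (w1 w2 : C) : 0 < Im w1 -> 0 < Im w2 ->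
 SI chi w1 = x%:C -> SI chi w2 = x%:C -> w1 = w2.
Proof.
move=> i1 i2 e1 e2.
have [[pm [jm [pp [jp [I1 b1 I2 b2]]]]]|[sg pu]] := mixed_or_pure.
 have [i0 [ti cb]] := exists_top I1 b1 chi.
 exact: (upper_root_uniq I1 b1 I2 b2 ti cb i1 i2 e1 e2).
have nz : Im w1 != 0 by rewrite gt_eqF.
by case: (pure_nonreal pu nz e1).
Qed.

Lemma nonreal_mult chi (x : R) (w : C) : Im w != 0 -> SI chi w = x%:C ->
 root_mult (SI chi) x%:C w = 1%:E.
Proof.
move=> iw Sw.
have [[pm [jm [pp [jp [I1 b1 I2 b2]]]]]|[sg pu]] := mixed_or_pure.
 have [i0 [ti cb]] := exists_top I1 b1 chi.
 have [dd dd0 cd] := nonreal_root_simple I1 b1 I2 b2 ti cb iw Sw.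
 by apply: root_mult_simple; rewrite // (cder_derive1 cd).
by case: (pure_nonreal pu iw Sw).
Qed.

Lemma ImJ (w : C) : Im (conjc w) = - Im w. Proof. by case: w. Qed.

Lemma rootJ chi kappa (w : C) : is_root M chi kappa w -> is_root M chi kappa (conjc w).
Proof.
rewrite /is_root => Sw; have [iw|iw] := eqVneq (Im w) 0.
 by have -> : conjc w = w by case: w iw {Sw} => a c /= ->; rewrite oppr0.
by rewrite S_infJ // Sw conjc_real.
Qed.

Lemma nonreal_root_upper chi kappa (w : C) : Im w != 0 -> is_root M chi kappa w ->
 exists wp, [/\ 0 < Im wp, is_root M chi kappa wp & w = wp \/ w = conjc wp].
Proof.
move=> iw rw; have [l|g|E] := ltgtP (Im w) 0.
- exists (conjc w); split; [by rewrite ImJ oppr_gt0|exact: rootJ|right; by rewrite conjcK].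
- by exists w; split => //; left.
- by rewrite E eqxx in iw.
Qed.

Lemma nonreal_root_pair chi kappa (wp w : C) : 0 < Im wp -> is_root M chi kappa wp ->
 Im w != 0 -> is_root M chi kappa w -> w = wp \/ w = conjc wp.
Proof.
move=> ip rp iw rw; have [wq [iq rq]] := nonreal_root_upper iw rw.
by rewrite (upper_unique iq ip rq rp).
Qed.

Lemma roots_upper1 chi kappa (wp : C) : 0 < Im wp -> is_root M chi kappa wp ->
 roots_in M upper chi kappa = 1%:E.
Proof.
move=> ip rp; have np : Im wp != 0 by rewrite gt_eqF.
rewrite -(nonreal_mult np rp); apply: root_count1 => //.
by move=> y iy ry; exact: upper_unique ry rp.
Qed.

Lemma roots_upper0 chi kappa : (forall w, 0 < Im w -> ~ is_root M chi kappa w) ->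
 roots_in M upper chi kappa = 0%E.
Proof. exact: root_count0. Qed.

Lemma roots_nonreal chi kappa : (roots_in M nonreal chi kappa <= 2%:E)%E.
Proof.
have [[wp [ip rp]]|no] := pselect (exists wp : C, 0 < Im wp /\ is_root M chi kappa wp).
 have np : Im wp != 0 by rewrite gt_eqF.
 apply: le_trans (@root_count2 R _ _ _ wp (conjc wp) _) _.
  by move=> y iy ry; exact: nonreal_root_pair ry.
 rewrite (nonreal_mult np rp) (@nonreal_mult chi (xpt M kappa)).
 - by rewrite -EFinD lee_fin -[1 + 1]/(2%:R).
 - by rewrite ImJ oppr_eq0.
 - exact: rootJ.
rewrite /roots_in root_count0 ?lee_fin // => w iw rw.
by have [wp [ip rp _]] := nonreal_root_upper iw rw; apply: no; exists wp.
Qed.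

Variables (D : discretization R) (col : R -> R -> int) (gam : R -> R -> R[i]) (U : R -> set R[i]).
Variables (Lg : R -> R[i] -> R[i]) (nu : R -> {finite_measure set R -> \bar R}).
Hypothesis hadm : forall chi, regular_col M chi ->
 admissible M D chi (col chi) (gam chi) (U chi) (Lg chi).
Hypothesis hnu : forall chi, regular_col M chi ->
 limit_measure M D chi (col chi) (gam chi) (Lg chi) (nu chi).

Lemma alpha_gt0 : 0 < alpha M. Proof. by case: hM => _ _ _ _ []. Qed.

Lemma xpt_gt0 kappa : 0 < xpt M kappa. Proof. exact: expR_gt0. Qed.

Lemma slope_value (s a : R) : alpha M * pi / 2 * s = pi - a ->
 s = 2 / alpha M - 2 * a / (pi * alpha M).
Proof.
have aN : alpha M != 0 by rewrite gt_eqF // alpha_gt0.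
have pN : (pi : R) != 0 by rewrite gt_eqF // pi_gt0.
move: (pi : R) pN => P pN E.
have -> : s = 2 / (alpha M * P) * (alpha M * P / 2 * s) by field; rewrite pN aN.
by rewrite E; field; rewrite pN aN.
Qed.

(** The slope is decided by the presence of an upper root, strictly between the two frozen values if
    there is one and at one of them otherwise. With the uniqueness of that root, both equivalences
    of the theorem follow. *)
Lemma good_cases chi kappa : good_point M nu chi kappa ->
 (exists wp, [/\ 0 < Im wp, is_root M chi kappa wp &
   slope M nu chi kappa = 2 / alpha M - 2 * carg wp / (pi * alpha M)]) \/
 (forall w, 0 < Im w -> ~ is_root M chi kappa w) /\
 (slope M nu chi kappa = 0 \/ slope M nu chi kappa = 2 / alpha M).
Proof.
case=> -[reg _] [St _] _ [Ks [_ iii]].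
have adm := hadm reg; have lim := hnu reg; have x0 := xpt_gt0 kappa.
have aN : alpha M != 0 by rewrite gt_eqF // alpha_gt0.
have pN : (pi : R) != 0 by rewrite gt_eqF // pi_gt0.
have fin s : alpha M * pi / 2 * s = 0 \/ alpha M * pi / 2 * s = pi -> s = 0 \/ s = 2 / alpha M.
 case=> E; [left|right].
  have : alpha M * pi / 2 * s = pi - pi by rewrite subrr.
  by move/slope_value => ->; move: (pi : R) pN => P pN; field; rewrite pN aN.
 have : alpha M * pi / 2 * s = pi - 0 by rewrite subr0.
 by move/slope_value => ->; rewrite mulr0 mul0r subr0.
have [[pm [jm [pp [jp [I1 b1 I2 b2]]]]]|[sg pu]] := mixed_or_pure.
 have [[wp [ip rp]]|no] := pselect (exists wp : C, 0 < Im wp /\ is_root M chi kappa wp).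
  left; exists wp; split => //; rewrite -ang_carg ?ltW //.
   by apply: slope_value; exact: (slope_root I1 b1 I2 b2 adm lim x0 St ip rp).
  by apply: contraTneq ip => ->; rewrite ltxx.
 have nr w : 0 < Im w -> ~ is_root M chi kappa w by move=> iw rw; apply: no; exists w.
 right; split => //; apply: fin.
 exact: (slope_noroot I1 b1 I2 b2 adm lim x0 St nr).
have nr w : 0 < Im w -> ~ is_root M chi kappa w.
 by move=> iw; apply: (pure_nonreal pu); rewrite gt_eqF.
right; split => //; apply: fin.
apply: (pure_slope pu adm lim x0 _ St).
(* With one sign, 1 is the value S_{chi,K}(0) for + and C_{chi,K} for -, which [assumption_iii]
   keeps different from x. *)
have [S1 C1] := iii Ks (leqnn _); apply/eqP => E; rewrite E in S1 C1.
case: sg pu => pu.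
 by apply: S1; exact: (S_K0_plus pu).
by apply: C1; exact: (C_K_minus pu).
Qed.

Lemma good_real_roots chi kappa : (forall w, 0 < Im w -> ~ is_root M chi kappa w) ->
 forall w, is_root M chi kappa w -> Im w = 0.
Proof.
move=> nr w rw; apply/eqP/negPn/negP => iw.
by have [wp [ip rp _]] := nonreal_root_upper iw rw; case: (nr wp).
Qed.

Lemma carg_upper (w : C) : 0 < Im w -> 0 < carg w < pi.
Proof.
move=> iw; rewrite -ang_carg ?ltW //; first exact: ang_upper.
by apply: contraTneq iw => ->; rewrite ltxx.
Qed.

Lemma slope_bounds (a : R) : 0 < a < pi ->
 0 < 2 / alpha M - 2 * a / (pi * alpha M) < 2 / alpha M.
Proof.
move=> /andP[a0 api]; have al := alpha_gt0; have p0 : (0 : R) < pi := pi_gt0 R.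
have aN : alpha M != 0 by rewrite gt_eqF.
have pN : (pi : R) != 0 by rewrite gt_eqF.
have -> : 2 / alpha M - 2 * a / (pi * alpha M) = 2 * (pi - a) / (pi * alpha M).
 by move: (pi : R) pN => P pN; field; rewrite pN aN.
have -> : 2 / alpha M = 2 * pi / (pi * alpha M) by move: (pi : R) pN => P pN; field; rewrite pN aN.
have pa : 0 < pi * alpha M by rewrite mulr_gt0.
by rewrite divr_gt0 ?mulr_gt0 ?subr_gt0 //= ltr_pM2r ?invr_gt0 // ltr_pM2l // ltrBlDr ltrDl.
Qed.

Lemma liquid_root chi kappa : good_point M nu chi kappa -> liquid M nu chi kappa ->
 exists2 wp : C, 0 < Im wp & is_root M chi kappa wp.
Proof.
move=> gp [_ /andP[s0 s2]]; have [[wp [ip rp _]]|[_ [E|E]]] := good_cases gp.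
- by exists wp.
- by rewrite E ltxx in s0.
- by rewrite E ltxx in s2.
Qed.

Lemma frozen_noroot chi kappa : good_point M nu chi kappa -> frozen M nu chi kappa ->
 forall w, 0 < Im w -> ~ is_root M chi kappa w.
Proof.
move=> gp [_ fr]; have [[wp [ip _ E]]|[nr _]] := good_cases gp; last by [].
have /andP[l1 l2] := slope_bounds (carg_upper ip); rewrite -E in l1 l2.
by case: fr => F; rewrite F ltxx in l1 l2.
Qed.

Lemma part_one chi kappa : good_point M nu chi kappa ->
 [/\ (forall w, is_root M chi kappa w -> is_root M chi kappa (conjc w)) /\
   (roots_in M nonreal chi kappa <= 2%:E)%E,
   liquid M nu chi kappa <-> unique_nonreal_pair M chi kappa,
   liquid M nu chi kappa -> forall wp, upper wp -> is_root M chi kappa wp ->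
    0 < carg wp < pi /\
    slope M nu chi kappa = 2 / alpha M - 2 * carg wp / (pi * alpha M) &
   frozen M nu chi kappa <-> forall w, is_root M chi kappa w -> Im w = 0].
Proof.
move=> gp; have reg : regular_point M nu chi kappa by case: gp.
have form wp : 0 < Im wp -> is_root M chi kappa wp ->
  slope M nu chi kappa = 2 / alpha M - 2 * carg wp / (pi * alpha M).
 move=> ip rp; have [[wq [iq rq E]]|[nr _]] := good_cases gp; last by case: (nr wp).
 by rewrite (upper_unique ip iq rp rq).
split.
- by split=> [w|]; [apply: rootJ|apply: roots_nonreal].
- split=> [/(liquid_root gp)[wp ip rp]|[wp [ip E]]].
  exists wp; split => //; apply/seteqP; split => [w [iw rw]|w].
   exact: nonreal_root_pair rw.
  case=> ->; split.
  + by rewrite /nonreal /= gt_eqF.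
  + exact: rp.
  + by rewrite /nonreal /= ImJ oppr_eq0 gt_eqF.
  + exact: rootJ.
 have [_ rp] : [set w | nonreal w /\ is_root M chi kappa w] wp by rewrite E; left.
 by split=> //; rewrite (form wp ip rp) slope_bounds ?carg_upper.
- by move=> _ wp ip rp; split; [exact: carg_upper|exact: form].
- split=> [fr|re]; first exact: good_real_roots (frozen_noroot gp fr).
 split=> //; have [[wp [ip rp _]]|[]] := good_cases gp; last by [].
 by move: ip; rewrite (re wp rp) ltxx.
Qed.

Lemma near_params (pt : R * R) (d : R) : 0 < d ->
 \forall pt' \near pt, `|pt'.1 - pt.1| < d /\ `|xpt M pt'.2 - xpt M pt.2| < d.
Proof.
move=> d0.
have c2 : {for pt, continuous (fun q : R * R => xpt M q.2)}.
 apply: continuous_comp; first exact: cvg_snd.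
 apply: continuous_comp; last exact: continuous_expR.
 by apply: cvgN; apply: cvgM; [exact: cvg_cst|exact: cvg_id].
have c1 : {for pt, continuous (fun q : R * R => q.1)} by exact: cvg_fst.
apply: filterS2 ((cvgr_distC_lt _ _ c1) d d0) ((cvgr_distC_lt _ _ c2) d d0) => q /= h1 h2.
by split; rewrite // distrC.
Qed.

(** The count is 1 or 0, an upper root being unique and simple: [upper_persist] covers the value 1,
    [no_upper_near] the value 0. *)
Lemma upper_locally_const (pt : R * R) : regular_col M pt.1 ->
 ~ has_multiple_real_root M pt.1 pt.2 ->
 \forall pt' \near pt, roots_in M upper pt'.1 pt'.2 = roots_in M upper pt.1 pt.2.
Proof.
move=> reg nm; have x0 := xpt_gt0 pt.2.
have [[pm [jm [pp [jp [I1 b1 I2 b2]]]]]|[sg pu]] := mixed_or_pure; last first.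
 have z chi kappa : roots_in M upper chi kappa = 0%E.
  by apply: roots_upper0 => w iw; apply: (pure_nonreal pu); rewrite gt_eqF.
 by apply: filterS (near_params pt (@ltr01 R)) => q _; rewrite !z.
have [[wp [ip rp]]|no] := pselect (exists wp : C, 0 < Im wp /\ is_root M pt.1 pt.2 wp).
 have [d d0 H] := upper_persist I1 b1 I2 b2 reg x0 ip rp.
 rewrite (roots_upper1 ip rp); apply: filterS (near_params pt d0) => q [h1 h2].
 by have [w [iw rw]] := H _ _ h1 h2; exact: roots_upper1 iw rw.
have nr w : 0 < Im w -> ~ is_root M pt.1 pt.2 w by move=> iw rw; apply: no; exists w.
have simple (t : R) : SI pt.1 t%:C = (xpt M pt.2)%:C -> ~ cder (SI pt.1) t%:C 0.
 move=> rt /cder_derive1 c0; apply: nm; exists t; split => //.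
 exact/(root_mult_multiple rt).
have [d d0 H] := no_upper_near I1 b1 I2 b2 reg x0 nr simple.
rewrite (roots_upper0 nr); apply: filterS (near_params pt d0) => q [h1 h2].
by apply: roots_upper0 => w iw; exact: H h1 h2 w iw.
Qed.

(** Without a multiple real root the count would be constant near pt, although it is 1 at nearby
    liquid points and 0 at nearby frozen ones. *)
Lemma boundary_multiple (pt : R * R) : (NN M nu)° pt -> frozen_boundary M nu pt ->
 exists w : R, real_multiple_root M pt.1 pt.2 w.
Proof.
move=> ipt [cl1 cl2]; have gp : good_point M nu pt.1 pt.2 := interior_subset ipt.
have reg : regular_col M pt.1 by case: gp => -[].
have [[w [rw mw]]|nm] := pselect (has_multiple_real_root M pt.1 pt.2).
 exists w; split => //.
 by rewrite /dlog ((root_mult_multiple rw).1 mw) mul0r.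
have nb : nbhs pt [set q | good_point M nu q.1 q.2 /\
  roots_in M upper q.1 q.2 = roots_in M upper pt.1 pt.2].
 by apply: filterS2 ipt (upper_locally_const reg nm) => q; split.
have [q1 [lq [g1 e1]]] := cl1 _ nb; have [q2 [fq [g2 e2]]] := cl2 _ nb.
have [wp ip rp] := liquid_root g1 lq.
move: e1; rewrite -e2 (roots_upper1 ip rp) (roots_upper0 (frozen_noroot g2 fq)) => -[] /eqP.
by rewrite oner_eq0.
Qed.

(** If sign - occurs, S_chi takes the default value 0 at 0; if not, its value there is 1 =
    S_{chi,K}(0), which [assumption_iii] excludes. *)
Lemma good_root_neq0 chi kappa (w : R) : good_point M nu chi kappa ->
 is_root M chi kappa w%:C -> w != 0.
Proof.
move=> [_ _ _ [Ks [_ iii]]] rw; apply/eqP => w0; move: rw; rewrite /is_root w0 => rw.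
have x0 := xpt_gt0 kappa.
have [[p [j [ij bj]]]|no] := pselect (exists p j, idx p j /\ b p j = false).
 move: rw; rewrite (S_inf_zero_minus chi ij bj) => /CI E.
 by rewrite -E ltxx in x0.
have pu p j : idx p j -> b p j = true.
 by move=> ij; apply/negPn/negP => /negbTE h; apply: no; exists p, j.
have [S1 _] := iii Ks (leqnn _); apply: S1.
by rewrite -rw (S_inf_zero_plus chi pu); exact: (S_K0_plus pu).
Qed.

Lemma fold_multiplicity (pt : R * R) (w : R) : good_point M nu pt.1 pt.2 ->
 nondegenerate_fold M pt.1 pt.2 w ->
 root_mult (SI pt.1) (xpt M pt.2)%:C w%:C = 2%:E.
Proof.
move=> gp [[rw dl] d2]; have x0 : xpt M pt.2 != 0 by rewrite gt_eqF // xpt_gt0.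
have xC : (xpt M pt.2)%:C != 0 :> C by apply: contra_neq x0 => /CI.
have c := S_inf_regular (good_root_neq0 gp rw) x0 rw.
exact: (fold_double rw xC c dl d2).
Qed.

End Characteristic.

End Model.

Theorem theorem2p8 (R : realType) (M : model R) (D : discretization R)
    (col : R -> R -> int) (gam : R -> R -> R[i]) (U : R -> set R[i])
    (Lg : R -> R[i] -> R[i]) (nu : R -> {finite_measure set R -> \bar R})
    (hM : wf_model M) (hD : scaling_assumptions M D) (hsep : separation M)
    (hcol : forall chi, regular_col M chi -> column_at M chi (col chi))
    (hadm : forall chi, regular_col M chi ->
      admissible M D chi (col chi) (gam chi) (U chi) (Lg chi))
    (hnu : forall chi, regular_col M chi ->
      limit_measure M D chi (col chi) (gam chi) (Lg chi) (nu chi)) :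
  [/\ forall chi kappa, good_point M nu chi kappa ->
        [/\ (forall w, is_root M chi kappa w -> is_root M chi kappa (conjc w)) /\
            (roots_in M nonreal chi kappa <= 2%:E)%E,
            liquid M nu chi kappa <-> unique_nonreal_pair M chi kappa,
            liquid M nu chi kappa -> forall wp, upper wp ->
              is_root M chi kappa wp ->
              0 < carg wp < pi /\
              slope M nu chi kappa =
                2 / alpha M - 2 * carg wp / (pi * alpha M) &
            frozen M nu chi kappa <->
              forall w, is_root M chi kappa w -> complex.Im w = 0],
      forall pt : R * R, (NN M nu)° pt ->
        ~ has_multiple_real_root M pt.1 pt.2 ->
        \forall pt' \near pt,
          roots_in M upper pt'.1 pt'.2 = roots_in M upper pt.1 pt.2,
      forall pt : R * R, (NN M nu)° pt -> frozen_boundary M nu pt ->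
        exists w : R, real_multiple_root M pt.1 pt.2 w &
      forall (pt : R * R) (w : R), (NN M nu)° pt ->
        nondegenerate_fold M pt.1 pt.2 w ->
        root_mult (S_inf M pt.1) (xpt M pt.2)%:C w%:C = 2%:E].
Proof.
split=> [chi kappa gp|pt ipt nm|pt ipt fb|pt w ipt nf].
- exact: (part_one hM hsep hadm hnu gp).
- have gp : good_point M nu pt.1 pt.2 := interior_subset ipt.
  by apply: (upper_locally_const hM hsep _ nm); case: gp => -[].
- exact: (boundary_multiple hM hsep hadm hnu ipt fb).
- have gp : good_point M nu pt.1 pt.2 := interior_subset ipt.
  exact: (fold_multiplicity hM hsep gp nf).
Qed.
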